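(* Let $(F_1,\omega_1)$ and $(F_2,\omega_2)$ be two closed symplectic surfaces, let $F$ be a closed surface, and let $g=(g_1,g_2):F\to F_1\times F_2$ be a smooth Lagrangian immersion into $(F_1\times F_2,\ \omega_1\times(-\omega_2))$. Then there exist a number $\delta>0$ and a regular homotopy of Lagrangian immersions $g^t:F\to F_1\times F_2$, $t\in[0,\delta]$, such that: (1) $g^t|_{t=0}=g$; (2) $g^t$ is a smooth Lagrangian immersion for all $t\in(0,\delta]$, and the bisingular set of $g^\delta$ consists of bifold points and finitely many cusp points.
   Context: The form $\omega_1\times(-\omega_2)$ on $F_1\times F_2$ is $\mathrm{pr}_1^*\omega_1-\mathrm{pr}_2^*\omega_2$. A Lagrangian immersion of a surface $F$ is an immersion $g:F\to F_1\times F_2$ with $g^*(\omega_1\times(-\omega_2))=0$. A regular homotopy means a smooth one-parameter family of immersions. For a smooth map $f:F\to\tilde F$ between surfaces: $x\in F$ is a singular (critical) point if $\operatorname{rank} df_x<2$; a critical point $x$ is a fold point if there are local coordinates $(x_1,x_2)$ centered at $x$ and $(y_1,y_2)$ centered at $f(x)$ in which $f(x_1,x_2)=(x_1,x_2^2)$; a critical point $x$ is a cusp point of $f$ if there are such coordinates with $f(x_1,x_2)=(x_1,x_1x_2+x_2^3)$. For a Lagrangian immersion $g=(g_1,g_2):F\to F_1\times F_2$: $x\in F$ is bisingular if it is a critical point of both $g_1$ and $g_2$; the bisingular set is the set of bisingular points. A bisingular point is a bifold point if it is a fold point of both $g_1$ and $g_2$; it is a cusp point (of $g$) if it is a cusp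 point of $g_1$ or of $g_2$. *)

(* Defs.v *)
From HB Require Import structures.
From mathcomp Require Import all_boot all_order all_algebra.
From mathcomp Require Import all_classical all_reals all_analysis.
Set Implicit Arguments.
Unset Strict Implicit.
Unset Printing Implicit Defensive.
Import Order.TTheory GRing.Theory Num.Theory.
Import numFieldNormedType.Exports.
Local Open Scope classical_set_scope.
Local Open Scope ring_scope.

(* [Ck k U f] is meant for [U] open.  The model spaces below are finite
   dimensional, so constant directions suffice to iterate differentiation. *)
Fixpoint Ck (R : realType) (V W : normedModType R) (k : nat) (U : set V)
    (f : V -> W) : Prop :=
  match k with
  | 0%N => forall x, U x -> {for x, continuous f}
  | k'.+1 => (forall x, U x -> differentiable f x) /\
             (forall v : V, Ck k' U ('D_v f))
  end.

Definition Cinf (R : realType) (V W : normedModType R) (U : set V)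
  (f : V -> W) : Prop := forall k, Ck k U f.

Section Ck_theory.
Variable R : realType.

Lemma near_open (V : normedModType R) (U : set V) (P : V -> Prop) x :
  open U -> U x -> (forall y, U y -> P y) -> \forall y \near x, P y.
Proof.
by move=> oU Ux UP; apply: filterS UP _; exact: open_nbhs_nbhs.
Qed.

Lemma eq_Ck (V W : normedModType R) k (U : set V) (f g : V -> W) :
  open U -> (forall x, U x -> f x = g x) -> Ck k U f -> Ck k U g.
Proof.
move=> oU; elim: k f g => [|k IH] f g fg /=.
  move=> cf x Ux; have := cf x Ux; rewrite /prop_for /continuous_at (fg x Ux).
  apply: cvg_trans; apply: near_eq_cvg.
  by apply: (near_open oU Ux) => y Uy; exact: fg.
case=> df Df; split.
  move=> x Ux; have nfg : {near x, f =1 g} by exact: near_open Ux fg.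
  apply/diff_locallyP.
  have /diff_locallyP[cd eqd] := df x Ux.
  have xs : \forall h \near (0 : V), f (h + x) = g (h + x).
    by move: nfg; rewrite (near_shift 0 x); apply: filterS => h; rewrite /= subr0.
  have key : g \o shift x = cst (g x) + 'd f x +o_ (0 : V) id.
    apply/eqaddoP => e e0; have /eqaddoP/(_ e e0) H := eqd.
    near=> h.
    have -> : (g \o shift x - (cst (g x) + 'd f x)) h
            = (f \o shift x - (cst (f x) + 'd f x)) h.
      by rewrite !fctE /= (fg x Ux); congr (_ - _); apply/esym; near: h.
    by near: h.
  by have -> : 'd g x = 'd f x :> (V -> W) by exact: diff_unique cd key.
move=> v; apply: IH (Df v) => x Ux.
apply: near_eq_derive; exact: near_open Ux fg.
Unshelve. all: by end_near. Qed.

Lemma Ck_cst (V W : normedModType R) k (U : set V) (a : W) :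
  Ck k U (cst a : V -> W).
Proof.
elim: k a => [|k IH] a /=; first by move=> x _; exact: cvg_cst.
split=> [x _|v]; first exact: differentiable_cst.
have -> : 'D_v (cst a : V -> W) = cst 0 by apply/funext => x; rewrite derive_cst.
exact: IH.
Qed.

Lemma Cinf_id (V : normedModType R) (U : set V) : Cinf U (@id V).
Proof.
case=> [|k] /=; first by move=> x _; exact: cvg_id.
split=> [x _|v].
  have c : continuous (idfun : V -> V) by move=> y; exact: cvg_id.
  exact: (@linear_differentiable R V V idfun x c).
have -> : 'D_v (@id V) = cst v by apply/funext => x; rewrite derive_id.
exact: Ck_cst.
Qed.

Lemma differentiable_map (V W V' W' : normedModType R) (f : V -> W)
    (f' : V' -> W') (p : V * V') :
  differentiable f p.1 -> differentiable f' p.2 ->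
  differentiable (fun q : V * V' => (f q.1, f' q.2)) p /\
  forall v, 'D_v (fun q : V * V' => (f q.1, f' q.2)) p
            = ('D_v.1 f p.1, 'D_v.2 f' p.2).
Proof.
move=> df df'.
have c1 : continuous (fst : V * V' -> V) by move=> ?; exact: cvg_fst.
have c2 : continuous (snd : V * V' -> V') by move=> ?; exact: cvg_snd.
have d1 : differentiable (fst : V * V' -> V) p by exact: (linear_differentiable p c1).
have d2 : differentiable (snd : V * V' -> V') p by exact: (linear_differentiable p c2).
have e1 : differentiable (f \o (fst : V * V' -> V)) p.
  exact: (differentiable_comp d1 df).
have e2 : differentiable (f' \o (snd : V * V' -> V')) p.
  exact: (differentiable_comp d2 df').
have e : differentiable (fun q : V * V' => (f q.1, f' q.2)) p.
  exact: (differentiable_pair e1 e2).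
split=> // v.
rewrite !deriveE // (diff_pair e1 e2) /=.
rewrite (diff_comp d1 df) (diff_comp d2 df') /=.
by rewrite (diff_lin p c1) (diff_lin p c2).
Qed.

Lemma open_setX (S T : topologicalType) (A : set S) (B : set T) :
  open A -> open B -> open (A `*` B).
Proof.
rewrite !openE => oA oB [x y] [/= Ax By].
by exists (A, B) => //; split; [exact: oA|exact: oB].
Qed.

Lemma continuous_map (S T S' T' : topologicalType) (f : S -> T)
    (f' : S' -> T') (x : S) (x' : S') :
  {for x, continuous f} -> {for x', continuous f'} ->
  {for (x, x'), continuous (fun q : S * S' => (f q.1, f' q.2))}.
Proof.
move=> cf cf' P [[A B] [/= nA nB] ABP].
exists (f @^-1` A, f' @^-1` B) => [|[y y'] [/= ? ?]].
  by split; [exact: cf|exact: cf'].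
exact: ABP.
Qed.

Lemma Ck_map (V W V' W' : normedModType R) k (U : set V) (U' : set V')
    (f : V -> W) (f' : V' -> W') :
  open U -> open U' -> Ck k U f -> Ck k U' f' ->
  Ck k (U `*` U') (fun q : V * V' => (f q.1, f' q.2)).
Proof.
move=> oU oU'; elim: k f f' => [|k IH] f f' /=.
  move=> cf cf' [x x'] [/= Ux Ux'].
  exact: continuous_map (cf _ Ux) (cf' _ Ux').
case=> df Df [df' Df']; split.
  by move=> p [p1 p2]; case: (differentiable_map (df _ p1) (df' _ p2)).
move=> v; apply: (eq_Ck _ _ (IH _ _ (Df v.1) (Df' v.2))).
  exact: open_setX.
by move=> p [p1 p2]; case: (differentiable_map (df _ p1) (df' _ p2)) => _ ->.
Qed.

End Ck_theory.

(* [fwd] and [bwd] are total functions, but are only meaningful on [dom] and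
   [cod] respectively. *)
Record chart (R : realType) (E : normedModType R) (M : topologicalType) :=
  Chart {
  dom : set M;
  cod : set E;
  fwd : M -> E;
  bwd : E -> M;
  dom_open : open dom;
  cod_open : open cod;
  fwd_cod : forall x, dom x -> cod (fwd x);
  bwd_dom : forall u, cod u -> dom (bwd u);
  fwdK : forall x, dom x -> bwd (fwd x) = x;
  bwdK : forall u, cod u -> fwd (bwd u) = u;
  fwd_continuous : forall x, dom x -> {for x, continuous fwd};
  bwd_continuous : forall u, cod u -> {for u, continuous bwd}
}.

Definition smooth_transition (R : realType) (E : normedModType R)
    (M : topologicalType) (c d : chart E M) : Prop :=
  Cinf (cod c `&` bwd c @^-1` dom d) (fwd d \o bwd c).

(* A smooth manifold without boundary modelled on [E], with smooth structure
   generated by the atlas [{chart_at x | x in M}].  The chart [chart_at x] also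
   trivialises the tangent space at [x], so that [T_x M] is represented by [E]
   through the differential of [fwd (chart_at x)]. *)
Record manifold (R : realType) (E : normedModType R) := Manifold {
  carrier :> topologicalType;
  chart_at : carrier -> chart E carrier;
  chart_at_dom : forall x, dom (chart_at x) x;
  chart_at_smooth : forall x y, smooth_transition (chart_at x) (chart_at y);
  manifold_hausdorff : hausdorff_space carrier;
  manifold_second_countable : @second_countable carrier
}.

Definition surface (R : realType) := manifold 'rV[R]_2.

Definition closed_manifold (R : realType) (E : normedModType R)
  (M : manifold E) : Prop := compact [set: M].

Section real_line.
Variable R : realType.

Definition id_chart : chart R R.
Proof.
by apply: (@Chart R R R setT setT id id) => // *;
  [exact: openT|exact: openT|exact: cvg_id|exact: cvg_id].
Defined.

Lemma real_second_countable : @second_countable R.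
Proof.
exists (range (fun q : rat * rat => ball (ratr q.1 : R) (ratr q.2))).
  by apply: sub_countable (card_image_le _ _) _; exact: countableP.
split; first by move=> _ [q _ <-]; exact: ball_open.
move=> x A /=; rewrite nbhsE => -[B [oB Bx] BA].
have [c [r [xb bB]]] := open_subball_rat oB (mem_set Bx).
exists (ball (ratr c : R) (ratr r)).
  by split; [exists (c, r)|exact: set_mem xb].
exact: subset_trans bB BA.
Qed.

Definition real_line : manifold R.
Proof.
apply: (@Manifold R R R (fun=> id_chart)) => //.
- by move=> x y; exact: Cinf_id.
- exact: real_second_countable.
Defined.

End real_line.

Section product_manifold.
Variables (R : realType) (E E' : normedModType R).

Definition prod_chart (M M' : topologicalType) (c : chart E M)
  (c' : chart E' M') : chart (E * E')%type (M * M')%type.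
Proof.
apply: (@Chart R (E * E')%type (M * M')%type
  (dom c `*` dom c') (cod c `*` cod c')
  (fun p => (fwd c p.1, fwd c' p.2)) (fun u => (bwd c u.1, bwd c' u.2))).
- by apply: open_setX; exact: dom_open.
- by apply: open_setX; exact: cod_open.
- by move=> x [? ?]; split; exact: fwd_cod.
- by move=> x [? ?]; split; exact: bwd_dom.
- by move=> [x x'] [/= ? ?]; rewrite !fwdK.
- by move=> [x x'] [/= ? ?]; rewrite !bwdK.
- by move=> [x x'] [/= ? ?]; apply: continuous_map; exact: fwd_continuous.
- by move=> [x x'] [/= ? ?]; apply: continuous_map; exact: bwd_continuous.
Defined.

Lemma prod_hausdorff (S T : topologicalType) :
  hausdorff_space S -> hausdorff_space T -> hausdorff_space (S * T)%type.
Proof.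
move=> hS hT [x y] [x' y'] cl; congr (_, _).
  apply: hS => A B nA nB.
  have [] := cl (A `*` setT) (B `*` setT).
  - by exists (A, setT) => //; split=> //; exact: filterT.
  - by exists (B, setT) => //; split=> //; exact: filterT.
  by move=> [a b] [[/= ? _] [/= ? _]]; exists a.
apply: hT => A B nA nB.
have [] := cl (setT `*` A) (setT `*` B).
- by exists (setT, A) => //; split=> //; exact: filterT.
- by exists (setT, B) => //; split=> //; exact: filterT.
by move=> [a b] [[/= _ ?] [/= _ ?]]; exists b.
Qed.

Lemma prod_second_countable (S T : topologicalType) :
  @second_countable S -> @second_countable T ->
  @second_countable (S * T)%type.
Proof.
move=> [A cA [oA bA]] [B cB [oB bB]].
exists ((fun p : set S * set T => p.1 `*` p.2) @` (A `*` B)).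
  by apply: sub_countable (card_image_le _ _) _; exact: countableX.
split; first by move=> _ [[a b] [/= ? ?] <-]; apply: open_setX; auto.
move=> [x y] C [[P Q] /= [nP nQ] PQC].
have [a [Aa ax] aP] := bA x P nP; have [b [Bb bx] bQ] := bB y Q nQ.
exists (a `*` b); first by split=> //; exists (a, b).
by move=> [u v] [/= ? ?]; apply: PQC; split; [exact: aP|exact: bQ].
Qed.

Lemma transition_open (F : normedModType R) (M : topologicalType)
  (c d : chart F M) : open (cod c `&` bwd c @^-1` dom d).
Proof.
rewrite openE => u [cu du]; apply: filterI.
  by apply: open_nbhs_nbhs; split=> //; exact: cod_open.
apply: (bwd_continuous cu); apply: open_nbhs_nbhs; split=> //.
exact: dom_open.
Qed.

Definition prod_manifold (M : manifold E) (M' : manifold E') :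
  manifold (E * E')%type.
Proof.
apply: (@Manifold R (E * E')%type (M * M')%type
  (fun p => prod_chart (chart_at p.1) (chart_at p.2))).
- by move=> p; split; exact: chart_at_dom.
- move=> p q k.
  have := Ck_map (transition_open _ _) (transition_open _ _)
    (chart_at_smooth p.1 q.1 k) (chart_at_smooth p.2 q.2 k).
  congr (Ck _ _ _); apply/seteqP; split=> u /=.
    by move=> [[? ?] [? ?]].
  by move=> [[? ?] [? ?]].
- by apply: prod_hausdorff; exact: manifold_hausdorff.
- by apply: prod_second_countable; exact: manifold_second_countable.
Defined.

End product_manifold.

Section smooth_maps.
Variables (R : realType) (E E' : normedModType R).
Variables (M : manifold E) (N : manifold E').

Definition local_rep (f : M -> N) (x : M) : E -> E' :=
  fwd (chart_at (f x)) \o f \o bwd (chart_at x).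

Definition smooth_at (f : M -> N) (x : M) : Prop :=
  {for x, continuous f} /\
  exists U : set E, [/\ open U, U (fwd (chart_at x) x) & Cinf U (local_rep f x)].

Definition smooth (f : M -> N) : Prop := forall x, smooth_at f x.

(* Smoothness on an arbitrary subset: existence of local smooth extensions. *)
Definition smooth_on (A : set M) (f : M -> N) : Prop :=
  forall x, A x -> exists h : M -> N,
    smooth_at h x /\ \forall y \near x, A y -> f y = h y.

Definition differential (f : M -> N) (x : M) : E -> E' :=
  'd (local_rep f x) (fwd (chart_at x) x).

Definition immersion (f : M -> N) : Prop :=
  smooth f /\ forall x, injective (differential f x).

End smooth_maps.

(* The one-parameter family is smooth as a map on [0, d] * M, in both variables
   jointly and up to the endpoints of the time interval. *)
Definition regular_homotopy (R : realType) (E E' : normedModType R)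
    (M : manifold E) (N : manifold E') (d : R) (G : R -> M -> N) : Prop :=
  @smooth_on R _ _ (prod_manifold (real_line R) M) N
    [set p | 0 <= p.1 <= d] (fun p => G p.1 p.2) /\
  forall t, 0 <= t <= d -> immersion (G t).

Section two_forms.
Variables (R : realType) (E : normedModType R).

(* [w x] is a bilinear form on [T_x M], in the trivialisation [chart_at x]. *)
Definition form2 (M : manifold E) := M -> E -> E -> R.

Definition form2_in_chart (M : manifold E) (c : chart E M) (w : form2 M)
    (u v v' : E) : R :=
  let D := 'd (fwd (chart_at (bwd c u)) \o bwd c) u in
  w (bwd c u) (D v) (D v').

Definition alternating (M : manifold E) (w : form2 M) : Prop :=
  forall x, [/\ forall a u v v', w x (a *: u + v) v' = a * w x u v' + w x v v',
                forall a u v v', w x v' (a *: u + v) = a * w x v' u + w x v' v &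
                forall v, w x v v = 0].

Definition smooth_form2 (M : manifold E) (w : form2 M) : Prop :=
  forall (x : M) (v v' : E),
    Cinf (cod (chart_at x)) (fun u => form2_in_chart (chart_at x) w u v v').

Definition closed_form2 (M : manifold E) (w : form2 M) : Prop :=
  forall (x : M) (u v1 v2 v3 : E), cod (chart_at x) u ->
    let wc v v' := fun z => form2_in_chart (chart_at x) w z v v' in
    'D_v1 (wc v2 v3) u + 'D_v2 (wc v3 v1) u + 'D_v3 (wc v1 v2) u = 0.

Definition symplectic (M : manifold E) (w : form2 M) : Prop :=
  [/\ alternating w, smooth_form2 w, closed_form2 w &
      forall x v, (forall v', w x v v' = 0) -> v = 0].

End two_forms.

Definition pullback (R : realType) (E E' : normedModType R) (M : manifold E)
    (N : manifold E') (f : M -> N) (w : form2 N) : form2 M :=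
  fun x v v' => w (f x) (differential f x v) (differential f x v').

Definition form2_minus (R : realType) (E E' : normedModType R)
    (M : manifold E) (N : manifold E') (w1 : form2 M) (w2 : form2 N) :
    form2 (prod_manifold M N) :=
  fun p v v' =>
    @pullback _ _ _ (prod_manifold M N) M fst w1 p v v'
    - @pullback _ _ _ (prod_manifold M N) N snd w2 p v v'.

Section lagrangian_surfaces.
Variables (R : realType) (F F1 F2 : surface R).

Definition lagrangian_immersion (w1 : form2 F1) (w2 : form2 F2)
    (g : F -> prod_manifold F1 F2) : Prop :=
  immersion g /\
  forall x v v', pullback g (form2_minus w1 w2) x v v' = 0.

End lagrangian_surfaces.

Section singularities.
Variables (R : realType) (F N : surface R).

Definition critical_point (f : F -> N) (x : F) : Prop :=
  (\rank (lin1_mx (differential f x)) < 2)%N.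

(* [c] belongs to the maximal atlas. *)
Definition local_coordinates (M : surface R) (c : chart 'rV[R]_2 M) : Prop :=
  forall y : M, smooth_transition c (chart_at y) /\
                smooth_transition (chart_at y) c.

Definition centered_coordinates (M : surface R) (x : M)
    (c : chart 'rV[R]_2 M) : Prop :=
  [/\ local_coordinates c, dom c x & fwd c x = 0].

Definition row2 (a b : R) : 'rV[R]_2 := \row_j (if j == 0 then a else b).

Definition has_normal_form (f : F -> N) (x : F) (h : R -> R -> 'rV[R]_2) : Prop :=
  exists (c : chart 'rV[R]_2 F) (d : chart 'rV[R]_2 N),
    [/\ centered_coordinates x c, centered_coordinates (f x) d &
        \forall u \near (0 : 'rV[R]_2),
          dom d (f (bwd c u)) /\ fwd d (f (bwd c u)) = h (u 0 0) (u 0 1)].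

Definition fold_point (f : F -> N) (x : F) : Prop :=
  critical_point f x /\
  has_normal_form f x (fun x1 x2 => row2 x1 (x2 ^+ 2)).

Definition cusp_point (f : F -> N) (x : F) : Prop :=
  critical_point f x /\
  has_normal_form f x (fun x1 x2 => row2 x1 (x1 * x2 + x2 ^+ 3)).

End singularities.

Section bisingularities.
Variables (R : realType) (F F1 F2 : surface R).
Variable g : F -> prod_manifold F1 F2.

Let g1 : F -> F1 := fun x => (g x).1.
Let g2 : F -> F2 := fun x => (g x).2.

Definition bisingular_set : set F :=
  [set x | critical_point g1 x /\ critical_point g2 x].

Definition bifold_point (x : F) : Prop :=
  [/\ bisingular_set x, fold_point g1 x & fold_point g2 x].

Definition bisingular_cusp_point (x : F) : Prop :=
  bisingular_set x /\ (cusp_point g1 x \/ cusp_point g2 x).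

End bisingularities.

(* Main.v *)
Require Import Defs.
From HB Require Import structures.
From mathcomp Require Import all_boot all_order all_algebra.
From mathcomp Require Import all_classical all_reals all_analysis.
From mathcomp Require Import ring lra.
Set Implicit Arguments.
Unset Strict Implicit.
Unset Printing Implicit Defensive.
Import Order.TTheory GRing.Theory Num.Theory.
Import numFieldNormedType.Exports.
Local Open Scope classical_set_scope.
Local Open Scope ring_scope.

(* Around a point of a Lagrangian immersion there are Darboux coordinates (q1, p1)
   and (q2, p2) of the two factors such that (q1, q2) are coordinates of F; then
   g = ((q1, A), (q2, B)) with A_2 = - B_1 =: u, a point is bisingular iff u = 0,
   and for every function h of (q1, q2) the change A + h_1, B - h_2 is again a
   Lagrangian immersion, in which u is replaced by u + h_12.  Polynomial h with
   three small coefficients avoid (u, u_1, u_2) = 0, (u, u_2, u_22) = 0 and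
   (u, u_1, u_11) = 0, by an elementary form of Sard's theorem: the image of a
   Lipschitz map from the plane to 3-space misses points close to 0.  Now the points
   with u = 0 and u_1, u_2 <> 0 are folds of both projections, by the Morse lemma with
   a parameter, and the other bisingular points are isolated.  Near one with
   u_2 = 0 a further h, small for the weights (2, 1) of (q1, q2), turns u into
   a q1 + b q2^2 / 2 without creating a second zero of (u, u_2); then A is a cusp up
   to affine changes of coordinates, and no general normal form theorem for cusps is
   needed.  The case u_1 = 0 is symmetric. *)

(** * Smooth maps between normed spaces *)

(** Each genericity condition is reached by a deformation supported in one patch, which must not
    destroy what was reached in the others. All conditions are therefore open conditions on compact
    balls, and a small enough parameter preserves them. A degenerate point is then changed once
    more, with a support that avoids the other degenerate points, until u is literally the cusp
    polynomial. For the weights (2, 1) that polynomial is homogeneous and the remainder of u has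
    higher weight; correcting it on a shrinking box therefore costs arbitrarily little in u_1 and
    u_22. The signs of these two derivatives are all that the uniqueness of the degenerate point
    needs, by convexity in one variable, so no unfolding theory enters. Finiteness of the cusp set
    is a separate matter: bisingular points outside a finite list are folds of both projections, and
    no germ is both a fold and a cusp. Every deformation is run through by a smooth step that is
    constant outside [0, 1], so that finitely many of them compose to a single smooth homotopy. *)

Section Smooth.
Variable R : realType.

(* A finite coordinate system: [Ck] only differentiates along constant
   directions, so the chain rule needs the middle space to be spanned by
   finitely many of them. *)
Class findim (V : normedModType R) : Prop := Findim {
  findimP : exists n (e : 'I_n -> V) (c : 'I_n -> {linear V -> R}),
    (forall i, continuous (c i)) /\ forall v, v = \sum_i c i v *: e i }.

Global Instance findim_R : findim R.
Proof.
constructor; exists 1%N, (fun=> 1), (fun=> idfun); split.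
  by move=> _ x; exact: cvg_id.
by move=> v; rewrite big_ord1 /= [_ *: _]mulr1.
Qed.

Global Instance findim_prod (V W : normedModType R) :
  findim V -> findim W -> findim (V * W)%type.
Proof.
move=> [[n [e [c [cc ce]]]]] [[m [e' [c' [cc' ce']]]]]; constructor.
pose E (k : 'I_n + 'I_m) : V * W :=
  match k with inl i => (e i, 0) | inr j => (0, e' j) end.
pose C (k : 'I_n + 'I_m) : {linear (V * W)%type -> R} :=
  match k with inl i => c i \o fst | inr j => c' j \o snd end.
exists (n + m)%N, (fun k => E (fintype.split k)), (fun k => C (fintype.split k)); split.
  move=> k x; rewrite /C; case: (fintype.split k) => i.
    by apply: continuous_comp; [exact: cvg_fst|exact: cc].
  by apply: continuous_comp; [exact: cvg_snd|exact: cc'].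
move=> [v w]; rewrite big_split_ord /=.
have -> : \sum_(i < n) C (fintype.split (lshift m i)) (v, w) *: E (fintype.split (lshift m i))
  = \sum_(i < n) (c i v *: e i, 0).
  apply: eq_bigr => i _; rewrite (unsplitK (inl i)) /=.
  by rewrite /C /E; congr (_, _); rewrite /= scaler0.
have -> : \sum_(i < m) C (fintype.split (rshift n i)) (v, w) *: E (fintype.split (rshift n i))
  = \sum_(i < m) (0, c' i w *: e' i).
  apply: eq_bigr => i _; rewrite (unsplitK (inr i)) /=.
  by rewrite /C /E; congr (_, _); rewrite /= scaler0.
have s1 (I : finType) (f : I -> V) : \sum_i (f i, 0 : W) = (\sum_i f i, 0).
  by elim/big_rec2: _ => // i a b _ ->; congr (_, _); rewrite /= ?addr0.
have s2 (I : finType) (f : I -> W) : \sum_i (0 : V, f i) = (0, \sum_i f i).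
  by elim/big_rec2: _ => // i a b _ ->; congr (_, _); rewrite /= ?addr0.
by rewrite s1 s2 -ce -ce'; congr (_, _); rewrite ?addr0 ?add0r.
Qed.

Section vec.
Variables (n : nat) (i : 'I_n).
Definition vcoord (v : 'rV[R]_n) : R := v 0 i.
Lemma vcoord_linear : linear vcoord.
Proof. by move=> a u v; rewrite /vcoord !mxE. Qed.
HB.instance Definition _ := GRing.isLinear.Build _ _ _ _ _ vcoord_linear.
Lemma vcoord_continuous : continuous vcoord.
Proof. exact: coord_continuous. Qed.
End vec.

Global Instance findim_rV n : findim 'rV[R]_n.
Proof.
constructor; exists n, (fun i => delta_mx 0 i), (fun i => vcoord i); split.
  by move=> i; exact: vcoord_continuous.
by move=> v; rewrite {1}[v]row_sum_delta.
Qed.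

Lemma Ck_lin (V W : normedModType R) (f : {linear V -> W}) k U :
  continuous f -> Ck k U f.
Proof.
move=> cf; case: k => [|k] /=; first by move=> x _; exact: cf.
have df x : differentiable f x by exact: linear_differentiable.
split=> [x _|v]; first exact: df.
have -> : 'D_v f = cst (f v).
  by apply/funext => x; rewrite deriveE // diff_lin.
exact: Ck_cst.
Qed.

Lemma CkS (V W : normedModType R) k U (f : V -> W) : Ck k.+1 U f -> Ck k U f.
Proof.
elim: k f => [|k IH] f [df Df].
  by move=> x Ux; apply: differentiable_continuous; exact: df.
by split=> // v; apply: IH; exact: Df.
Qed.

Lemma Ck_sub (V W : normedModType R) k (U U' : set V) (f : V -> W) :
  U' `<=` U -> Ck k U f -> Ck k U' f.
Proof.
move=> UU; elim: k f => [|k IH] f /=; first by move=> h x /UU; exact: h.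
by move=> [df Df]; split=> [x /UU|v]; [exact: df|exact: IH].
Qed.

Lemma Ck_local (V W : normedModType R) k (U : set V) (f : V -> W) :
  (forall x, U x -> exists U', U' x /\ Ck k U' f) -> Ck k U f.
Proof.
elim: k f => [|k IH] f h /=.
  by move=> x /h[U' [U'x]]; exact.
split; first by move=> x /h[U' [U'x [df _]]]; exact: df.
move=> v; apply: IH => x /h[U' [U'x [_ Df]]].
by exists U'; split=> //; exact: Df.
Qed.

Lemma CkD (V W : normedModType R) k (U : set V) (f g : V -> W) :
  open U -> Ck k U f -> Ck k U g -> Ck k U (fun x => f x + g x).
Proof.
move=> oU; elim: k f g => [|k IH] f g /=.
  by move=> cf cg x Ux; apply: cvgD; [exact: cf|exact: cg].
move=> [df Df] [dg Dg]; split=> [x Ux|v].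
  by apply: differentiableD; [exact: df|exact: dg].
apply: (eq_Ck oU _ (IH _ _ (Df v) (Dg v))) => x Ux.
by rewrite [RHS]deriveD //; apply: diff_derivable; [exact: df|exact: dg].
Qed.

Section scale.
Variables (V W : normedModType R).

Lemma scale_bilinear : bilinear_for
    (GRing.Scale.Law.clone _ _ *:%R _) (GRing.Scale.Law.clone _ _ *:%R _)
    (fun (a : R) (w : W) => a *: w).
Proof.
split=> [u'|u] a x y /=; first by rewrite scalerDl scalerA.
by rewrite scalerDr !scalerA mulrC.
Qed.
Let sc (a : R) (w : W) := a *: w.
HB.instance Definition _ :=
  bilinear_isBilinear.Build R R W W _ _ sc scale_bilinear.

Lemma differentiable_scale (a : V -> R) (f : V -> W) x :
  differentiable a x -> differentiable f x ->
  differentiable (fun y => a y *: f y) x /\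
  forall v, 'D_v (fun y => a y *: f y) x = 'D_v a x *: f x + a x *: 'D_v f x.
Proof.
move=> da df.
have csc : continuous (fun p : R * W => sc p.1 p.2).
  by move=> [u w]; exact: scale_continuous.
have dp := differentiable_pair da df.
have ds := @differentiable_bilin _ _ _ _ sc (a x, f x) csc.
have dc := @differentiable_comp _ _ _ _ (fun y => (a y, f y)) _ _ dp ds.
split; first exact: dc.
move=> v; rewrite !deriveE //.
have := @diff_comp _ _ _ _ (fun y => (a y, f y)) _ _ dp ds.
rewrite /comp /= => ->; rewrite /= diff_pair // diff_bilin //=.
by rewrite addrC.
Qed.

Lemma CkZ k (U : set V) (a : V -> R) (f : V -> W) :
  open U -> Ck k U a -> Ck k U f -> Ck k U (fun x => a x *: f x).
Proof.
move=> oU; elim: k a f => [|k IH] a f.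
  by move=> ca cf x Ux; apply: cvgZ; [exact: ca|exact: cf].
move=> ha hf; have := CkS ha; have := CkS hf; case: ha hf => da Da [df Df].
move=> kf ka; split=> [x Ux|v].
  by have [] := differentiable_scale (da _ Ux) (df _ Ux).
apply: (eq_Ck oU _ (CkD oU (IH _ _ (Da v) kf) (IH _ _ ka (Df v)))) => x Ux.
by have [_ ->] := differentiable_scale (da _ Ux) (df _ Ux).
Qed.
End scale.

Lemma derive_comp (U V W : normedModType R) (f : U -> V) (g : V -> W) x v :
  differentiable f x -> differentiable g (f x) ->
  'D_v (g \o f) x = 'D_('D_v f x) g (f x).
Proof.
move=> df dg; rewrite !deriveE //; last exact: differentiable_comp.
by rewrite diff_comp.
Qed.

Lemma derive_sumr (V W : normedModType R) n (a : 'I_n -> R) (e : 'I_n -> V)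
    (f : V -> W) x : differentiable f x ->
  'D_(\sum_i a i *: e i) f x = \sum_i a i *: 'D_(e i) f x.
Proof.
move=> df; rewrite deriveE // linear_sum.
by apply: eq_bigr => i _; rewrite linearZ deriveE.
Qed.

Lemma Ck_sum (V W : normedModType R) k (U : set V) n (f : 'I_n -> V -> W) :
  open U -> (forall i, Ck k U (f i)) -> Ck k U (fun x => \sum_i f i x).
Proof.
move=> oU; elim: n f => [|n IH] f h.
  apply: (eq_Ck oU _ (@Ck_cst R V W k U 0)) => x _; by rewrite big_ord0.
apply: (eq_Ck oU _ (CkD oU (IH _ (fun i => h (widen_ord (leqnSn n) i)))
  (h ord_max))) => x _.
by rewrite big_ord_recr.
Qed.

Lemma Ck_linl (V W X : normedModType R) k (A : set V) (f : V -> W)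
    (l : {linear W -> X}) :
  open A -> continuous l -> Ck k A f -> Ck k A (l \o f).
Proof.
move=> oA cl; elim: k f => [|k IH] f /=.
  by move=> hf x Ax; apply: continuous_comp; [exact: hf|exact: cl].
move=> [df Df]; split=> [x Ax|w].
  apply: (@differentiable_comp _ _ _ _ f l); first exact: df.
  exact: linear_differentiable.
apply: (eq_Ck oA _ (IH _ (Df w))) => x Ax.
have ll : differentiable l (f x) by exact: linear_differentiable.
rewrite derive_comp //; last exact: df.
by rewrite [RHS]deriveE // diff_lin.
Qed.

(** In D_v (g o f) the direction in which g is differentiated moves with the point. Expanded in the
    coordinates [c i] it leaves only the constant directions [e i], and the induction applies to
    each ['D_(e i) g]. *)
Lemma Ck_comp (U V W : normedModType R) k (A : set U) (B : set V)
    (f : U -> V) (g : V -> W) : findim V -> open A ->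
  (forall x, A x -> B (f x)) -> Ck k A f -> Ck k B g -> Ck k A (g \o f).
Proof.
move=> [[n [e [c [cc ce]]]]] oA AB; elim: k g => [|k IH] g hf.
  by move=> hg x Ax; apply: continuous_comp; [exact: hf|exact/hg/AB].
have kf := CkS hf; case: hf => df Df hg.
have kg := CkS hg; case: hg => dg Dg.
split=> [x Ax|v].
  by apply: differentiable_comp; [exact: df|exact/dg/AB].
have h i : Ck k A (fun x => c i ('D_v f x) *: 'D_(e i) g (f x)).
  apply: CkZ => //; last exact: (IH ('D_(e i) g) kf (Dg _)).
  have : Ck k A ('D_v f) by exact: Df.
  exact: Ck_linl.
apply: (eq_Ck oA _ (Ck_sum oA h)) => x Ax.
rewrite derive_comp //; [|exact: df|exact/dg/AB].
by rewrite [in RHS](ce ('D_v f x)) derive_sumr //; exact/dg/AB.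
Qed.

End Smooth.

Section Smooth_maps.
Variable R : realType.
Implicit Types V W X : normedModType R.

Lemma Cinf_derive V W (U : set V) (f : V -> W) v :
  Cinf U f -> Cinf U ('D_v f).
Proof. by move=> h k; have [_] := h k.+1; exact. Qed.

Lemma Cinf_diff V W (U : set V) (f : V -> W) x :
  Cinf U f -> U x -> differentiable f x.
Proof. by move=> /(_ 1%N)[h _]; exact: h. Qed.

Lemma Cinf_cont V W (U : set V) (f : V -> W) x :
  Cinf U f -> U x -> {for x, continuous f}.
Proof. by move=> /(_ 0%N); exact. Qed.

Lemma eq_Cinf V W (U : set V) (f g : V -> W) :
  open U -> (forall x, U x -> f x = g x) -> Cinf U f -> Cinf U g.
Proof. by move=> oU fg h k; exact: (eq_Ck oU fg). Qed.

Lemma Cinf_sub V W (U U' : set V) (f : V -> W) :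
  U' `<=` U -> Cinf U f -> Cinf U' f.
Proof. by move=> UU h k; exact: Ck_sub (h k). Qed.

Lemma Cinf_local V W (U : set V) (f : V -> W) :
  (forall x, U x -> exists U', U' x /\ Cinf U' f) -> Cinf U f.
Proof.
move=> h k; apply: Ck_local => x /h[U' [U'x Hf]].
by exists U'; split.
Qed.

Lemma Cinf_cst V W (U : set V) (a : W) : Cinf U (fun=> a : W).
Proof. by move=> k; exact: Ck_cst. Qed.

Lemma Cinf_lin V W (U : set V) (f : {linear V -> W}) :
  continuous f -> Cinf U f.
Proof. by move=> cf k; exact: Ck_lin. Qed.

Lemma CinfD V W (U : set V) (f g : V -> W) :
  open U -> Cinf U f -> Cinf U g -> Cinf U (fun x => f x + g x).
Proof. by move=> oU hf hg k; exact: CkD. Qed.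

Lemma CinfZ V W (U : set V) (a : V -> R) (f : V -> W) :
  open U -> Cinf U a -> Cinf U f -> Cinf U (fun x => a x *: f x).
Proof. by move=> oU ha hf k; exact: CkZ. Qed.

Lemma CinfM V (U : set V) (a f : V -> R) :
  open U -> Cinf U a -> Cinf U f -> Cinf U (fun x => a x * f x).
Proof. by move=> oU ha hf; exact: (@CinfZ V R U a f). Qed.

Lemma CinfN V W (U : set V) (f : V -> W) :
  open U -> Cinf U f -> Cinf U (fun x => - f x).
Proof.
move=> oU hf; have := CinfZ oU (@Cinf_cst V R U (-1)) hf.
by apply: eq_Cinf => // x _; rewrite scaleN1r.
Qed.

Lemma CinfB V W (U : set V) (f g : V -> W) :
  open U -> Cinf U f -> Cinf U g -> Cinf U (fun x => f x - g x).
Proof. by move=> oU hf hg; apply: CinfD => //; exact: CinfN. Qed.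

Lemma CinfX V (U : set V) (f : V -> R) n :
  open U -> Cinf U f -> Cinf U (fun x => f x ^+ n).
Proof.
move=> oU hf; elim: n => [|n IH].
  by apply: (eq_Cinf oU _ (@Cinf_cst V R U 1)) => x _; rewrite expr0.
by apply: (eq_Cinf oU _ (CinfM oU hf IH)) => x _; rewrite exprS.
Qed.

Lemma Cinf_comp (U V W : normedModType R) (A : set U) (B : set V) (f : U -> V) (g : V -> W) :
  findim V -> open A -> (forall x, A x -> B (f x)) ->
  Cinf A f -> Cinf B g -> Cinf A (fun x => g (f x)).
Proof. by move=> fV oA AB hf hg k; exact: (Ck_comp fV oA AB). Qed.

Lemma Cinf_linl V W X (A : set V) (f : V -> W) (l : {linear W -> X}) :
  open A -> continuous l -> Cinf A f -> Cinf A (fun x => l (f x)).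
Proof. by move=> oA cl h k; exact: Ck_linl. Qed.

Lemma CkV V (U : set V) (f : V -> R) k :
  open U -> (forall x, U x -> f x != 0) -> Ck k U f ->
  Ck k U (fun x => (f x)^-1).
Proof.
move=> oU f0; elim: k => [|k IH] hf.
  by move=> x Ux; apply: cvgV; [exact: f0|exact: hf].
have kf := IH (CkS hf); case: hf => df Df; split=> [x Ux|v].
  by apply: differentiableV; [exact: df|exact: f0].
have /(eq_Ck oU) : forall x, U x ->
    (fun y => ((-1) * ((f y)^-1 * (f y)^-1)) *: 'D_v f y) x
    = 'D_v (fun x0 : V => (f x0)^-1) x.
  move=> x Ux; have dfx : derivable f x v by apply: diff_derivable; exact: df.
  rewrite [RHS](deriveV (f0 _ Ux) dfx).
  by rewrite mulN1r -invfM expr2.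
by apply; do 3 ?[apply: CkZ => //|exact: Ck_cst|exact: (@CkZ _ V R)|exact: Df].
Qed.

Lemma CinfV V (U : set V) (f : V -> R) :
  open U -> (forall x, U x -> f x != 0) -> Cinf U f ->
  Cinf U (fun x => (f x)^-1).
Proof. by move=> oU f0 hf k; exact: CkV. Qed.

Lemma Cinf_pair V W X (U : set V) (f : V -> W) (g : V -> X) :
  open U -> Cinf U f -> Cinf U g -> Cinf U (fun x => (f x, g x)).
Proof.
move=> oU hf hg k; elim: k f g hf hg => [|k IH] f g hf hg.
  by move=> x Ux; apply: cvg_pair; [exact: (Cinf_cont hf Ux)|exact: (Cinf_cont hg Ux)].
split=> [x Ux|v].
  by apply: differentiable_pair; [exact: (Cinf_diff hf Ux)|exact: (Cinf_diff hg Ux)].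
apply: (eq_Ck oU _ (IH _ _ (Cinf_derive v hf) (Cinf_derive v hg))) => x Ux.
have df := Cinf_diff hf Ux; have dg := Cinf_diff hg Ux.
by rewrite !deriveE // ?(diff_pair df dg) //; exact: differentiable_pair.
Qed.

Lemma fst_cont V W : continuous (fst : V * W -> V).
Proof. by move=> x; exact: cvg_fst. Qed.
Lemma snd_cont V W : continuous (snd : V * W -> W).
Proof. by move=> x; exact: cvg_snd. Qed.

Lemma Cinf_fst V W (U : set (V * W)) : Cinf U (fst : V * W -> V).
Proof. exact: (@Cinf_lin _ _ U fst (@fst_cont V W)). Qed.
Lemma Cinf_snd V W (U : set (V * W)) : Cinf U (snd : V * W -> W).
Proof. exact: (@Cinf_lin _ _ U snd (@snd_cont V W)). Qed.

Lemma Cinf_coord n (U : set 'rV[R]_n) i :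
  Cinf U (fun v : 'rV[R]_n => v 0 i).
Proof. exact: (@Cinf_lin _ _ U (vcoord i) (@vcoord_continuous R n i)). Qed.

Lemma Cinf_coordl V n (U : set V) (f : V -> 'rV[R]_n) i :
  open U -> Cinf U f -> Cinf U (fun x => f x 0 i).
Proof.
move=> oU; exact: (Cinf_linl (l := vcoord i) oU (@vcoord_continuous R n i)).
Qed.

Lemma row2_coord (v : 'rV[R]_2) : v = row2 (v 0 0) (v 0 1).
Proof.
apply/rowP => j; rewrite mxE; case: j => -[|[|//]] jlt /=.
  by rewrite (_ : Ordinal jlt = 0) //; apply/val_inj.
by rewrite (_ : Ordinal jlt = 1) //; apply/val_inj.
Qed.

Lemma row20 (a b : R) : row2 a b 0 0 = a. Proof. by rewrite mxE. Qed.
Lemma row21 (a b : R) : row2 a b 0 1 = b. Proof. by rewrite mxE. Qed.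

Lemma row2E (a b : R) : row2 a b = a *: row2 1 0 + b *: row2 0 1.
Proof.
apply/rowP => j; rewrite !mxE; case: eqP => _; rewrite mulr1 mulr0 ?addr0 //.
by rewrite add0r.
Qed.

Lemma Cinf_row2 V (U : set V) (a b : V -> R) :
  open U -> Cinf U a -> Cinf U b -> Cinf U (fun x => row2 (a x) (b x)).
Proof.
move=> oU ha hb; have h1 := CinfZ oU ha (@Cinf_cst V _ U (row2 1 0)).
have h2 := CinfZ oU hb (@Cinf_cst V _ U (row2 0 1)).
by apply: (eq_Cinf oU _ (CinfD oU h1 h2)) => x _; rewrite -row2E.
Qed.

Lemma derive_row2 V (a b : V -> R) x v :
  differentiable a x -> differentiable b x ->
  differentiable (fun y => row2 (a y) (b y)) x /\
  'D_v (fun y => row2 (a y) (b y)) x = row2 ('D_v a x) ('D_v b x).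
Proof.
move=> da db.
have -> : (fun y => row2 (a y) (b y)) =
   (fun y => a y *: row2 1 0) \+ (fun y => b y *: row2 0 1).
  by apply/funext => y; rewrite row2E.
have [d1 e1] := differentiable_scale da (differentiable_cst (row2 1 0) x).
have [d2 e2] := differentiable_scale db (differentiable_cst (row2 0 1) x).
split; first exact: differentiableD.
rewrite deriveD; [|exact: diff_derivable..].
by rewrite e1 e2 !derive_cst !scaler0 !addr0 -row2E.
Qed.

Lemma derive_coord V n (f : V -> 'rV[R]_n) x v i : differentiable f x ->
  differentiable (fun y => f y 0 i) x /\
  'D_v (fun y => f y 0 i) x = ('D_v f x) 0 i.
Proof.
move=> df.
have dl : differentiable (vcoord i) (f x).
  by apply: linear_differentiable; exact: vcoord_continuous.
split; first exact: (@differentiable_comp _ _ _ _ f (vcoord i)).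
change ('D_v (vcoord i \o f) x = ('D_v f x) 0 i).
by rewrite derive_comp // deriveE // diff_lin //; exact: vcoord_continuous.
Qed.

Lemma derive_R W (f : R -> W) x v : differentiable f x ->
  'D_v f x = v *: 'D_1 f x.
Proof.
move=> df; rewrite [LHS]deriveE // [in RHS]deriveE //.
by rewrite -linearZ [v *: 1]mulr1.
Qed.

Lemma Ck_R W (f : R -> W) (U : set R) k : open U ->
  (forall x, U x -> differentiable f x) -> Ck k U ('D_1 f) -> Ck k.+1 U f.
Proof.
move=> oU df Df; split=> // v.
apply: (eq_Ck oU _ (CkZ oU (@Ck_cst R R R k U v) Df)) => x Ux.
by rewrite [RHS]derive_R //; exact: df.
Qed.

Lemma derive_line V W (f : V -> W) (x v : V) (s : R) :
  differentiable f (x + s *: v) ->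
  is_derive s 1 (fun s : R => f (x + s *: v)) ('D_v f (x + s *: v)).
Proof.
move=> df.
have dl : differentiable (fun s : R => x + s *: v) s.
  apply: (@differentiableD _ _ _ (cst x) (fun s : R => s *: v)) => //.
have Dl : 'D_1 (fun s : R => x + s *: v) s = v.
  rewrite deriveE // (@diffD _ _ _ (cst x) (fun s : R => s *: v)) //.
  by rewrite diff_cst diff_val /= add0r scale1r.
have dc := @differentiable_comp _ _ _ _ (fun s : R => x + s *: v) f _ dl df.
apply: DeriveDef; first exact: diff_derivable.
change ('D_1 (f \o (fun s : R => x + s *: v)) s = 'D_v f (x + s *: v)).
by rewrite derive_comp // Dl.
Qed.

Lemma MVT_line V (f : V -> R) (x v : V) (h : R) : 0 < h ->
  (forall s, 0 <= s <= h -> differentiable f (x + s *: v)) ->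
  exists2 c, 0 < c < h & f (x + h *: v) - f x = h * 'D_v f (x + c *: v).
Proof.
move=> h0 df.
have [] := @MVT R (fun s : R => f (x + s *: v)) (fun s => 'D_v f (x + s *: v)) 0 h h0.
- move=> s; rewrite in_itv /= => /andP[s0 sh].
  by apply: derive_line; apply: df; rewrite !ltW.
- apply: derivable_within_continuous => s; rewrite in_itv /= => sI.
  by have [] := derive_line (df s sI).
- move=> c; rewrite in_itv /= => cI; rewrite scale0r addr0 subr0 => e.
  by exists c => //; rewrite e mulrC.
Qed.

Lemma MVT_le V (f : V -> R) (x v : V) (C : R) :
  (forall s, 0 <= s <= 1 -> differentiable f (x + s *: v)) ->
  (forall s, 0 <= s <= 1 -> `|'D_v f (x + s *: v)| <= C) ->
  `|f (x + v) - f x| <= C.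
Proof.
move=> df Cf; have [c /andP[c0 c1]] := MVT_line ltr01 df.
by rewrite scale1r mul1r => ->; apply: Cf; rewrite !ltW.
Qed.

Lemma dist_mid (a b c e : R) :
  `|a - c| < e / 2 -> `|b - c| < e / 2 -> `|a - b| <= e.
Proof.
rewrite !ltr_norml ler_norml => /andP[? ?] /andP[? ?].
by apply/andP; split; lra.
Qed.

(** The second difference of f over a small parallelogram is symmetric in v and w, and two
    applications of the mean value theorem make it h^2 times a mixed derivative at some point of the
    parallelogram, in either order. The two mixed derivatives thus share values at points
    arbitrarily close to x, where both are continuous. *)
Lemma derive_comm V (U : set V) (f : V -> R) x v w : open U -> U x ->
  Cinf U f -> 'D_v ('D_w f) x = 'D_w ('D_v f) x.
Proof.
move=> oU Ux hf.
have key v' w' (B : set V) (h : R) : 0 < h -> B `<=` U ->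
    (forall s t, 0 <= s <= h -> 0 <= t <= h -> B (x + s *: v' + t *: w')) ->
    exists2 y, B y & f (x + h *: v' + h *: w') - f (x + h *: v')
       - f (x + h *: w') + f x = h * (h * 'D_w' ('D_v' f) y).
  move=> h0 BU Bst; have h01 : 0 <= h <= h by apply/andP; split=> //; exact: ltW.
  have h00 : (0:R) <= 0 <= h by apply/andP; split=> //; exact: ltW.
  pose g y := f (y + h *: w') - f y.
  have dg s : 0 <= s <= h -> is_derive (x + s *: v') v' g
      ('D_v' f (x + s *: v' + h *: w') - 'D_v' f (x + s *: v')) /\
      differentiable g (x + s *: v').
    move=> sI; have dsh : differentiable (shift (h *: w')) (x + s *: v').
      by apply: (@differentiableD _ _ _ id (cst (h *: w'))).
    have df1 : differentiable f (shift (h *: w') (x + s *: v')).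
      by apply: (Cinf_diff hf); apply: BU; exact: Bst.
    have df2 : differentiable f (x + s *: v').
      by apply: (Cinf_diff hf); apply: BU; have := Bst _ _ sI h00; rewrite scale0r addr0.
    have dc := @differentiable_comp _ _ _ _ (shift (h *: w')) f _ dsh df1.
    have dgg : differentiable g (x + s *: v').
      exact: (@differentiableB _ _ _ (f \o shift (h *: w')) f).
    split=> //; apply: DeriveDef; first exact: diff_derivable.
    have -> : g = (f \o shift (h *: w')) - f by [].
    rewrite deriveB; [|exact: diff_derivable..].
    rewrite derive_comp //; congr ('D_ _ _ _ - _).
    rewrite /shift (@deriveD _ _ _ id (cst (h *: w'))) //.
    by rewrite derive_id derive_cst addr0.
  have [c cI] := @MVT_line _ g x v' h h0 (fun s sI => (dg s sI).2).
  have cI' : 0 <= c <= h by case/andP: cI => *; rewrite !ltW.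
  have [_ ->] := (dg c cI').1.
  have [|d dI e2] := @MVT_line _ ('D_v' f) (x + c *: v') w' h h0.
    move=> s sI; apply: (Cinf_diff (Cinf_derive _ hf)).
    by apply: BU; exact: Bst.
  rewrite e2 => e1; exists (x + c *: v' + d *: w').
    by apply: Bst => //; case/andP: dI => *; rewrite !ltW.
  by rewrite -e1 /g; ring.
apply/eqP; rewrite -subr_eq0 -normr_le0; apply/ler_addgt0Pr => e e0.
rewrite add0r.
have c1 := Cinf_cont (Cinf_derive v (Cinf_derive w hf)) Ux.
have c2 := Cinf_cont (Cinf_derive w (Cinf_derive v hf)) Ux.
have e2 : 0 < e / 2 by rewrite divr_gt0.
move/cvgrPdist_lt/(_ _ e2) : c1 => c1; move/cvgrPdist_lt/(_ _ e2) : c2 => c2.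
have nU : \forall y \near x, U y by apply: open_nbhs_nbhs.
have /nbhs_ballP[d /= d0 dB] : nbhs x (fun y => U y /\
    (`|'D_v ('D_w f) x - 'D_v ('D_w f) y| < e / 2 /\
     `|'D_w ('D_v f) x - 'D_w ('D_v f) y| < e / 2)).
  by apply: filterI nU _; exact: filterI c1 c2.
(* With h = d / (2 N) the parallelogram stays in the ball of radius d; the 1 keeps N positive when v
   = w = 0. *)
pose N := 1 + `|v| + `|w|.
have N0 : 0 < N by rewrite /N -addrA ltr_pwDl // addr_ge0.
pose h := d / 2 / N.
have h0 : 0 < h by rewrite !divr_gt0.
have inB v' w' s t : `|v'| + `|w'| <= N -> 0 <= s <= h -> 0 <= t <= h ->
    ball x d (x + s *: v' + t *: w').
  move=> vw /andP[s0 sh] /andP[t0 th]; rewrite -ball_normE /= -addrA opprD addNKr.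
  rewrite normrN (le_lt_trans (ler_normD _ _)) // !normrZ !ger0_norm //.
  have : h * (`|v'| + `|w'|) < d.
    apply: (@le_lt_trans _ _ (h * N)); first by rewrite ler_wpM2l // ltW.
    by rewrite /h -mulrA mulVf ?gt_eqF // mulr1 ltr_pdivrMr // ltr_pMr // ltr1n.
  by apply: le_lt_trans; rewrite mulrDr lerD // ler_wpM2r.
have BU : ball x d `<=` U by move=> y /dB[].
have [|y By ey] := key w v _ h h0 BU; first by move=> *; apply: inB => //; rewrite /N; lra.
have [|z Bz ez] := key v w _ h h0 BU; first by move=> *; apply: inB => //; rewrite /N; lra.
have e' : 'D_v ('D_w f) y = 'D_w ('D_v f) z.
  have sy : f (x + h *: w + h *: v) - f (x + h *: w) - f (x + h *: v) + f x =
            f (x + h *: v + h *: w) - f (x + h *: v) - f (x + h *: w) + f x.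
    by congr (_ + _); rewrite addrAC; congr (f _ - _ - _); rewrite addrAC.
  have /(mulfI (lt0r_neq0 h0)) := etrans (esym ey) (etrans sy ez).
  exact/mulfI/lt0r_neq0.
have [_ [y1 _]] := dB _ By; have [_ [_ z2]] := dB _ Bz.
by apply: dist_mid y1 _; rewrite e'.
Qed.

End Smooth_maps.

(** * Bump functions *)

Section Bump.
Variable R : realType.

(** The functions x^-n exp (-1/x), extended by 0. Differentiation sends the n-th one to a
    combination of the next two, so smoothness is one induction over all n at once; n = 0 is the
    usual flat function. *)
Definition eflat n (x : R) : R :=
  if 0 < x then x^-1 ^+ n * expR (- x^-1) else 0.

Lemma pow_le_expR m (y : R) : 0 <= y -> y ^+ m <= m`!%:R * expR y.
Proof.
case: m => [|m] y0; first by rewrite expr0 mul1r; rewrite -expR0 ler_expR.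
have := expR_ge1Dxn m y0; rewrite -ler_pdivrMl ?ltr0n ?fact_gt0 // mulrC.
by apply: le_trans; rewrite lerDr.
Qed.

(** This is y^(n+2) <= (n+2)! e^y at y = 1/x. A quadratic bound is exactly what makes the derivative
    at 0 exist and vanish. *)
Lemma eflat_le n (x : R) : `|eflat n x| <= (n.+2)`!%:R * x ^+ 2.
Proof.
rewrite /eflat; case: ifPn => [x0|_]; last first.
  by rewrite normr0 mulr_ge0 ?sqr_ge0 ?ler0n.
have y0 : 0 <= x^-1 by rewrite invr_ge0 ltW.
rewrite ger0_norm; last by rewrite mulr_ge0 ?exprn_ge0 ?expR_ge0.
have := pow_le_expR n.+2 y0.
rewrite expRN ler_pdivrMr ?expR_gt0 // => h.
have x2 : 0 < x ^+ 2 by rewrite exprn_gt0.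
rewrite -(ler_pM2r x2) in h.
have <- : x^-1 ^+ n.+2 * x ^+ 2 = x^-1 ^+ n.
  by rewrite -addn2 exprD -mulrA -exprMn mulVf ?gt_eqF // expr1n mulr1.
by rewrite [leRHS]mulrAC.
Qed.

Lemma is_derive_flat (f : R -> R) C : f 0 = 0 ->
  (forall x, `|f x| <= C * x ^+ 2) -> is_derive (0:R) (1:R) f 0.
Proof.
move=> f0 fC.
have key : h^-1 *: (f (h *: 1 + 0) - f 0) @[h --> (0:R)^'] --> (0:R).
  have C0 : 0 <= C by have := fC 1; rewrite expr1n mulr1; apply: le_trans.
  apply/cvgrPdist_le => e e0; near=> h.
  rewrite f0 subr0 addr0 [h *: 1]mulr1 sub0r normrN normrM normfV.
  have h0 : h != 0 by near: h; exact: nbhs_dnbhs_neq.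
  rewrite ler_pdivrMl ?normr_gt0 // (le_trans (fC h)) //.
  rewrite -real_normK ?num_real // expr2 mulrA mulrC ler_wpM2l //.
  apply: (@le_trans _ _ ((C + 1) * `|h|)); first by rewrite ler_wpM2r // lerDl.
  rewrite -ler_pdivlMl; last by rewrite ltr_wpDl.
  near: h; apply: dnbhs0_le; rewrite mulr_gt0 // invr_gt0 ltr_wpDl //.
split; first by apply/cvg_ex; exists 0.
exact/cvg_lim.
Unshelve. all: by end_near. Qed.

Lemma is_derive_eflat n (x : R) :
  is_derive x (1:R) (eflat n) (eflat n.+2 x - n%:R * eflat n.+1 x).
Proof.
have [x0|x0|->] := ltgtP x 0.
- have -> : eflat n.+2 x - n%:R * eflat n.+1 x = 0.
    by rewrite /eflat ltNge (ltW x0) /= mulr0 subr0.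
  have h0 : is_derive x (1:R) (cst 0 : R -> R) 0 by exact: is_derive_cst.
  refine (near_eq_is_derive _ h0).
  near=> y; rewrite /eflat /= ltNge ltW //=.
  by near: y; exact: lt_nbhsl.
- have xn0 : x != 0 by rewrite gt_eqF.
  have di : is_derive x (1:R) (fun x : R => x^-1) (- x ^- 2).
    apply: DeriveDef; first by apply: derivableV.
    by rewrite deriveV // derive_id [_ *: 1]mulr1.
  have de : is_derive x (1:R) (fun x : R => expR (- x^-1)) (x ^- 2 * expR (- x^-1)).
    have dn : is_derive x (1:R) (fun x : R => - x^-1) (x ^- 2).
      by apply: is_derive_eq; rewrite opprK.
    have := @is_derive1_comp _ expR (fun x : R => - x^-1) _ _ _ (is_derive_expR (- x^-1)) dn.
    by rewrite mulrC.
  have dX := is_deriveX n di.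
  have dM := is_deriveM dX de.
  have dE : is_derive x (1:R) (fun x => x^-1 ^+ n * expR (- x^-1))
      (eflat n.+2 x - n%:R * eflat n.+1 x); last first.
    refine (near_eq_is_derive _ dE).
    near=> y; rewrite /eflat /= (_ : 0 < y) //.
    by near: y; exact: lt_nbhsr.
  have eM : (fun x => x^-1 ^+ n * expR (- x^-1)) =
      (fun x : R => x^-1) ^+ n * (fun x : R => expR (- x^-1)).
    by apply/funext => y; rewrite !fctE.
  rewrite -eM in dM; case: dM => dM1 dM2; split => //.
  rewrite dM2 /eflat x0 /= /GRing.scale /= !fctE.
  rewrite -!exprVn.
  set E := expR _; set y := x^-1; case: n {dX eM dM1 dM2} => [|n].
    by rewrite !mul0r mulr0; ring.
  by rewrite succnK !exprS; ring.
- have -> : eflat n.+2 0 - n%:R * eflat n.+1 0 = 0 :> R.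
    by rewrite /eflat ltxx mulr0 subr0.
  apply: is_derive_flat (eflat_le n).
  by rewrite /eflat ltxx.
Unshelve. all: by end_near. Qed.

Lemma Cinf_eflat n : Cinf setT (eflat n).
Proof.
have d m (x : R) : differentiable (eflat m) x.
  by apply/derivable1_diffP; have [] := is_derive_eflat m x.
move=> k; elim: k n => [|k IH] n.
  by move=> x _; apply: differentiable_continuous.
apply: Ck_R => // [|].
  exact: openT.
have := CkD openT (IH n.+2) (CkZ openT (@Ck_cst R R R k setT (- n%:R)) (IH n.+1)).
apply: eq_Ck => [|x _]; first exact: openT.
have [_ ->] := is_derive_eflat n x.
by rewrite [_ *: _]mulNr.
Qed.

Lemma eflat0_ge0 (x : R) : 0 <= eflat 0 x.
Proof. by rewrite /eflat; case: ifP => // _; rewrite expr0 mul1r expR_ge0. Qed.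

Lemma eflat0_gt0 (x : R) : 0 < x -> 0 < eflat 0 x.
Proof. by rewrite /eflat => ->; rewrite expr0 mul1r expR_gt0. Qed.

Lemma eflat0_eq0 (x : R) : x <= 0 -> eflat 0 x = 0.
Proof. by rewrite /eflat leNgt; case: ifP. Qed.

(** A smooth step, constant outside [0, 1]: it serves for the cutoffs and also to reparametrize
    isotopies. *)
Definition sstep (t : R) : R := eflat 0 t / (eflat 0 t + eflat 0 (1 - t)).

Lemma sstep_den (t : R) : 0 < eflat 0 t + eflat 0 (1 - t).
Proof.
have [t0|t0] := ltP 0 t; first by rewrite ltr_pwDl ?eflat0_gt0 ?eflat0_ge0.
by rewrite ltr_wpDl ?eflat0_ge0 // eflat0_gt0 //; lra.
Qed.

Lemma sstep0 (t : R) : t <= 0 -> sstep t = 0.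
Proof. by move=> t0; rewrite /sstep eflat0_eq0 // mul0r. Qed.

Lemma sstep1 (t : R) : 1 <= t -> sstep t = 1.
Proof.
move=> t1; rewrite /sstep (@eflat0_eq0 (1 - t)) ?addr0; last lra.
by rewrite mulfV // gt_eqF // eflat0_gt0 //; lra.
Qed.

Lemma sstep_ge0 (t : R) : 0 <= sstep t.
Proof. by rewrite /sstep divr_ge0 ?eflat0_ge0 // ltW // sstep_den. Qed.

Lemma sstep_le1 (t : R) : sstep t <= 1.
Proof.
by rewrite /sstep ler_pdivrMr ?sstep_den // mul1r lerDl eflat0_ge0.
Qed.

Lemma Cinf_affine1 (a b : R) : Cinf setT (fun t : R => a + b * t).
Proof.
apply: CinfD; [exact: openT|exact: Cinf_cst|].
by apply: CinfM; [exact: openT|exact: Cinf_cst|exact: Cinf_id].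
Qed.

Lemma Cinf_sstep : Cinf setT sstep.
Proof.
have h : Cinf setT (fun t : R => eflat 0 (1 - t)).
  apply: (@Cinf_comp _ _ _ _ _ setT (fun t : R => 1 - t)) => //.
  - exact: openT.
  - apply: (eq_Cinf _ _ (Cinf_affine1 1 (-1))); first exact: openT.
    by move=> x _; rewrite mulN1r.
  - exact: Cinf_eflat.
apply: CinfM; [exact: openT|exact: Cinf_eflat|].
apply: CinfV; first exact: openT.
  by move=> x _; rewrite gt_eqF // sstep_den.
by apply: CinfD => //; [exact: openT|exact: Cinf_eflat].
Qed.

Definition bump1 (t : R) : R := sstep (2 - t) * sstep (2 + t).

Lemma Cinf_bump1 : Cinf setT bump1.
Proof.
apply: CinfM; first exact: openT.
  apply: (@Cinf_comp _ _ _ _ _ setT (fun t : R => 2 - t)) => //.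
  - exact: openT.
  - apply: (eq_Cinf _ _ (Cinf_affine1 2 (-1))); first exact: openT.
    by move=> x _; rewrite mulN1r.
  - exact: Cinf_sstep.
apply: (@Cinf_comp _ _ _ _ _ setT (fun t : R => 2 + t)) => //.
- exact: openT.
- apply: (eq_Cinf _ _ (Cinf_affine1 2 1)); first exact: openT.
  by move=> x _; rewrite mul1r.
- exact: Cinf_sstep.
Qed.

Lemma bump1_1 (t : R) : `|t| <= 1 -> bump1 t = 1.
Proof. by rewrite ler_norml => /andP[? ?]; rewrite /bump1 !sstep1 ?mulr1 //; lra. Qed.

Lemma bump1_0 (t : R) : 2 <= `|t| -> bump1 t = 0.
Proof.
rewrite ler_normr /bump1 => /orP[h|h].
  by rewrite sstep0 ?mul0r //; lra.
by rewrite (@sstep0 (2 + t)) ?mulr0 //; lra.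
Qed.

Definition bump2 (z : 'rV[R]_2) : R := bump1 (z 0 0) * bump1 (z 0 1).

Lemma Cinf_bump2 : Cinf setT bump2.
Proof.
have h i : Cinf setT (fun z : 'rV[R]_2 => bump1 (z 0 i)).
  apply: (@Cinf_comp _ _ _ _ _ setT (fun z : 'rV[R]_2 => z 0 i)) => //.
  - exact: openT.
  - exact: Cinf_coord.
  - exact: Cinf_bump1.
by apply: CinfM => //; exact: openT.
Qed.

Lemma norm2_le (z : 'rV[R]_2) (r : R) :
  (`|z| <= r) = (`|z 0 0| <= r) && (`|z 0 1| <= r).
Proof.
apply/idP/andP => [h|[h0 h1]].
  by split; apply: le_trans h; rewrite [leRHS]/Num.Def.normr /= mx_normrE;
    [exact: (le_bigmax _ _ (0, 0))|exact: (le_bigmax _ _ (0, 1))].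
have r0 : 0 <= r by exact: le_trans h0.
rewrite [leLHS]/Num.Def.normr /= mx_normrE (bigmax_le _ r0) //= => -[i j] _ /=.
rewrite (ord1 i); case: j => -[|[|//]] jlt /=.
  by rewrite (_ : Ordinal jlt = 0) //; apply/val_inj.
by rewrite (_ : Ordinal jlt = 1) //; apply/val_inj.
Qed.

Lemma norm2_lt (z : 'rV[R]_2) (r : R) :
  (`|z| < r) = (`|z 0 0| < r) && (`|z 0 1| < r).
Proof.
apply/idP/andP => [h|[h0 h1]].
  have := lexx `|z|; rewrite {1}norm2_le => /andP[a b].
  by split; apply: le_lt_trans h.
apply: (@le_lt_trans _ _ (Num.max `|z 0 0| `|z 0 1|)).
  by rewrite norm2_le !le_max !lexx orbT.
by rewrite gt_max h0.
Qed.

Lemma bump2_1 (z : 'rV[R]_2) : `|z| <= 1 -> bump2 z = 1.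
Proof. by rewrite norm2_le /bump2 => /andP[? ?]; rewrite !bump1_1 ?mulr1. Qed.

Lemma bump2_0 (z : 'rV[R]_2) : 2 <= `|z| -> bump2 z = 0.
Proof.
rewrite leNgt norm2_lt negb_and -!leNgt /bump2 => /orP[?|?].
  by rewrite bump1_0 ?mul0r.
by rewrite (@bump1_0 (z 0 1)) ?mulr0.
Qed.

End Bump.

(** * Integrals with parameters, primitives, Hadamard's lemma *)

Section Tube.
Lemma tube_nbhs (X Y : topologicalType) (K : set Y) (W : set (X * Y)) (x0 : X) :
  compact K -> (forall y, K y -> nbhs (x0, y) W) ->
  \forall x \near x0, forall y, K y -> W (x, y).
Proof.
move=> /compact_near_coveringP cK h.
apply: (cK X (nbhs x0) (fun x y => W (x, y))).
move=> y /h [[A B] [/= nA nB] AB].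
by exists (B, A) => //= -[y' x'] [/= By Ax]; apply: (AB (x', y')).
Qed.

Lemma tube_open (X Y : topologicalType) (K : set Y) (W : set (X * Y)) (x0 : X) :
  compact K -> open W -> (forall y, K y -> W (x0, y)) ->
  \forall x \near x0, forall y, K y -> W (x, y).
Proof.
move=> cK oW h; apply: tube_nbhs => // y /h Wy.
exact: open_nbhs_nbhs.
Qed.
End Tube.

Section Int01.
Variable R : realType.
Local Notation mu := (@lebesgue_measure R).
Local Notation I01 := (`[0%R, 1%R]%classic : set R).

Definition int01 (f : R -> R) : R := (\int[mu]_(s in I01) f s)%R.

Definition cont01 (f : R -> R) := forall s : R, 0 <= s <= 1 -> {for s, continuous f}.

Lemma cont01_within f : cont01 f -> {within I01, continuous f}.
Proof.
by move=> cf; apply: continuous_in_subspaceT => s; rewrite inE /= in_itv /=; exact: cf.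
Qed.

Lemma int01_itg f : cont01 f -> mu.-integrable I01 (EFin \o f).
Proof.
move=> cf; apply: continuous_compact_integrable; first exact: segment_compact.
exact: cont01_within.
Qed.

Lemma int01D f g : cont01 f -> cont01 g ->
  int01 (fun s => f s + g s) = int01 f + int01 g.
Proof. by move=> cf cg; apply: RintegralD => //; exact: int01_itg. Qed.

Lemma int01Z c f : cont01 f -> int01 (fun s => c * f s) = c * int01 f.
Proof. by move=> cf; apply: RintegralZl => //; exact: int01_itg. Qed.

Lemma eq_int01 f g : (forall s, 0 <= s <= 1 -> f s = g s) -> int01 f = int01 g.
Proof. by move=> fg; apply: eq_Rintegral => s; rewrite inE /= in_itv /=; exact: fg. Qed.

Lemma cont01D f g : cont01 f -> cont01 g -> cont01 (fun s => f s + g s).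
Proof. by move=> cf cg s sI; apply: cvgD; [exact: cf|exact: cg]. Qed.

Lemma cont01M f g : cont01 f -> cont01 g -> cont01 (fun s => f s * g s).
Proof. by move=> cf cg s sI; apply: cvgM; [exact: cf|exact: cg]. Qed.

Lemma cont01B f g : cont01 f -> cont01 g -> cont01 (fun s => f s - g s).
Proof. by move=> cf cg s sI; apply: cvgB; [exact: cf|exact: cg]. Qed.

Lemma cont01_cst c : cont01 (fun=> c).
Proof. by move=> s _; exact: cvg_cst. Qed.

Lemma int01B f g : cont01 f -> cont01 g ->
  int01 (fun s => f s - g s) = int01 f - int01 g.
Proof. by move=> cf cg; apply: RintegralB => //; exact: int01_itg. Qed.

Lemma cont01_sum n (f : 'I_n -> R -> R) :
  (forall i, cont01 (f i)) -> cont01 (fun s => \sum_i f i s).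
Proof.
elim: n f => [|n IH] f h s sI.
  rewrite (_ : (fun s0 => _) = cst 0); first exact: cvg_cst.
  by apply/funext => t; rewrite big_ord0.
rewrite (_ : (fun s0 => _) =
  (fun s => \sum_(i < n) f (widen_ord (leqnSn n) i) s + f ord_max s)).
  by apply: cont01D => //; apply: IH.
by apply/funext => t; rewrite big_ord_recr.
Qed.

Lemma int01_sum n (f : 'I_n -> R -> R) : (forall i, cont01 (f i)) ->
  int01 (fun s => \sum_i f i s) = \sum_i int01 (f i).
Proof.
elim: n f => [|n IH] f h.
  rewrite big_ord0 (_ : (fun s => _) = (fun s : R => 0 * (fun=> 0) s)).
    by rewrite int01Z ?mul0r //; exact: cont01_cst.
  by apply/funext => s; rewrite big_ord0 mul0r.
have hn i : cont01 (f (widen_ord (leqnSn n) i)) by exact: h.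
rewrite big_ord_recr /= -(IH (fun i => f (widen_ord (leqnSn n) i)) hn).
rewrite -int01D //; last exact: cont01_sum.
by apply: eq_int01 => s _; rewrite big_ord_recr.
Qed.

Lemma int01_le f C : cont01 f -> (forall s, 0 <= s <= 1 -> `|f s| <= C) ->
  `|int01 f| <= C.
Proof.
move=> cf fC; apply: (le_trans (le_normr_Rintegral _ (int01_itg cf))) => //.
have cn : cont01 (fun s => `|f s|).
  by move=> s sI; apply: cvg_norm; exact: cf.
have h s : I01 s -> `|f s| <= (cst C : R -> R) s.
  by rewrite /= in_itv /=; exact: fC.
apply: (le_trans (le_Rintegral _ (int01_itg cn) (int01_itg (@cont01_cst C)) h)) => //.
have m1 : mu I01 = 1%:E.
  by rewrite lebesgue_measure_itv /= lte_fin ltr01 -EFinB subr0.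
rewrite [leLHS]Rintegral_cst //; set m := (X in fine X).
have mE : m = 1%:E by exact: m1. rewrite mE /= mulr1.
exact: lexx.
Qed.

Lemma int01_FTC (f F : R -> R) : cont01 f ->
  (forall s : R, 0 <= s <= 1 -> is_derive s (1:R) F (f s)) -> int01 f = F 1 - F 0.
Proof.
move=> cf dF.
have cF (s : R) : 0 <= s <= 1 -> {for s, continuous F}.
  move=> sI; apply: differentiable_continuous; apply/derivable1_diffP.
  by have [] := dF s sI.
rewrite /int01 /Rintegral (@continuous_FTC2 _ f F) //.
- exact: cont01_within.
- split.
  + by move=> s; rewrite in_itv /= => /andP[*]; have [|//] := dF s; rewrite !ltW.
  + by apply: cvg_at_right_filter; apply: cF; rewrite lexx ler01.
  + by apply: cvg_at_left_filter; apply: cF; rewrite lexx ler01.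
- move=> s; rewrite in_itv /= => /andP[*]; have [|? <-] := dF s; rewrite ?derive1E //.
  by rewrite !ltW.
Qed.

Lemma diff_of_approx (V W : normedModType R) (f : V -> W) x (L : {linear V -> W}) :
  continuous L ->
  (forall e, 0 < e -> \forall h \near (0 : V),
     `|f (h + x) - f x - L h| <= e * `|h|) ->
  differentiable f x /\ forall v, 'D_v f x = L v.
Proof.
move=> cL H.
have key : f \o shift x = cst (f x) + L +o_ (0 : V) id.
  apply/eqaddoP => e e0; have := H e e0; apply: filterS => h /=.
  by rewrite !fctE /= opprD addrA.
have dL : 'd f x = L :> (V -> W) by exact: diff_unique cL key.
have df : differentiable f x by apply/diff_locallyP; rewrite dL; split.
by split=> // v; rewrite deriveE // dL.
Qed.

End Int01.

Section ParamInt.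
Variables (R : realType) (V : normedModType R).
Hypothesis fV : findim V.

Definition pint (f : V * R -> R) (x : V) : R := int01 (fun s => f (x, s)).

Lemma slice_cont (Y : topologicalType) (f : V * R -> Y) (x : V) (s : R) :
  {for (x, s), continuous f} -> {for s, continuous (fun s => f (x, s))}.
Proof.
move=> cf; apply: (@continuous_comp _ _ _ (fun s => (x, s)) f) => //.
apply: (@Cinf_cont _ _ _ setT) => //.
by apply: Cinf_pair; [exact: openT|exact: Cinf_cst|exact: Cinf_id].
Qed.

Lemma compact01 : compact [set s : R | 0 <= s <= 1].
Proof.
rewrite (_ : [set s : R | 0 <= s <= 1] = `[0, 1]%classic); first exact: segment_compact.
by apply/seteqP; split=> s /=; rewrite in_itv.
Qed.

Lemma pint_unif (O : set (V * R)) (f : V * R -> R) x : open O ->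
  (forall s, 0 <= s <= 1 -> O (x, s)) -> Cinf O f ->
  forall e, 0 < e -> \forall y \near x, forall s, 0 <= s <= 1 ->
    O (y, s) /\ `|f (y, s) - f (x, s)| <= e.
Proof.
move=> oO xO hf e e0.
have e2 : 0 < e / 2 by rewrite divr_gt0.
apply: (@tube_nbhs V R _ (fun p => O p /\ `|f p - f (x, p.2)| <= e) x compact01).
move=> s sI; have Os := xO s sI.
have nO : nbhs (x, s) O by apply: open_nbhs_nbhs.
have c1 := Cinf_cont hf Os; move/cvgrPdist_lt/(_ _ e2) : (c1) => n1.
have c2 : {for (x, s), continuous (fun p : V * R => f (x, p.2))}.
  apply: (@continuous_comp _ _ _ (fun p : V * R => (x, p.2)) f) => //.
  apply: (@Cinf_cont _ _ _ setT) => //.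
  by apply: Cinf_pair; [exact: openT|exact: Cinf_cst|exact: Cinf_snd].
move/cvgrPdist_lt/(_ _ e2) : (c2) => n2.
apply: filterS3 nO n1 n2 => p Op /= h1 h2.
by split=> //; apply: (@dist_mid R _ _ (f (x, s))); rewrite distrC.
Qed.

Lemma pint_cont01 (O : set (V * R)) (f : V * R -> R) x :
  (forall s, 0 <= s <= 1 -> O (x, s)) -> Cinf O f -> cont01 (fun s => f (x, s)).
Proof.
move=> xO hf s sI; apply: slice_cont; exact: (Cinf_cont hf (xO _ sI)).
Qed.

(** The candidate derivative is expanded in the finite coordinate system, which makes it linear and
    continuous. By the mean value theorem the remainder is an integral of differences of the
    ['D_(e i, 0) f], and these are small near x uniformly in s because [0, 1] is compact. *)
Lemma pint_diff (O : set (V * R)) (f : V * R -> R) x : open O ->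
  (forall s, 0 <= s <= 1 -> O (x, s)) -> Cinf O f ->
  differentiable (pint f) x /\
  forall v, 'D_v (pint f) x = pint ('D_(v, 0) f) x.
Proof.
move=> oO xO hf; have [n [e [c [cc ce]]]] := findimP (V := V).
have De (v : V) y s : O (y, s) ->
    'D_(v, 0) f (y, s) = \sum_i c i v * 'D_(e i, 0) f (y, s).
  move=> Oys; rewrite {1}(ce v).
  have -> : (\sum_i c i v *: e i, 0) = \sum_i c i v *: ((e i, 0) : V * R).
    rewrite (_ : \sum_i c i v *: ((e i, 0) : V * R) =
      \sum_i (c i v *: e i, 0)); last first.
      by apply: eq_bigr => i _; congr (_, _); rewrite /= scaler0.
    by elim/big_rec2: _ => // i a b _ <-; congr (_, _); rewrite /= addr0.
  by rewrite derive_sumr //; exact: (Cinf_diff hf).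
pose L (v : V) := \sum_i c i v * pint ('D_(e i, 0) f) x.
have linL : linear L.
  move=> a u v; rewrite /L scaler_sumr -big_split; apply: eq_bigr => i _ /=.
  by rewrite linearP mulrDl; congr (_ + _); rewrite scalerAl.
pose LM := GRing.isLinear.Build _ _ _ _ L linL.
pose LL : {linear V -> R} := HB.pack L LM.
have cL : continuous LL.
  have cs : Ck 0 setT (fun v => \sum_i c i v * pint ('D_(e i, 0) f) x).
    apply: Ck_sum; first exact: openT.
    move=> i; apply: (@CkZ _ V R 0 setT (c i)); first exact: openT.
      exact: Ck_lin.
    exact: Ck_cst.
  by move=> v; exact: (cs v).
have LE v : LL v = pint ('D_(v, 0) f) x.
  apply/esym; apply: (etrans (@eq_int01 _ (fun s => 'D_(v, 0) f (x, s))
     (fun s => \sum_i c i v * 'D_(e i, 0) f (x, s)) _)).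
    by move=> s /xO; exact: De.
  have ci i : cont01 (fun s => 'D_(e i, 0) f (x, s)).
    exact: (pint_cont01 xO (Cinf_derive (e i, 0) hf)).
  have hs := @int01_sum R n (fun i s => c i v * 'D_(e i, 0) f (x, s))
    (fun i => cont01M (@cont01_cst R (c i v)) (ci i)).
  apply: (etrans hs); apply: eq_bigr => i _; exact: int01Z.
suff [df Df] : differentiable (pint f) x /\ forall v, 'D_v (pint f) x = LL v.
  by split=> // v; rewrite Df LE.
apply: diff_of_approx => // eps eps0.
have kP i : exists k, 0 <= k /\ forall v, `|c i v| <= k * `|v|.
  by have [k k0 H] := linear_lipschitz (cc i); exists k; split=> //; exact: ltW.
pose k i := sval (cid (kP i)).
have k0 i : 0 <= k i by have [] := svalP (cid (kP i)).
have kc i v : `|c i v| <= k i * `|v| by have [_] := svalP (cid (kP i)); exact.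
(* The [k i] bound the coordinate forms, so the error eps / K in each partial derivative adds up to
   at most eps times the norm of h; the 1 keeps K positive. *)
pose K := 1 + \sum_i k i.
have K0 : 0 < K by rewrite /K ltr_pwDl // sumr_ge0.
have eK : 0 < eps / K by rewrite divr_gt0.
have : \forall y \near x, forall i, forall s, 0 <= s <= 1 ->
    O (y, s) /\ `|'D_(e i, 0) f (y, s) - 'D_(e i, 0) f (x, s)| <= eps / K.
  apply: filter_forall => i; exact: (pint_unif oO xO (Cinf_derive (e i, 0) hf) eK).
have nO : \forall y \near x, forall s, 0 <= s <= 1 -> O (y, s).
  exact: tube_open compact01 oO xO.
move=> /(filterI nO) /nbhs_ballP[d /= d0 dB].
apply/nbhs_ballP; exists d => //= h; rewrite -ball_normE /= sub0r normrN => hadamard0.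
have Bx (t : R) : 0 <= t <= 1 -> ball x d (x + t *: h).
  move=> /andP[t0 t1]; rewrite -ball_normE /= opprD addNKr normrN normrZ.
  rewrite ger0_norm //; apply: le_lt_trans hadamard0.
  by rewrite ler_piMl.
have O1 (t s : R) : 0 <= t <= 1 -> 0 <= s <= 1 -> O (x + t *: h, s).
  by move=> tI sI; have [H _] := dB _ (Bx t tI); exact: H.
have pt (s t : R) : (x, s) + t *: (h, 0) = (x + t *: h, s) :> V * R.
  by congr (_, _); rewrite /= scaler0 addr0.
rewrite -[L h]/(LL h) LE (_ : h + x = x + 1 *: h); last by rewrite scale1r addrC.
have c1 : cont01 (fun s => f (x + 1 *: h, s)).
  by apply: pint_cont01 hf => s; apply: O1; rewrite ler01 lexx.
have c2 : cont01 (fun s => f (x, s)) by exact: pint_cont01 xO hf.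
have c3 : cont01 (fun s => 'D_(h, 0) f (x, s)).
  exact: (pint_cont01 xO (Cinf_derive (h, 0) hf)).
rewrite /pint -int01B // -int01B //; last first.
  exact: (cont01B c1 c2).
apply: int01_le.
  exact: (cont01B (cont01B c1 c2) c3).
move=> s sI.
have [|t /andP[t0 t1]] := @MVT_line R (V * R)%type f (x, s) (h, 0) 1 ltr01.
  by move=> t tI; rewrite pt; apply: (Cinf_diff hf); exact: O1.
rewrite !pt mul1r => ->.
have tI : 0 <= t <= 1 by rewrite !ltW.
rewrite !De; [|exact: xO|exact: O1].
rewrite -sumrB (le_trans (ler_norm_sum _ _ _)) //.
apply: (@le_trans _ _ (\sum_i (k i * `|h| * (eps / K)))).
  apply: ler_sum => i _; rewrite -mulrBr normrM ler_pM //.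
  have [_ H] := dB _ (Bx t tI); by have [_] := H i s sI.
rewrite -mulr_suml -mulr_suml.
have -> : (\sum_i k i) * `|h| * (eps / K) = ((\sum_i k i) / K) * (eps * `|h|).
  by move: K^-1 (\sum_i k i) => a b; ring.
rewrite ler_piMl ?mulr_ge0 ?(ltW eps0) // ler_pdivrMr // mul1r /K.
by rewrite lerDr ler01.
Qed.

Lemma Cinf_pint (A : set V) (O : set (V * R)) (f : V * R -> R) :
  open A -> open O -> (forall x s, A x -> 0 <= s <= 1 -> O (x, s)) ->
  Cinf O f -> Cinf A (pint f).
Proof.
move=> oA oO AO hf k; elim: k f hf => [|k IH] f hf.
  move=> x Ax; apply: differentiable_continuous.
  by have [] := pint_diff oO (fun s => AO x s Ax) hf.
split=> [x Ax|v].
  by have [] := pint_diff oO (fun s => AO x s Ax) hf.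
apply: (eq_Ck oA _ (IH _ (Cinf_derive (v, 0) hf))) => x Ax.
by have [_ ->] := pint_diff oO (fun s => AO x s Ax) hf.
Qed.

End ParamInt.

Section Slices.
Variable R : realType.
Implicit Types V W X : normedModType R.

Lemma derive_slice1 V W X (F : V * W -> X) v x y :
  'D_(v, 0) F (x, y) = 'D_v (fun x => F (x, y)) x.
Proof.
rewrite /derive; set g1 := fun h => h^-1 *: _; set g2 := fun h => h^-1 *: _.
suff -> : g1 = g2 by [].
rewrite funeqE => h; rewrite /g1 /g2 /=; congr (_ *: (F _ - _)).
by congr (_, _); rewrite /= scaler0 add0r.
Qed.

Lemma derive_slice2 V W X (F : V * W -> X) w x y :
  'D_(0, w) F (x, y) = 'D_w (fun y => F (x, y)) y.
Proof.
rewrite /derive; set g1 := fun h => h^-1 *: _; set g2 := fun h => h^-1 *: _.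
suff -> : g1 = g2 by [].
rewrite funeqE => h; rewrite /g1 /g2 /=; congr (_ *: (F _ - _)).
by congr (_, _); rewrite /= scaler0 add0r.
Qed.

Lemma derive_aff V W (G : V -> W) x v w :
  (forall t, G (t *: v + x) = G x + t *: w) -> 'D_v G x = w.
Proof.
move=> h; have key : h^-1 *: ((G \o shift x) (h *: v) - G x) @[h --> (0:R)^'] --> w.
  apply: (@cvg_trans _ ((fun=> w) @ (0:R)^')); last exact: cvg_cst.
  apply: near_eq_cvg; near=> t.
  rewrite /= h addrAC subrr add0r scalerA mulVf ?scale1r //.
  by near: t; exact: nbhs_dnbhs_neq.
exact/cvg_lim.
Unshelve. all: by end_near. Qed.

Lemma derive_linear V (l : {linear V -> R}) x v : continuous l -> 'D_v l x = l v.
Proof. by move=> cl; apply: derive_aff => t; rewrite linearD linearZ /= addrC. Qed.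

Lemma deriveMf V (f g : V -> R) x v : differentiable f x -> differentiable g x ->
  'D_v (fun y => f y * g y) x = 'D_v f x * g x + f x * 'D_v g x.
Proof. by move=> df dg; have [_ ->] := differentiable_scale df dg. Qed.

Lemma deriveDf V W (f g : V -> W) x v : differentiable f x -> differentiable g x ->
  'D_v (fun y => f y + g y) x = 'D_v f x + 'D_v g x.
Proof. by move=> df dg; rewrite [LHS]deriveD //; exact: diff_derivable. Qed.

Lemma deriveBf V W (f g : V -> W) x v : differentiable f x -> differentiable g x ->
  'D_v (fun y => f y - g y) x = 'D_v f x - 'D_v g x.
Proof. by move=> df dg; rewrite [LHS]deriveB //; exact: diff_derivable. Qed.

Lemma deriveNf V W (f : V -> W) x v : differentiable f x ->
  'D_v (fun y => - f y) x = - 'D_v f x.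
Proof. by move=> df; rewrite [LHS]deriveN //; exact: diff_derivable. Qed.

Lemma deriveVf V (f : V -> R) x v : differentiable f x -> f x != 0 ->
  'D_v (fun y => (f y)^-1) x = - 'D_v f x / f x ^+ 2.
Proof.
move=> df f0; have dv : derivable f x v by exact: diff_derivable.
rewrite (deriveV f0 dv).
by rewrite /GRing.scale /= mulNr mulrC -mulNr.
Qed.

Lemma deriveZcf V W (f : V -> W) (c : R) x v : differentiable f x ->
  'D_v (fun y => c *: f y) x = c *: 'D_v f x.
Proof. by move=> df; rewrite [LHS]deriveZ //; exact: diff_derivable. Qed.

Lemma deriveZv V W (f : V -> W) (c : R) x v : differentiable f x ->
  'D_(c *: v) f x = c *: 'D_v f x.
Proof. by move=> df; rewrite [LHS]deriveE // [in RHS]deriveE // linearZ. Qed.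

Lemma deriveMcf V (f : V -> R) (c : R) x v : differentiable f x ->
  'D_v (fun y => c * f y) x = c * 'D_v f x.
Proof. by move=> df; rewrite -[RHS]/(c *: _) -deriveZcf. Qed.

End Slices.

Section Prim.
Variables (R : realType) (V : normedModType R).
Hypothesis fV : findim V.
Variables (l : {linear V -> R}) (e : V) (b : R).
Hypotheses (cl : continuous l) (le1 : l e = 1).

(** Since l e = 1, this is the segment from the projection of x along e onto the hyperplane l = b
    (time 0) to x itself (time 1). *)
Definition gam (p : V * R) : V := p.1 - ((1 - p.2) * (l p.1 - b)) *: e.

Lemma Cinf_gam : Cinf setT gam.
Proof.
have oT : open [set: V * R] by exact: openT.
apply: CinfB => //; first exact: Cinf_fst.
apply: (@CinfZ R (V * R)%type V setT (fun p => (1 - p.2) * (l p.1 - b)) (fun=> e)) => //; last exact: Cinf_cst.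
apply: CinfM => //.
  by apply: CinfB => //; [exact: Cinf_cst|exact: Cinf_snd].
apply: CinfB => //; last exact: Cinf_cst.
by apply: Cinf_linl => //; exact: Cinf_fst.
Qed.

Lemma gam1 x : gam (x, 1) = x.
Proof. by rewrite /gam /= subrr mul0r scale0r subr0. Qed.

Lemma gam0 x : gam (x, 0) = x - (l x - b) *: e.
Proof. by rewrite /gam /= subr0 mul1r. Qed.

Lemma derive_gam1 x s v :
  'D_(v, 0) gam (x, s) = v - ((1 - s) * l v) *: e.
Proof.
rewrite derive_slice1; apply: derive_aff => t; rewrite /gam /=.
have lE : l (t *: v + x) = t * l v + l x by rewrite linearD linearZ.
rewrite lE (_ : (1 - s) * (t * l v + l x - b) =
    (1 - s) * (l x - b) + t * ((1 - s) * l v)); last ring.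
rewrite scalerDl opprD addrA scalerBr scalerA addrA; congr (_ - _).
by rewrite -addrA addrC.
Qed.

Lemma derive_gam2 x s : 'D_(0, 1) gam (x, s) = (l x - b) *: e.
Proof.
rewrite derive_slice2; apply: derive_aff => t; rewrite /gam /=.
rewrite -addrA; congr (_ + _); rewrite scalerA -!scaleNr -scalerDl.
by congr (_ *: _); rewrite [t *: 1]mulr1 /GRing.scale /=; ring.
Qed.

Variables (A O : set V).
Hypotheses (oA : open A) (oO : open O).
Hypothesis AO : forall x (s : R), A x -> 0 <= s <= 1 -> O (gam (x, s)).

Let O' : set (V * R) := gam @^-1` O.
Let oO' : open O'.
Proof.
apply: open_comp => // p _.
exact: (Cinf_cont Cinf_gam).
Qed.

Lemma Cinf_compgam f : Cinf O f -> Cinf O' (fun p => f (gam p) : R).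
Proof.
move=> hf; apply: (@Cinf_comp _ _ _ _ O' O gam) => //.
exact: Cinf_sub Cinf_gam.
Qed.

Lemma derive_compgam (f : V -> R) p w : Cinf O f -> O' p ->
  'D_w (fun p => f (gam p)) p = 'D_('D_w gam p) f (gam p).
Proof.
move=> hf Op; apply: (@derive_comp _ _ _ _ gam) => //.
  exact: (Cinf_diff Cinf_gam).
exact: (Cinf_diff hf).
Qed.

(** The integral of f along that segment, rescaled to a fixed interval so that it is a parameter
    integral: a primitive of f in the direction e that vanishes on l = b. *)
Definition prim (f : V -> R) (x : V) : R :=
  (l x - b) * pint (fun p => f (gam p)) x.

Lemma Cinf_lb : Cinf A (fun x => l x - b).
Proof.
by apply: CinfB => //; [exact: Cinf_lin|exact: Cinf_cst].
Qed.

Lemma Cinf_prim f : Cinf O f -> Cinf A (prim f).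
Proof.
move=> hf; apply: CinfM => //; first exact: Cinf_lb.
by apply: (Cinf_pint fV oA oO' _ (Cinf_compgam hf)) => x s Ax; exact: AO.
Qed.

Lemma derive_prim f x v : Cinf O f -> A x -> 'D_v (prim f) x =
  l v * pint (fun p => f (gam p)) x +
  (l x - b) * pint ('D_(v, 0) (fun p => f (gam p))) x.
Proof.
move=> hf Ax.
have [dp Dp] := pint_diff fV oO' (fun s => AO Ax) (Cinf_compgam hf).
rewrite deriveMf //; last exact: (Cinf_diff Cinf_lb).
rewrite Dp; congr (_ * _ + _).
apply: derive_aff => t; have -> : l (t *: v + x) = t * l v + l x.
  by rewrite linearD linearZ.
by rewrite /GRing.scale /=; ring.
Qed.

(** Differentiating under the integral produces the integral of d/ds (s f (gam (x, s))), which is f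
    (gam (x, 1)). *)
Lemma derive_prim1 f x : Cinf O f -> A x -> 'D_e (prim f) x = f x.
Proof.
move=> hf Ax; rewrite derive_prim // le1 mul1r.
have hF := Cinf_compgam hf.
have xO (s : R) : 0 <= s <= 1 -> O' (x, s) by exact: AO.
have c1 := pint_cont01 xO hF.
have c2 := pint_cont01 xO (Cinf_derive (e, 0) hF).
rewrite /pint -int01Z // -int01D //; last first.
  exact: (cont01M (@cont01_cst R (l x - b)) c2).
have dF (s : R) : 0 <= s <= 1 -> is_derive s (1 : R) (fun s => s * f (gam (x, s)))
    (f (gam (x, s)) + (l x - b) * 'D_(e, 0) (fun p => f (gam p)) (x, s)).
  move=> sI; have Os := xO s sI.
  have dFp := Cinf_diff hF Os.
  have di : differentiable (fun s : R => (x, s)) s.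
    by apply: (@Cinf_diff _ _ _ setT) => //; apply: Cinf_pair; [exact: openT|exact: Cinf_cst|exact: Cinf_id].
  have dc := @differentiable_comp _ _ _ _ (fun s : R => (x, s)) (fun p => f (gam p)) s di dFp.
  have did : differentiable (@id R) s by [].
  have [dM DM] := differentiable_scale did dc.
  apply: DeriveDef; first exact: diff_derivable.
  rewrite [LHS]DM derive_id [1 *: _]mul1r; congr (_ + _).
  have -> : 'D_1 ((fun p => f (gam p)) \o (fun s => (x, s))) s
      = 'D_(0, 1) (fun p => f (gam p)) (x, s) by rewrite derive_slice2.
  have df := Cinf_diff hf Os.
  have E1 : 'D_(0, 1) (fun p => f (gam p)) (x, s) = (l x - b) * 'D_e f (gam (x, s)).
    by rewrite (derive_compgam _ hf Os) derive_gam2 deriveZv.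
  have E2 : 'D_(e, 0) (fun p => f (gam p)) (x, s) = s * 'D_e f (gam (x, s)).
    rewrite (derive_compgam _ hf Os) derive_gam1 le1 mulr1.
    have -> : e - (1 - s) *: e = s *: e.
      by rewrite -{1}[e]scale1r -scalerBl opprB addrCA subrr addr0.
    by rewrite deriveZv.
  by rewrite E1 E2 /GRing.scale /= mulrCA.
rewrite (int01_FTC _ dF); last first.
  exact: (cont01D c1 (cont01M (@cont01_cst R (l x - b)) c2)).
by rewrite mul0r subr0 mul1r gam1.
Qed.

(** The factor in Hadamard's lemma: a quotient, smooth also where l = b, of f x - f (gam (x, 0)) by
    l x - b. *)
Definition hadamard (f : V -> R) : V -> R := pint (fun p => 'D_e f (gam p)).

Lemma Cinf_hadamard f : Cinf O f -> Cinf A (hadamard f).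
Proof.
move=> hf; apply: (Cinf_pint fV oA oO' _ (Cinf_compgam (Cinf_derive e hf))).
by move=> x s Ax; exact: AO.
Qed.

Lemma hadamardE f x : Cinf O f -> A x ->
  f x = f (x - (l x - b) *: e) + (l x - b) * hadamard f x.
Proof.
move=> hf Ax; have xO (s : R) : 0 <= s <= 1 -> O' (x, s) by exact: AO.
have c1 := pint_cont01 xO (Cinf_compgam (Cinf_derive e hf)).
have dF (s : R) : 0 <= s <= 1 -> is_derive s (1 : R) (fun s => f (gam (x, s)))
    ((l x - b) * 'D_e f (gam (x, s))).
  move=> sI; have Os := xO s sI; have hF := Cinf_compgam hf.
  have dFp := Cinf_diff hF Os.
  have di : differentiable (fun s : R => (x, s)) s.
    by apply: (@Cinf_diff _ _ _ setT) => //; apply: Cinf_pair; [exact: openT|exact: Cinf_cst|exact: Cinf_id].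
  have dc := @differentiable_comp _ _ _ _ (fun s : R => (x, s)) (fun p => f (gam p)) s di dFp.
  apply: DeriveDef; first exact: diff_derivable.
  apply: (etrans (esym (derive_slice2 (fun p => f (gam p)) 1 x s))).
  by rewrite (derive_compgam _ hf Os) derive_gam2 deriveZv //; exact: (Cinf_diff hf).
have := int01_FTC (cont01M (@cont01_cst R (l x - b)) c1) dF.
rewrite int01Z // gam1 gam0 /hadamard /pint => ->.
by rewrite addrC subrK.
Qed.

End Prim.

(** * A quantitative form of Sard's theorem *)

Section Sard.
Variable R : realType.

Lemma cell_near (x y r s : R) :
  r * 2 <= (x + 1) * s <= (r + 1) * 2 -> r * 2 <= (y + 1) * s <= (r + 1) * 2 ->
  `|x * s - y * s| <= 2.
Proof.
rewrite !mulrDl !mul1r => /andP[? ?] /andP[? ?].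
by rewrite ler_norml; apply/andP; split; lra.
Qed.

(* A Lipschitz image of the square in 3-space misses points arbitrarily close to
   0: among the (m+1)^3 points of a grid of mesh s/m, two lie in the image of one
   of the n^2 small squares as soon as (m+1)^3 > n^2. *)
Lemma sard3 (psi : 'I_3 -> 'rV[R]_2 -> R) (L eps : R) : 0 < eps ->
  (forall i z z', `|z| <= 1 -> `|z'| <= 1 ->
     `|psi i z - psi i z'| <= L * `|z - z'|) ->
  exists a : 'I_3 -> R, (forall i, `|a i| < eps) /\
    forall z, `|z| <= 1 -> exists i, psi i z != a i.
Proof.
move=> eps0 lip; apply: contrapT => no.
have all a : (forall i, `|a i| < eps) ->
    exists z, `|z| <= 1 /\ forall i, psi i z = a i.
  move=> ae; apply: contrapT => nz; apply: no; exists a; split=> // z z1.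
  apply: contrapT => ni; apply: nz; exists z; split=> // i.
  by apply/eqP; apply: contrapT => /negP ii; apply: ni; exists i.
have [k kP] : exists k : nat, (0 < k)%N /\ `|L| * 4 / eps * 2 < k%:R.
  have := archi_boundP (x := `|L| * 4 / eps * 2).
  set k := Num.bound _ => h; exists k.+1; split=> //.
  apply: lt_le_trans (h _) _; last by rewrite ler_nat.
  by rewrite !mulr_ge0 // invr_ge0 ltW.
case: kP => k0 kP.
(* Then n^2 = m^3 < (m+1)^3, while m / n = 1 / k is as small as desired: the mesh eps / (2 m) of the
   grid exceeds 2 L / n, the variation of [psi] over a square of side 2 / n. *)
pose m := (k ^ 2)%N; pose n := (k ^ 3)%N.
have m0 : (0 < m)%N by rewrite expn_gt0 k0.
have n0 : (0 < n)%N by rewrite expn_gt0 k0.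
pose pt (u : {ffun 'I_3 -> 'I_m.+1}) (i : 'I_3) : R := eps / 2 * ((u i)%:R / m%:R).
have ptlt u i : `|pt u i| < eps.
  rewrite /pt ger0_norm ?mulr_ge0 ?invr_ge0 ?ler0n ?(ltW eps0) //.
  apply: (@le_lt_trans _ _ (eps / 2)); last by rewrite ltr_pdivrMr // ltr_pMr // ltr1n.
  rewrite ler_piMr ?divr_ge0 ?(ltW eps0) // ler_pdivrMr ?ltr0n // mul1r ler_nat.
  by rewrite -ltnS.
pose zz u := sval (cid (all (pt u) (ptlt u))).
have zz1 u : `|zz u| <= 1 by have [] := svalP (cid (all (pt u) (ptlt u))).
have zzp u i : psi i (zz u) = pt u i by have [_] := svalP (cid (all (pt u) (ptlt u))).
(* The minimum puts the endpoint x = 1 into the last cell; cells count as closed intervals from here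
   on. *)
pose cell (x : R) : nat := minn n.-1 (Num.truncn ((x + 1) / 2 * n%:R)).
have cellP x : `|x| <= 1 -> (cell x)%:R * 2 <= (x + 1) * n%:R <= ((cell x).+1)%:R * 2.
  rewrite ler_norml => /andP[x1 x2].
  have y0 : 0 <= (x + 1) / 2 * n%:R.
    by rewrite !mulr_ge0 ?ler0n ?invr_ge0 //; lra.
  have yn : (x + 1) / 2 * n%:R <= n%:R.
    rewrite ler_piMl ?ler0n // ler_pdivrMr //; lra.
  have tr := truncn_itv y0.
  have key : (cell x)%:R <= (x + 1) / 2 * n%:R <= (cell x).+1%:R.
    rewrite /cell; set t := Num.truncn _ in tr *; case/andP: tr => t1 t2.
    have [tn|tn] := leqP n.-1 t.
      rewrite prednK // yn andbT.
      by apply: le_trans t1; rewrite ler_nat.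
    by rewrite t1 ltW.
  by case/andP: key => k1 k2; apply/andP; split; lra.
have cell_lt x : (cell x < n)%N.
  by rewrite /cell; apply: leq_ltn_trans (geq_minl _ _) _; rewrite prednK.
pose cc u : 'I_n * 'I_n := (Ordinal (cell_lt (zz u 0 0)), Ordinal (cell_lt (zz u 0 1))).
have ninj : ~ injective cc.
  move=> ci; have := leq_card cc ci.
  rewrite card_ffun card_prod !card_ord leqNgt.
  have nm : (n * n = m ^ 3)%N by rewrite mulnn /n /m -!expnM.
  by rewrite nm ltn_exp2r // ltnSn.
apply: ninj => u v cuv; apply: contrapT => uv.
have [i ui] : exists i, u i != v i.
  apply: contrapT => nu; apply: uv; apply/ffunP => i.
  by apply/eqP; apply: contrapT => /negP ii; apply: nu; exists i.
have n0R : 0 < n%:R :> R by rewrite ltr0n.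
have near x y : `|x| <= 1 -> `|y| <= 1 -> cell x = cell y -> `|x - y| <= 2 / n%:R.
  move=> /cellP + /cellP + cxy; rewrite cxy -[(cell y).+1%:R]natr1 => hx hy.
  rewrite ler_pdivlMr // -[X in _ * X](ger0_norm (ltW n0R)) -normrM.
  by rewrite mulrBl; apply: cell_near hx hy.
have dz : `|zz u - zz v| <= 2 / n%:R.
  have := zz1 u; have := zz1 v; rewrite !norm2_le => /andP[v0 v1] /andP[u0 u1].
  by rewrite !mxE; case: cuv => c0 c1; rewrite !near.
have := lip i _ _ (zz1 u) (zz1 v); rewrite !zzp.
have uvi : 1 <= `|(u i)%:R - (v i)%:R : R|.
  have : (u i : nat) != v i by [].
  rewrite neq_ltn => /orP[h|h].
    rewrite distrC ger0_norm ?subr_ge0 ?ler_nat 1?ltnW // lerBrDr.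
    by rewrite addrC natr1 ler_nat.
  rewrite ger0_norm ?subr_ge0 ?ler_nat 1?ltnW // lerBrDr.
  by rewrite addrC natr1 ler_nat.
rewrite /pt -mulrBr -mulrBl !normrM !normfV.
rewrite (ger0_norm (ltW eps0)) !normr_nat.
move=> h.
have m0R : 0 < m%:R :> R by rewrite ltr0n.
have h1 : eps / 2 * (1 / m%:R) <= `|L| * (2 / n%:R).
  apply: (@le_trans _ _ (eps / 2 * (`|(u i)%:R - (v i)%:R| / m%:R))).
    by rewrite ler_wpM2l ?divr_ge0 ?(ltW eps0) // ler_wpM2r ?invr_ge0 ?ler0n.
  apply: (le_trans h); apply: (@le_trans _ _ (`|L| * `|zz u - zz v|)).
    by rewrite ler_wpM2r // ler_norm.
  by rewrite ler_wpM2l.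
have kR : 0 < k%:R :> R by rewrite ltr0n.
have mE : m%:R = k%:R ^+ 2 :> R by rewrite /m natrX.
have nE : n%:R = k%:R ^+ 3 :> R by rewrite /n natrX.
have h2 : eps / 2 * k%:R <= `|L| * 2.
  move: h1; rewrite mE nE mul1r mulrA.
  rewrite ler_pdivrMr ?exprn_gt0 // -!mulrA (_ : k%:R ^- 3 * k%:R ^+ 2 = k%:R^-1).
    by rewrite !mulrA ler_pdivlMr.
  by rewrite exprS invfM mulfVK // gt_eqF // exprn_gt0.
move: kP; rewrite ltNge => /negP; apply.
have h3 : k%:R <= `|L| * 4 / eps.
  rewrite ler_pdivlMr //; move: h2; move: (k%:R : R) `|L| => p q *; lra.
by apply: (le_trans h3); rewrite ler_peMr ?ler1n // divr_ge0 ?(ltW eps0) // mulr_ge0.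
Qed.

End Sard.

(** * The inverse function theorem in the plane *)

Section IFT0.
Variable R : realType.
(** The contraction argument of [ift2] takes place in a complete space. *)
HB.instance Definition _ := Uniform_isComplete.Build 'rV[R]_2 (@cauchy_cvg 'rV[R]_2).
End IFT0.

(* The two basis vectors are sealed: testing [row2 1 0] and [row2 0 1] for
   convertibility is very slow. *)
Fact be0_key : unit. Proof. exact: tt. Qed.
Fact be1_key : unit. Proof. exact: tt. Qed.
Definition be0 {R : realType} : 'rV[R]_2 := locked_with be0_key (row2 1 0).
Definition be1 {R : realType} : 'rV[R]_2 := locked_with be1_key (row2 0 1).
Lemma be0E (R : realType) : be0 = row2 1 0 :> 'rV[R]_2.
Proof. by rewrite /be0 unlock. Qed.
Lemma be1E (R : realType) : be1 = row2 0 1 :> 'rV[R]_2.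
Proof. by rewrite /be1 unlock. Qed.
Lemma be00 (R : realType) : (be0 : 'rV[R]_2) 0 0 = 1.
Proof. by rewrite be0E row20. Qed.
Lemma be01 (R : realType) : (be0 : 'rV[R]_2) 0 1 = 0.
Proof. by rewrite be0E row21. Qed.
Lemma be10 (R : realType) : (be1 : 'rV[R]_2) 0 0 = 0.
Proof. by rewrite be1E row20. Qed.
Lemma be11 (R : realType) : (be1 : 'rV[R]_2) 0 1 = 1.
Proof. by rewrite be1E row21. Qed.

Section IFT.
Variable R : realType.
Local Notation E2 := ('rV[R]_2).

Lemma be_sum (v : E2) : v = v 0 0 *: be0 + v 0 1 *: be1.
Proof. by rewrite {1}(row2_coord v) row2E be0E be1E. Qed.

Section lin2.
Variables (W : normedModType R) (w0 w1 : W).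
Definition lin2 (v : E2) : W := v 0 0 *: w0 + v 0 1 *: w1.
Lemma lin2_linear : linear lin2.
Proof.
move=> a u v; rewrite /lin2 !mxE !scalerDl scalerDr !scalerA.
by rewrite addrACA.
Qed.
HB.instance Definition _ := GRing.isLinear.Build _ _ _ _ lin2 lin2_linear.
Lemma lin2_cont : continuous lin2.
Proof.
have oT : open [set: E2] by exact: openT.
have h : Cinf setT lin2.
  apply: CinfD => //; apply: CinfZ => //; do ?[exact: Cinf_cst|exact: Cinf_coord].
by move=> x; exact: (Cinf_cont h).
Qed.
Lemma lin2_le v : `|lin2 v| <= (`|w0| + `|w1|) * `|v|.
Proof.
have := lexx `|v|; rewrite {1}norm2_le => /andP[v0 v1].
rewrite (le_trans (ler_normD _ _)) // !normrZ mulrDl.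
by rewrite lerD // mulrC ler_wpM2l.
Qed.
End lin2.

Lemma derive2E (W : normedModType R) (f : E2 -> W) x v : differentiable f x ->
  'D_v f x = lin2 ('D_be0 f x) ('D_be1 f x) v.
Proof.
by move=> df; rewrite {1}(be_sum v) !deriveE // linearD !linearZ.
Qed.

Definition det2 (u v : E2) : R := u 0 0 * v 0 1 - u 0 1 * v 0 0.

(** Cramer's rule for [lin2 u v]. *)
Definition inv2 (u v : E2) : E2 -> E2 :=
  lin2 ((det2 u v)^-1 *: row2 (v 0 1) (- u 0 1))
       ((det2 u v)^-1 *: row2 (- v 0 0) (u 0 0)).

Lemma inv2K u v : det2 u v != 0 -> cancel (lin2 u v) (inv2 u v).
Proof.
move=> d0 w; rewrite [RHS]row2_coord [LHS]row2_coord; congr row2;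
rewrite /inv2 /lin2 !mxE /= ; move: d0; rewrite /det2 => d0; field.
all: exact: d0.
Qed.

Lemma inv2K' u v : det2 u v != 0 -> cancel (inv2 u v) (lin2 u v).
Proof.
move=> d0 w; rewrite [RHS]row2_coord [LHS]row2_coord; congr row2;
rewrite /inv2 /lin2 !mxE /= ; move: d0; rewrite /det2 => d0; field.
all: exact: d0.
Qed.

Definition jac (f : E2 -> E2) (x : E2) : R := det2 ('D_be0 f x) ('D_be1 f x).

Lemma Cinf_jac (U : set E2) f : open U -> Cinf U f -> Cinf U (jac f).
Proof.
move=> oU hf; apply: CinfB => //; apply: CinfM => //; apply: Cinf_coordl => //;
exact: Cinf_derive.
Qed.

Lemma open_normlt (V : normedModType R) (r : R) : open [set z : V | `|z| < r].
Proof.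
rewrite (_ : [set z : V | _] = (fun z : V => `|z|) @^-1` [set t | t < r]) //.
by apply: open_comp; [move=> ? _; exact: norm_continuous|exact: open_lt].
Qed.

Lemma open_normgt (V : normedModType R) (r : R) : open [set z : V | r < `|z|].
Proof.
rewrite (_ : [set z : V | _] = (fun z : V => `|z|) @^-1` [set t | r < t]) //.
by apply: open_comp; [move=> ? _; exact: norm_continuous|exact: open_gt].
Qed.

Lemma nbhs_ballnorm (V : normedModType R) (x : V) (P : set V) : nbhs x P ->
  exists2 r : R, 0 < r & forall y, `|y - x| <= r -> P y.
Proof.
move=> /nbhs_ballP[r /= r0 rP]; exists (r / 2); first by rewrite divr_gt0.
move=> y yx; apply: rP; rewrite -ball_normE /= distrC; apply: le_lt_trans yx _.
by rewrite ltr_pdivrMr // ltr_pMr // ltr1n.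
Qed.

(** Near x0 all partial derivatives of both coordinates are at most 1/4, hence 1/2 for the two
    directions together, and the mean value theorem applies along segments, which stay in the ball
    by convexity. *)
Lemma small_lip (U : set E2) (g : E2 -> E2) x0 : open U -> U x0 -> Cinf U g ->
  (forall v, 'D_v g x0 = 0) ->
  exists2 r : R, 0 < r & forall x y, `|x - x0| <= r -> `|y - x0| <= r ->
    U x /\ `|g x - g y| <= `|x - y| / 2.
Proof.
move=> oU Ux0 hg Dg0.
pose P (k : 'I_2) (v : E2) (x : E2) := `|'D_v (fun y => g y 0 k) x| <= 1 / 4.
have nP k v : \forall x \near x0, P k v x.
  have c := Cinf_cont (Cinf_derive v (Cinf_coordl k oU hg)) Ux0.
  have [_ e] := derive_coord v k (Cinf_diff hg Ux0).
  have q0 : 0 < 1 / 4 :> R by [].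
  move/cvgrPdist_le/(_ _ q0) : c; apply: filterS => x.
  by rewrite e Dg0 mxE sub0r normrN.
have nU : \forall x \near x0, U x by apply: open_nbhs_nbhs.
have : \forall x \near x0, (U x /\ (P 0 be0 x /\ P 0 be1 x)) /\ (P 1 be0 x /\ P 1 be1 x).
  apply: filterI; last by apply: filterI; exact: nP.
  by apply: filterI => //; apply: filterI; exact: nP.
move=> /nbhs_ballnorm[r r0 rP]; exists r => // x y xr yr.
have Ux : U x by have [[]] := rP x xr.
split=> //.
have seg (s : R) : 0 <= s <= 1 -> `|y + s *: (x - y) - x0| <= r.
  move=> /andP[s0 s1].
  have -> : y + s *: (x - y) - x0 = (1 - s) *: (y - x0) + s *: (x - x0).
    by apply/rowP => k; rewrite !mxE; ring.
  rewrite (le_trans (ler_normD _ _)) // !normrZ (ger0_norm s0) ger0_norm ?subr_ge0 //.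
  rewrite (_ : r = (1 - s) * r + s * r); last by ring.
  by rewrite lerD // ler_wpM2l // subr_ge0.
have comp k : (forall z, `|z - x0| <= r -> P k be0 z /\ P k be1 z) ->
    `|g x 0 k - g y 0 k| <= `|x - y| / 2.
  move=> Pk; have hk := Cinf_coordl k oU hg.
  have := @MVT_le R E2 (fun y => g y 0 k) y (x - y) (`|x - y| / 2).
  rewrite (_ : y + (x - y) = x); last by rewrite addrC subrK.
  apply=> s sI; have [[Us _] _] := rP _ (seg s sI).
    exact: (Cinf_diff hk).
  have [p0 p1] := Pk _ (seg s sI).
  rewrite derive2E; last exact: (Cinf_diff hk).
  rewrite (le_trans (lin2_le _ _ _)) // mulrC ler_wpM2l //.
  by apply: (le_trans (lerD p0 p1)); rewrite -mulrDl; lra.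
rewrite norm2_le !mxE; apply/andP; split; apply: comp => z /rP[[_ ?] ?] //.
Qed.

(** Let A be the inverse of the differential at x0. For y near f x0 the map x - A (f x) + A y
    contracts a closed ball around x0 and its fixed point is the preimage of y. The resulting
    inverse is Lipschitz, from which it is differentiable with the inverse matrix as derivative, and
    then smooth by induction. *)
Theorem ift2 (f : E2 -> E2) (U : set E2) x0 :
  open U -> U x0 -> Cinf U f -> jac f x0 != 0 ->
  exists (U' V' : set E2) (g : E2 -> E2),
    [/\ open U' /\ U' x0, U' `<=` U, open V' /\ Cinf V' g,
        (forall x, U' x -> V' (f x) /\ g (f x) = x) &
        (forall y, V' y -> U' (g y) /\ f (g y) = y)].
Proof.
move=> oU Ux0 hf j0.
(* Where the Jacobian does not vanish, the inverse matrix [G] below is a smooth function of the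
   point. *)
pose UJ := U `&` [set x | jac f x != 0].
have oUJ : open UJ.
  rewrite openE => x [Ux jx]; apply: filterI; first exact: open_nbhs_nbhs.
  have c := Cinf_cont (Cinf_jac oU hf) Ux.
  by apply: (c [set y | y != 0]); apply: open_nbhs_nbhs; split=> //; exact: open_neq.
have hfJ : Cinf UJ f by apply: Cinf_sub hf => x [].
pose A := inv2 ('D_be0 f x0) ('D_be1 f x0).
have lA : Cinf setT A by apply: Cinf_lin; exact: lin2_cont.
have oT : open [set: E2] by exact: openT.
have AD u v : A (u - v) = A u - A v by rewrite /A /inv2 linearB.
pose g x := x - A (f x).
have hAf : Cinf UJ (fun x => A (f x)) by apply: (Cinf_comp _ oUJ _ hfJ lA).
have hg : Cinf UJ g by apply: CinfB => //; exact: Cinf_id.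
have UJ0 : UJ x0 by [].
have Dg v : 'D_v g x0 = 0.
  rewrite deriveBf ?derive_id; [|by []|exact: (Cinf_diff hAf)].
  have df0 := Cinf_diff hf Ux0.
  have -> : 'D_v (fun x => A (f x)) x0 = A ('D_v f x0).
    apply: (etrans (derive_comp (f := f) (g := A) v df0 (Cinf_diff lA (I : setT (f x0))))).
    by apply: derive_aff => t; rewrite /A /inv2 linearD linearZ addrC.
  by rewrite (derive2E v df0) /A inv2K // subrr.
have [r r0 rP] := small_lip oUJ UJ0 hg Dg.
have key x y : `|x - x0| <= r -> `|y - x0| <= r -> `|x - y| <= 2 * `|A (f x - f y)|.
  move=> xr yr; have [_ h] := rP x y xr yr.
  have e : x - y = (g x - g y) + A (f x - f y).
    by rewrite AD /g; apply/rowP => k; rewrite !mxE; ring.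
  have : `|x - y| <= `|x - y| / 2 + `|A (f x - f y)|.
    by rewrite {1}e (le_trans (ler_normD _ _)) // lerD2r.
  by move: `|x - y| `|A _| => p q; lra.
(* With this bound and the factor 1/2, [T] maps the closed ball of radius r into the open one, so
   the fixed point is interior. *)
pose V' := [set y | `|A (y - f x0)| < r / 2].
have r2 : 0 < r / 2 by rewrite divr_gt0.
have x0r : `|x0 - x0| <= r by rewrite subrr normr0 ltW.
have hn : Cinf setT (fun y => A (y - f x0)).
  apply: (@Cinf_comp _ _ _ _ _ setT (fun y => y - f x0) A) => //.
  by apply: CinfB => //; [exact: Cinf_id|exact: Cinf_cst].
have oV' : open V'.
  rewrite (_ : V' = (fun y => `|A (y - f x0)|) @^-1` [set t | t < r / 2]) //.
  apply: open_comp; last exact: open_lt.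
  by move=> y _; have c := Cinf_cont hn (I : setT y); exact: cvg_norm c.
have AN0 : A 0 = 0 by rewrite /A /inv2 linear0.
have ex y : exists p, V' y -> `|p - x0| < r /\ f p = y.
  have [Vy|nVy] := pselect (V' y); last by exists 0.
  pose B := closed_ball_ (fun x : E2 => `|x|) x0 r.
  pose T x := g x + A y.
  have Tx x : `|x - x0| <= r -> T x - x0 = (g x - g x0) + A (y - f x0).
    by move=> xr; rewrite AD /T /g; apply/rowP => k; rewrite !mxE; ring.
  have Tle x : `|x - x0| <= r -> `|T x - x0| < `|x - x0| / 2 + r / 2.
    move=> xr; rewrite Tx //; apply: (le_lt_trans (ler_normD _ _)).
    by apply: ler_ltD; [have [] := rP x x0 xr x0r|exact: Vy].
  have TB : set_fun B B T.
    move=> x; rewrite /B /closed_ball_ /= distrC => xr; rewrite distrC.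
    apply/ltW/(lt_le_trans (Tle _ xr)).
    by move: `|_| xr => p pr; lra.
  have i2 : 0 <= 1 / 2 :> R by [].
  have ctr : is_contraction (mkfun_fun TB).
    exists (NngNum i2); split; first by rewrite /= ltr_pdivrMr // mul1r ltr1n.
    move=> [u v] [] /=; rewrite /B /closed_ball_ /= => Bu Bv.
    rewrite /mkfun /T opprD addrACA subrr addr0 mulrC mul1r.
    by rewrite distrC in Bu; rewrite distrC in Bv; have [] := rP u v Bu Bv.
  have cB : closed B by exact: closed_closed_ball_.
  have [|p Bp pT] := @banach_fixed_point R 'rV[R]_2 B (mkfun_fun TB) ctr cB.
    by exists x0; rewrite /B /closed_ball_ /= subrr normr0 ltW.
  have {pT}pT : p = T p by exact: pT.
  have pr : `|p - x0| <= r by move: Bp; rewrite /B /closed_ball_ /= distrC.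
  exists p => _; split.
    by have := Tle p pr; rewrite -pT; move: `|_| => q; lra.
  have e : A (f p) = A y.
    have : g p + A y = p by rewrite -/(T p).
    by rewrite /g addrAC => /eqP; rewrite subr_eq => /eqP /addrI.
  by rewrite -[f p](inv2K' j0) -/(A (f p)) e (inv2K' j0).
have [h hP] := choice ex.
have hr y : V' y -> `|h y - x0| < r by move=> /hP[].
have fh y : V' y -> f (h y) = y by move=> /hP[].
have UJh y : V' y -> UJ (h y).
  by move=> /hr /ltW hy; have [] := rP _ _ hy x0r.
have [K K0 AK] := linear_lipschitz (@lin2_cont _
   ((det2 ('D_be0 f x0) ('D_be1 f x0))^-1 *: row2 ('D_be1 f x0 0 1) (- ('D_be0 f x0) 0 1))
   ((det2 ('D_be0 f x0) ('D_be1 f x0))^-1 *: row2 (- ('D_be1 f x0) 0 0) ('D_be0 f x0 0 0))).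
have hlip y y' : V' y -> V' y' -> `|h y - h y'| <= 2 * K * `|y - y'|.
  move=> Vy Vy'; apply: (le_trans (key _ _ (ltW (hr _ Vy)) (ltW (hr _ Vy')))).
  by rewrite !fh // -mulrA ler_wpM2l //; exact: AK.
pose G (v x : E2) := inv2 ('D_be0 f x) ('D_be1 f x) v.
have hG v : Cinf UJ (G v).
  have hj : Cinf UJ (fun x => (jac f x)^-1).
    apply: CinfV; [exact: oUJ|by move=> x []|exact: (Cinf_jac oUJ hfJ)].
  apply: CinfD => //; apply: CinfZ => //; do ?exact: Cinf_cst.
    apply: CinfZ => //; apply: Cinf_row2 => //; do ?apply: CinfN => //;
      apply: Cinf_coordl => //; exact: Cinf_derive.
  apply: CinfZ => //; apply: Cinf_row2 => //; do ?apply: CinfN => //;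
    apply: Cinf_coordl => //; exact: Cinf_derive.
have dh y : V' y -> differentiable h y /\ forall v, 'D_v h y = G v (h y).
  move=> Vy; have Uh := UJh y Vy; have jh : jac f (h y) != 0 by case: Uh.
  have df := Cinf_diff hfJ Uh.
  pose L := @lin2 E2
   ((jac f (h y))^-1 *: row2 ('D_be1 f (h y) 0 1) (- ('D_be0 f (h y)) 0 1))
   ((jac f (h y))^-1 *: row2 (- ('D_be1 f (h y)) 0 0) ('D_be0 f (h y) 0 0)).
  have [M M0 LM] := linear_lipschitz (@lin2_cont _
   ((jac f (h y))^-1 *: row2 ('D_be1 f (h y) 0 1) (- ('D_be0 f (h y)) 0 1))
   ((jac f (h y))^-1 *: row2 (- ('D_be1 f (h y)) 0 0) ('D_be0 f (h y) 0 0))).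
  apply: diff_of_approx; first exact: lin2_cont.
  move=> eps eps0.
  (* M bounds the inverse matrix at h y and 2 K is a Lipschitz constant of [h]; the remainder of f
     is multiplied by both. *)
  have c0 : 0 < eps / (M * (2 * K)) by rewrite divr_gt0 // mulr_gt0 // mulr_gt0.
  have /diff_locallyP[_ /eqaddoP/(_ _ c0) H] := df.
  have /nbhs_ballnorm[d d0 dP] := H.
  have nV : \forall w \near (0 : E2), V' (w + y).
    have cs : {for (0 : E2), continuous (fun w : E2 => w + y)}.
      apply: (@Cinf_cont _ _ _ setT) => //.
      by apply: CinfD => //; [exact: Cinf_id|exact: Cinf_cst].
    by apply: cs; rewrite /= add0r; exact: open_nbhs_nbhs.
  have dK : 0 < d / (2 * K) by rewrite divr_gt0 // mulr_gt0.
  have nd : \forall w \near (0 : E2), `|w| <= d / (2 * K).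
    by apply/nbhs_ballP; exists (d / (2 * K)) => //= w; rewrite -ball_normE /= sub0r normrN => /ltW.
  apply: filterS2 nV nd => w Vw wd.
  pose k := h (w + y) - h y.
  have kw : `|k| <= 2 * K * `|w|.
    by have := hlip _ _ Vw Vy; rewrite addrK.
  have kd : `|k - 0| <= d.
    rewrite subr0; apply: (le_trans kw); rewrite mulrC -ler_pdivlMr //.
    by rewrite mulr_gt0.
  have := dP k kd; rewrite !fctE /= /k subrK !fh //.
  rewrite -/k => Hk.
  have e1 : h (w + y) - h y - L w = L (- (w + y - (y + 'd f (h y) k))).
    have -> : - (w + y - (y + 'd f (h y) k)) = 'd f (h y) k - w.
      by apply/rowP => i; rewrite !mxE; ring.
    have Lk : L ('d f (h y) k) = k.
      rewrite -(deriveE k df) (derive2E k df).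
      exact: (inv2K jh k).
    have LB u v : L (u - v) = L u - L v by exact: linearB.
    by rewrite LB Lk.
  rewrite e1; apply: (le_trans (LM _)); rewrite normrN.
  apply: (@le_trans _ _ (M * (eps / (M * (2 * K)) * (2 * K * `|w|)))).
    rewrite ler_wpM2l ?(ltW M0) //; apply: (le_trans Hk).
    by rewrite ler_wpM2l // ltW.
  have MK : M * (2 * K) != 0 by rewrite gt_eqF // mulr_gt0 // mulr_gt0.
  have reassoc (c p q t : R) : p * (c * (q * t)) = c * (p * q) * t by ring.
  by rewrite reassoc divfK.
(* The derivative of [h] is [G v] composed with [h] itself, so each order of smoothness yields the
   next. *)
have hh : Cinf V' h.
  move=> n; elim: n => [|n IH].
    by move=> y /dh[dhy _]; exact: differentiable_continuous.
  split=> [y /dh[]//|v].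
  have hc : Ck n V' (G v \o h).
    exact: (@Ck_comp R E2 E2 E2 n V' UJ h (G v) (findim_rV R 2) oV' UJh IH (hG v n)).
  by apply: (eq_Ck oV' _ hc) => y Vy; exact: (esym ((dh y Vy).2 v)).
exists ([set x | `|x - x0| < r] `&` (UJ `&` f @^-1` V')), V', h.
have oUr : open [set x : E2 | `|x - x0| < r].
  rewrite (_ : [set x : E2 | `|x - x0| < r] = ball x0 r); first exact: ball_open.
  by apply/seteqP; split=> x; rewrite -ball_normE /= distrC.
split; last first.
- move=> y Vy; split; last exact: fh.
  split; first exact: hr.
  split; first exact: UJh.
  by rewrite /preimage /= (fh _ Vy).
- move=> x [xr [Ux Vx]]; split; first exact: Vx.
  apply/eqP; rewrite -subr_eq0 -normr_le0.
  have := key _ _ (ltW (hr _ Vx)) (ltW xr).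
  by rewrite fh // subrr AN0 normr0 mulr0.
- by split.
- by move=> x [_ [[]]].
- split; last by split; [|split]; rewrite /V' /= ?subrr ?normr0 ?AN0 ?normr0.
  rewrite openE => x [xr [Ux Vx]]; apply: filterI; first exact: open_nbhs_nbhs.
  apply: filterI; first exact: open_nbhs_nbhs.
  by apply: (Cinf_cont hfJ Ux); exact: open_nbhs_nbhs.
Qed.

End IFT.

Lemma open_preim (X Y : topologicalType) (A : set X) (B : set Y) (f : X -> Y) :
  open A -> open B -> (forall x, A x -> {for x, continuous f}) ->
  open (A `&` f @^-1` B).
Proof.
move=> oA oB cf; rewrite openE => x [Ax Bfx]; apply: filterI.
  exact: open_nbhs_nbhs.
by apply: (cf x Ax); exact: open_nbhs_nbhs.
Qed.

(** * Charts and smooth families of maps *)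

Section Charts.
Variable R : realType.
Local Notation E2 := ('rV[R]_2).

Section OneSurface.
Variable M : surface R.
Implicit Types c d e : chart E2 M.

Lemma chart_local (x : M) : local_coordinates (chart_at x).
Proof. by move=> y; split; exact: chart_at_smooth. Qed.

Lemma trans_open c d : open (cod c `&` bwd c @^-1` dom d).
Proof. exact: transition_open. Qed.

Lemma local_trans c d : local_coordinates c -> local_coordinates d ->
  smooth_transition c d.
Proof.
move=> lc ld; apply: Cinf_local => u [cu du].
pose e := chart_at (bwd c u).
have eu : dom e (bwd c u) by exact: chart_at_dom.
pose U' := (cod c `&` bwd c @^-1` dom d) `&` (cod c `&` bwd c @^-1` dom e).
have oU' : open U' by apply: openI; exact: trans_open.
exists U'; split; first by [].
have h1 : Cinf U' (fwd e \o bwd c).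
  by apply: Cinf_sub (lc (bwd c u)).1 => v [].
have h2 : Cinf (cod e `&` bwd e @^-1` dom d) (fwd d \o bwd e) := (ld (bwd c u)).2.
have h3 : Cinf U' (fun v => (fwd d \o bwd e) ((fwd e \o bwd c) v)).
  apply: (Cinf_comp (findim_rV R 2) oU' _ h1 h2) => v [[cv dv] [_ ev]] /=.
  by split; [exact: fwd_cod|rewrite /= fwdK].
by apply: (eq_Cinf oU' _ h3) => v [[cv dv] [_ ev]] /=; rewrite fwdK.
Qed.

Section Dchart.
Variables (c : chart E2 M) (U V : set E2) (f g : E2 -> E2).
Hypotheses (oU : open U) (oV : open V) (Uc : U `<=` cod c).
Hypotheses (fU : forall x, U x -> V (f x) /\ g (f x) = x).
Hypotheses (gV : forall y, V y -> U (g y) /\ f (g y) = y).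
Hypotheses (cf : Cinf U f) (cg : Cinf V g).

Definition dchart : chart E2 M.
Proof.
apply: (@Chart R E2 M (dom c `&` fwd c @^-1` U) V (f \o fwd c) (bwd c \o g)).
- apply: open_preim; [exact: dom_open|exact: oU|].
  by move=> x; exact: fwd_continuous.
- exact: oV.
- by move=> x [_ /fU[]].
- move=> u /gV[Ug _]; split; first exact: bwd_dom (Uc Ug).
  by rewrite /preimage /= bwdK //; exact: Uc.
- by move=> x [dx /fU[_ e]] /=; rewrite e fwdK.
- by move=> u /gV[Ug e] /=; rewrite bwdK //; exact: Uc.
- move=> x [dx Ux]; apply: continuous_comp; first exact: fwd_continuous.
  exact: (Cinf_cont cf Ux).
- move=> u Vu; apply: continuous_comp; first exact: (Cinf_cont cg Vu).
  by apply: bwd_continuous; apply: Uc; have [] := gV Vu.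
Defined.

Lemma dchart_local : local_coordinates c -> local_coordinates dchart.
Proof.
move=> lc y; split.
  have oW := @trans_open dchart (chart_at y).
  apply: (Cinf_comp (findim_rV R 2) oW _ (Cinf_sub _ cg) (lc y).1).
    by move=> v [/= Vv dv]; split=> //; apply: Uc; have [] := gV Vv.
  by move=> v [].
have oW := @trans_open (chart_at y) dchart.
apply: (Cinf_comp (findim_rV R 2) oW _ (Cinf_sub _ (lc y).2) cf).
  by move=> v [/= cv [dv Uv]].
by move=> v [/= cv [dv Uv]]; split.
Qed.

End Dchart.

(** Darboux, adapted and normal form coordinates are all obtained in this way from explicit
    functions of the plane. *)
Lemma chart_ift c x (U : set E2) (f : E2 -> E2) :
  local_coordinates c -> dom c x -> open U -> U `<=` cod c -> U (fwd c x) ->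
  Cinf U f -> jac f (fwd c x) != 0 ->
  exists d, [/\ local_coordinates d, dom d x &
    forall y, dom d y -> [/\ dom c y, U (fwd c y) & fwd d y = f (fwd c y)]].
Proof.
move=> lc dx oU Uc Ux hf jf.
have [U' [V [g [[oU' U'x] U'U [oV hg] fU gV]]]] := ift2 oU Ux hf jf.
have U'c : U' `<=` cod c by move=> z /U'U /Uc.
have hf' : Cinf U' f by exact: Cinf_sub hf.
exists (dchart oU' oV U'c fU gV hf' hg); split.
- exact: dchart_local.
- by split.
- by move=> y [dy Uy]; split=> //; exact: U'U.
Qed.

End OneSurface.

Section Families.
Variables (P : normedModType R) (M N : surface R).
Hypothesis fP : findim P.
Variables (O : set P).
Implicit Types (G : P -> M -> N) (c : chart E2 M) (d : chart E2 N).

Definition prep c d G (p : P * E2) : E2 := fwd d (G p.1 (bwd c p.2)).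

Definition prep_dom c d G : set (P * E2) :=
  [set p | [/\ O p.1, cod c p.2 & dom d (G p.1 (bwd c p.2))]].

(** Joint smoothness in the parameter and the point. A single pair of charts around each (a, x) is
    required, which suits families defined by cases; [smooth_family_rep] then gives smoothness in
    every pair. *)
Definition smooth_family G : Prop := forall a x, O a -> exists c d (W : set (P * E2)),
  [/\ local_coordinates c /\ local_coordinates d, dom c x,
      open W /\ W (a, fwd c x), W `<=` prep_dom c d G & Cinf W (prep c d G)].

Lemma smooth_family_rep_local G c d : smooth_family G -> local_coordinates c -> local_coordinates d ->
  forall p, prep_dom c d G p -> exists W, [/\ open W, W p, W `<=` prep_dom c d G &
    Cinf W (prep c d G)].
Proof.
move=> hG lc ld p [Op cp dp].
have [c' [d' [W' [[lc' ld'] c'x [oW' W'p] W'dom hW']]]] := hG p.1 (bwd c p.2) Op.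
pose T := fwd c' \o bwd c.
pose A : set (P * E2) := snd @^-1` (cod c `&` bwd c @^-1` dom c').
have oA : open A.
  by apply: open_comp; [move=> ? _; exact: snd_cont|exact: trans_open].
have hT : Cinf A (fun q : P * E2 => (q.1, T q.2)).
  apply: Cinf_pair => //; first exact: Cinf_fst.
  apply: (Cinf_comp (findim_rV R 2) oA _ (@Cinf_snd R P E2 A) (local_trans lc lc')).
  by move=> q [].
pose W1 := A `&` (fun q : P * E2 => (q.1, T q.2)) @^-1` W'.
have oW1 : open W1.
  by apply: open_preim; [exact: oA|exact: oW'|] => q Aq; exact: (Cinf_cont hT Aq).
have h1 : Cinf W1 (fun q => prep c' d' G (q.1, T q.2)).
  apply: (Cinf_comp (findim_prod fP (findim_rV R 2)) oW1 _ (Cinf_sub _ hT) hW').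
    by move=> q [].
  by move=> q [].
have TK q : W1 q -> bwd c' (T q.2) = bwd c q.2.
  by move=> [[cq dq] _]; rewrite /T /= fwdK.
pose W2 := W1 `&` (fun q => prep c' d' G (q.1, T q.2)) @^-1`
   (cod d' `&` bwd d' @^-1` dom d).
have oW2 : open W2.
  apply: open_preim; [exact: oW1|exact: trans_open|].
  by move=> q Wq; exact: (Cinf_cont h1 Wq).
have GE q : W1 q -> bwd d' (prep c' d' G (q.1, T q.2)) = G q.1 (bwd c q.2).
  move=> Wq; have [Oq cq dq] := W'dom _ Wq.2.
  by rewrite /prep /= fwdK // TK.
have W1p : W1 p.
  have Ap : A p by split.
  by split.
exists W2; split=> //.
- split=> //; split.
    by apply: fwd_cod; have [_ _ /=] := W'dom _ W'p; rewrite fwdK.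
  by rewrite /preimage /= GE.
- move=> q [Wq [cq dq]]; have [Oq _ _] := W'dom _ Wq.2.
  split=> //; first by case: Wq => [[]].
  by move: dq; rewrite /preimage /= GE.
have h3 : Cinf W2 (fun q => (fwd d \o bwd d') (prep c' d' G (q.1, T q.2))).
  apply: (Cinf_comp (findim_rV R 2) oW2 _ (Cinf_sub _ h1) (local_trans ld' ld)).
    by move=> q [].
  by move=> q [].
apply: (eq_Cinf oW2 _ h3) => q [Wq _] /=.
by rewrite GE.
Qed.

Lemma smooth_family_rep G c d : smooth_family G -> local_coordinates c -> local_coordinates d ->
  open (prep_dom c d G) /\ Cinf (prep_dom c d G) (prep c d G).
Proof.
move=> hG lc ld; have h := smooth_family_rep_local hG lc ld; split.
  rewrite openE => p /h[W [oW Wp WD _]].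
  by apply: filterS WD _; exact: open_nbhs_nbhs.
by apply: Cinf_local => p /h[W [oW Wp WD hW]]; exists W.
Qed.

Lemma smooth_family_local G : (forall a x, O a -> exists G' (A : set (P * M)),
   [/\ smooth_family G', open A, A (a, x) & forall p, A p -> G p.1 p.2 = G' p.1 p.2]) ->
  smooth_family G.
Proof.
move=> h a x Oa; have [G' [A [hG' oA Ax GG']]] := h a x Oa.
have [c [d [W [[lc ld] dx [oW Wx] WD hW]]]] := hG' a x Oa.
pose B : set (P * E2) := snd @^-1` cod c.
have oB : open B.
  by apply: open_comp; [move=> ? _; exact: snd_cont|exact: cod_open].
pose W2 := W `&` (B `&` (fun q : P * E2 => (q.1, bwd c q.2)) @^-1` A).
have oW2 : open W2.
  apply: openI; first exact: oW.
  apply: open_preim; [exact: oB|exact: oA|] => -[q1 q2] Bq.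
  have c1 : {for q1, continuous (@id P)} by exact: cvg_id.
  exact: (continuous_map c1 (bwd_continuous Bq)).
exists c, d, W2; split=> //.
- split=> //; split=> //; split; first exact: fwd_cod.
  by rewrite /preimage /= fwdK.
- move=> q [Wq [Bq Aq]]; have [Oq cq dq] := WD _ Wq.
  by split=> //; have /= -> := GG' _ Aq.
have hW2 : Cinf W2 (prep c d G') by apply: Cinf_sub hW => q [].
apply: (eq_Cinf oW2 _ hW2) => q [Wq [Bq Aq]].
by rewrite /prep; have /= -> := GG' _ Aq.
Qed.

End Families.

End Charts.

(** * Coordinate representatives, differentials and critical points *)

Section Representatives.
Variable R : realType.
Local Notation E2 := ('rV[R]_2).

Lemma Cinf_slice (P V W : normedModType R) (A : set (P * V)) (F : P * V -> W) (a : P) :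
  findim P -> findim V -> open A -> Cinf A F ->
  open [set z | A (a, z)] /\ Cinf [set z | A (a, z)] (fun z => F (a, z)).
Proof.
move=> fP fV oA hF.
have hp : Cinf setT (fun z : V => (a, z)).
  by apply: Cinf_pair; [exact: openT|exact: Cinf_cst|exact: Cinf_id].
have oAz : open [set z | A (a, z)].
  by apply: (@open_comp _ _ (fun z : V => (a, z)) A) => // z _; exact: (Cinf_cont hp (I : setT z)).
split=> //; apply: (@Cinf_comp _ _ _ _ _ A (fun z => (a, z)) F _ oAz _ _ hF) => //.
exact: Cinf_sub hp.
Qed.

Section Rep.
Variables (M N : surface R).
Implicit Types (f : M -> N) (c : chart E2 M) (d : chart E2 N).

Definition rep c d f (z : E2) : E2 := fwd d (f (bwd c z)).

Definition rdom c d f : set E2 := [set z | cod c z /\ dom d (f (bwd c z))].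

Lemma smooth_const_family (P : normedModType R) f : smooth f ->
  smooth_family (setT : set P) (fun=> f).
Proof.
move=> hf a x _; have [_ [U [oU Ux hU]]] := hf x.
pose c := chart_at x; pose d := chart_at (f x).
pose B : set E2 := U `&` (cod c `&` (f \o bwd c) @^-1` dom d).
have oB : open B.
  apply: openI; first exact: oU.
  apply: open_preim; [exact: cod_open|exact: dom_open|] => z cz.
  by apply: continuous_comp; [exact: bwd_continuous|have [] := hf (bwd c z)].
have oW : open (snd @^-1` B : set (P * E2)).
  by apply: open_comp => // ? _; exact: snd_cont.
have dx : dom c x by exact: chart_at_dom.
exists c, d, (snd @^-1` B); split.
- by split; exact: chart_local.
- exact: dx.
- split; first exact: oW.
  split; first exact: Ux.
  split; first exact: fwd_cod.
  by rewrite /preimage /= fwdK //; exact: chart_at_dom.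
- by move=> q [_ [cq dq]]; split.
- apply: (Cinf_comp (findim_rV R 2) oW _ (@Cinf_snd R P E2 _) hU).
  by move=> q [].
Qed.

Lemma smooth_family_slice (P : normedModType R) (fP : findim P) (O : set P) (G : P -> M -> N) a c d :
  O a -> smooth_family O G -> local_coordinates c -> local_coordinates d ->
  open (rdom c d (G a)) /\ Cinf (rdom c d (G a)) (rep c d (G a)).
Proof.
move=> Oa hG lc ld; have [oD hD] := smooth_family_rep fP hG lc ld.
have [oS hS] := Cinf_slice a fP (findim_rV R 2) oD hD.
have e : [set z | prep_dom O c d G (a, z)] = rdom c d (G a).
  by apply/seteqP; split=> z; [move=> [_ /= ? ?]; split|move=> [? ?]; split].
by rewrite -e.
Qed.

(** A map is regarded as a constant family, for which the change of charts has been settled. *)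
Lemma srep f c d : smooth f -> local_coordinates c -> local_coordinates d ->
  open (rdom c d f) /\ Cinf (rdom c d f) (rep c d f).
Proof.
move=> hf lc ld.
exact: (smooth_family_slice (findim_R R) (I : setT (0 : R)) (@smooth_const_family R f hf) lc ld).
Qed.

Lemma smooth_family_smooth (P : normedModType R) (fP : findim P) (O : set P) (G : P -> M -> N) a :
  O a -> smooth_family O G -> smooth (G a).
Proof.
move=> Oa hG x; pose c := chart_at x; pose d := chart_at (G a x).
have [oD hD] := smooth_family_slice fP Oa hG (chart_local x) (chart_local (G a x)).
have cx : dom c x by exact: chart_at_dom.
have Dx : rdom c d (G a) (fwd c x).
  by split; [exact: fwd_cod|rewrite fwdK //; exact: chart_at_dom].
split; last by exists (rdom c d (G a)); split.
have nD : \forall y \near x, dom c y /\ rdom c d (G a) (fwd c y).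
  apply: filterI; first by apply: open_nbhs_nbhs; split => //; exact: dom_open.
  by apply: (fwd_continuous cx); exact: open_nbhs_nbhs.
have cc : {for x, continuous (bwd d \o (rep c d (G a) \o fwd c))}.
  apply: continuous_comp; last first.
    by apply: bwd_continuous; rewrite /rep /= fwdK //; apply: fwd_cod; exact: chart_at_dom.
  by apply: continuous_comp; [exact: fwd_continuous|exact: (Cinf_cont hD Dx)].
have ex : (bwd d \o (rep c d (G a) \o fwd c)) x = G a x.
  by rewrite /rep /= fwdK // fwdK //; exact: chart_at_dom.
move: cc; rewrite /prop_for /continuous_at ex; apply: cvg_trans.
apply: near_eq_cvg; apply: filterS nD => y [cy [_ dy]] /=.
by rewrite /rep /= fwdK //; rewrite fwdK // in dy; rewrite fwdK.
Qed.

End Rep.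

Section TD.
Variable M : surface R.
Implicit Types c d e : chart E2 M.

(** The differential at x of the change of charts: tangent vectors are recorded in [chart_at x] and
    have to be converted to the chart in use. *)
Definition tD c d x (v : E2) : E2 := 'D_v (fwd d \o bwd c) (fwd c x).

Lemma tD_diff c d x : local_coordinates c -> local_coordinates d ->
  dom c x -> dom d x -> differentiable (fwd d \o bwd c) (fwd c x).
Proof.
move=> lc ld cx dx; apply: (Cinf_diff (local_trans lc ld)).
by split; [exact: fwd_cod|rewrite /preimage /= fwdK].
Qed.

Lemma tDK c d x v : local_coordinates c -> local_coordinates d ->
  dom c x -> dom d x -> tD d c x (tD c d x v) = v.
Proof.
move=> lc ld cx dx; rewrite /tD.
have e : fwd d x = (fwd d \o bwd c) (fwd c x) by rewrite /= fwdK.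
have d1 := tD_diff lc ld cx dx.
have d2 : differentiable (fwd c \o bwd d) ((fwd d \o bwd c) (fwd c x)).
  by rewrite -e; exact: tD_diff.
rewrite e -(derive_comp v d1 d2).
rewrite -[RHS](derive_id (fwd c x) v); apply: near_eq_derive.
have [oT] : open (cod c `&` bwd c @^-1` dom d) /\ True by split=> //; exact: trans_open.
move=> _; have nT : \forall z \near fwd c x, (cod c `&` bwd c @^-1` dom d) z.
  apply: open_nbhs_nbhs; split=> //.
  by split; [exact: fwd_cod|rewrite /preimage /= fwdK].
by apply: filterS nT => z [cz dz] /=; rewrite fwdK // bwdK.
Qed.

Lemma tD0 c d x : tD c d x 0 = 0.
Proof. by rewrite /tD derive0. Qed.

End TD.

Section Diff.
Variables (M N : surface R) (f : M -> N).
Hypothesis hf : smooth f.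
Variables (c : chart E2 M) (d : chart E2 N) (x : M).
Hypotheses (lc : local_coordinates c) (ld : local_coordinates d).
Hypotheses (cx : dom c x) (dx : dom d (f x)).

Lemma rdom_x : rdom c d f (fwd c x).
Proof. by split; [exact: fwd_cod|rewrite fwdK]. Qed.

Lemma rep_diff : differentiable (rep c d f) (fwd c x).
Proof. by have [_ h] := srep hf lc ld; exact: (Cinf_diff h rdom_x). Qed.

Lemma local_rep_diff : differentiable (local_rep f x) (fwd (chart_at x) x).
Proof.
have [_ h] := srep hf (chart_local x) (chart_local (f x)).
apply: (Cinf_diff h); split; first by apply: fwd_cod; exact: chart_at_dom.
by rewrite fwdK; exact: chart_at_dom.
Qed.

Lemma differentialE v : differential f x v =
  tD d (chart_at (f x)) (f x) ('D_(tD (chart_at x) c x v) (rep c d f) (fwd c x)).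
Proof.
pose c0 := chart_at x; pose d0 := chart_at (f x).
have lc0 := chart_local x; have ld0 := chart_local (f x).
have c0x : dom c0 x by exact: chart_at_dom.
have d0x : dom d0 (f x) by exact: chart_at_dom.
rewrite /differential -(deriveE v local_rep_diff).
have e1 : fwd c x = (fwd c \o bwd c0) (fwd c0 x) by rewrite /= fwdK.
have d1 : differentiable (fwd c \o bwd c0) (fwd c0 x) by exact: tD_diff.
have d2 : differentiable (rep c d f) ((fwd c \o bwd c0) (fwd c0 x)).
  by rewrite -e1; exact: rep_diff.
have e2 : fwd d (f x) = rep c d f ((fwd c \o bwd c0) (fwd c0 x)).
  by rewrite -e1 /rep fwdK.
have d3 : differentiable (fwd d0 \o bwd d) (rep c d f ((fwd c \o bwd c0) (fwd c0 x))).
  by rewrite -e2; exact: tD_diff.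
rewrite /tD e2 e1 -/c0 -/d0.
rewrite -(derive_comp v d1 d2) -(derive_comp v (differentiable_comp d1 d2) d3).
apply: near_eq_derive.
have nT : \forall z \near fwd c0 x, (cod c0 `&` bwd c0 @^-1` dom c) z.
  apply: open_nbhs_nbhs; split; first exact: trans_open.
  by split; [exact: fwd_cod|rewrite /preimage /= fwdK].
have [oD _] := srep hf lc0 ld.
have nD : \forall z \near fwd c0 x, rdom c0 d f z.
  apply: open_nbhs_nbhs; split => //.
  by split; [exact: fwd_cod|rewrite fwdK].
apply: filterS2 nT nD => z [cz dz] [_ dfz].
by rewrite /local_rep /rep /= fwdK // fwdK.
Qed.

Lemma differential0P v : differential f x v = 0 <->
  'D_(tD (chart_at x) c x v) (rep c d f) (fwd c x) = 0.
Proof.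
have d0x : dom (chart_at (f x)) (f x) by exact: chart_at_dom.
rewrite differentialE; split=> [e|->]; last exact: tD0.
have := tDK ('D_(tD (chart_at x) c x v) (rep c d f) (fwd c x)) ld
  (chart_local (f x)) dx d0x.
by rewrite e tD0 => <-.
Qed.

Lemma tD_neq0 v : v != 0 -> tD (chart_at x) c x v != 0.
Proof.
apply: contra => /eqP e; apply/eqP.
by rewrite -(tDK v (chart_local x) lc (chart_at_dom x) cx) e tD0.
Qed.

End Diff.

Lemma row2P (u v : E2) : u 0 0 = v 0 0 -> u 0 1 = v 0 1 -> u = v.
Proof. by move=> e0 e1; rewrite (row2_coord u) (row2_coord v) e0 e1. Qed.

Lemma jac0P (F : E2 -> E2) z : differentiable F z ->
  jac F z = 0 <-> exists2 v, v != 0 & 'D_v F z = 0.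
Proof.
move=> dF; split=> [j0|[v v0 Dv]]; last first.
  apply/eqP; apply: contraT => j0; move: v0.
  by rewrite -(inv2K j0 v) -(derive2E v dF) Dv /inv2 linear0 eqxx.
move: j0; rewrite /jac /det2.
have main (u w : E2) : u 0 0 * w 0 1 - u 0 1 * w 0 0 = 0 ->
    exists2 v, v != 0 & lin2 u w v = 0.
  (* Both are kernel vectors because the determinant vanishes; if both are zero, then u = 0 and (1,
     0) is in the kernel. *)
  move=> d0; pose a := row2 (w 0 1) (- u 0 1); pose b := row2 (w 0 0) (- u 0 0).
  have la : lin2 u w a = 0.
    by apply: row2P; rewrite /lin2 !mxE /=; [rewrite -d0|]; ring.
  have lb : lin2 u w b = 0.
    by apply: row2P; rewrite /lin2 !mxE /=; [|rewrite -[RHS]oppr0 -d0]; ring.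
  have [a0|a0] := eqVneq a 0; last by exists a.
  have [b0|b0] := eqVneq b 0; last by exists b.
  have ua : u 0 1 = 0 by have := congr1 (fun m : E2 => m 0 1) a0; rewrite row21 mxE => /eqP; rewrite oppr_eq0 => /eqP.
  have ub : u 0 0 = 0 by have := congr1 (fun m : E2 => m 0 1) b0; rewrite row21 mxE => /eqP; rewrite oppr_eq0 => /eqP.
  exists (row2 1 0).
    apply/eqP => /(congr1 (fun m : E2 => m 0 0)); rewrite row20 mxE => /eqP.
    by rewrite oner_eq0.
  rewrite /lin2 row20 row21 scale0r addr0 scale1r (row2_coord u) ua ub.
  by apply/rowP => j; rewrite !mxE; case: ifP.
move=> /main[v v0 lv]; exists v => //.
by rewrite derive2E.
Qed.

Lemma critical_ker (M N : surface R) (f : M -> N) x : smooth f ->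
  critical_point f x <-> exists2 v, v != 0 & differential f x v = 0.
Proof.
move=> hf; rewrite /critical_point.
pose A := lin1_mx (differential f x).
have AE v : v *m A = differential f x v by exact: mul_rV_lin1.
split=> [rk|[v v0 dv]].
  have : kermx A != 0.
    by rewrite kermx_eq0 /row_free ltn_eqF.
  move=> /rowV0Pn[v /sub_kermxP vA v0]; exists v => //.
  by rewrite -AE.
rewrite ltn_neqAle rank_leq_row andbT; apply: contraL v0 => rf.
by rewrite negbK -(mulmx_free_eq0 _ rf) AE dv.
Qed.

Lemma critical_jac (M N : surface R) (f : M -> N) x (c : chart E2 M) (d : chart E2 N) :
  smooth f -> local_coordinates c -> local_coordinates d ->
  dom c x -> dom d (f x) ->
  critical_point f x <-> jac (rep c d f) (fwd c x) = 0.
Proof.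
move=> hf lc ld cx dx.
apply: (iff_trans (critical_ker x hf)); apply: iff_trans (iff_sym (jac0P (rep_diff hf lc ld cx dx))).
have c0x := chart_at_dom x; have l0 := chart_local x.
split=> [[v v0 /(differential0P hf lc ld cx dx) e]|[v v0 e]].
  by exists (tD (chart_at x) c x v) => //; exact: tD_neq0.
exists (tD c (chart_at x) x v).
  apply: contra v0 => /eqP e0.
  by rewrite -(tDK v lc l0 cx c0x) e0 tD0.
apply/(differential0P hf lc ld cx dx).
by rewrite (tDK v lc l0 cx c0x).
Qed.

End Representatives.

(** * Maps into a product, and Darboux charts *)

Section Products.
Variable R : realType.
Local Notation E2 := ('rV[R]_2).

Lemma det2_lin (u w a b : E2) :
  det2 (lin2 u w a) (lin2 u w b) = det2 u w * det2 a b.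
Proof. by rewrite /det2 /lin2 !mxE; ring. Qed.

Lemma det2_row (a b c d : R) : det2 (row2 a b) (row2 c d) = a * d - b * c.
Proof. by rewrite /det2 !row20 !row21. Qed.

Section Pair.
Variables (F F1 F2 : surface R).
Implicit Types g : F -> prod_manifold F1 F2.

Lemma smooth_pairP g : smooth g <->
  smooth (fun x => (g x).1 : F1) /\ smooth (fun x => (g x).2 : F2).
Proof.
split=> [hg|[h1 h2] x].
  split=> x; have [cg [U [oU Ux hU]]] := hg x; split.
  - apply: (@continuous_comp _ _ _ g (fst : F1 * F2 -> F1)) => //; exact: cvg_fst.
  - exists U; split=> //.
    have := @Cinf_linl R E2 _ _ U (local_rep g x) (fst : {linear (E2 * E2)%type -> E2}) oU.
    by move=> /(_ (@fst_cont R E2 E2) hU).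
  - apply: (@continuous_comp _ _ _ g (snd : F1 * F2 -> F2)) => //; exact: cvg_snd.
  - exists U; split=> //.
    have := @Cinf_linl R E2 _ _ U (local_rep g x) (snd : {linear (E2 * E2)%type -> E2}) oU.
    by move=> /(_ (@snd_cont R E2 E2) hU).
have [c1 [U1 [oU1 U1x hU1]]] := h1 x; have [c2 [U2 [oU2 U2x hU2]]] := h2 x.
split.
  rewrite /prop_for /continuous_at (surjective_pairing (g x)).
  rewrite (_ : g = fun y => ((g y).1, (g y).2)).
    by apply: cvg_pair; [exact: c1|exact: c2].
  by apply/funext => y; exact: surjective_pairing.
exists (U1 `&` U2); split; first exact: openI.
  by split.
have := Cinf_pair (openI oU1 oU2) (Cinf_sub (@subIsetl _ U1 U2) hU1) (Cinf_sub (@subIsetr _ U1 U2) hU2).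
by [].
Qed.

Lemma differential_pair g x v : smooth g ->
  differential g x v = (differential (fun x => (g x).1 : F1) x v,
                        differential (fun x => (g x).2 : F2) x v).
Proof.
move=> /smooth_pairP[h1 h2].
have d1 := local_rep_diff h1 x; have d2 := local_rep_diff h2 x.
exact: (congr1 (fun h => h v) (diff_pair d1 d2)).
Qed.

Lemma differential_fst (p : prod_manifold F1 F2) v :
  @differential R _ _ (prod_manifold F1 F2) F1 fst p v = v.1.
Proof.
rewrite /differential.
have e : \forall u \near (fwd (chart_at p) p), (fst : E2 * E2 -> E2) u =
     @local_rep R _ _ (prod_manifold F1 F2) F1 fst p u.
  have o : open (cod (chart_at p)) by exact: cod_open.
  have n : \forall u \near fwd (chart_at p) p, cod (chart_at p) u.
    by apply: open_nbhs_nbhs; split=> //; apply: fwd_cod; exact: chart_at_dom.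
  by apply: filterS n => -[u1 u2] [/= c1 c2]; rewrite /local_rep /= bwdK.
have dl : differentiable (@local_rep R _ _ (prod_manifold F1 F2) F1 fst p)
     (fwd (chart_at p) p).
  have df : differentiable (fst : E2 * E2 -> E2) (fwd (chart_at p) p).
    by apply: linear_differentiable; exact: fst_cont.
  (* The projection and its representative agree only near the point, so differentiability is
     transferred on the interior of the set where they agree. *)
  have : Ck 1 [set u | (fst : E2 * E2 -> E2) u = @local_rep R _ _ (prod_manifold F1 F2) F1 fst p u]° (fst : E2 * E2 -> E2) by apply: Ck_lin; exact: fst_cont.
  move=> /(eq_Ck (@open_interior _ _) _) H.
  have [|H1 _] := H (@local_rep R _ _ (prod_manifold F1 F2) F1 fst p).
    by move=> u /interior_subset.
  by apply: H1.
rewrite -(deriveE v dl) -(near_eq_derive v e).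
by apply: derive_aff => t; rewrite addrC.
Qed.

Lemma differential_snd (p : prod_manifold F1 F2) v :
  @differential R _ _ (prod_manifold F1 F2) F2 snd p v = v.2.
Proof.
rewrite /differential.
have e : \forall u \near (fwd (chart_at p) p), (snd : E2 * E2 -> E2) u =
     @local_rep R _ _ (prod_manifold F1 F2) F2 snd p u.
  have o : open (cod (chart_at p)) by exact: cod_open.
  have n : \forall u \near fwd (chart_at p) p, cod (chart_at p) u.
    by apply: open_nbhs_nbhs; split=> //; apply: fwd_cod; exact: chart_at_dom.
  by apply: filterS n => -[u1 u2] [/= c1 c2]; rewrite /local_rep /= bwdK.
have dl : differentiable (@local_rep R _ _ (prod_manifold F1 F2) F2 snd p)
     (fwd (chart_at p) p).
  have : Ck 1 [set u | (snd : E2 * E2 -> E2) u = @local_rep R _ _ (prod_manifold F1 F2) F2 snd p u]° (snd : E2 * E2 -> E2) by apply: Ck_lin; exact: snd_cont.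
  move=> /(eq_Ck (@open_interior _ _) _) H.
  have [|H1 _] := H (@local_rep R _ _ (prod_manifold F1 F2) F2 snd p).
    by move=> u /interior_subset.
  by apply: H1.
rewrite -(deriveE v dl) -(near_eq_derive v e).
by apply: derive_aff => t; rewrite addrC.
Qed.

Lemma pullbackE (w1 : form2 F1) (w2 : form2 F2) g x v v' : smooth g ->
  pullback g (form2_minus w1 w2) x v v' =
  w1 (g x).1 (differential (fun x => (g x).1 : F1) x v) (differential (fun x => (g x).1 : F1) x v')
  - w2 (g x).2 (differential (fun x => (g x).2 : F2) x v) (differential (fun x => (g x).2 : F2) x v').
Proof.
move=> hg; rewrite /pullback /form2_minus /pullback.
by rewrite !differential_fst !differential_snd !differential_pair.
Qed.

End Pair.

Section Darboux.
Variables (N : surface R) (w : form2 N).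
Implicit Types c d e : chart E2 N.

Definition darboux d := local_coordinates d /\
  forall u, cod d u -> forall v v', form2_in_chart d w u v v' = det2 v v'.

Lemma tD_comp c d e x v : local_coordinates c -> local_coordinates d ->
  local_coordinates e -> dom c x -> dom d x -> dom e x ->
  tD d e x (tD c d x v) = tD c e x v.
Proof.
move=> lc ld le cx dx ex; rewrite /tD.
have E : fwd d x = (fwd d \o bwd c) (fwd c x) by rewrite /= fwdK.
have d1 := tD_diff lc ld cx dx.
have d2 : differentiable (fwd e \o bwd d) ((fwd d \o bwd c) (fwd c x)).
  by rewrite -E; exact: tD_diff.
rewrite E -(derive_comp v d1 d2); apply: near_eq_derive.
have nT : \forall z \near fwd c x, (cod c `&` bwd c @^-1` dom d) z.
  apply: open_nbhs_nbhs; split; first exact: trans_open.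
  by split; [exact: fwd_cod|rewrite /preimage /= fwdK].
by apply: filterS nT => z [cz dz] /=; rewrite fwdK.
Qed.

Lemma form2_in_chartE c x v v' : local_coordinates c -> dom c x ->
  form2_in_chart c w (fwd c x) v v' =
  w x (tD c (chart_at x) x v) (tD c (chart_at x) x v').
Proof.
move=> lc cx; rewrite /form2_in_chart fwdK //.
by rewrite /tD !deriveE //; exact: (tD_diff lc (chart_local x) cx (chart_at_dom x)).
Qed.

Lemma tD_lin c d x v : local_coordinates c -> local_coordinates d ->
  dom c x -> dom d x -> tD c d x v = lin2 (tD c d x be0) (tD c d x be1) v.
Proof. by move=> lc ld cx dx; rewrite /tD derive2E //; exact: tD_diff. Qed.

Hypothesis sw : symplectic w.

Lemma alt2 c x v v' : local_coordinates c -> dom c x ->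
  form2_in_chart c w (fwd c x) v v' =
  form2_in_chart c w (fwd c x) be0 be1 * det2 v v'.
Proof.
move=> lc cx; rewrite !form2_in_chartE //.
have [alt _ _ _] := sw; have [L1 L2 L3] := alt x.
have l0 := chart_local x; have c0 := chart_at_dom x.
rewrite (tD_lin v lc l0 cx c0) (tD_lin v' lc l0 cx c0).
move: (tD _ _ _ be0) (tD _ _ _ be1) => a b.
have Dl u u' r : w x (u + u') r = w x u r + w x u' r.
  by have := L1 1 u u' r; rewrite scale1r mul1r.
have Dr u u' r : w x r (u + u') = w x r u + w x r u'.
  by have := L2 1 u u' r; rewrite scale1r mul1r.
have zl r : w x 0 r = 0.
  by have /esym/eqP := Dl 0 0 r; rewrite addr0 -subr_eq0 addrK => /eqP.
have zr r : w x r 0 = 0.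
  by have /esym/eqP := Dr 0 0 r; rewrite addr0 -subr_eq0 addrK => /eqP.
have Zl k u r : w x (k *: u) r = k * w x u r.
  by have := L1 k u 0 r; rewrite zl !addr0.
have Zr k u r : w x r (k *: u) = k * w x r u.
  by have := L2 k u 0 r; rewrite zr !addr0.
have A : w x b a = - w x a b.
  apply/eqP; rewrite -subr_eq0 opprK; apply/eqP.
  by have := L3 (a + b); rewrite Dl !Dr !L3 add0r addr0 addrC.
rewrite /lin2 Dl !Dr !Zl !Zr !L3 A /det2.
by move: (w x a b) => k; ring.
Qed.

Lemma form_neq0 c x : local_coordinates c -> dom c x ->
  form2_in_chart c w (fwd c x) be0 be1 != 0.
Proof.
move=> lc cx; apply/eqP => e0; have [_ _ _ nd] := sw.
have l0 := chart_local x; have c0 := chart_at_dom x.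
have h v' : w x (tD c (chart_at x) x be0) v' = 0.
  rewrite -(tDK v' l0 lc c0 cx) -form2_in_chartE // alt2 // e0.
  by rewrite mul0r.
have e := nd x _ h; have := tDK be0 lc l0 cx c0; rewrite e tD0.
move=> /(congr1 (fun m : E2 => m 0 0)); rewrite mxE be00 => /eqP.
by rewrite eq_sym oner_eq0.
Qed.

Lemma Cinf_form (x : N) : Cinf (cod (chart_at x))
  (fun u => form2_in_chart (chart_at x) w u be0 be1).
Proof. by have [_ sm _ _] := sw; exact: sm. Qed.

(* Darboux coordinates (q, p) with [q] a prescribed coordinate of the chart and
   [p] a primitive of the area density. *)
Lemma darboux_exists (y : N) (i : 'I_2) : exists d, [/\ darboux d, dom d y &
  forall z, dom d z -> dom (chart_at y) z /\ fwd d z 0 0 = fwd (chart_at y) z 0 i].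
Proof.
pose c := chart_at y; pose u0 := fwd c y.
have lc : local_coordinates c by exact: chart_local.
have cy : dom c y by exact: chart_at_dom.
pose rho (u : E2) := form2_in_chart c w u be0 be1.
have hrho : Cinf (cod c) rho by exact: Cinf_form.
have cu0 : nbhs u0 (cod c).
  by apply: open_nbhs_nbhs; split; [exact: cod_open|exact: fwd_cod].
have /nbhs_ballP[r /= r0 rB] := cu0.
pose A := ball u0 r; have oA : open A by exact: ball_open.
have hA : Cinf A rho by apply: Cinf_sub hrho.
(* A ball of the sup norm is a square, so it contains the segments parallel to an axis along which
   the primitive is taken. *)
have key (j : 'I_2) (e : E2) (e0 : vcoord j e = 1) : (forall k, k != j -> e 0 k = 0) ->
  forall x (s : R), A x -> 0 <= s <= 1 -> A (gam (vcoord j) e (u0 0 j) (x, s)).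
  move=> ek x s; rewrite /A -!ball_normE /= !norm2_lt.
  move=> xA /andP[s0 s1]; have B (k : 'I_2) : `|(u0 - x) 0 k| < r ->
      `|(u0 - gam (vcoord j) e (u0 0 j) (x, s)) 0 k| < r.
    rewrite /gam /= !mxE /vcoord; have [->|kj] := eqVneq k j.
      rewrite -[e 0 j]/(vcoord j e) e0 mulr1 => h.
      have -> : u0 0 j - (x 0 j - (1 - s) * (x 0 j - u0 0 j)) = s * (u0 0 j - x 0 j).
        by ring.
      by rewrite normrM (ger0_norm s0); apply: le_lt_trans h; rewrite ler_piMl.
    by rewrite ek // mulr0 subr0.
  by case/andP: xA => /B -> /B ->.
have oT := openT.
have Aud : A u0 by exact: ballxx.
have Asub : A `<=` cod c by [].
have [Phi [hPhi PhiE jPhi]] : exists Phi : E2 -> E2, [/\ Cinf A Phi,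
    forall u, Phi u 0 0 = u 0 i & forall u, A u -> jac Phi u = rho u].
  have [i0|i1] : i = 0 \/ i = 1.
    by case: i => -[|[|//]] p; [left|right]; apply: val_inj.
  - pose l : {linear E2 -> R} := vcoord (1 : 'I_2).
    have cl : continuous l by exact: vcoord_continuous.
    have le : l be1 = 1 by rewrite /l /= /vcoord be11.
    have AO := key 1 be1 le _.
    have {}AO x (s : R) : A x -> 0 <= s <= 1 -> A (gam l be1 (u0 0 1) (x, s)).
      apply: AO => k k1; have -> : k = 0 by move: k1; case: k => -[|[|//]] p // _; apply: val_inj.
      by rewrite be10.
    pose p := prim l be1 (u0 0 1) rho.
    have hp : Cinf A p by exact: (Cinf_prim (findim_rV R 2) cl oA oA AO hA).
    exists (fun u : E2 => row2 (u 0 0) (p u)); split.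
    + by apply: Cinf_row2 => //; exact: Cinf_coord.
    + by move=> u; rewrite row20 i0.
    + move=> u Au.
      have dq : differentiable (fun u : E2 => u 0 0) u by exact: (Cinf_diff (@Cinf_coord R 2 setT 0)).
      have dp := Cinf_diff hp Au.
      have E v : 'D_v (fun u : E2 => row2 (u 0 0) (p u)) u =
          row2 ('D_v (fun u : E2 => u 0 0) u) ('D_v p u).
        by have [_] := derive_row2 v dq dp.
      have e1 : 'D_be1 p u = rho u by exact: (derive_prim1 (findim_rV R 2) cl le oA oA AO hA Au).
      have e2 : 'D_be0 (fun u : E2 => u 0 0) u = 1.
        by apply: derive_aff => t; rewrite !mxE ?be00 ?be11 [t *: 1]mulr1 mulr1 addrC.
      have e3 : 'D_be1 (fun u : E2 => u 0 0) u = 0.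
        by apply: derive_aff => t; rewrite !mxE ?be10 ?be01 scaler0 mulr0 add0r addr0.
      apply: (etrans (f_equal2 (@det2 R) (E be0) (E be1))); rewrite det2_row.
      by rewrite e1 e2 e3 mul1r mulr0 subr0.
  (* Here q is the second coordinate of the chart and the primitive is taken along the first; with
     the minus sign the pair again has Jacobian [rho]. *)
  - pose l : {linear E2 -> R} := vcoord (0 : 'I_2).
    have cl : continuous l by exact: vcoord_continuous.
    have le : l be0 = 1 by rewrite /l /= /vcoord be00.
    have AO := key 0 be0 le _.
    have {}AO x (s : R) : A x -> 0 <= s <= 1 -> A (gam l be0 (u0 0 0) (x, s)).
      apply: AO => k k1; have -> : k = 1 by move: k1; case: k => -[|[|//]] p // _; apply: val_inj.
      by rewrite be01.
    pose p := prim l be0 (u0 0 0) rho.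
    have hp : Cinf A p by exact: (Cinf_prim (findim_rV R 2) cl oA oA AO hA).
    have hNp : Cinf A (fun u : E2 => - p u) by exact: CinfN.
    exists (fun u : E2 => row2 (u 0 1) (- p u)); split.
    + by apply: Cinf_row2 => //; exact: Cinf_coord.
    + by move=> u; rewrite row20 i1.
    + move=> u Au.
      have dq : differentiable (fun u : E2 => u 0 1) u by exact: (Cinf_diff (@Cinf_coord R 2 setT 1)).
      have dp := Cinf_diff hp Au; have dNp := Cinf_diff hNp Au.
      have E v : 'D_v (fun u : E2 => row2 (u 0 1) (- p u)) u =
          row2 ('D_v (fun u : E2 => u 0 1) u) (- 'D_v p u).
        by rewrite -(deriveNf v dp); have [_] := derive_row2 v dq dNp.
      have e1 : 'D_be0 p u = rho u by exact: (derive_prim1 (findim_rV R 2) cl le oA oA AO hA Au).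
      have e2 : 'D_be1 (fun u : E2 => u 0 1) u = 1.
        by apply: derive_aff => t; rewrite !mxE ?be00 ?be11 [t *: 1]mulr1 mulr1 addrC.
      have e3 : 'D_be0 (fun u : E2 => u 0 1) u = 0.
        by apply: derive_aff => t; rewrite !mxE ?be10 ?be01 scaler0 mulr0 add0r addr0.
      apply: (etrans (f_equal2 (@det2 R) (E be0) (E be1))); rewrite det2_row.
      by rewrite e1 e2 e3 mul0r sub0r mulr1 opprK.
have j0 : jac Phi u0 != 0 by rewrite jPhi //; exact: form_neq0.
have [d [ld dy dP]] := chart_ift lc cy oA Asub Aud hPhi j0.
exists d; split=> //; last first.
  by move=> z /dP[cz _ ->]; split=> //; exact: PhiE.
split=> // u du v v'.
pose x := bwd d u; have dx : dom d x by exact: bwd_dom.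
have ux : u = fwd d x by rewrite bwdK.
have [cx Ax ex] := dP x dx.
have l0 := chart_local x; have c0 := chart_at_dom x.
rewrite ux form2_in_chartE //.
rewrite -(tD_comp v ld lc l0 dx cx c0) -(tD_comp v' ld lc l0 dx cx c0).
rewrite -form2_in_chartE // alt2 //.
have TP a : tD c d x a = lin2 ('D_be0 Phi (fwd c x)) ('D_be1 Phi (fwd c x)) a.
  rewrite -derive2E; last exact: (Cinf_diff hPhi Ax).
  rewrite /tD; apply: near_eq_derive.
  have nT : \forall z \near fwd c x, (cod c `&` bwd c @^-1` dom d) z.
    apply: open_nbhs_nbhs; split; first exact: trans_open.
    by split; [exact: fwd_cod|rewrite /preimage /= fwdK].
  apply: filterS nT => z [cz dz] /=.
  by have [_ _ ->] := dP _ dz; rewrite bwdK.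
have h : det2 v v' = rho (fwd c x) * det2 (tD d c x v) (tD d c x v').
  have V b := etrans (esym (tDK b ld lc dx cx)) (TP (tD d c x b)).
  apply: (etrans (f_equal2 (@det2 R) (V v) (V v'))); apply: (etrans (det2_lin _ _ _ _)).
  by rewrite -/(jac Phi (fwd c x)) jPhi.
by rewrite h.
Qed.

End Darboux.

End Products.

(** * Lagrangian immersions in Darboux charts *)

Section Lagr.
Variable R : realType.
Local Notation E2 := ('rV[R]_2).

Lemma pull_darboux (M N : surface R) (w : form2 N) (f : M -> N) x
    (c : chart E2 M) (d : chart E2 N) v v' : smooth f ->
  local_coordinates c -> darboux w d -> dom c x -> dom d (f x) ->
  w (f x) (differential f x v) (differential f x v') =
  jac (rep c d f) (fwd c x) *
    det2 (tD (chart_at x) c x v) (tD (chart_at x) c x v').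
Proof.
move=> hf lc [ld dw] cx dx.
have dr := rep_diff hf lc ld cx dx.
have du : cod d (fwd d (f x)) by exact: fwd_cod.
have E := dw _ du ('D_(tD (chart_at x) c x v) (rep c d f) (fwd c x))
  ('D_(tD (chart_at x) c x v') (rep c d f) (fwd c x)).
rewrite (form2_in_chartE w _ _ ld dx) in E.
rewrite (differentialE hf lc ld cx dx v) (differentialE hf lc ld cx dx v') E.
by rewrite (derive2E _ dr) (derive2E (tD (chart_at x) c x v') dr) det2_lin.
Qed.

Variables (F F1 F2 : surface R) (w1 : form2 F1) (w2 : form2 F2).
Hypotheses (sw1 : symplectic w1) (sw2 : symplectic w2).
Implicit Types g : F -> prod_manifold F1 F2.

Definition g1 g : F -> F1 := fun x => (g x).1.
Definition g2 g : F -> F2 := fun x => (g x).2.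

Definition smooth2 g := smooth (g1 g) /\ smooth (g2 g).

(** Meant for Darboux charts: equal Jacobians say that the two areas have the same pull-back, and
    the absence of a common kernel is the immersion condition. *)
Definition lagr_in (c : chart E2 F) (d1 : chart E2 F1) (d2 : chart E2 F2) g z :=
  jac (rep c d1 (g1 g)) z = jac (rep c d2 (g2 g)) z /\
  forall v, 'D_v (rep c d1 (g1 g)) z = 0 -> 'D_v (rep c d2 (g2 g)) z = 0 -> v = 0.

Definition lagr_at g x := exists c d1 d2,
  [/\ local_coordinates c, darboux w1 d1, darboux w2 d2,
      [/\ dom c x, dom d1 (g1 g x) & dom d2 (g2 g x)] & lagr_in c d1 d2 g (fwd c x)].

Lemma LI_smooth g : lagrangian_immersion w1 w2 g -> smooth2 g.
Proof. by move=> [[/smooth_pairP]]. Qed.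

Lemma differential0 (M N : surface R) (f : M -> N) x : differential f x 0 = 0.
Proof. exact: linear0. Qed.

Lemma inj_ker g x v : smooth g -> injective (differential g x) ->
  differential (g1 g) x v = 0 -> differential (g2 g) x v = 0 -> v = 0.
Proof.
move=> sg inj e1 e2; apply: inj.
rewrite (differential_pair x v sg) (differential_pair x 0 sg).
apply: f_equal2; first exact: (etrans e1 (esym (differential0 (g1 g) x))).
exact: (etrans e2 (esym (differential0 (g2 g) x))).
Qed.

Lemma LI_in g c d1 d2 x : lagrangian_immersion w1 w2 g ->
  local_coordinates c -> darboux w1 d1 -> darboux w2 d2 ->
  dom c x -> dom d1 (g1 g x) -> dom d2 (g2 g x) -> lagr_in c d1 d2 g (fwd c x).
Proof.
move=> LI lc D1 D2 cx d1x d2x; have [h1 h2] := LI_smooth LI.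
have [[sg inj] lag] := LI; have c0x := chart_at_dom x; have l0 := chart_local x.
split.
  have := lag x (tD c (chart_at x) x be0) (tD c (chart_at x) x be1).
  rewrite (pullbackE w1 w2 _ _ _ sg).
  have E1 := pull_darboux (tD c (chart_at x) x be0) (tD c (chart_at x) x be1) h1 lc D1 cx d1x.
  have E2' := pull_darboux (tD c (chart_at x) x be0) (tD c (chart_at x) x be1) h2 lc D2 cx d2x.
  have db : det2 (tD (chart_at x) c x (tD c (chart_at x) x be0))
      (tD (chart_at x) c x (tD c (chart_at x) x be1)) = 1.
    apply: (etrans (f_equal2 (@det2 R) (tDK be0 lc l0 cx c0x) (tDK be1 lc l0 cx c0x))).
    by rewrite /det2 be00 be11 be01 be10 mulr1 mulr0 subr0.
  rewrite db mulr1 in E1; rewrite db mulr1 in E2'.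
  move=> H; rewrite -E1 -E2'; exact: (subr0_eq H).
move=> v e1 e2.
have z1 : differential (g1 g) x (tD c (chart_at x) x v) = 0.
  by apply/(differential0P h1 lc D1.1 cx d1x); rewrite (tDK v lc l0 cx c0x).
have z2 : differential (g2 g) x (tD c (chart_at x) x v) = 0.
  by apply/(differential0P h2 lc D2.1 cx d2x); rewrite (tDK v lc l0 cx c0x).
have e0 : tD c (chart_at x) x v = 0 by exact: (inj_ker sg (inj x) z1 z2).
by rewrite -(tDK v lc l0 cx c0x) e0 tD0.
Qed.

Lemma LI_of g : smooth2 g -> (forall x, lagr_at g x) -> lagrangian_immersion w1 w2 g.
Proof.
move=> [h1 h2] H; have sg : smooth g by apply/smooth_pairP; split.
split; first split=> // x.
  have [c [d1 [d2 [lc D1 D2 [cx d1x d2x] [_ ker]]]]] := H x.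
  have key v : differential g x v = 0 -> v = 0.
    rewrite (differential_pair x v sg) => -[e1 e2].
    have k1 := (differential0P h1 lc D1.1 cx d1x v).1 e1.
    have k2 := (differential0P h2 lc D2.1 cx d2x v).1 e2.
    have := ker _ k1 k2 => e0.
    by rewrite -(tDK v (chart_local x) lc (chart_at_dom x) cx) e0 tD0.
  move=> u v uv; have uv0 : u - v = 0.
    apply: key; apply: (etrans (linearB (differential g x) u v)).
    exact: (etrans (f_equal2 (fun a b => a - b) uv (erefl (differential g x v))) (subrr _)).
  by rewrite -[u](subrK v) uv0 add0r.
move=> x v v'; have [c [d1 [d2 [lc D1 D2 [cx d1x d2x] [je _]]]]] := H x.
rewrite (pullbackE w1 w2 _ _ _ sg).
have E1 := pull_darboux v v' h1 lc D1 cx d1x.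
have E2' := pull_darboux v v' h2 lc D2 cx d2x.
apply: (etrans (f_equal2 (fun a b => a - b) E1 E2')).
by rewrite je subrr.
Qed.

Lemma rep_near (M N : surface R) (f f' : M -> N) x (c : chart E2 M) (d : chart E2 N) :
  dom c x -> (\forall y \near x, f y = f' y) ->
  \forall z \near fwd c x, rep c d f z = rep c d f' z.
Proof.
move=> cx n; have cc : {for fwd c x, continuous (bwd c)}.
  by apply: bwd_continuous; exact: fwd_cod.
have n' : nbhs (bwd c (fwd c x)) [set y | f y = f' y] by rewrite fwdK.
have nn : \forall z \near fwd c x, f (bwd c z) = f' (bwd c z) := cc _ n'.
by near=> z; rewrite /rep; congr (fwd d _); near: z.
Unshelve. all: by end_near.
Qed.

Lemma lagr_at_near g g' x : (\forall y \near x, g y = g' y) -> lagr_at g x -> lagr_at g' x.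
Proof.
move=> n [c [d1 [d2 [lc D1 D2 [cx d1x d2x] [je ker]]]]].
have gx : g x = g' x by exact: (nbhs_singleton n).
have n1 : \forall y \near x, g1 g y = g1 g' y by apply: filterS n => y; rewrite /g1 => ->.
have n2 : \forall y \near x, g2 g y = g2 g' y by apply: filterS n => y; rewrite /g2 => ->.
have r1 := rep_near d1 cx n1; have r2 := rep_near d2 cx n2.
have e1 v := near_eq_derive v r1; have e2 v := near_eq_derive v r2.
exists c, d1, d2; split; [exact: lc|exact: D1|exact: D2| |].
  by rewrite /g1 /g2 -gx; split.
split.
  exact: (etrans (esym (f_equal2 (@det2 R) (e1 be0) (e1 be1))) (etrans je (f_equal2 (@det2 R) (e2 be0) (e2 be1)))).
by move=> v; rewrite -e1 -e2; exact: ker.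
Qed.

(* If no coordinates of the two factors have independent pull-backs, the two
   differentials have a common kernel. *)
Lemma parallel_rows (r0 r1 s0 s1 : E2) :
  det2 r0 s0 = 0 -> det2 r0 s1 = 0 -> det2 r1 s0 = 0 -> det2 r1 s1 = 0 ->
  det2 r0 r1 = 0 -> det2 s0 s1 = 0 ->
  exists2 v : E2, v != 0 &
    [/\ det2 r0 v = 0, det2 r1 v = 0, det2 s0 v = 0 & det2 s1 v = 0].
Proof.
have anti (a b : E2) : det2 a b = 0 -> det2 b a = 0.
  by move=> h; rewrite /det2 -[RHS]oppr0 -h /det2; ring.
have self (a : E2) : det2 a a = 0 by rewrite /det2; ring.
have z (a : E2) : det2 0 a = 0 by rewrite /det2 !mxE; ring.
move=> a00 a01 a10 a11 r01 s01.
have [e0|n] := eqVneq r0 0; last by exists r0 => //; split=> //; exact: anti.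
have [e1|n] := eqVneq r1 0; last by exists r1 => //; split=> //; exact: anti.
have [e2|n] := eqVneq s0 0; last by exists s0 => //; split=> //; exact: anti.
have [e3|n] := eqVneq s1 0; last by exists s1 => //; split=> //; exact: anti.
exists be0; last by rewrite e0 e1 e2 e3; split; exact: z.
apply/eqP => /(congr1 (fun m : E2 => m 0 0)); rewrite be00 mxE => /eqP.
by rewrite oner_eq0.
Qed.

Lemma indep_zero (r0 r1 s : E2) : det2 r0 r1 != 0 -> det2 r0 s = 0 ->
  det2 r1 s = 0 -> s = 0.
Proof.
rewrite /det2 => d h0 h1; apply: row2P; rewrite mxE; apply: (mulfI d); rewrite mulr0.
  have -> : (r0 0 0 * r1 0 1 - r0 0 1 * r1 0 0) * s 0 0 =
     r1 0 0 * (r0 0 0 * s 0 1 - r0 0 1 * s 0 0) - r0 0 0 * (r1 0 0 * s 0 1 - r1 0 1 * s 0 0).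
    by ring.
  by rewrite h0 h1 !mulr0 subr0.
have -> : (r0 0 0 * r1 0 1 - r0 0 1 * r1 0 0) * s 0 1 =
   r1 0 1 * (r0 0 0 * s 0 1 - r0 0 1 * s 0 0) - r0 0 1 * (r1 0 0 * s 0 1 - r1 0 1 * s 0 0).
  by ring.
by rewrite h0 h1 !mulr0 subr0.
Qed.

Lemma rep_rows (M N : surface R) (f : M -> N) (c : chart E2 M) (d : chart E2 N) z i :
  differentiable (rep c d f) z ->
  forall v, ('D_v (rep c d f) z) 0 i =
    det2 (row2 (('D_be0 (rep c d f) z) 0 i) (('D_be1 (rep c d f) z) 0 i))
         (row2 (- v 0 1) (v 0 0)).
Proof.
move=> dr v; apply: (etrans (congr1 (fun m : E2 => m 0 i) (derive2E v dr))).
by move: ('D_be0 _ z) ('D_be1 _ z) => p q; rewrite /lin2 det2_row !mxE; ring.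
Qed.

Definition grad (f : E2 -> R) z : E2 := row2 ('D_be0 f z) ('D_be1 f z).

(** Otherwise each row of the differential of the first component is parallel to each row of the
    second. The two components are critical at the same points, since the pulled back areas agree.
    If both are critical, all four rows are parallel and have a common kernel vector, against
    immersion. If both are regular, the rows of the second are parallel to two independent vectors,
    hence zero, a contradiction. *)
Lemma indep_coords g x : lagrangian_immersion w1 w2 g ->
  let c := chart_at x in
  exists i j : 'I_2,
   det2 (grad (fun z => rep c (chart_at (g1 g x)) (g1 g) z 0 i) (fwd c x))
        (grad (fun z => rep c (chart_at (g2 g x)) (g2 g) z 0 j) (fwd c x)) != 0.
Proof.
move=> LI c; have [h1 h2] := LI_smooth LI; have lc : local_coordinates c := chart_local x.
have cx : dom c x := chart_at_dom x.
pose d1 := chart_at (g1 g x); pose d2 := chart_at (g2 g x).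
have l1 : local_coordinates d1 := chart_local _; have l2 : local_coordinates d2 := chart_local _.
have x1 : dom d1 (g1 g x) := chart_at_dom _; have x2 : dom d2 (g2 g x) := chart_at_dom _.
have dr1 := rep_diff h1 lc l1 cx x1; have dr2 := rep_diff h2 lc l2 cx x2.
set z := fwd c x in dr1 dr2 *.
apply: contrapT => no.
pose r i := grad (fun z => rep c d1 (g1 g) z 0 i) z.
pose s j := grad (fun z => rep c d2 (g2 g) z 0 j) z.
have rs i j : det2 (r i) (s j) = 0.
  by apply/eqP; apply: contraT => n; case: no; exists i, j.
have rE i : r i = row2 (('D_be0 (rep c d1 (g1 g)) z) 0 i) (('D_be1 (rep c d1 (g1 g)) z) 0 i).
  exact: (f_equal2 (@row2 R) (derive_coord be0 i dr1).2 (derive_coord be1 i dr1).2).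
have sE i : s i = row2 (('D_be0 (rep c d2 (g2 g)) z) 0 i) (('D_be1 (rep c d2 (g2 g)) z) 0 i).
  exact: (f_equal2 (@row2 R) (derive_coord be0 i dr2).2 (derive_coord be1 i dr2).2).
have jr : det2 (r 0) (r 1) = jac (rep c d1 (g1 g)) z.
  rewrite rE rE det2_row /jac; move: ('D_be0 _ z) ('D_be1 _ z) => p q.
  by rewrite /det2; ring.
have js : det2 (s 0) (s 1) = jac (rep c d2 (g2 g)) z.
  rewrite sE sE det2_row /jac; move: ('D_be0 _ z) ('D_be1 _ z) => p q.
  by rewrite /det2; ring.
have crit12 : jac (rep c d1 (g1 g)) z = 0 <-> jac (rep c d2 (g2 g)) z = 0.
  have [e1 [D1 e1x _]] := darboux_exists sw1 (g1 g x) 0.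
  have [e2 [D2 e2x _]] := darboux_exists sw2 (g2 g x) 0.
  have [je _] := LI_in LI lc D1 D2 cx e1x e2x.
  have A1 := critical_jac h1 lc l1 cx x1; have A2 := critical_jac h2 lc l2 cx x2.
  have B1 := critical_jac h1 lc D1.1 cx e1x; have B2 := critical_jac h2 lc D2.1 cx e2x.
  split=> h.
    by apply/A2/B2; rewrite -je; apply/B1/A1.
  by apply/A1/B1; rewrite je; apply/B2/A2.
have [j1|j1] := eqVneq (jac (rep c d1 (g1 g)) z) 0.
  have j2 := crit12.1 j1.
  have [v v0 [v1 v2 v3 v4]] := parallel_rows (rs 0 0) (rs 0 1) (rs 1 0) (rs 1 1)
     (etrans jr j1) (etrans js j2).
  pose v' := row2 (v 0 1) (- v 0 0).
  have vE : row2 (- v' 0 1) (v' 0 0) = v.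
    by rewrite row20 row21 opprK -row2_coord.
  have k1 : 'D_v' (rep c d1 (g1 g)) z = 0.
    apply: row2P; rewrite (rep_rows _ dr1) vE mxE.
      by apply: etrans v1; rewrite rE.
    by apply: etrans v2; rewrite rE.
  have k2 : 'D_v' (rep c d2 (g2 g)) z = 0.
    apply: row2P; rewrite (rep_rows _ dr2) vE mxE.
      by apply: etrans v3; rewrite sE.
    by apply: etrans v4; rewrite sE.
  have [[sg inj] _] := LI.
  have z1 : differential (g1 g) x (tD c c x v') = 0.
    by apply/(differential0P h1 lc l1 cx x1); rewrite (tDK v' lc lc cx cx).
  have z2 : differential (g2 g) x (tD c c x v') = 0.
    by apply/(differential0P h2 lc l2 cx x2); rewrite (tDK v' lc lc cx cx).
  have e0 := inj_ker sg (inj x) z1 z2.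
  have v'0 : v' = 0 by rewrite -(tDK v' lc lc cx cx) e0 tD0.
  by move: v0; rewrite -vE v'0 !mxE oppr0 => /eqP; apply; apply: row2P; rewrite !mxE.
have s0 j : s j = 0.
  apply: (@indep_zero (r 0) (r 1)) => //; by rewrite jr.
move/eqP: j1; apply; apply/crit12; rewrite -js s0 /det2 !mxE; ring.
Qed.

End Lagr.

(** * Hamiltonian deformations *)

Section Bracket.
Variables (R : realType) (V : normedModType R) (v0 v1 : V).
Implicit Types f g h a b : V -> R.

Lemma bilin_alg (s p p' r r' q q' D : R) :
  ((p + s * p') * q - (r + s * r') * q') / D = (p * q - r * q') / D + s * ((p' * q - r' * q') / D).
Proof. by ring. Qed.

Lemma bilin_algr (p p' r r' q q' D : R) :
  (q * (p + p') - q' * (r + r')) / D = (q * p - q' * r) / D + (q * p' - q' * r') / D.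
Proof. by ring. Qed.

(** The Jacobian of (a, b) along v0 and v1. By Cramer's rule the partial derivatives in coordinates
    (Q1, Q2) are quotients of such brackets, so no chart with these coordinates has to be
    introduced. The space and the directions are arbitrary in order to admit a parameter space as an
    extra factor. *)
Definition br a b x : R := 'D_v0 a x * 'D_v1 b x - 'D_v1 a x * 'D_v0 b x.

Lemma Cinf_br (A : set V) a b : open A -> Cinf A a -> Cinf A b -> Cinf A (br a b).
Proof.
move=> oA ha hb; apply: (CinfB oA (CinfM oA _ _) (CinfM oA _ _)); exact: Cinf_derive.
Qed.

Variables (Q1 Q2 : V -> R).

Definition Dl := br Q1 Q2.
(* [dd1] and [dd2] are the partial derivatives in the coordinates [(Q1, Q2)]. *)
Definition dd1 f x : R := br f Q2 x / Dl x.
Definition dd2 f x : R := br Q1 f x / Dl x.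

Variable A : set V.
Hypotheses (oA : open A) (hQ1 : Cinf A Q1) (hQ2 : Cinf A Q2).
Hypothesis D0 : forall x, A x -> Dl x != 0.

Lemma Cinf_Dl : Cinf A Dl. Proof. exact: Cinf_br. Qed.

Lemma Cinf_VDl : Cinf A (fun x => (Dl x)^-1).
Proof. exact: (CinfV oA D0 Cinf_Dl). Qed.

Lemma Cinf_dd1 f : Cinf A f -> Cinf A (dd1 f).
Proof. by move=> hf; apply: (CinfM oA (Cinf_br oA hf hQ2) Cinf_VDl). Qed.

Lemma Cinf_dd2 f : Cinf A f -> Cinf A (dd2 f).
Proof. by move=> hf; apply: (CinfM oA (Cinf_br oA hQ1 hf) Cinf_VDl). Qed.

Lemma derive_eqon f g x v : (forall y, A y -> f y = g y) -> A x -> 'D_v f x = 'D_v g x.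
Proof.
move=> fg Ax; apply: near_eq_derive.
have nA : \forall y \near x, A y by apply: open_nbhs_nbhs.
by apply: filterS nA => y; exact: fg.
Qed.

Lemma dd1_eqon f g x : (forall y, A y -> f y = g y) -> A x -> dd1 f x = dd1 g x.
Proof.
move=> fg Ax; rewrite /dd1 /br.
by rewrite (derive_eqon v0 fg Ax) (derive_eqon v1 fg Ax).
Qed.

Lemma dd2_eqon f g x : (forall y, A y -> f y = g y) -> A x -> dd2 f x = dd2 g x.
Proof.
move=> fg Ax; rewrite /dd2 /br.
by rewrite (derive_eqon v0 fg Ax) (derive_eqon v1 fg Ax).
Qed.

Lemma dd1D f g x : Cinf A f -> Cinf A g -> A x ->
  dd1 (fun y => f y + g y) x = dd1 f x + dd1 g x.
Proof.
move=> hf hg Ax; have df := Cinf_diff hf Ax; have dg := Cinf_diff hg Ax.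
rewrite /dd1 /br (deriveDf v0 df dg) (deriveDf v1 df dg).
by rewrite -['D_v0 g x]mul1r -['D_v1 g x]mul1r bilin_alg !mul1r.
Qed.

Lemma dd2D f g x : Cinf A f -> Cinf A g -> A x ->
  dd2 (fun y => f y + g y) x = dd2 f x + dd2 g x.
Proof.
move=> hf hg Ax; have df := Cinf_diff hf Ax; have dg := Cinf_diff hg Ax.
rewrite /dd2 /br (deriveDf v0 df dg) (deriveDf v1 df dg).
exact: bilin_algr.
Qed.

Lemma dd1B f g x : Cinf A f -> Cinf A g -> A x ->
  dd1 (fun y => f y - g y) x = dd1 f x - dd1 g x.
Proof.
move=> hf hg Ax; have df := Cinf_diff hf Ax; have dg := Cinf_diff hg Ax.
rewrite /dd1 /br (deriveBf v0 df dg) (deriveBf v1 df dg).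
by rewrite -(mulN1r ('D_v0 g x)) -(mulN1r ('D_v1 g x)) bilin_alg mulN1r.
Qed.

Lemma dd1_alg (p0 p1 q0 q1 h0 h1 p00 p01 p11 q00 q01 q11 h00 h01 h11 : R) :
  p0 * q1 - p1 * q0 != 0 ->
  let D := p0 * q1 - p1 * q0 in
  let D0' := p00 * q1 + p0 * q01 - (p01 * q0 + p1 * q00) in
  let D1' := p01 * q1 + p0 * q11 - (p11 * q0 + p1 * q01) in
  let M := h0 * q1 - h1 * q0 in
  let M0 := h00 * q1 + h0 * q01 - (h01 * q0 + h1 * q00) in
  let M1 := h01 * q1 + h0 * q11 - (h11 * q0 + h1 * q01) in
  let N := p0 * h1 - p1 * h0 in
  let N0 := p00 * h1 + p0 * h01 - (p01 * h0 + p1 * h00) in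
  let N1 := p01 * h1 + p0 * h11 - (p11 * h0 + p1 * h01) in
  ((N0 * D^-1 + N * (- D0' / D ^+ 2)) * q1 - (N1 * D^-1 + N * (- D1' / D ^+ 2)) * q0) / D
  = (p0 * (M1 * D^-1 + M * (- D1' / D ^+ 2)) - p1 * (M0 * D^-1 + M * (- D0' / D ^+ 2))) / D.
Proof. by move=> d /=; field. Qed.

Lemma derive_br f g x v : Cinf A f -> Cinf A g -> A x ->
  'D_v (br f g) x =
  'D_v ('D_v0 f) x * 'D_v1 g x + 'D_v0 f x * 'D_v ('D_v1 g) x -
  ('D_v ('D_v1 f) x * 'D_v0 g x + 'D_v1 f x * 'D_v ('D_v0 g) x).
Proof.
move=> hf hg Ax.
have f0 := Cinf_derive v0 hf; have f1 := Cinf_derive v1 hf.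
have k0 := Cinf_derive v0 hg; have k1 := Cinf_derive v1 hg.
have e1 := deriveMf v (Cinf_diff f0 Ax) (Cinf_diff k1 Ax).
have e2 := deriveMf v (Cinf_diff f1 Ax) (Cinf_diff k0 Ax).
have m1 := Cinf_diff (CinfM oA f0 k1) Ax; have m2 := Cinf_diff (CinfM oA f1 k0) Ax.
exact: (etrans (deriveBf v m1 m2) (f_equal2 (fun p q : R => p - q) e1 e2)).
Qed.

(** After expansion, and the exchange of the derivatives along v0 and v1, only the rational identity
    [dd1_alg] remains. *)
Lemma dd_comm h x : Cinf A h -> A x -> dd1 (dd2 h) x = dd2 (dd1 h) x.
Proof.
move=> hh Ax.
have dD := Cinf_diff Cinf_Dl Ax; have dV := Cinf_diff Cinf_VDl Ax.
have dM := Cinf_diff (Cinf_br oA hh hQ2) Ax.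
have dN := Cinf_diff (Cinf_br oA hQ1 hh) Ax.
have E1 v : 'D_v (dd1 h) x = 'D_v (br h Q2) x * (Dl x)^-1 +
    br h Q2 x * (- 'D_v Dl x / Dl x ^+ 2).
  by rewrite -(deriveVf v dD (D0 Ax)); exact: deriveMf.
have E2 v : 'D_v (dd2 h) x = 'D_v (br Q1 h) x * (Dl x)^-1 +
    br Q1 h x * (- 'D_v Dl x / Dl x ^+ 2).
  by rewrite -(deriveVf v dD (D0 Ax)); exact: deriveMf.
have dl := D0 Ax.
have L1 : dd1 (dd2 h) x = ('D_v0 (dd2 h) x * 'D_v1 Q2 x
    - 'D_v1 (dd2 h) x * 'D_v0 Q2 x) / Dl x by [].
have L2 : dd2 (dd1 h) x = ('D_v0 Q1 x * 'D_v1 (dd1 h) x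
    - 'D_v1 Q1 x * 'D_v0 (dd1 h) x) / Dl x by [].
rewrite L1 L2 (E1 v0) (E1 v1) (E2 v0) (E2 v1) {L1 L2 E1 E2}.
rewrite /Dl (derive_br v0 hQ1 hQ2 Ax) (derive_br v1 hQ1 hQ2 Ax).
rewrite (derive_br v0 hh hQ2 Ax) (derive_br v1 hh hQ2 Ax).
rewrite (derive_br v0 hQ1 hh Ax) (derive_br v1 hQ1 hh Ax).
have S f : Cinf A f -> 'D_v1 ('D_v0 f) x = 'D_v0 ('D_v1 f) x.
  by move=> hf; exact: (derive_comm v1 v0 oA Ax hf).
rewrite (S _ hQ1) (S _ hQ2) (S _ hh) /br.
move: dl; rewrite /Dl /br => dl.
exact: dd1_alg.
Qed.

Lemma dd_comp (B : set 'rV[R]_2) (H : 'rV[R]_2 -> R) x : open B -> Cinf B H ->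
  A x -> B (row2 (Q1 x) (Q2 x)) ->
  dd1 (fun y => H (row2 (Q1 y) (Q2 y))) x = 'D_be0 H (row2 (Q1 x) (Q2 x)) /\
  dd2 (fun y => H (row2 (Q1 y) (Q2 y))) x = 'D_be1 H (row2 (Q1 x) (Q2 x)).
Proof.
move=> oB hH Ax Bx; have d1 := Cinf_diff hQ1 Ax; have d2 := Cinf_diff hQ2 Ax.
have dH := Cinf_diff hH Bx.
have E v : 'D_v (fun y => H (row2 (Q1 y) (Q2 y))) x =
    'D_v Q1 x * 'D_be0 H (row2 (Q1 x) (Q2 x)) + 'D_v Q2 x * 'D_be1 H (row2 (Q1 x) (Q2 x)).
  have [dr Dr] := derive_row2 v d1 d2.
  have := derive_comp (f := fun y => row2 (Q1 y) (Q2 y)) (g := H) v dr dH.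
  rewrite Dr => e; apply: (etrans e).
  apply: (etrans (derive2E (row2 ('D_v Q1 x) ('D_v Q2 x)) dH)).
  by rewrite /lin2 row20 row21.
have dl := D0 Ax.
rewrite /dd1 /dd2 /br (E v0) (E v1); move: dl; rewrite /Dl /br.
move: ('D_be0 H _) ('D_be1 H _) ('D_v0 Q1 x) ('D_v1 Q1 x) ('D_v0 Q2 x) ('D_v1 Q2 x).
by move=> a b p0 p1 q0 q1 dl; split; field.
Qed.

End Bracket.

Section Mono.
Variable R : realType.
Local Notation E2 := ('rV[R]_2).

Definition mono i j (q : E2) : R := q 0 0 ^+ i * q 0 1 ^+ j.

Lemma Cinf_mono i j : Cinf setT (mono i j).
Proof.
have oT : open [set: E2] by exact: openT.
by apply: CinfM => //; apply: CinfX => //; exact: Cinf_coord.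
Qed.

Lemma derive_coord_be (x v : E2) k : 'D_v (fun q : E2 => q 0 k) x = v 0 k.
Proof. by apply: derive_aff => t; rewrite !mxE addrC. Qed.

Lemma derive_pow (V : normedModType R) (f : V -> R) i x v : differentiable f x ->
  'D_v (fun y => f y ^+ i) x = i%:R * f x ^+ i.-1 * 'D_v f x.
Proof.
move=> df; have dv : derivable f x v by exact: diff_derivable.
have -> : (fun y => f y ^+ i) = f ^+ i by apply/funext => y; rewrite !fctE.
by rewrite (deriveX i dv) /GRing.scale /= mulr_natl.
Qed.

Lemma derive_mono0 i j x : 'D_be0 (mono i j) x = i%:R * mono i.-1 j x.
Proof.
have d k n : differentiable (fun q : E2 => q 0 k ^+ n) x.
  by apply: (@Cinf_diff _ _ _ setT) => //; apply: CinfX; [exact: openT|exact: Cinf_coord].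
have dc k : differentiable (fun q : E2 => q 0 k) x.
  by apply: (@Cinf_diff _ _ _ setT) => //; exact: Cinf_coord.
apply: (etrans (deriveMf be0 (d 0 i) (d 1 j))).
rewrite (derive_pow i be0 (dc 0)) (derive_pow j be0 (dc 1)) !derive_coord_be.
by rewrite be00 be01 /mono; ring.
Qed.

Lemma derive_mono1 i j x : 'D_be1 (mono i j) x = j%:R * mono i j.-1 x.
Proof.
have d k n : differentiable (fun q : E2 => q 0 k ^+ n) x.
  by apply: (@Cinf_diff _ _ _ setT) => //; apply: CinfX; [exact: openT|exact: Cinf_coord].
have dc k : differentiable (fun q : E2 => q 0 k) x.
  by apply: (@Cinf_diff _ _ _ setT) => //; exact: Cinf_coord.
apply: (etrans (deriveMf be1 (d 0 i) (d 1 j))).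
rewrite (derive_pow i be1 (dc 0)) (derive_pow j be1 (dc 1)) !derive_coord_be.
by rewrite be10 be11 /mono; ring.
Qed.

End Mono.

Section BrSlice.
Variables (R : realType) (P V : normedModType R) (v0 v1 : V).
Local Notation W := (P * V)%type.

Lemma br_slice (f g : W -> R) a z :
  br ((0, v0) : W) (0, v1) f g (a, z) = br v0 v1 (fun z => f (a, z)) (fun z => g (a, z)) z.
Proof. by rewrite /br !derive_slice2. Qed.

Lemma dd1_slice (Q1 Q2 f : W -> R) a z :
  dd1 ((0, v0) : W) (0, v1) Q1 Q2 f (a, z) =
  dd1 v0 v1 (fun z => Q1 (a, z)) (fun z => Q2 (a, z)) (fun z => f (a, z)) z.
Proof. by rewrite /dd1 /Dl !br_slice. Qed.

Lemma dd2_slice (Q1 Q2 f : W -> R) a z :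
  dd2 ((0, v0) : W) (0, v1) Q1 Q2 f (a, z) =
  dd2 v0 v1 (fun z => Q1 (a, z)) (fun z => Q2 (a, z)) (fun z => f (a, z)) z.
Proof. by rewrite /dd2 /Dl !br_slice. Qed.

End BrSlice.

Section Perturb.
Variable R : realType.
Local Notation E2 := ('rV[R]_2).
Variables (F F1 F2 : surface R) (w1 : form2 F1) (w2 : form2 F2).
Hypotheses (sw1 : symplectic w1) (sw2 : symplectic w2).
Local Notation LI := (lagrangian_immersion w1 w2).
Implicit Types g : F -> prod_manifold F1 F2.

Lemma lagr_at_LI g x : LI g -> lagr_at w1 w2 g x.
Proof.
move=> LIg; have [d1 [D1 x1 _]] := darboux_exists sw1 (g1 g x) 0.
have [d2 [D2 x2 _]] := darboux_exists sw2 (g2 g x) 0.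
exists (chart_at x), d1, d2; split.
- exact: chart_local.
- exact: D1.
- exact: D2.
- by split=> //; exact: chart_at_dom.
- by apply: (LI_in LIg (chart_local x) D1 D2) => //; exact: chart_at_dom.
Qed.

Lemma dd_eqon3 (A : set E2) (Q1 Q2 f Q1' Q2' f' : E2 -> R) x : open A -> A x ->
  (forall z, A z -> Q1 z = Q1' z) -> (forall z, A z -> Q2 z = Q2' z) ->
  (forall z, A z -> f z = f' z) ->
  [/\ Dl be0 be1 Q1 Q2 x = Dl be0 be1 Q1' Q2' x,
      dd1 be0 be1 Q1 Q2 f x = dd1 be0 be1 Q1' Q2' f' x &
      dd2 be0 be1 Q1 Q2 f x = dd2 be0 be1 Q1' Q2' f' x].
Proof.
move=> oA Ax e1 e2 e3; rewrite /dd1 /dd2 /Dl /br.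
by rewrite (derive_eqon oA be0 e1 Ax) (derive_eqon oA be0 e2 Ax) (derive_eqon oA be0 e3 Ax)
  (derive_eqon oA be1 e1 Ax) (derive_eqon oA be1 e2 Ax) (derive_eqon oA be1 e3 Ax).
Qed.

Lemma compact_ballnorm (r : R) : compact [set z : E2 | `|z| <= r].
Proof.
have -> : [set z : E2 | `|z| <= r] = closed_ball_ (fun z : E2 => `|z|) 0 r.
  by apply/seteqP; split=> z; rewrite /closed_ball_ /= sub0r normrN.
apply: bounded_closed_compact; last exact: closed_closed_ball_.
exists r; split; first exact: num_real.
by move=> s rs z; rewrite /closed_ball_ /= sub0r normrN => /le_trans; apply; exact: ltW.
Qed.

Section Coords.
Variables (c : chart E2 F) (d1 : chart E2 F1) (d2 : chart E2 F2).

Definition cQ1 g z : R := rep c d1 (g1 g) z 0 0.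
Definition cP1 g z : R := rep c d1 (g1 g) z 0 1.
Definition cQ2 g z : R := rep c d2 (g2 g) z 0 0.
Definition cP2 g z : R := rep c d2 (g2 g) z 0 1.

Definition cDl g := Dl be0 be1 (cQ1 g) (cQ2 g).

(** The region where (Q1, Q2) are local coordinates of F, and so where a Hamiltonian in these
    variables acts. *)
Definition vdom g : set E2 :=
  [set z | [/\ rdom c d1 (g1 g) z, rdom c d2 (g2 g) z & cDl g z != 0]].

Hypotheses (lc : local_coordinates c) (l1 : local_coordinates d1) (l2 : local_coordinates d2).

Lemma vdomP g : smooth2 g -> [/\ open (vdom g),
  Cinf (vdom g) (rep c d1 (g1 g)) & Cinf (vdom g) (rep c d2 (g2 g))].
Proof.
move=> [h1 h2]; have [op1 H1] := srep h1 lc l1; have [op2 H2] := srep h2 lc l2.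
pose A := rdom c d1 (g1 g) `&` rdom c d2 (g2 g).
have oA : open A by exact: openI.
have K1 : Cinf A (rep c d1 (g1 g)) by apply: Cinf_sub H1 => z [].
have K2 : Cinf A (rep c d2 (g2 g)) by apply: Cinf_sub H2 => z [].
have hD : Cinf A (cDl g).
  by apply: (Cinf_br be0 be1 oA); apply: (Cinf_coordl 0 oA).
have e : vdom g = A `&` (cDl g) @^-1` [set t | t != 0].
  by apply/seteqP; split=> z; [move=> []|move=> [[]]].
split.
- rewrite e; apply: open_preim; [exact: oA|exact: open_neq|].
  by move=> z Az; exact: (Cinf_cont hD Az).
- by apply: Cinf_sub K1 => z [].
- by apply: Cinf_sub K2 => z [].
Qed.

Lemma vdom_cod g z : vdom g z -> cod c z.
Proof. by move=> [[]]. Qed.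

Lemma jac_br1 g z : differentiable (rep c d1 (g1 g)) z ->
  jac (rep c d1 (g1 g)) z = br be0 be1 (cQ1 g) (cP1 g) z.
Proof.
move=> dr; have e v k := (derive_coord v k dr).2.
rewrite /br /jac /det2; move: (e be0 0) (e be0 1) (e be1 0) (e be1 1).
by rewrite /cQ1 /cP1 => -> -> -> ->; rewrite [X in _ - X]mulrC.
Qed.

Lemma jac_br2 g z : differentiable (rep c d2 (g2 g)) z ->
  jac (rep c d2 (g2 g)) z = br be0 be1 (cQ2 g) (cP2 g) z.
Proof.
move=> dr; have e v k := (derive_coord v k dr).2.
rewrite /br /jac /det2; move: (e be0 0) (e be0 1) (e be1 0) (e be1 1).
by rewrite /cQ2 /cP2 => -> -> -> ->; rewrite [X in _ - X]mulrC.
Qed.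

(* {Q1, P1} = Delta * d2 P1 and {Q2, P2} = - Delta * d1 P2 *)
Lemma lagr_inP g z : smooth2 g -> vdom g z ->
  lagr_in c d1 d2 g z <->
  dd2 be0 be1 (cQ1 g) (cQ2 g) (cP1 g) z = - dd1 be0 be1 (cQ1 g) (cQ2 g) (cP2 g) z.
Proof.
move=> sg Vz; have [oV h1 h2] := vdomP sg.
have dr1 := Cinf_diff h1 Vz; have dr2 := Cinf_diff h2 Vz.
have Dz : cDl g z != 0 by case: Vz.
have anti : br be0 be1 (cP2 g) (cQ2 g) z = - br be0 be1 (cQ2 g) (cP2 g) z.
  rewrite /br; move: ('D_be0 _ z) ('D_be1 _ z) ('D_be0 (cQ2 g) z) ('D_be1 (cQ2 g) z).
  by move=> p q r s; ring.
rewrite /lagr_in (jac_br1 dr1) (jac_br2 dr2) /dd1 /dd2 anti mulNr opprK.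
split=> [[-> _]//|e]; split; first by apply: (mulIf (invr_neq0 Dz)).
move=> v e1 e2.
have k1 : 'D_v (cQ1 g) z = 0 by rewrite (derive_coord v 0 dr1).2 e1 mxE.
have k2 : 'D_v (cQ2 g) z = 0 by rewrite (derive_coord v 0 dr2).2 e2 mxE.
have q1 : differentiable (cQ1 g) z := (derive_coord v 0 dr1).1.
have q2 : differentiable (cQ2 g) z := (derive_coord v 0 dr2).1.
move: k1 k2; rewrite (derive2E v q1) (derive2E v q2) /lin2.
move: Dz; rewrite /cDl /Dl /br.
move: ('D_be0 (cQ1 g) z) ('D_be1 (cQ1 g) z) ('D_be0 (cQ2 g) z) ('D_be1 (cQ2 g) z).
move=> p0 p1 q0 q1' dz k1 k2.
apply: (@indep_zero R (row2 (- p1) p0) (row2 (- q1') q0)).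
- by rewrite det2_row (_ : _ - _ = p0 * q1' - p1 * q0) //; ring.
- rewrite /det2 row20 row21 -[RHS]oppr0 -k1 /GRing.scale /=; ring.
- rewrite /det2 row20 row21 -[RHS]oppr0 -k2 /GRing.scale /=; ring.
Qed.

End Coords.

Section Deform.
Variables (c : chart E2 F) (d1 : chart E2 F1) (d2 : chart E2 F2).
Hypotheses (lc : local_coordinates c) (D1 : darboux w1 d1) (D2 : darboux w2 d2).
Variables (g : F -> prod_manifold F1 F2) (LIg : LI g).
Variables (P : normedModType R) (fP : findim P) (h : P * E2 -> R) (O : set P) (rho : R).
Local Notation U := (vdom c d1 d2 g).
Hypothesis oO : open O.
Hypothesis hh : Cinf (snd @^-1` U) h.
Hypothesis KU : forall z : E2, `|z| <= rho -> U z.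
Hypothesis h0 : forall a z, U z -> rho < `|z| -> h (a, z) = 0.

Let q1 := cQ1 c d1 g.
Let p1 := cP1 c d1 g.
Let q2 := cQ2 c d2 g.
Let p2 := cP2 c d2 g.

(* Adding [(h_1, - h_2)] to [(P1, P2)] preserves [P1_2 = - P2_1]. *)
Definition new1 (a : P) (z : E2) : E2 :=
  row2 (q1 z) (p1 z + dd1 be0 be1 q1 q2 (fun z => h (a, z)) z).
Definition new2 (a : P) (z : E2) : E2 :=
  row2 (q2 z) (p2 z - dd2 be0 be1 q1 q2 (fun z => h (a, z)) z).

Hypothesis hO : forall a z, O a -> `|z| <= rho ->
  cod d1 (new1 a z) /\ cod d2 (new2 a z).

(** The two cases fit together because [new1] and [new2] are the representatives of [g] outside the
    ball of radius rho. *)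
Definition deform (a : P) (x : F) : prod_manifold F1 F2 :=
  if pselect (dom c x /\ U (fwd c x)) then
    (bwd d1 (new1 a (fwd c x)), bwd d2 (new2 a (fwd c x)))
  else g x.

Let sg : smooth2 g := LI_smooth LIg.
Let oU : open U. Proof. by have [] := vdomP lc D1.1 D2.1 sg. Qed.

Lemma new_out a z : U z -> rho < `|z| ->
  new1 a z = rep c d1 (g1 g) z /\ new2 a z = rep c d2 (g2 g) z.
Proof.
move=> Uz zr.
pose B := U `&` [set z : E2 | rho < `|z|].
have oB : open B.
  by apply: openI => //; exact: open_normgt.
have Bz : B z by split.
have hB y : B y -> h (a, y) = 0 by move=> [Uy yr]; exact: h0.
have e v : 'D_v (fun z => h (a, z)) z = 0.
  by rewrite (derive_eqon oB v (g := fun=> 0) hB Bz) derive_cst.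
rewrite /new1 /new2 /dd1 /dd2 /br !e !mulr0 !mul0r subrr mul0r addr0 subr0.
by split; rewrite [RHS]row2_coord.
Qed.

Lemma new_cod a z : O a -> U z -> cod d1 (new1 a z) /\ cod d2 (new2 a z).
Proof.
move=> Oa Uz; have [zr|zr] := leP `|z| rho; first exact: hO.
have [-> ->] := new_out a Uz zr; have [[_ r1] [_ r2] _] := Uz.
by split; exact: fwd_cod.
Qed.

Lemma new_zero a z : (forall y, h (a, y) = 0) ->
  new1 a z = rep c d1 (g1 g) z /\ new2 a z = rep c d2 (g2 g) z.
Proof.
move=> ha; have e : (fun z => h (a, z)) = cst 0 by apply/funext.
rewrite /new1 /new2 /dd1 /dd2 /br e !derive_cst !mulr0 !mul0r subrr mul0r addr0 subr0.
by split; rewrite [RHS]row2_coord.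
Qed.

Lemma deform_zero a : (forall y, h (a, y) = 0) -> deform a = g.
Proof.
move=> ha; apply/funext => x; rewrite /deform; case: pselect => // -[cx Ux].
have [e1 e2] := new_zero (fwd c x) ha; have [[_ r1] [_ r2] _] := Ux.
rewrite e1 e2 /rep; rewrite fwdK // in r1 r2 *.
by rewrite (fwdK r1) (fwdK r2) /g1 /g2 -surjective_pairing.
Qed.

Lemma deform_in a x : dom c x -> U (fwd c x) ->
  deform a x = (bwd d1 (new1 a (fwd c x)), bwd d2 (new2 a (fwd c x))).
Proof. by move=> cx Ux; rewrite /deform; case: pselect => // -[]; split. Qed.

Let K : set F := bwd c @` [set z | `|z| <= rho].

Lemma deform_out a x : ~ K x -> deform a x = g x.
Proof.
move=> nK; rewrite /deform; case: pselect => // -[cx Ux].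
have zr : rho < `|fwd c x|.
  by rewrite ltNge; apply/negP => le; apply: nK; exists (fwd c x) => //; exact: fwdK.
have [-> ->] := new_out a Ux zr; rewrite /rep fwdK // !fwdK //.
- by rewrite /g1 /g2 -surjective_pairing.
- by have [_ [_]] := Ux; rewrite fwdK.
- by have [[_]] := Ux; rewrite fwdK.
Qed.

(** The support is the image of a compact ball, closed because F is Hausdorff; this is what makes
    the extension by [g] smooth at the edge of the chart. *)
Lemma deform_openNK : open (~` K).
Proof.
rewrite openC; apply: compact_closed; first exact: manifold_hausdorff.
apply: continuous_compact; last exact: compact_ballnorm.
apply: continuous_in_subspaceT => z; rewrite inE => zr.
by apply: bwd_continuous; exact: (vdom_cod (KU zr)).
Qed.

Let oUP : open (snd @^-1` U : set (P * E2)).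
Proof. by apply: open_comp => // ? _; exact: snd_cont. Qed.

Let Cs (f : E2 -> R) : Cinf U f -> Cinf (snd @^-1` U) (fun p : P * E2 => f p.2).
Proof.
by move=> hf; apply: (Cinf_comp (findim_rV R 2) oUP _ (@Cinf_snd R P E2 _) hf).
Qed.

Lemma Cinf_coordsU : [/\ Cinf U q1, Cinf U p1, Cinf U q2 & Cinf U p2].
Proof.
have [_ r1 r2] := vdomP lc D1.1 D2.1 sg.
by split; [apply: (Cinf_coordl 0 oU)|apply: (Cinf_coordl 1 oU)
  |apply: (Cinf_coordl 0 oU)|apply: (Cinf_coordl 1 oU)].
Qed.

Lemma Cinf_new : Cinf (snd @^-1` U) (fun p => new1 p.1 p.2) /\
  Cinf (snd @^-1` U) (fun p => new2 p.1 p.2).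
Proof.
have [hq1 hp1 hq2 hp2] := Cinf_coordsU.
have Dn p : (snd @^-1` U) p ->
    Dl ((0, be0) : P * E2) (0, be1) (fun p => q1 p.2) (fun p => q2 p.2) p != 0.
  by case: p => a z [_ _ dz]; rewrite /Dl br_slice.
have E1 : Cinf (snd @^-1` U) (dd1 ((0, be0) : P * E2) (0, be1) (fun p => q1 p.2) (fun p => q2 p.2) h).
  exact: (Cinf_dd1 oUP (Cs hq1) (Cs hq2) Dn hh).
have E2' : Cinf (snd @^-1` U) (dd2 ((0, be0) : P * E2) (0, be1) (fun p => q1 p.2) (fun p => q2 p.2) h).
  exact: (Cinf_dd2 oUP (Cs hq1) (Cs hq2) Dn hh).
split; apply: (Cinf_row2 oUP); [exact: Cs| |exact: Cs|].
  apply: (CinfD oUP); first exact: Cs.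
  by apply: (eq_Cinf oUP _ E1) => -[a z] _; rewrite dd1_slice.
apply: (CinfB oUP); first exact: Cs.
by apply: (eq_Cinf oUP _ E2') => -[a z] _; rewrite dd2_slice.
Qed.

Lemma deform_rep a z : O a -> U z ->
  [/\ rdom c d1 (g1 (deform a)) z, rdom c d2 (g2 (deform a)) z,
      rep c d1 (g1 (deform a)) z = new1 a z & rep c d2 (g2 (deform a)) z = new2 a z].
Proof.
move=> Oa Uz; have cz := vdom_cod Uz; have [n1 n2] := new_cod Oa Uz.
have e : deform a (bwd c z) = (bwd d1 (new1 a z), bwd d2 (new2 a z)).
  by rewrite deform_in ?bwdK //; exact: bwd_dom.
split.
- by split=> //; rewrite /g1 e; exact: bwd_dom.
- by split=> //; rewrite /g2 e; exact: bwd_dom.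
- by rewrite /rep /g1 e /= bwdK.
- by rewrite /rep /g2 e /= bwdK.
Qed.

(** Over the complement of the compact [K] the family is constant, and over the chart domain it is
    read off from [new1] and [new2]; these two open sets cover F. The index selects the
    component. *)
Lemma deform_family (i : bool) :
  if i then smooth_family O (fun a => g1 (deform a)) else smooth_family O (fun a => g2 (deform a)).
Proof.
pose W := (fst @^-1` O `&` snd @^-1` U : set (P * E2)).
have oW : open W.
  by apply: openI; last exact: oUP; apply: open_comp => // ? _; exact: fst_cont.
have [N1 N2] := Cinf_new.
have out (N : surface R) (f : F -> N) (G : P -> F -> N) : smooth f ->
    (forall a x, ~ K x -> G a x = f x) -> forall a x, O a -> ~ K x ->
    exists c0 d0 (W0 : set (P * E2)), [/\ local_coordinates c0 /\ local_coordinates d0,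
      dom c0 x, open W0 /\ W0 (a, fwd c0 x), W0 `<=` prep_dom O c0 d0 G &
      Cinf W0 (prep c0 d0 G)].
  move=> hf GE a x Oa nK.
  have [c0 [d0 [W0 [[l0 l0'] cx [oW0 W0x] W0D hW0]]]] := @smooth_const_family R F N P f hf a x (I : setT a).
  pose B := cod c0 `&` bwd c0 @^-1` (~` K).
  have oB : open B.
    apply: open_preim; [exact: cod_open|exact: deform_openNK|].
    by move=> z; exact: bwd_continuous.
  pose W1 := W0 `&` ((fst @^-1` O) `&` (snd @^-1` B)).
  have oW1 : open W1.
    apply: openI => //; apply: openI.
      by apply: open_comp => // ? _; exact: fst_cont.
    by apply: open_comp => // ? _; exact: snd_cont.
  exists c0, d0, W1; split=> //.
  - split=> //; split=> //; split=> //; split; first exact: fwd_cod.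
    by rewrite /preimage /= fwdK.
  - move=> p [W0p [Op [cp nKp]]]; have [_ _ dp] := W0D _ W0p.
    by split=> //; rewrite GE.
  - have hW1 : Cinf W1 (prep c0 d0 (fun=> f)) by apply: Cinf_sub hW0 => p [].
    by apply: (eq_Cinf oW1 _ hW1) => p [W0p [Op [cp nKp]]]; rewrite /prep GE.
have inn (N : surface R) (d : chart E2 N) (G : P -> F -> N) (n : P -> E2 -> E2) :
    local_coordinates d ->
    Cinf (snd @^-1` U) (fun p => n p.1 p.2) ->
    (forall a z, O a -> U z -> rdom c d (G a) z /\ rep c d (G a) z = n a z) ->
    forall a x, O a -> K x ->
    exists c0 d0 (W0 : set (P * E2)), [/\ local_coordinates c0 /\ local_coordinates d0,
      dom c0 x, open W0 /\ W0 (a, fwd c0 x), W0 `<=` prep_dom O c0 d0 G &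
      Cinf W0 (prep c0 d0 G)].
  move=> ld hn nE a x Oa [z zr <-].
  have Uz := KU zr; have cz := vdom_cod Uz.
  exists c, d, W; split=> //.
  - exact: bwd_dom.
  - by split=> //; rewrite bwdK //; split.
  - by move=> p [Op Up]; have [[? ?] _] := nE _ _ Op Up; split.
  - have hW : Cinf W (fun p => n p.1 p.2) by apply: Cinf_sub hn => p [].
    by apply: (eq_Cinf oW _ hW) => p [Op Up]; have [_ <-] := nE _ _ Op Up.
case: i => a x Oa; have [Kx|nKx] := pselect (K x).
- apply: (inn F1 d1 _ new1 D1.1 N1) => // b z Ob Uz.
  by have [? ? ? ?] := deform_rep Ob Uz.
- by apply: (out F1 (g1 g) _ sg.1) => // b y nKy; rewrite /g1 deform_out.
- apply: (inn F2 d2 _ new2 D2.1 N2) => // b z Ob Uz.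
  by have [? ? ? ?] := deform_rep Ob Uz.
- by apply: (out F2 (g2 g) _ sg.2) => // b y nKy; rewrite /g2 deform_out.
Qed.

Lemma deform_coords a : O a -> forall z, U z ->
  [/\ cQ1 c d1 (deform a) z = q1 z, cQ2 c d2 (deform a) z = q2 z,
     cP1 c d1 (deform a) z = p1 z + dd1 be0 be1 q1 q2 (fun z => h (a, z)) z &
     cP2 c d2 (deform a) z = p2 z - dd2 be0 be1 q1 q2 (fun z => h (a, z)) z].
Proof.
move=> Oa z Uz; have [_ _ r1 r2] := deform_rep Oa Uz.
by rewrite /cQ1 /cQ2 /cP1 /cP2 r1 r2 !row20 !row21.
Qed.

Lemma deform_vdom a z : O a -> U z -> vdom c d1 d2 (deform a) z.
Proof.
move=> Oa Uz; have [r1 r2 _ _] := deform_rep Oa Uz; split=> //.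
have e1 y : U y -> cQ1 c d1 (deform a) y = q1 y by move=> Uy; have [] := deform_coords Oa Uy.
have e2 y : U y -> cQ2 c d2 (deform a) y = q2 y by move=> Uy; have [] := deform_coords Oa Uy.
rewrite /cDl; have [-> _ _] := dd_eqon3 oU Uz e1 e2 e1.
by case: Uz.
Qed.

Lemma deform_LI a : O a -> LI (deform a).
Proof.
move=> Oa.
have f1 : smooth_family O (fun a => g1 (deform a)) := deform_family true.
have f2 : smooth_family O (fun a => g2 (deform a)) := deform_family false.
have s1 : smooth (g1 (deform a)) := smooth_family_smooth fP Oa f1.
have s2 : smooth (g2 (deform a)) := smooth_family_smooth fP Oa f2.
apply: LI_of => // x; have [[z zr <-]|nKx] := pselect (K x); last first.
  have n : \forall y \near x, g y = deform a y.
    have nK : nbhs x (~` K) by apply: open_nbhs_nbhs; split=> //; exact: deform_openNK.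
    by apply: filterS nK => y nKy; rewrite deform_out.
  exact: (lagr_at_near n (lagr_at_LI x LIg)).
have Uz := KU zr; have cz := vdom_cod Uz.
have [r1 r2 _ _] := deform_rep Oa Uz; have Vz := deform_vdom Oa Uz.
exists c, d1, d2; split; [exact: lc|exact: D1|exact: D2| |].
  by split; [exact: bwd_dom|exact: r1.2|exact: r2.2].
rewrite (bwdK cz); apply/(lagr_inP lc D1.1 D2.1 (conj s1 s2) Vz).
have base : lagr_in c d1 d2 g z.
  have [[_ x1] [_ x2] _] := Uz.
  by have := LI_in LIg lc D1 D2 (bwd_dom cz) x1 x2; rewrite bwdK.
move/(lagr_inP lc D1.1 D2.1 sg Uz) : base => base.
have [hq1 hp1 hq2 hp2] := Cinf_coordsU.
have Dn y : U y -> Dl be0 be1 q1 q2 y != 0 by move=> [].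
have [hU hE] := Cinf_slice a fP (findim_rV R 2) oUP hh.
have {hU}hE : Cinf U (fun z => h (a, z)) by exact: hE.
have e1 y : U y -> cQ1 c d1 (deform a) y = q1 y by move=> Uy; have [] := deform_coords Oa Uy.
have e2 y : U y -> cQ2 c d2 (deform a) y = q2 y by move=> Uy; have [] := deform_coords Oa Uy.
have e3 y : U y -> cP1 c d1 (deform a) y =
    p1 y + dd1 be0 be1 q1 q2 (fun z => h (a, z)) y.
  by move=> Uy; have [] := deform_coords Oa Uy.
have e4 y : U y -> cP2 c d2 (deform a) y =
    p2 y - dd2 be0 be1 q1 q2 (fun z => h (a, z)) y.
  by move=> Uy; have [] := deform_coords Oa Uy.
have [_ _ ->] := dd_eqon3 oU Uz e1 e2 e3.
have [_ -> _] := dd_eqon3 oU Uz e1 e2 e4.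
have k1 := Cinf_dd1 oU hq1 hq2 Dn hE; have k2 := Cinf_dd2 oU hq1 hq2 Dn hE.
rewrite (dd2D be0 be1 q1 q2 hp1 k1 Uz) (dd1B be0 be1 q1 q2 hp2 k2 Uz).
rewrite (dd_comm oU hq1 hq2 Dn hE Uz) opprB addrC -/q1 -/p1.
by congr (_ + _).
Qed.

End Deform.

(* The family is constant outside [0, T], so that isotopies can be concatenated
   smoothly. *)
Definition isotopic g g' := exists (T : R) (G : R -> F -> prod_manifold F1 F2),
  [/\ 0 < T, smooth_family (setT : set R) (fun t => g1 (G t)) /\ smooth_family (setT : set R) (fun t => g2 (G t)),
      forall t, LI (G t), forall t, t <= 0 -> G t = g & forall t, T <= t -> G t = g'].

Lemma isotopic_LI g g' : isotopic g g' -> LI g'.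
Proof. by move=> [T [G [_ _ L _ e]]]; rewrite -(e T). Qed.

Lemma isotopic_refl g : LI g -> isotopic g g.
Proof.
move=> L; exists 1, (fun=> g); have [s1 s2] := LI_smooth L.
by split=> //; split; exact: smooth_const_family.
Qed.

Lemma smooth_family_comp (M N : surface R) (P P' : normedModType R) (fP : findim P) (fP' : findim P')
    (O : set P) (O' : set P') (l : P' -> P) (G : P -> M -> N) :
  open O' -> Cinf O' l -> (forall t, O' t -> O (l t)) -> smooth_family O G ->
  smooth_family O' (fun t => G (l t)).
Proof.
move=> oO' hl lO hG t x Ot.
have [c [d [W [[lc ld] cx [oW Wx] WD hW]]]] := hG (l t) x (lO t Ot).
pose A : set (P' * E2) := fst @^-1` O'.
have oA : open A by apply: open_comp => // ? _; exact: fst_cont.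
have hm : Cinf A (fun p : P' * E2 => (l p.1, p.2)).
  apply: (Cinf_pair oA); last exact: Cinf_snd.
  by apply: (Cinf_comp fP' oA _ (@Cinf_fst R P' E2 A) hl).
pose W' := A `&` (fun p : P' * E2 => (l p.1, p.2)) @^-1` W.
have oW' : open W'.
  by apply: (open_preim oA oW) => p Ap; exact: (Cinf_cont hm Ap).
exists c, d, W'; split=> //.
- by move=> p [Ap Wp]; have [Op cp dp] := WD _ Wp; split.
- apply: (Cinf_comp (findim_prod fP (findim_rV R 2)) oW' _ (Cinf_sub _ hm) hW).
    by move=> p [].
  by move=> p [].
Qed.

Lemma smooth_family_glue (M N : surface R) (G H : R -> M -> N) (a b : R) : a < b ->
  smooth_family (setT : set R) G -> smooth_family (setT : set R) H ->
  (forall t : R, a < t -> t < b -> G t = H t) ->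
  smooth_family (setT : set R) (fun t : R => if t < b then G t else H t).
Proof.
move=> ab hG hH e; apply: smooth_family_local => t x _.
have [tb|bt] := ltP (t : R) b.
  exists G, (fst @^-1` [set s : R | s < b]); split=> //.
    by apply: open_comp; [move=> ? _; exact: cvg_fst|exact: open_lt].
  by move=> p /= ->.
exists H, (fst @^-1` [set s : R | a < s]); split=> //.
- by apply: open_comp; [move=> ? _; exact: cvg_fst|exact: open_gt].
- by rewrite /preimage /=; exact: lt_le_trans bt.
- by move=> p /= ap; case: ltP => // pb; rewrite e.
Qed.

Lemma isotopic_trans g g' g'' : isotopic g g' -> isotopic g' g'' -> isotopic g g''.
Proof.
move=> [T [G [T0 [G1 G2] LG e0 eT]]] [S [H [S0 [H1 H2] LH f0 fS]]].
(* The second isotopy starts one unit late: both families are then equal to g' on the open interval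
   (T, T + 1), where they are glued. *)
pose H' t := H (t - (T + 1)).
have sh : Cinf setT (fun t : R => t - (T + 1)).
  by apply: CinfB; [exact: openT|exact: Cinf_id|exact: Cinf_cst].
have oT : open [set: R] by exact: openT.
have H1' : smooth_family (setT : set R) (fun t : R => g1 (H' t)).
  exact: (smooth_family_comp (findim_R R) (findim_R R) oT sh (fun t _ => I : setT _) H1).
have H2' : smooth_family (setT : set R) (fun t : R => g2 (H' t)).
  exact: (smooth_family_comp (findim_R R) (findim_R R) oT sh (fun t _ => I : setT _) H2).
have TT : T < T + 1 by rewrite ltrDl.
have e (t : R) : T < t -> t < T + 1 -> G t = H' t.
  by move=> Tt tT; rewrite eT ?(ltW Tt) // /H' f0 // subr_le0 ltW.
pose K t := if t < T + 1 then G t else H' t.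
have K1 : smooth_family (setT : set R) (fun t : R => g1 (K t)).
  have -> : (fun t => g1 (K t)) = (fun t => if t < T + 1 then g1 (G t) else g1 (H' t)).
    by apply/funext => t; rewrite /K; case: ifP.
  by apply: (smooth_family_glue TT G1 H1') => t ? ?; rewrite e.
have K2 : smooth_family (setT : set R) (fun t : R => g2 (K t)).
  have -> : (fun t => g2 (K t)) = (fun t => if t < T + 1 then g2 (G t) else g2 (H' t)).
    by apply/funext => t; rewrite /K; case: ifP.
  by apply: (smooth_family_glue TT G2 H2') => t ? ?; rewrite e.
exists (T + 1 + S), K; split.
- by rewrite !addr_gt0.
- exact: conj K1 K2.
- by move=> t; rewrite /K; case: ifP => _; [exact: LG|exact: LH].
- by move=> t t0; rewrite /K (le_lt_trans t0) ?e0 // addr_gt0.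
- move=> t tS; rewrite /K ltNge (_ : T + 1 <= t) /=.
    by rewrite /H' fS // lerBrDl.
  by apply: le_trans tS; rewrite lerDl ltW.
Qed.

Lemma isotopic_deform (c : chart E2 F) (d1 : chart E2 F1) (d2 : chart E2 F2) g
    (P : normedModType R) (h : P * E2 -> R) (O : set P) (rho : R) a :
  local_coordinates c -> darboux w1 d1 -> darboux w2 d2 -> LI g -> findim P -> open O ->
  Cinf (snd @^-1` vdom c d1 d2 g) h ->
  (forall z : E2, `|z| <= rho -> vdom c d1 d2 g z) ->
  (forall a z, vdom c d1 d2 g z -> rho < `|z| -> h (a, z) = 0) ->
  (forall a z, O a -> `|z| <= rho ->
     cod d1 (new1 c d1 d2 g h a z) /\ cod d2 (new2 c d1 d2 g h a z)) ->
  (forall s : R, 0 <= s <= 1 -> O (s *: a)) ->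
  (forall z, h (0, z) = 0) ->
  isotopic g (deform c d1 d2 g h a).
Proof.
move=> lc D1 D2 LIg fP oO hh KU h0 hO seg hz.
(* The segment from 0 to a, at a speed that makes the family constant before time 0 and after time
   1. *)
have Lst : Cinf setT (fun t : R => sstep t *: a).
  by apply: CinfZ; [exact: openT|exact: Cinf_sstep|exact: Cinf_cst].
have lO (t : R) : setT t -> O (sstep t *: a).
  by move=> _; apply: seg; rewrite sstep_ge0 sstep_le1.
have oT : open [set: R] by exact: openT.
exists 1, (fun t => deform c d1 d2 g h (sstep t *: a)); split.
- exact: ltr01.
- split.
    exact: (smooth_family_comp fP (findim_R R) oT Lst lO (deform_family lc D1 D2 LIg oO hh KU h0 hO true)).
  exact: (smooth_family_comp fP (findim_R R) oT Lst lO (deform_family lc D1 D2 LIg oO hh KU h0 hO false)).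
- by move=> t; exact: (deform_LI lc D1 D2 LIg fP oO hh KU h0 hO (lO t I)).
- by move=> t t0; rewrite sstep0 // scale0r; apply: deform_zero.
- by move=> t t1; rewrite sstep1 // scale1r.
Qed.

End Perturb.

(** * Genericity *)

Section Lip.
Variable R : realType.
Local Notation E2 := ('rV[R]_2).

Lemma cont_bound (V : normedModType R) (K : set V) (f : V -> R) : compact K ->
  (forall x, K x -> {for x, continuous f}) -> exists C, forall x, K x -> `|f x| <= C.
Proof.
move=> cK cf; have : compact (f @` K).
  by apply: continuous_compact cK; apply: continuous_in_subspaceT => x; rewrite inE; exact: cf.
move=> /compact_bounded[C [_ hC]]; exists (C + 1) => x Kx.
by apply: hC; [rewrite ltrDl|exists x].
Qed.

Lemma lip_ball (U : set E2) (f : E2 -> R) : open U -> Cinf U f ->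
  (forall z : E2, `|z| <= 1 -> U z) ->
  exists L, forall z z' : E2, `|z| <= 1 -> `|z'| <= 1 -> `|f z - f z'| <= L * `|z - z'|.
Proof.
move=> oU hf KU; have cK := @compact_ballnorm R 1.
have cD v z : [set z : E2 | `|z| <= 1] z -> {for z, continuous ('D_v f)}.
  by move=> /KU Uz; exact: (Cinf_cont (Cinf_derive v hf) Uz).
have [C0 h0] := cont_bound cK (cD be0); have [C1 h1] := cont_bound cK (cD be1).
exists (C0 + C1) => z z' z1 z'1.
have seg (s : R) : 0 <= s <= 1 -> `|z' + s *: (z - z')| <= 1.
  move=> /andP[s0 s1].
  have -> : z' + s *: (z - z') = s *: z + (1 - s) *: z'.
    by rewrite scalerBr scalerBl scale1r addrCA addrC -addrA addrC.
  apply: le_trans (ler_normD _ _) _; rewrite !normrZ (ger0_norm s0) ger0_norm ?subr_ge0 //.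
  have a := ler_wpM2l s0 z1; have s1' : 0 <= 1 - s by rewrite subr_ge0.
  by have b := ler_wpM2l s1' z'1; lra.
have -> : f z - f z' = f (z' + (z - z')) - f z' by rewrite [z' + _]addrC subrK.
apply: MVT_le => s s01; have ss := seg s s01; have Us := KU _ ss.
  exact: (Cinf_diff hf Us).
rewrite (derive2E (z - z') (Cinf_diff hf Us)).
apply: le_trans (lin2_le _ _ _) _; apply: ler_wpM2r => //.
by apply: lerD; [exact: h0|exact: h1].
Qed.

Lemma rV3_lt (a : 'rV[R]_3) (e : R) : 0 < e -> (forall i, `|a 0 i| < e) -> `|a| < e.
Proof.
move=> e0 h; rewrite [ltLHS]/Num.Def.normr /= mx_normrE.
by apply: bigmax_lt => // -[i j] _; rewrite ord1; exact: h.
Qed.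

End Lip.

(** * Polynomial perturbations, jets and openness of the conditions *)

Section Comb.
Variable R : realType.
Local Notation E2 := ('rV[R]_2).
Implicit Types (a : nat -> R) (e : nat -> nat * nat).

(** Coefficients and exponents are given by functions, so that a partial derivative of such a
    combination is again one. All explicit polynomials of the proof have this form. *)
Definition comb a e (q : E2) : R := a 0%N * mono (e 0%N).1 (e 0%N).2 q +
  (a 1%N * mono (e 1%N).1 (e 1%N).2 q + a 2%N * mono (e 2%N).1 (e 2%N).2 q).

Lemma Cinf_comb a e : Cinf setT (comb a e).
Proof.
have oT : open [set: E2] by exact: openT.
have h i : Cinf setT (fun q : E2 => a i * mono (e i).1 (e i).2 q).
  by apply: CinfM => //; [exact: Cinf_cst|exact: Cinf_mono].
exact: (CinfD oT (h 0%N) (CinfD oT (h 1%N) (h 2%N))).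
Qed.

Lemma derive_comb v a e (k : nat -> R) e' :
  (forall i q, 'D_v (mono (e i).1 (e i).2) q = k i * mono (e' i).1 (e' i).2 q) ->
  'D_v (comb a e) = comb (fun i => a i * k i) e'.
Proof.
move=> E; apply/funext => q.
have dm' i : differentiable (mono (e i).1 (e i).2) q.
  by apply: (@Cinf_diff _ _ _ setT) => //; exact: Cinf_mono.
have dm i : differentiable (fun q => a i * mono (e i).1 (e i).2 q) q.
  apply: (@Cinf_diff _ _ _ setT) => //.
  by apply: CinfM; [exact: openT|exact: Cinf_cst|exact: Cinf_mono].
have {}E i : 'D_v (fun q => a i * mono (e i).1 (e i).2 q) q =
    a i * k i * mono (e' i).1 (e' i).2 q.
  by rewrite (deriveMcf _ _ (dm' i)) E mulrA.
have dd := @differentiableD _ _ _ _ _ _ (dm 1%N) (dm 2%N).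
by rewrite (deriveDf v (dm 0%N) dd) (deriveDf v (dm 1%N) (dm 2%N)) !E.
Qed.

Lemma derive_comb0 a e : 'D_be0 (comb a e) =
  comb (fun i => a i * (e i).1%:R) (fun i => ((e i).1.-1, (e i).2)).
Proof. by apply: derive_comb => i q; rewrite derive_mono0. Qed.

Lemma derive_comb1 a e : 'D_be1 (comb a e) =
  comb (fun i => a i * (e i).2%:R) (fun i => ((e i).1, (e i).2.-1)).
Proof. by apply: derive_comb => i q; rewrite derive_mono1. Qed.

End Comb.

Section Jets.
Variable R : realType.
Local Notation E2 := ('rV[R]_2).

Section word.
Variables (V : normedModType R) (v0 v1 : V) (Q1 Q2 : V -> R).
(* A word stands for an iterated derivative: [false] for [dd1], [true] for [dd2]. *)
Definition dword (w : seq bool) (f : V -> R) : V -> R :=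
  foldr (fun b f => if b then dd2 v0 v1 Q1 Q2 f else dd1 v0 v1 Q1 Q2 f) f w.

Lemma Cinf_dword (A : set V) w f : open A -> Cinf A Q1 -> Cinf A Q2 ->
  (forall x, A x -> Dl v0 v1 Q1 Q2 x != 0) -> Cinf A f -> Cinf A (dword w f).
Proof.
move=> oA h1 h2 D0 hf; elim: w => //= -[] w IH.
  exact: (Cinf_dd2 oA h1 h2 D0 IH).
exact: (Cinf_dd1 oA h1 h2 D0 IH).
Qed.

Lemma dword_eqon (A : set V) w f f' : open A -> (forall x, A x -> f x = f' x) ->
  forall x, A x -> dword w f x = dword w f' x.
Proof.
move=> oA e; elim: w => //= -[] w IH x Ax.
  exact: (dd2_eqon v0 v1 Q1 Q2 oA IH Ax).
exact: (dd1_eqon v0 v1 Q1 Q2 oA IH Ax).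
Qed.

End word.

Definition pword (w : seq bool) (H : E2 -> R) : E2 -> R :=
  foldr (fun b f => if b then 'D_be1 f else 'D_be0 f) H w.

Lemma Cinf_pword w H : Cinf setT H -> Cinf setT (pword w H).
Proof. by move=> hH; elim: w => //= -[] w IH; exact: Cinf_derive. Qed.

Lemma dword_eqon3 (A : set E2) w (Q1 Q2 f Q1' Q2' f' : E2 -> R) : open A ->
  (forall z, A z -> Q1 z = Q1' z) -> (forall z, A z -> Q2 z = Q2' z) ->
  (forall z, A z -> f z = f' z) ->
  forall x, A x -> dword be0 be1 Q1 Q2 w f x = dword be0 be1 Q1' Q2' w f' x.
Proof.
move=> oA e1 e2 e3; elim: w => //= -[] w IH x Ax;
by have [_ ? ?] := dd_eqon3 oA Ax e1 e2 IH.
Qed.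

Lemma dword_comp (Q1 Q2 : E2 -> R) (A : set E2) w H : open A -> Cinf A Q1 -> Cinf A Q2 ->
  (forall x, A x -> Dl be0 be1 Q1 Q2 x != 0) -> Cinf setT H ->
  forall x, A x -> dword be0 be1 Q1 Q2 w (fun y => H (row2 (Q1 y) (Q2 y))) x =
    pword w H (row2 (Q1 x) (Q2 x)).
Proof.
move=> oA h1 h2 D0 hH; have oT : open [set: E2] by exact: openT.
elim: w => //= -[] w IH x Ax.
  rewrite (dd2_eqon be0 be1 Q1 Q2 oA IH Ax).
  by have [_ ->] := dd_comp h1 h2 D0 oT (Cinf_pword w hH) Ax I.
rewrite (dd1_eqon be0 be1 Q1 Q2 oA IH Ax).
by have [-> _] := dd_comp h1 h2 D0 oT (Cinf_pword w hH) Ax I.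
Qed.

Lemma dwordD (Q1 Q2 : E2 -> R) (A : set E2) w f f' : open A -> Cinf A Q1 -> Cinf A Q2 ->
  (forall x, A x -> Dl be0 be1 Q1 Q2 x != 0) -> Cinf A f -> Cinf A f' ->
  forall x, A x -> dword be0 be1 Q1 Q2 w (fun y => f y + f' y) x =
    dword be0 be1 Q1 Q2 w f x + dword be0 be1 Q1 Q2 w f' x.
Proof.
move=> oA h1 h2 D0 hf hf'; elim: w => //= -[] w IH x Ax.
  rewrite (dd2_eqon be0 be1 Q1 Q2 oA IH Ax).
  exact: (dd2D be0 be1 Q1 Q2 (Cinf_dword w oA h1 h2 D0 hf) (Cinf_dword w oA h1 h2 D0 hf') Ax).
rewrite (dd1_eqon be0 be1 Q1 Q2 oA IH Ax).
exact: (dd1D be0 be1 Q1 Q2 (Cinf_dword w oA h1 h2 D0 hf) (Cinf_dword w oA h1 h2 D0 hf') Ax).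
Qed.

Lemma dword_slice (P : normedModType R) (Q1 Q2 f : P * E2 -> R) w a z :
  dword ((0, be0) : P * E2) (0, be1) Q1 Q2 w f (a, z) =
  dword be0 be1 (fun z => Q1 (a, z)) (fun z => Q2 (a, z)) w (fun z => f (a, z)) z.
Proof.
elim: w z => //= b w IH z.
have e : (fun z => dword ((0, be0) : P * E2) (0, be1) Q1 Q2 w f (a, z)) =
   dword be0 be1 (fun z => Q1 (a, z)) (fun z => Q2 (a, z)) w (fun z => f (a, z)).
  by apply/funext.
by case: b; [rewrite dd2_slice e|rewrite dd1_slice e].
Qed.

End Jets.

Section Generic.
Variable R : realType.
Local Notation E2 := ('rV[R]_2).
Local Notation E3 := ('rV[R]_3).
Variables (F F1 F2 : surface R) (w1 : form2 F1) (w2 : form2 F2).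
Hypotheses (sw1 : symplectic w1) (sw2 : symplectic w2).
Local Notation LI := (lagrangian_immersion w1 w2).
Implicit Types g : F -> prod_manifold F1 F2.

Record patch := Patch { pc : chart E2 F; pd1 : chart E2 F1; pd2 : chart E2 F2 }.
Implicit Types p : patch.

Definition wfp p := [/\ local_coordinates (pc p), darboux w1 (pd1 p) & darboux w2 (pd2 p)].

Definition pQ1 p g := cQ1 (pc p) (pd1 p) g.
Definition pP1 p g := cP1 (pc p) (pd1 p) g.
Definition pQ2 p g := cQ2 (pc p) (pd2 p) g.
Definition pdom p g := vdom (pc p) (pd1 p) (pd2 p) g.

Definition jet p w g : E2 -> R :=
  dword be0 be1 (pQ1 p g) (pQ2 p g) w (dd2 be0 be1 (pQ1 p g) (pQ2 p g) (pP1 p g)).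

(* With [u = dd2 P1], the excluded triples are (u, u_1, u_2), (u, u_2, u_22) and
   (u, u_1, u_11). *)
Definition jet_words (m i : nat) : seq bool :=
  nth [::] (nth [::] [:: [:: [::]; [:: false]; [:: true]];
                         [:: [::]; [:: true]; [:: true; true]];
                         [:: [::]; [:: false]; [:: false; false]]] m) i.

(** Three radii occur: the conditions are imposed up to radius 1, the cutoff of the Hamiltonian is 1
    up to radius 2, and it vanishes from radius 4 on. *)
Definition valid p g := LI g /\ forall z : E2, `|z| <= 4 -> pdom p g z.

(** The index may range over all of nat: beyond 2 the default word is the empty one, which is entry
    0 again. *)
Definition cond p (m : nat) g := forall z : E2, `|z| <= 1 -> exists i : nat, jet p (jet_words m i) g z != 0.

(* Three parameters are enough: every genericity condition excludes three
   equations in two unknowns. *)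
Definition stable (S : (F -> prod_manifold F1 F2) -> Prop) :=
  forall (O : set E3) (G : E3 -> F -> prod_manifold F1 F2) a0, open O -> O a0 ->
    smooth_family O (fun a => g1 (G a)) -> smooth_family O (fun a => g2 (G a)) -> (forall a, O a -> LI (G a)) ->
    S (G a0) -> \forall a \near a0, S (G a).

Lemma stableI S S' : stable S -> stable S' -> stable (fun g => S g /\ S' g).
Proof.
move=> s s' O G a0 oO Oa h1 h2 L [Sa S'a].
exact: filterI (s O G a0 oO Oa h1 h2 L Sa) (s' O G a0 oO Oa h1 h2 L S'a).
Qed.

Lemma jet_smooth p g : wfp p -> smooth2 g ->
  [/\ open (pdom p g), Cinf (pdom p g) (pQ1 p g), Cinf (pdom p g) (pQ2 p g),
      Cinf (pdom p g) (dd2 be0 be1 (pQ1 p g) (pQ2 p g) (pP1 p g)) &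
      forall w, Cinf (pdom p g) (jet p w g)].
Proof.
move=> [lc [l1 _] [l2 _]] sg; have [oU r1 r2] := vdomP lc l1 l2 sg.
have hq1 : Cinf (pdom p g) (pQ1 p g) by apply: (Cinf_coordl 0 oU).
have hp1 : Cinf (pdom p g) (pP1 p g) by apply: (Cinf_coordl 1 oU).
have hq2 : Cinf (pdom p g) (pQ2 p g) by apply: (Cinf_coordl 0 oU).
have D0 x : pdom p g x -> Dl be0 be1 (pQ1 p g) (pQ2 p g) x != 0 by case.
have hu := Cinf_dd2 oU hq1 hq2 D0 hp1.
split=> // w; exact: (Cinf_dword w oU hq1 hq2 D0 hu).
Qed.

(** Brackets on the product with the parameter space, in the directions (0, be0) and (0, be1),
    restrict on each slice to those of the plane; smoothness of the jets in (a, z) jointly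
    follows. *)
Lemma jet_family p (P : normedModType R) (O : set P) (G : P -> F -> prod_manifold F1 F2) :
  findim P -> open O -> wfp p -> smooth_family O (fun a => g1 (G a)) -> smooth_family O (fun a => g2 (G a)) ->
  let W := [set q : P * E2 | O q.1 /\ pdom p (G q.1) q.2] in
  open W /\ forall w, Cinf W (fun q => jet p w (G q.1) q.2).
Proof.
move=> fP oO [lc [l1 _] [l2 _]] h1 h2 W.
have [op1 k1] := smooth_family_rep fP h1 lc l1; have [op2 k2] := smooth_family_rep fP h2 lc l2.
set D1 := prep_dom _ _ _ _ in op1 k1; set D2 := prep_dom _ _ _ _ in op2 k2.
have oA : open (D1 `&` D2) := openI op1 op2.
have q1s : Cinf (D1 `&` D2) (fun q : P * E2 => pQ1 p (G q.1) q.2).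
  by apply: (Cinf_coordl 0 oA); apply: Cinf_sub k1 => q [].
have p1s : Cinf (D1 `&` D2) (fun q : P * E2 => pP1 p (G q.1) q.2).
  by apply: (Cinf_coordl 1 oA); apply: Cinf_sub k1 => q [].
have q2s : Cinf (D1 `&` D2) (fun q : P * E2 => pQ2 p (G q.1) q.2).
  by apply: (Cinf_coordl 0 oA); apply: Cinf_sub k2 => q [].
pose D := Dl ((0, be0) : P * E2) (0, be1) (fun q => pQ1 p (G q.1) q.2) (fun q => pQ2 p (G q.1) q.2).
have DE a z : D (a, z) = Dl be0 be1 (pQ1 p (G a)) (pQ2 p (G a)) z by exact: br_slice.
have hD : Cinf (D1 `&` D2) D by exact: (Cinf_br _ _ oA q1s q2s).
have WE : W = (D1 `&` D2) `&` D @^-1` [set t | t != 0].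
  apply/seteqP; split=> -[a z].
    by move=> [/= Oa [[c1 x1] [c2 x2] d0]]; split; [split; split|rewrite /preimage /= DE].
  move=> [[[Oa c1 x1] [_ _ x2]]]; rewrite /preimage /= DE => d0.
  by split=> //; split.
have oW : open W.
  rewrite WE; apply: open_preim; [exact: oA|exact: open_neq|].
  by move=> q Aq; exact: (Cinf_cont hD Aq).
have sub : W `<=` D1 `&` D2 by rewrite WE => q [].
split=> // w.
have Dn q : W q -> D q != 0 by rewrite WE => -[].
have r1 := Cinf_sub sub q1s; have r2 := Cinf_sub sub q2s; have r3 := Cinf_sub sub p1s.
have := Cinf_dword w oW r1 r2 Dn (Cinf_dd2 oW r1 r2 Dn r3).
apply: (eq_Cinf oW) => -[a z] _; rewrite dword_slice /jet /=.
apply: (congr1 (fun f => dword be0 be1 (pQ1 p (G a)) (pQ2 p (G a)) w f z)).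
by apply/funext => y; exact: dd2_slice.
Qed.

(** An open condition in (a, z) that holds on a compact ball of z persists for nearby a, by the tube
    lemma; the same argument gives [stable_cond]. *)
Lemma stable_valid p : wfp p -> stable (valid p).
Proof.
move=> wp O G a0 oO Oa h1 h2 L [_ V].
have [oW _] := jet_family (findim_rV R 3) oO wp h1 h2.
have := tube_open (@compact_ballnorm R 4) oW (x0 := a0) _.
move=> /(_ (fun z z4 => conj Oa (V z z4))) H.
have nO : nbhs a0 O by apply: open_nbhs_nbhs.
apply: filterS2 nO H => a Oa' H; split; first exact: L.
by move=> z z4; have [] := H z z4.
Qed.

Lemma stable_cond p m : wfp p -> stable (fun g => valid p g /\ cond p m g).
Proof.
move=> wp O G a0 oO Oa h1 h2 L [V C].
have SV := stable_valid wp oO Oa h1 h2 L V.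
have [oW hW] := jet_family (findim_rV R 3) oO wp h1 h2.
set W := [set _ | _] in oW hW.
pose A (i : nat) := W `&` (fun q : E3 * E2 => jet p (jet_words m i) (G q.1) q.2) @^-1` [set t | t != 0].
have oA i : open (A i).
  apply: open_preim; [exact: oW|exact: open_neq|].
  by move=> q Wq; exact: (Cinf_cont (hW (jet_words m i)) Wq).
pose B := \bigcup_i A i.
have oB : open B by exact: bigcup_open.
have a0B z : `|z| <= 1 -> B (a0, z).
  move=> z1; have [i ne] := C z z1; exists i => //; split=> //; split=> //=.
  by apply: V.2; apply: le_trans z1 _; rewrite ler1n.
have H := tube_open (@compact_ballnorm R 1) oB a0B.
apply: filterS2 SV H => a Va H; split=> // z z1.
by have [i _ [_ ne]] := H z z1; exists i.
Qed.

End Generic.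

Section Step.
Variable R : realType.
Local Notation E2 := ('rV[R]_2).
Local Notation E3 := ('rV[R]_3).

(* Exponents of the three monomials added to [u] to avoid the [m]-th triple;
   [psi] solves for their coefficients. *)
Definition jet_exponents (m k : nat) : nat * nat :=
  nth (0, 0)%N (nth [::] [:: [:: (0, 0); (1, 0); (0, 1)];
                             [:: (0, 0); (0, 1); (0, 2)];
                             [:: (0, 0); (1, 0); (2, 0)]] m) k.

Definition psi (m k : nat) (t : nat -> R) (q : E2) : R :=
  nth 0 (nth [::]
   [:: [:: t 1%N * q 0 0 + t 2%N * q 0 1 - t 0%N; - t 1%N; - t 2%N];
       [:: t 1%N * q 0 1 - t 2%N * (q 0 1 * q 0 1 / 2) - t 0%N; t 2%N * q 0 1 - t 1%N; - (t 2%N / 2)];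
       [:: t 1%N * q 0 0 - t 2%N * (q 0 0 * q 0 0 / 2) - t 0%N; t 2%N * q 0 0 - t 1%N; - (t 2%N / 2)]] m) k.

Definition ce (w : seq bool) (ae : (nat -> R) * (nat -> nat * nat)) :=
  foldr (fun b ae => if b then (fun i => ae.1 i * (ae.2 i).2%:R, fun i => ((ae.2 i).1, (ae.2 i).2.-1))
    else (fun i => ae.1 i * (ae.2 i).1%:R, fun i => ((ae.2 i).1.-1, (ae.2 i).2))) ae w.

Lemma pword_comb w a e : pword w (comb a e) = comb (ce w (a, e)).1 (ce w (a, e)).2.
Proof.
elim: w => //= -[] w ->; [exact: derive_comb1|exact: derive_comb0].
Qed.

(** The three equations are triangular in the coefficients. If the perturbed jet vanishes at a
    point, the coefficients are thus the value there of a map built from the old jet: the bad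
    parameters form the image of a map from the plane to 3-space. *)
Lemma psi_solve m k a t q : (m < 3)%N -> (k < 3)%N ->
  (forall i, (i < 3)%N -> t i + pword (jet_words m i) (comb a (jet_exponents m)) q = 0) -> psi m k t q = a k.
Proof.
move=> m3 k3 h; move: (h 0%N isT) (h 1%N isT) (h 2%N isT) => {h}.
case: m m3 => [|[|[|//]]] _; case: k k3 => [|[|[|//]]] _;
  rewrite !pword_comb /comb /mono /psi /= ?expr0 ?expr1;
  move: (a 0%N) (a 1%N) (a 2%N) (q 0 0) (q 0 1) => a0 a1 a2 x y h0 h1 h2.
- have -> : t 1%N = - a1 by lra.
  have -> : t 2%N = - a2 by lra.
  have -> : t 0%N = - (a0 + a1 * x + a2 * y) by lra.
  by ring.
- lra.
- lra.
- have e2 : t 2%N = - (2 * a2) by lra.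
  have e1 : t 1%N = - (a1 + 2 * a2 * y) by move: h1 e2; clear; lra.
  have -> : t 0%N = - (a0 + a1 * y + a2 * y ^+ 2) by move: h0; clear; lra.
  by rewrite e1 e2; field.
- have e2 : t 2%N = - (2 * a2) by lra.
  have e1 : t 1%N = - (a1 + 2 * a2 * y) by move: h1 e2; clear; lra.
  by rewrite e1 e2; ring.
- have -> : t 2%N = - (2 * a2) by lra.
  by field.
- have e2 : t 2%N = - (2 * a2) by lra.
  have e1 : t 1%N = - (a1 + 2 * a2 * x) by move: h1 e2; clear; lra.
  have -> : t 0%N = - (a0 + a1 * x + a2 * x ^+ 2) by move: h0; clear; lra.
  by rewrite e1 e2; field.
- have e2 : t 2%N = - (2 * a2) by lra.
  have e1 : t 1%N = - (a1 + 2 * a2 * x) by move: h1 e2; clear; lra.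
  by rewrite e1 e2; ring.
- have -> : t 2%N = - (2 * a2) by lra.
  by field.
Qed.

Lemma Cinf_psi (A : set E2) m k (t : nat -> E2 -> R) (Q1 Q2 : E2 -> R) : open A ->
  (forall i, Cinf A (t i)) -> Cinf A Q1 -> Cinf A Q2 ->
  Cinf A (fun z => psi m k (t ^~ z) (row2 (Q1 z) (Q2 z))).
Proof.
move=> oA ht h1 h2.
have hc (c : R) : Cinf A (fun _ : E2 => c) by exact: Cinf_cst.
have S (f f' : E2 -> R) : Cinf A f -> Cinf A f' -> Cinf A (fun z => f z - f' z).
  by move=> ? ?; exact: CinfB.
have N (f : E2 -> R) : Cinf A f -> Cinf A (fun z => - f z) by exact: CinfN.
have D (f f' : E2 -> R) : Cinf A f -> Cinf A f' -> Cinf A (fun z => f z + f' z).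
  by move=> ? ?; exact: CinfD.
have M (f f' : E2 -> R) : Cinf A f -> Cinf A f' -> Cinf A (fun z => f z * f' z).
  by move=> ? ?; exact: CinfM.
rewrite /psi; under eq_fun do rewrite row20 row21.
case: m => [|[|[|m]]]; case: k => [|[|[|k]]] /=; rewrite ?nth_nil; try exact: hc.
- exact: (S _ _ (D _ _ (M _ _ (ht 1%N) h1) (M _ _ (ht 2%N) h2)) (ht 0%N)).
- exact: (N _ (ht 1%N)).
- exact: (N _ (ht 2%N)).
- exact: (S _ _ (S _ _ (M _ _ (ht 1%N) h2) (M _ _ (ht 2%N) (M _ _ (M _ _ h2 h2) (hc 2^-1)))) (ht 0%N)).
- exact: (S _ _ (M _ _ (ht 2%N) h2) (ht 1%N)).
- exact: (N _ (M _ _ (ht 2%N) (hc 2^-1))).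
- exact: (S _ _ (S _ _ (M _ _ (ht 1%N) h1) (M _ _ (ht 2%N) (M _ _ (M _ _ h1 h1) (hc 2^-1)))) (ht 0%N)).
- exact: (S _ _ (M _ _ (ht 2%N) h1) (ht 1%N)).
- exact: (N _ (M _ _ (ht 2%N) (hc 2^-1))).
Qed.

Definition half_bump (z : E2) : R := bump2 (2^-1 *: z).

Lemma Cinf_half_bump : Cinf setT half_bump.
Proof.
have oT : open [set: E2] by exact: openT.
have hs : Cinf setT (fun z : E2 => (2^-1 : R) *: z).
  by apply: CinfZ; [exact: oT|exact: Cinf_cst|exact: Cinf_id].
exact: (Cinf_comp (findim_rV R 2) oT (fun _ _ => I) hs (@Cinf_bump2 R)).
Qed.

Lemma half_bump1 z : `|z| <= 2 -> half_bump z = 1.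
Proof.
by move=> z2; apply: bump2_1; rewrite normrZ ger0_norm ?invr_ge0 // ler_pdivrMl // mulr1.
Qed.

Lemma half_bump0 z : 4 <= `|z| -> half_bump z = 0.
Proof.
move=> z4; apply: bump2_0; rewrite normrZ ger0_norm ?invr_ge0 // ler_pdivlMl //.
by rewrite (_ : 2 * 2 = 4) //; ring.
Qed.

(** A Hamiltonian h adds its mixed derivative h_12 to u, whence the raised exponents and the
    division by both of them. *)
Definition prim_comb m (a : nat -> R) : E2 -> R :=
  comb (fun k => a k / ((jet_exponents m k).1.+1%:R * (jet_exponents m k).2.+1%:R)) (fun k => ((jet_exponents m k).1.+1, (jet_exponents m k).2.+1)).

Lemma prim_combE m a : 'D_be1 ('D_be0 (prim_comb m a)) = comb a (jet_exponents m).
Proof.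
apply: (etrans (congr1 (fun f : E2 -> R => 'D_be1 f) (derive_comb0 _ _))).
apply: (etrans (derive_comb1 _ _)); apply/funext => q; rewrite /comb /=.
have e (x : R) (i j : nat) : x / (i.+1%:R * j.+1%:R) * i.+1%:R * j.+1%:R = x.
  by rewrite -mulrA divfK // mulf_neq0 ?pnatr_eq0.
by rewrite !e.
Qed.

Lemma prim_comb0 m q : prim_comb m (fun=> 0) q = 0.
Proof. by rewrite /prim_comb /comb !mul0r !addr0. Qed.

Definition coord3 (a : E3) (k : nat) : R := a 0 (inord k).

Lemma Cinf_prim_comb m : Cinf setT (fun p : E3 * E2 => prim_comb m (coord3 p.1) p.2).
Proof.
have oT : open [set: E3 * E2] by exact: openT.
have ha k : Cinf setT (fun p : E3 * E2 => coord3 p.1 k).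
  exact: (Cinf_coordl (inord k) oT (@Cinf_fst R E3 E2 setT)).
have hm i j : Cinf setT (fun p : E3 * E2 => mono i j p.2 : R).
  exact: (Cinf_comp (findim_rV R 2) oT (fun _ _ => I) (@Cinf_snd R E3 E2 setT) (@Cinf_mono R i j)).
have h k i j (c : R) : Cinf setT (fun p : E3 * E2 => coord3 p.1 k / c * mono i j p.2).
  apply: (CinfM oT _ (hm i j)); apply: (CinfM oT (ha k)); exact: Cinf_cst.
rewrite /prim_comb /comb; exact: (CinfD oT (h _ _ _ _) (CinfD oT (h _ _ _ _) (h _ _ _ _))).
Qed.

Variables (F F1 F2 : surface R) (w1 : form2 F1) (w2 : form2 F2).
Hypotheses (sw1 : symplectic w1) (sw2 : symplectic w2).
Local Notation LI := (lagrangian_immersion w1 w2).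
Implicit Types g : F -> prod_manifold F1 F2.

Section one.
Variables (p : patch F F1 F2) (m : nat) (g : F -> prod_manifold F1 F2).
Hypotheses (wp : wfp w1 w2 p) (vg : valid w1 w2 p g) (m3 : (m < 3)%N).
Local Notation U := (pdom p g).
Local Notation Q z := (row2 (pQ1 p g z) (pQ2 p g z)).

Definition hamilton (q : E3 * E2) : R := half_bump q.2 * prim_comb m (coord3 q.1) (Q q.2).

Lemma Cinf_hamilton : Cinf (snd @^-1` U) hamilton.
Proof.
have [oU h1 h2 _ _] := jet_smooth wp (LI_smooth vg.1).
have oUP : open (snd @^-1` U : set (E3 * E2)).
  by apply: open_comp => // ? _; exact: snd_cont.
have hs : Cinf (snd @^-1` U) (snd : E3 * E2 -> E2) by exact: Cinf_snd.
have c1 : Cinf (snd @^-1` U) (fun q : E3 * E2 => half_bump q.2).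
  exact: (Cinf_comp (findim_rV R 2) oUP (fun _ _ => I) hs (@Cinf_half_bump)).
have cQ : Cinf (snd @^-1` U) (fun q : E3 * E2 => Q q.2).
  exact: (Cinf_comp (findim_rV R 2) oUP (fun _ h => h) hs (Cinf_row2 oU h1 h2)).
have cp : Cinf (snd @^-1` U) (fun q : E3 * E2 => (q.1, Q q.2)).
  by apply: (Cinf_pair oUP) => //; exact: Cinf_fst.
apply: (CinfM oUP c1).
exact: (Cinf_comp (findim_prod (findim_rV R 3) (findim_rV R 2)) oUP (fun _ _ => I) cp (Cinf_prim_comb m)).
Qed.

Lemma hamilton_out a z : 4 < `|z| -> hamilton (a, z) = 0.
Proof. by move=> z4; rewrite /hamilton half_bump0 ?mul0r // ltW. Qed.

Lemma hamilton0 z : hamilton (0, z) = 0.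
Proof.
rewrite /hamilton /= (_ : coord3 0 = fun=> 0) ?prim_comb0 ?mulr0 //.
by apply/funext => k; rewrite /coord3 mxE.
Qed.

Local Notation nw1 := (new1 (pc p) (pd1 p) (pd2 p) g hamilton).
Local Notation nw2 := (new2 (pc p) (pd1 p) (pd2 p) g hamilton).

Lemma small_params : exists2 e : R, 0 < e & forall (a : E3) z, `|a| < e -> `|z| <= 4 ->
  cod (pd1 p) (nw1 a z) /\ cod (pd2 p) (nw2 a z).
Proof.
have [lc D1 D2] := wp; have [LIg Vg] := vg.
have [N1 N2] := Cinf_new lc D1 D2 LIg Cinf_hamilton.
have [oU _ _ _ _] := jet_smooth wp (LI_smooth LIg).
have oUP : open (snd @^-1` U : set (E3 * E2)).
  by apply: open_comp => // ? _; exact: snd_cont.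
pose W1 := (snd @^-1` U : set (E3 * E2)) `&` (fun q => nw1 q.1 q.2) @^-1` cod (pd1 p).
pose W2 := (snd @^-1` U : set (E3 * E2)) `&` (fun q => nw2 q.1 q.2) @^-1` cod (pd2 p).
have oW1 : open W1.
  by apply: (open_preim oUP (cod_open _)) => q Uq; exact: (Cinf_cont N1 Uq).
have oW2 : open W2.
  by apply: (open_preim oUP (cod_open _)) => q Uq; exact: (Cinf_cont N2 Uq).
have base z : `|z| <= 4 -> (W1 `&` W2) (0, z).
  move=> z4; have Uz := Vg z z4.
  have [e1 e2] : nw1 0 z = rep (pc p) (pd1 p) (g1 g) z /\ nw2 0 z = rep (pc p) (pd2 p) (g2 g) z.
    by apply: new_zero; exact: hamilton0.
  have [[_ r1] [_ r2] _] := Uz.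
  split; split=> //; rewrite /preimage /= ?e1 ?e2; exact: fwd_cod.
have := tube_open (@compact_ballnorm R 4) (openI oW1 oW2) base.
move=> /nbhs_ballnorm[r r0 H]; exists r => // a z ar z4.
have [] := H a _ z z4; first by rewrite subr0 ltW.
by move=> [_ ?] [_ ?].
Qed.

Local Notation def := (deform (pc p) (pd1 p) (pd2 p) g hamilton).

(** On the ball of radius 2, a neighbourhood of the unit ball, the cutoff is 1 and the Hamiltonian
    is a polynomial in (Q1, Q2); its [dd1] and [dd2] are the partial derivatives of that
    polynomial. *)
Lemma jet_deform (e : R) (a : E3) z w :
  (forall (a : E3) z, `|a| < e -> `|z| <= 4 -> cod (pd1 p) (nw1 a z) /\ cod (pd2 p) (nw2 a z)) ->
  `|a| < e -> `|z| <= 1 ->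
  jet p w (def a) z = jet p w g z + pword w (comb (coord3 a) (jet_exponents m)) (Q z).
Proof.
move=> he ae z1; have [lc D1 D2] := wp; have [LIg Vg] := vg.
have [oU h1 h2 hu hj] := jet_smooth wp (LI_smooth LIg).
have [_ hp1 _ _] := Cinf_coordsU lc D1 D2 LIg.
have KU : forall z : E2, `|z| <= 4 -> U z by [].
have h0 : forall a z, U z -> 4 < `|z| -> hamilton (a, z) = 0 by move=> ? ? _; exact: hamilton_out.
have dc := deform_coords lc D1 D2 LIg h0 he (O := [set a | `|a| < e]) ae.
pose A := U `&` [set y : E2 | `|y| < 2].
have oA : open A.
  by apply: openI => //; exact: open_normlt.
have Az : A z.
  split; first by apply: Vg; apply: le_trans z1 _; rewrite ler1n.
  by apply: le_lt_trans z1 _; rewrite ltr1n.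
have AU : A `<=` U by move=> y [].
have Dn y : U y -> Dl be0 be1 (pQ1 p g) (pQ2 p g) y != 0 by case.
have e1 y : A y -> pQ1 p (def a) y = pQ1 p g y by move=> /AU Uy; have [] := dc _ Uy.
have e2 y : A y -> pQ2 p (def a) y = pQ2 p g y by move=> /AU Uy; have [] := dc _ Uy.
pose ha y := hamilton (a, y).
have [_ hh] := Cinf_slice a (findim_rV R 3) (findim_rV R 2)
  (open_comp (fun x _ => @snd_cont _ _ _ x) oU) Cinf_hamilton.
have {}hh : Cinf U ha by exact: hh.
have e3 y : A y -> pP1 p (def a) y = pP1 p g y + dd1 be0 be1 (pQ1 p g) (pQ2 p g) ha y.
  by move=> /AU Uy; have [] := dc _ Uy.
have hH := Cinf_comb (fun k => coord3 a k / ((jet_exponents m k).1.+1%:R * (jet_exponents m k).2.+1%:R))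
  (fun k => ((jet_exponents m k).1.+1, (jet_exponents m k).2.+1)).
rewrite -/(prim_comb m (coord3 a)) in hH.
have haE y : A y -> ha y = prim_comb m (coord3 a) (Q y).
  by move=> [_ y2]; rewrite /ha /hamilton /= half_bump1 ?mul1r // ltW.
have E4 y : A y -> dd2 be0 be1 (pQ1 p (def a)) (pQ2 p (def a)) (pP1 p (def a)) y =
    dd2 be0 be1 (pQ1 p g) (pQ2 p g) (pP1 p g) y + comb (coord3 a) (jet_exponents m) (Q y).
  move=> Ay; have [_ _ ->] := dd_eqon3 oA Ay e1 e2 e3.
  rewrite (dd2D be0 be1 _ _ hp1 (Cinf_dd1 oU h1 h2 Dn hh) (AU _ Ay)).
  apply: f_equal2 => //; rewrite -prim_combE.
  have := dword_comp [:: true; false] oU h1 h2 Dn hH (AU _ Ay).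
  rewrite -(dword_eqon be0 be1 _ _ [:: true; false] oA haE Ay); exact.
rewrite /jet (dword_eqon3 w oA e1 e2 E4 Az).
have hV : Cinf U (fun y => comb (coord3 a) (jet_exponents m) (Q y)).
  exact: (Cinf_comp (findim_rV R 2) oU (fun _ _ => I) (Cinf_row2 oU h1 h2) (Cinf_comb _ _)).
rewrite (dwordD w oU h1 h2 Dn hu hV (AU _ Az)).
by rewrite (dword_comp w oU h1 h2 Dn (Cinf_comb _ _) (AU _ Az)).
Qed.

(** The bad parameters lie in the image of the unit ball under [psi] of the jets, a Lipschitz map,
    so [sard3] offers arbitrarily small good ones. Small parameters also keep validity and the
    previously achieved open property S. *)
Lemma generic_step S : stable w1 w2 S -> S g ->
  exists g', [/\ isotopic w1 w2 g g', S g', valid w1 w2 p g' & cond p m g'].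
Proof.
move=> sS Sg; have [lc D1 D2] := wp; have [LIg Vg] := vg.
have [e e0 he] := small_params.
pose O := [set a : E3 | `|a| < e].
have oO : open O by exact: open_normlt.
have O0 : O 0 by rewrite /O /= normr0.
have KU : forall z : E2, `|z| <= 4 -> U z by [].
have h0 : forall a z, U z -> 4 < `|z| -> hamilton (a, z) = 0 by move=> ? ? _; exact: hamilton_out.
have f1 := deform_family lc D1 D2 LIg oO Cinf_hamilton KU h0 he true.
have f2 := deform_family lc D1 D2 LIg oO Cinf_hamilton KU h0 he false.
have L a (Oa : O a) := deform_LI sw1 sw2 lc D1 D2 LIg (findim_rV R 3) oO Cinf_hamilton KU h0 he Oa.
have iso a : `|a| < e -> isotopic w1 w2 g (def a).
  move=> ae; apply: (isotopic_deform sw1 sw2 lc D1 D2 LIg (findim_rV R 3) oO Cinf_hamilton KU h0 he _ hamilton0).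
  move=> s /andP[s0 s1]; rewrite /O /= normrZ ger0_norm //.
  by apply: le_lt_trans ae; rewrite ler_piMl.
have def0 : def 0 = g by apply: deform_zero; exact: hamilton0.
have near0 : \forall a \near (0 : E3), valid w1 w2 p (def a) /\ S (def a).
  apply: filterI.
    by apply: (stable_valid wp oO O0 f1 f2 L); rewrite def0.
  by apply: (sS O _ 0 oO O0 f1 f2 L); rewrite def0.
have [r r0 Hr] := nbhs_ballnorm near0.
pose e' := Num.min e r; have e'0 : 0 < e' by rewrite lt_min e0.
have [oU h1 h2 hu hj] := jet_smooth wp (LI_smooth LIg).
pose ps (k : 'I_3) z := psi m k (fun i => jet p (jet_words m i) g z) (Q z).
have lips : exists Lc : 'I_3 -> R, forall (k : 'I_3) (z z' : E2), `|z| <= 1 -> `|z'| <= 1 ->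
    `|ps k z - ps k z'| <= Lc k * `|z - z'|.
  suff : forall k : 'I_3, exists Lk, forall z z' : E2, `|z| <= 1 -> `|z'| <= 1 ->
    `|ps k z - ps k z'| <= Lk * `|z - z'| by move=> /choice[Lc hLc]; exists Lc.
  move=> k; apply: (lip_ball oU).
    exact: (Cinf_psi m k oU (fun i => hj (jet_words m i)) h1 h2).
  by move=> z z1; apply: Vg; apply: le_trans z1 _; rewrite ler1n.
have [Lc hL] := lips.
pose Ls := \sum_k `|Lc k|.
have kL k : Lc k <= Ls.
  by apply: le_trans (ler_norm _) _; rewrite /Ls (bigD1 k) //= lerDl sumr_ge0.
have hLs (k : 'I_3) (z z' : E2) : `|z| <= 1 -> `|z'| <= 1 ->
    `|ps k z - ps k z'| <= Ls * `|z - z'|.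
  by move=> z1 z'1; apply: le_trans (hL k z z' z1 z'1) (ler_wpM2r (normr_ge0 _) (kL k)).
have [a [ae Ha]] := sard3 e'0 hLs.
pose A : E3 := \row_i a i.
have Ae' : `|A| < e' by apply: rV3_lt => // i; rewrite mxE.
have Ae : `|A| < e by apply: lt_le_trans Ae' _; rewrite ge_min lexx.
have [VA SA] : valid w1 w2 p (def A) /\ S (def A).
  by apply: Hr; rewrite subr0; apply: le_trans (ltW Ae') _; rewrite ge_min lexx orbT.
exists (def A); split=> //; first exact: iso.
move=> z z1; apply: contrapT => no.
have [k /eqP] := Ha z z1; apply.
have all0 i : (i < 3)%N -> jet p (jet_words m i) g z + pword (jet_words m i) (comb (coord3 A) (jet_exponents m)) (Q z) = 0.
  move=> i3; rewrite -(jet_deform (jet_words m i) he Ae z1).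
  by apply/eqP; apply: contrapT => ne; apply: no; exists i; apply/negP.
by rewrite /ps (psi_solve m3 (ltn_ord k) all0) /coord3 mxE inord_val.
Qed.

End one.

End Step.

(** * Covering by finitely many patches *)

Section Cover.
Variable R : realType.
Local Notation E2 := ('rV[R]_2).
Variables (F F1 F2 : surface R) (w1 : form2 F1) (w2 : form2 F2).
Hypotheses (sw1 : symplectic w1) (sw2 : symplectic w2).
Local Notation LI := (lagrangian_immersion w1 w2).
Implicit Types g : F -> prod_manifold F1 F2.

Lemma rescale_chart (c : chart E2 F) (u0 : E2) (s : R) : s != 0 -> local_coordinates c ->
  exists c' : chart E2 F, [/\ local_coordinates c', dom c' = dom c,
    forall v, cod c' v = cod c (u0 + s *: v), forall v, bwd c' v = bwd c (u0 + s *: v) &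
    forall x, fwd c' x = s^-1 *: (fwd c x - u0)].
Proof.
move=> s0 lc.
pose f (u : E2) : E2 := s^-1 *: (u - u0); pose k (v : E2) : E2 := u0 + s *: v.
have kf u : k (f u) = u by rewrite /k /f scalerA mulfV // scale1r addrC subrK.
have fk v : f (k v) = v by rewrite /k /f addrC addKr scalerA mulVf // scale1r.
have oT : open [set: E2] by exact: openT.
have cf : Cinf setT f.
  by apply: CinfZ => //; [exact: Cinf_cst|apply: CinfB => //; [exact: Cinf_id|exact: Cinf_cst]].
have ck : Cinf setT k.
  by apply: CinfD => //; [exact: Cinf_cst|apply: CinfZ => //; [exact: Cinf_cst|exact: Cinf_id]].
have oV : open (k @^-1` cod c).
  by apply: open_comp (cod_open c) => v _; exact: (Cinf_cont ck I).
have cod_sub : cod c `<=` cod c by [].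
have fU x : cod c x -> (k @^-1` cod c) (f x) /\ k (f x) = x by rewrite /preimage /= kf.
have kV y : (k @^-1` cod c) y -> cod c (k y) /\ f (k y) = y by rewrite fk.
exists (dchart (cod_open c) oV cod_sub fU kV (Cinf_sub (fun _ _ => I) cf) (Cinf_sub (fun _ _ => I) ck)).
split=> //; first exact: dchart_local.
by apply/seteqP; split=> x; [move=> []|move=> cx; split=> //; exact: fwd_cod].
Qed.

(** The independent coordinates of [indep_coords] are completed to Darboux charts of the factors;
    the chart of F is centered at x and scaled by r / 4, so that the ball of radius 4 becomes one on
    which these coordinates stay independent. *)
Lemma patch_at g x : LI g -> exists p, [/\ wfp w1 w2 p, valid w1 w2 p g, dom (pc p) x &
  `|fwd (pc p) x| < 1].
Proof.
move=> L; pose c := chart_at x; have lc : local_coordinates c by exact: chart_local.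
have cx : dom c x by exact: chart_at_dom.
have [i [j dij]] := indep_coords sw1 sw2 x L.
have [d1 [D1 x1 h1]] := darboux_exists sw1 (g1 g x) i.
have [d2 [D2 x2 h2]] := darboux_exists sw2 (g2 g x) j.
have sg := LI_smooth L.
have [op1 K1] := srep sg.1 lc D1.1; have [op2 K2] := srep sg.2 lc D2.1.
pose u0 := fwd c x.
have r1 : rdom c d1 (g1 g) u0 by split; [exact: fwd_cod|rewrite /u0 fwdK].
have r2 : rdom c d2 (g2 g) u0 by split; [exact: fwd_cod|rewrite /u0 fwdK].
have e1 z : rdom c d1 (g1 g) z -> cQ1 c d1 g z = rep c (chart_at (g1 g x)) (g1 g) z 0 i.
  by move=> [_ dz]; rewrite /cQ1 /rep; have [_ ->] := h1 _ dz.
have e2 z : rdom c d2 (g2 g) z -> cQ2 c d2 g z = rep c (chart_at (g2 g x)) (g2 g) z 0 j.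
  by move=> [_ dz]; rewrite /cQ2 /rep; have [_ ->] := h2 _ dz.
have U0 : vdom c d1 d2 g u0.
  split=> //; rewrite /cDl /Dl /br.
  rewrite (derive_eqon op1 be0 e1 r1) (derive_eqon op1 be1 e1 r1).
  rewrite (derive_eqon op2 be0 e2 r2) (derive_eqon op2 be1 e2 r2).
  by move: dij; rewrite /grad det2_row.
have [oU hr1 hr2] := vdomP lc D1.1 D2.1 sg.
have nU : nbhs u0 (vdom c d1 d2 g) by apply: open_nbhs_nbhs.
have [r r0 Hr] := nbhs_ballnorm nU.
pose s := r / 4; have s0 : 0 < s by rewrite divr_gt0.
have sn0 : s != 0 by rewrite gt_eqF.
have [c' [lc' domc' codc' bwdc' fwdc']] := rescale_chart u0 sn0 lc.
exists (Patch c' d1 d2); split=> //=.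
- split=> // z z4.
  have Us : vdom c d1 d2 g (u0 + s *: z).
    apply: Hr; rewrite [u0 + _]addrC addrK normrZ (gtr0_norm s0) /s.
    by rewrite mulrAC ler_pdivrMr // ler_pM2l.
  have [[q1 q1'] [q2 q2'] dl] := Us.
  split; [by split; rewrite ?codc' ?bwdc'|by split; rewrite ?codc' ?bwdc'|].
  have hc1 : Cinf (vdom c d1 d2 g) (cQ1 c d1 g) by apply: (Cinf_coordl 0 oU).
  have hc2 : Cinf (vdom c d1 d2 g) (cQ2 c d2 g) by apply: (Cinf_coordl 0 oU).
  pose k (v : E2) : E2 := u0 + s *: v.
  have ck : Cinf setT k.
    have oT : open [set: E2] by exact: openT.
    by apply: CinfD => //; [exact: Cinf_cst|apply: CinfZ => //; [exact: Cinf_cst|exact: Cinf_id]].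
  have Dk v : 'D_v k z = s *: v.
    by apply: derive_aff => t; rewrite /k scalerDr !scalerA [s * t]mulrC addrCA addrC -addrA.
  have chain (f : E2 -> R) v : differentiable f (k z) ->
      'D_v (fun y => f (k y)) z = s * 'D_v f (k z).
    move=> df; apply: (etrans (derive_comp v (Cinf_diff ck (I : setT z)) df)).
    by rewrite Dk deriveZv.
  have E1 : cQ1 c' d1 g = fun y => cQ1 c d1 g (k y).
    by apply/funext => y; rewrite /cQ1 /rep bwdc'.
  have E2' : cQ2 c' d2 g = fun y => cQ2 c d2 g (k y).
    by apply/funext => y; rewrite /cQ2 /rep bwdc'.
  have df1 := Cinf_diff hc1 Us; have df2 := Cinf_diff hc2 Us.
  rewrite /cDl /Dl /br E1 E2' (chain _ be0 df1) (chain _ be1 df1) (chain _ be0 df2) (chain _ be1 df2).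
  have dl' : cDl c d1 d2 g (k z) != 0 by exact: dl.
  move: dl'; rewrite /cDl /Dl /br; clear dl.
  move: ('D_be0 (cQ1 c d1 g) (k z)) ('D_be1 (cQ1 c d1 g) (k z)) ('D_be0 (cQ2 c d2 g) (k z)) ('D_be1 (cQ2 c d2 g) (k z)).
  move=> a b a' b' dl.
  have -> : s * a * (s * b') - s * b * (s * a') = s * s * (a * b' - b * a') by ring.
  by apply: mulf_neq0 => //; apply: mulf_neq0.
- by rewrite domc'.
- by rewrite fwdc' subrr scaler0 normr0.
Qed.

Lemma stable_all n (T : nat -> (F -> prod_manifold F1 F2) -> Prop) :
  (forall i, (i < n)%N -> stable w1 w2 (T i)) ->
  stable w1 w2 (fun g => forall i, (i < n)%N -> T i g).
Proof.
elim: n => [|n IH] h.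
  by move=> O G a0 *; exact: filterE.
have e : (fun g => forall i, (i < n.+1)%N -> T i g) =
    (fun g => (forall i, (i < n)%N -> T i g) /\ T n g).
  apply/funext => g; apply/propext; split=> [H|[H1 H2] i].
    by split=> [i ni|]; apply: H => //; exact: ltnW.
  by rewrite ltnS leq_eqVlt => /orP[/eqP -> //|]; exact: H1.
rewrite e; apply: stableI; last exact: h.
by apply: IH => i ni; apply: h; exact: ltnW.
Qed.

(** The number k codes condition k mod 3 on patch k / 3. The conditions are achieved one by one,
    those already achieved being the property S that [generic_step] preserves. *)
Lemma generic_list n (P : nat -> patch F F1 F2) g : LI g ->
  (forall i, (i < n)%N -> wfp w1 w2 (P i)) -> (forall i, (i < n)%N -> valid w1 w2 (P i) g) ->
  forall N, (N <= n * 3)%N -> exists g', [/\ isotopic w1 w2 g g',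
    forall i, (i < n)%N -> valid w1 w2 (P i) g' &
    forall k, (k < N)%N -> valid w1 w2 (P (k %/ 3)%N) g' /\ cond (P (k %/ 3)%N) (k %% 3) g'].
Proof.
move=> L wP vP; elim=> [|N IH] Nn; first by exists g; split=> //; exact: isotopic_refl.
have [g' [iso V C]] := IH (ltnW Nn).
have kn k : (k < n * 3)%N -> (k %/ 3 < n)%N by rewrite ltn_divLR.
pose S g := (forall i, (i < n)%N -> valid w1 w2 (P i) g) /\
  (forall k, (k < N)%N -> valid w1 w2 (P (k %/ 3)%N) g /\ cond (P (k %/ 3)%N) (k %% 3) g).
have sS : stable w1 w2 S.
  apply: stableI; apply: stable_all => i ni; first by apply: stable_valid; exact: wP.
  by apply: stable_cond; apply: wP; apply: kn; apply: ltn_trans ni Nn.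
have Nn' := kn _ Nn.
have [g'' [iso' [V' C'] VN CN]] := generic_step sw1 sw2 (wP _ Nn') (V _ Nn') (ltn_pmod N (isT : (0 < 3)%N)) sS (conj V C).
exists g''; split; [exact: isotopic_trans iso iso'|exact: V'|].
by move=> k; rewrite ltnS leq_eqVlt => /orP[/eqP ->|kN]; [split|exact: C'].
Qed.

Lemma finite_subcover (T : topologicalType) (B : T -> set T) : compact [set: T] ->
  (forall x, open (B x) /\ B x x) -> exists s : seq T, forall x, exists2 y, y \in s & B y x.
Proof.
move=> /compact_near_coveringP cT hB.
(* The filter of properties that hold for every list containing some fixed list; for it the
   near-covering form of compactness reads as the existence of a finite subcover. *)
pose Fs : set_system (seq T) := [set A : set (seq T) | exists s0 : seq T, forall s : seq T, {subset s0 <= s} -> A s].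
have filterFs : Filter Fs.
  split; first by exists [::].
  - move=> P Q [s hs] [s' hs']; exists (s ++ s') => t st; split.
      by apply: hs => y ys; apply: st; rewrite mem_cat ys.
    by apply: hs' => y ys; apply: st; rewrite mem_cat ys orbT.
  - by move=> P Q PQ [s hs]; exists s => t st; apply: PQ; exact: hs.
have [] := cT (seq T) Fs (fun (s : seq T) x => exists2 y, y \in s & B y x) filterFs.
  move=> x _; exists (B x, [set s : seq T | x \in s]).
    split=> /=; first by apply: open_nbhs_nbhs; split; case: (hB x).
    by exists [:: x] => s; apply; rewrite inE.
  by move=> [x' s] [/= Bx xs]; exists x.
by move=> s hs; exists s => x; exact: (hs s (fun _ h => h) x I).
Qed.

Definition generic_at g x := exists p, [/\ wfp w1 w2 p, dom (pc p) x, pdom p g (fwd (pc p) x) &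
   forall m, (m < 3)%N -> exists i, jet p (jet_words m i) g (fwd (pc p) x) != 0].

Theorem generic g : compact [set: F] -> LI g ->
  exists g', isotopic w1 w2 g g' /\ forall x, generic_at g' x.
Proof.
move=> cF L.
have [pt Hpt] := choice (fun x => patch_at x L).
pose B (x : F) : set F := dom (pc (pt x)) `&` fwd (pc (pt x)) @^-1` [set z | `|z| < 1].
have oB x : open (B x).
  by apply: open_preim; [exact: dom_open|exact: open_normlt|
    move=> y; exact: fwd_continuous].
have [D cov] : exists s : seq F, forall x, exists2 y, y \in s & B y x.
  by apply: finite_subcover cF _ => x; split=> //; have [_ _ dx fx] := Hpt x; split.
(* A default point is needed to index the cover, so the empty surface is treated apart. *)
case: (pselect (exists x0 : F, True)) => [[x0 _]|nF]; last first.
  by exists g; split=> [|x]; [exact: isotopic_refl|case: nF; exists x].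
pose n := size D; pose P i := pt (nth x0 D i).
have [g' [iso V C]] : exists g', [/\ isotopic w1 w2 g g',
    forall i, (i < n)%N -> valid w1 w2 (P i) g' &
    forall k, (k < n * 3)%N -> valid w1 w2 (P (k %/ 3)%N) g' /\ cond (P (k %/ 3)%N) (k %% 3) g'].
  apply: (generic_list L _ _ (leqnn _)) => i _; by have [? ? _ _] := Hpt (nth x0 D i).
exists g'; split=> // x; have [y Dy [dy fy]] := cov x.
pose i := index y D.
have ni : (i < n)%N by rewrite index_mem.
have Pi : P i = pt y by rewrite /P nth_index.
exists (pt y); have [wy _ _ _] := Hpt y; split=> //.
  have [_ Vi] := V i ni; rewrite -Pi; apply: Vi; rewrite Pi; apply: ltW; apply: lt_trans fy _.
  by rewrite ltr1n.
move=> m m3; have km : (i * 3 + m < n * 3)%N.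
  apply: (@leq_trans (i * 3 + 3)); first by rewrite ltn_add2l.
  by rewrite -mulSnr leq_mul2r ni orbT.
have [_] := C _ km; rewrite divnMDl // divn_small // addn0 modnMDl modn_small // Pi.
by apply; exact: ltW.
Qed.

End Cover.

(** * Cusp modification *)

Section Flat.
Variables (R : realType) (V : normedModType R) (fV : findim V).
Variables (l : {linear V -> R}) (e : V).
Hypotheses (cl : continuous l) (le1 : l e = 1).

Definition hadamard0 (f : V -> R) : V -> R := hadamard l e 0 f.

Let oT : open [set: V]. Proof. exact: openT. Qed.
Let AO (x : V) (s : R) : [set: V] x -> 0 <= s <= 1 -> [set: V] (gam l e 0 (x, s)).
Proof. by []. Qed.

Variable f : V -> R.
Hypothesis hf : Cinf setT f.

Lemma Cinf_hadamard0 : Cinf setT (hadamard0 f).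
Proof. exact: (Cinf_hadamard fV cl oT oT AO hf). Qed.

Lemma hadamard0E x : f x = f (x - l x *: e) + l x * hadamard0 f x.
Proof. by have := hadamardE fV cl oT AO hf (I : setT x); rewrite !subr0. Qed.

Let dl x : differentiable l x. Proof. exact: linear_differentiable. Qed.

Lemma derive_proj x : differentiable (fun x => f (x - l x *: e)) x /\
  'D_e (fun x => f (x - l x *: e)) x = 0.
Proof.
split.
  have hp : Cinf setT (fun x : V => x - l x *: e).
    apply: CinfB => //; first exact: Cinf_id.
    by apply: CinfZ => //; [exact: Cinf_lin|exact: Cinf_cst].
  exact: (Cinf_diff (Cinf_comp fV oT (fun _ _ => I) hp hf) (I : setT x)).
apply: derive_aff => t; rewrite scaler0 addr0.
have -> : l (t *: e + x) = t + l x.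
  by rewrite linearD linearZ; congr (_ + _); rewrite le1; exact: mulr1.
by congr f; rewrite scalerDl opprD addrACA subrr add0r.
Qed.

Lemma derive_hadamard0 x : 'D_e f x = hadamard0 f x + l x * 'D_e (hadamard0 f) x.
Proof.
have fE : f = fun x => f (x - l x *: e) + l x * hadamard0 f x by apply/funext => y; exact: hadamard0E.
have [dp ep] := derive_proj x.
have dh : differentiable (hadamard0 f) x by exact: (Cinf_diff Cinf_hadamard0 (I : setT x)).
have dm : differentiable (fun x => l x * hadamard0 f x) x.
  by have [] := differentiable_scale (dl x) dh.
rewrite {1}fE (deriveDf e dp dm) ep add0r (deriveMf e (dl x) dh).
by rewrite derive_linear // le1 mul1r.
Qed.

Lemma derive2_hadamard0 x : 'D_e ('D_e f) x = 2 * 'D_e (hadamard0 f) x + l x * 'D_e ('D_e (hadamard0 f)) x.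
Proof.
have fE : 'D_e f = fun x => hadamard0 f x + l x * 'D_e (hadamard0 f) x by apply/funext => y; exact: derive_hadamard0.
have dh : differentiable (hadamard0 f) x by exact: (Cinf_diff Cinf_hadamard0 (I : setT x)).
have dh' : differentiable ('D_e (hadamard0 f)) x by exact: (Cinf_diff (Cinf_derive e Cinf_hadamard0) (I : setT x)).
have dm : differentiable (fun x => l x * 'D_e (hadamard0 f) x) x.
  by have [] := differentiable_scale (dl x) dh'.
rewrite fE (deriveDf e dh dm) (deriveMf e (dl x) dh').
by rewrite derive_linear // le1 mul1r addrA -mulr2n mulr_natl.
Qed.

End Flat.

Section Flat2.
Variables (R : realType) (V : normedModType R) (fV : findim V).
Variables (l : {linear V -> R}) (e : V).
Hypotheses (cl : continuous l) (le1 : l e = 1).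
Local Notation hadamard0 := (hadamard0 l e).

Let l0 x : l (x - l x *: e) = 0.
Proof.
have -> : l (x - l x *: e) = l x - l x * l e by rewrite linearB linearZ.
by rewrite le1 mulr1 subrr.
Qed.

(** On the hyperplane the Hadamard quotient takes the value of the derivative, so iterating the
    quotient gives Taylor's formula in the direction e with a smooth last factor. *)
Lemma hadamard0_base f x : Cinf setT f -> l x = 0 ->
  'D_e f x = hadamard0 f x /\ 'D_e ('D_e f) x = 2 * 'D_e (hadamard0 f) x.
Proof.
move=> hf lx; rewrite (derive2_hadamard0 fV cl le1 hf) (derive_hadamard0 fV cl le1 hf) lx.
by rewrite !mul0r !addr0.
Qed.

Lemma hadamard0_2 f x : Cinf setT f -> 'D_e f (x - l x *: e) = 0 ->
  f x = f (x - l x *: e) + l x ^+ 2 * hadamard0 (hadamard0 f) x.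
Proof.
move=> hf h1; have h := Cinf_hadamard0 fV e cl hf.
rewrite {1}(hadamard0E fV e cl hf) {1}(hadamard0E fV e cl h).
by rewrite -(hadamard0_base hf (l0 x)).1 h1 add0r mulrA -expr2.
Qed.

Lemma hadamard0_2_base f x : Cinf setT f -> l x = 0 -> 'D_e ('D_e f) x = 2 * hadamard0 (hadamard0 f) x.
Proof.
move=> hf lx; have h := Cinf_hadamard0 fV e cl hf.
by rewrite (hadamard0_base hf lx).2 (hadamard0_base h lx).1.
Qed.

Lemma hadamard0_3 f : Cinf setT f -> (forall x, l x = 0 -> f x = 0) ->
  (forall x, l x = 0 -> 'D_e f x = 0) -> (forall x, l x = 0 -> 'D_e ('D_e f) x = 0) ->
  forall x, f x = l x ^+ 3 * hadamard0 (hadamard0 (hadamard0 f)) x.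
Proof.
move=> hf h0 h1 h2 x; have E := hadamard0_2 hf (h1 _ (l0 x)).
have h := Cinf_hadamard0 fV e cl (Cinf_hadamard0 fV e cl hf).
have b : hadamard0 (hadamard0 f) (x - l x *: e) = 0.
  have := hadamard0_2_base hf (l0 x); rewrite (h2 _ (l0 x)) => /esym/eqP.
  by rewrite mulf_eq0 pnatr_eq0 /= => /eqP.
have H := etrans (hadamard0E fV e cl h x) (etrans (congr1 (fun s => s + l x * hadamard0 (hadamard0 (hadamard0 f)) x) b) (add0r _)).
apply: (etrans E).
apply: (etrans (f_equal2 (fun s t => s + l x ^+ 2 * t) (h0 _ (l0 x)) H)) => /=.
by move: (hadamard0 (hadamard0 (hadamard0 f)) x) (l x) => t y; rewrite add0r mulrA -exprSr.
Qed.

End Flat2.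

Section Ext.
Variable R : realType.
Local Notation E2 := ('rV[R]_2).

(** A bump supported in the ball of radius r / 2 multiplies f. Germs are thus replaced by functions
    on the whole plane, which spares the domains in what follows. *)
Lemma Cinf_ext (U : set E2) (f : E2 -> R) (r : R) : open U -> 0 < r -> Cinf U f ->
  (forall z : E2, `|z| <= r -> U z) ->
  exists2 f' : E2 -> R, Cinf setT f' & forall z : E2, `|z| <= r / 4 -> f' z = f z.
Proof.
move=> oU r0 hf rU; pose k := 4 / r.
have k0 : 0 < k by rewrite divr_gt0.
pose b z := bump2 (k *: z).
have oT : open [set: E2] by exact: openT.
have hb : Cinf setT b.
  have hs : Cinf setT (fun z : E2 => k *: z) by apply: CinfZ => //; [exact: Cinf_cst|exact: Cinf_id].
  exact: (Cinf_comp (findim_rV R 2) oT (fun _ _ => I) hs (@Cinf_bump2 R)).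
have b0 z : r / 2 <= `|z| -> b z = 0.
  move=> rz; apply: bump2_0; rewrite normrZ (gtr0_norm k0) /k mulrAC ler_pdivlMr //.
  by move: rz; rewrite ler_pdivrMr // => rz; lra.
exists (fun z => b z * f z); last first.
  move=> z zr; rewrite /b bump2_1 ?mul1r // normrZ (gtr0_norm k0) /k mulrAC ler_pdivrMr //.
  by rewrite mul1r; move: zr; rewrite ler_pdivlMr //; lra.
apply: Cinf_local => z _; have [zr|zr] := ltP `|z| r.
  exists U; split=> //; first by apply: rU; exact: ltW.
  by apply: CinfM => //; exact: Cinf_sub hb.
exists [set z : E2 | r / 2 < `|z|]; split.
  by apply: lt_le_trans zr; rewrite ltr_pdivrMr //; lra.
have oB := @open_normgt R E2 (r / 2).
apply: (eq_Cinf oB _ (@Cinf_cst R E2 R _ 0)) => y ry.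
by rewrite b0 ?mul0r // ltW.
Qed.

End Ext.

Section Modify.
Variable R : realType.
Local Notation E2 := ('rV[R]_2).
Local Notation V := (R * E2)%type.

Let oT : open [set: E2]. Proof. exact: openT. Qed.
Let oTV : open [set: V]. Proof. exact: openT. Qed.
Let fV : findim V. Proof. exact: (findim_prod (findim_R R) (findim_rV R 2)). Qed.

Local Notation ev := ((1, 0) : V).

(** The dilation with weights (2, 1). Its factor e = [p.1] is a variable, so that Hadamard's lemma
    can divide by powers of e with a quotient that is smooth down to e = 0. *)
Definition squeeze (p : V) : E2 := row2 (p.1 ^+ 2 * p.2 0 0) (p.1 * p.2 0 1).

Lemma Cinf_eps : Cinf setT (fst : V -> R). Proof. exact: Cinf_fst. Qed.

Lemma Cinf_sco i : Cinf setT (fun p : V => p.2 0 i).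
Proof. exact: (Cinf_coordl i oTV (@Cinf_snd R R E2 setT)). Qed.

Lemma Cinf_squeeze : Cinf setT squeeze.
Proof.
apply: (Cinf_row2 oTV).
  exact: (CinfM oTV (CinfX 2 oTV Cinf_eps) (Cinf_sco 0)).
exact: (CinfM oTV Cinf_eps (Cinf_sco 1)).
Qed.

Lemma derive_squeeze (p : V) :
  'D_ev squeeze p = row2 (2 * p.1 * p.2 0 0) (p.2 0 1).
Proof.
have d1 : differentiable (fun p : V => p.1 ^+ 2) p.
  exact: (Cinf_diff (CinfX 2 oTV Cinf_eps) (I : setT p)).
have d0 : differentiable (fst : V -> R) p by exact: (Cinf_diff Cinf_eps (I : setT p)).
have dc i : differentiable (fun p : V => p.2 0 i) p by exact: (Cinf_diff (Cinf_sco i) (I : setT p)).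
have dp i : 'D_ev (fun p : V => p.2 0 i) p = 0.
  by apply: derive_aff => t; rewrite /= !mxE mulr0 add0r scaler0 addr0.
have df : 'D_ev (fst : V -> R) p = 1.
  by apply: derive_aff => t; rewrite /= addrC.
have m1 : differentiable (fun p : V => p.1 ^+ 2 * p.2 0 0) p.
  by have [] := differentiable_scale d1 (dc 0).
have m2 : differentiable (fun p : V => p.1 * p.2 0 1) p.
  by have [] := differentiable_scale d0 (dc 1).
have [_ ->] := derive_row2 ev m1 m2.
rewrite (deriveMf ev d1 (dc 0)) (deriveMf ev d0 (dc 1)) !dp df.
by rewrite (derive_pow 2 ev d0) df !mulr0 !addr0 mulr1 mul1r expr1.
Qed.

Lemma derive_squeezed (f : E2 -> R) (p : V) : Cinf setT f ->
  'D_ev (fun p => f (squeeze p)) p =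
  2 * p.1 * p.2 0 0 * 'D_be0 f (squeeze p) + p.2 0 1 * 'D_be1 f (squeeze p).
Proof.
move=> hf; have df := Cinf_diff hf (I : setT (squeeze p)).
have ds := Cinf_diff Cinf_squeeze (I : setT p).
apply: (etrans (derive_comp ev ds df)).
by rewrite derive_squeeze derive2E // /lin2 row20 row21.
Qed.

Lemma squeeze0 z : squeeze (0, z) = 0.
Proof. by rewrite /squeeze expr0n /= !mul0r; apply/rowP => i; rewrite !mxE; case: ifP. Qed.

Lemma Cinf_squeezed (f : E2 -> R) : Cinf setT f -> Cinf setT (fun p => f (squeeze p)).
Proof. exact: (Cinf_comp (findim_rV R 2) oTV (fun _ _ => I) Cinf_squeeze). Qed.

(* Vanishing to order 3 for the weights (2, 1), those of the cusp model. *)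
Lemma weight3 (w : E2 -> R) : Cinf setT w -> w 0 = 0 -> 'D_be0 w 0 = 0 ->
  'D_be1 w 0 = 0 -> 'D_be1 ('D_be1 w) 0 = 0 ->
  exists2 W : V -> R, Cinf setT W & forall p, w (squeeze p) = p.1 ^+ 3 * W p.
Proof.
move=> hw w0 w1 w2 w22.
pose om p := w (squeeze p); have hom : Cinf setT om by exact: Cinf_squeezed.
have cl : continuous (fst : V -> R) by move=> ?; exact: fst_cont.
have le1 : (fst : {linear V -> R}) ev = 1 by [].
pose hf3 := hadamard0 fst ev (hadamard0 fst ev (hadamard0 fst ev om)); exists hf3.
  exact: (Cinf_hadamard0 fV _ cl (Cinf_hadamard0 fV _ cl (Cinf_hadamard0 fV _ cl hom))).
have E1 p : 'D_ev om p =
  2 * p.1 * p.2 0 0 * 'D_be0 w (squeeze p) + p.2 0 1 * 'D_be1 w (squeeze p).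
  exact: derive_squeezed.
(* At e = 0 the function and its first two derivatives in e are w, z1 D1 w and 2 z0 D0 w + z1^2 D1
   D1 w, with w and its derivatives taken at the origin, where all of these vanish. *)
apply: (hadamard0_3 fV cl le1 hom) => -[e z] /= ->.
- by rewrite /om squeeze0.
- by rewrite E1 /= squeeze0 w1 w2 !mulr0 addr0.
have -> : 'D_ev om = fun p : V =>
  p.1 * (2 * (p.2 0 0 * 'D_be0 w (squeeze p))) + p.2 0 1 * 'D_be1 w (squeeze p).
  by apply/funext => p; rewrite E1; ring.
have h1 : Cinf setT (fun p : V => 2 * (p.2 0 0 * 'D_be0 w (squeeze p))).
  apply: (CinfM oTV); first exact: Cinf_cst.
  exact: (CinfM oTV (Cinf_sco 0) (Cinf_squeezed (Cinf_derive be0 hw))).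
have h2 : Cinf setT (fun p : V => 'D_be1 w (squeeze p)).
  exact: (Cinf_squeezed (Cinf_derive be1 hw)).
have d1 := Cinf_diff Cinf_eps (I : setT ((0, z) : V)).
have d2 := Cinf_diff h1 (I : setT ((0, z) : V)).
have d3 := Cinf_diff (Cinf_sco 1) (I : setT ((0, z) : V)).
have d4 := Cinf_diff h2 (I : setT ((0, z) : V)).
have m1 := (differentiable_scale d1 d2).1; have m2 := (differentiable_scale d3 d4).1.
rewrite (deriveDf ev m1 m2) (deriveMf ev d1 d2) (deriveMf ev d3 d4).
rewrite (derive_squeezed (0, z) (Cinf_derive be1 hw)) /= squeeze0 w1 w2 w22.
by rewrite !(mul0r, mulr0, addr0).
Qed.

End Modify.

Section Modify_cusp.
Variable R : realType.
Local Notation E2 := ('rV[R]_2).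
Local Notation V := (R * E2)%type.

Let oT : open [set: E2]. Proof. exact: openT. Qed.
Let oTV : open [set: V]. Proof. exact: openT. Qed.
Let fV : findim V. Proof. exact: (findim_prod (findim_R R) (findim_rV R 2)). Qed.

Local Notation e0 := ((0, be0) : V).
Local Notation e1 := ((0, be1) : V).

Definition pco (i : 'I_2) : {linear V -> R} := vcoord i \o snd.

Lemma pco_cont i : continuous (pco i).
Proof.
move=> p; apply: continuous_comp; first exact: snd_cont.
exact: vcoord_continuous.
Qed.

Lemma double_primitive (W : V -> R) : Cinf setT W ->
  exists2 P : V -> R, Cinf setT P & forall p, 'D_e1 ('D_e0 P) p = W p.
Proof.
move=> hW.
have AO i e (x : V) (s : R) : [set: V] x -> 0 <= s <= 1 -> [set: V] (gam (pco i) e 0 (x, s)) by [].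
have h1 := Cinf_prim fV (@pco_cont 1) oTV oTV (AO 1 e1) hW.
have l0 : pco 0 e0 = 1 by exact: be00.
have l1 : pco 1 e1 = 1 by exact: be11.
exists (prim (pco 0) e0 0 (prim (pco 1) e1 0 W)).
  exact: (Cinf_prim fV (@pco_cont 0) oTV oTV (AO 0 e0) h1).
move=> p.
have -> : 'D_e0 (prim (pco 0) e0 0 (prim (pco 1) e1 0 W)) = prim (pco 1) e1 0 W.
  by apply/funext => q; exact: (derive_prim1 fV (@pco_cont 0) l0 oTV oTV (AO 0 e0) h1 (I : setT q)).
exact: (derive_prim1 fV (@pco_cont 1) l1 oTV oTV (AO 1 e1) hW (I : setT p)).
Qed.

Lemma open_norm2 (r : R) : open [set p : V | r < `|p.2|].
Proof.
rewrite (_ : [set p : V | _] = (fun p : V => `|p.2|) @^-1` [set t | r < t]) //.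
apply: open_comp; last exact: open_gt.
by move=> p _; apply: continuous_comp; [exact: snd_cont|exact: norm_continuous].
Qed.

Definition osupp (G : V -> R) := forall p, 2 < `|p.2| -> G p = 0.

Lemma osupp_derive G v : osupp G -> osupp ('D_v G).
Proof.
move=> G0 p p2.
by rewrite (derive_eqon (@open_norm2 2) v (g := fun=> 0) G0 p2) derive_cst.
Qed.

(** The bound is uniform down to e = 0, so that e can be chosen after it. *)
Lemma osupp_bound G : Cinf setT G -> osupp G ->
  exists C, forall (e : R) z, 0 <= e <= 1 -> `|G (e, z)| <= C.
Proof.
move=> hG G0.
have cK : compact ([set e : R | 0 <= e <= 1] `*` [set z : E2 | `|z| <= 2]).
  by apply: compact_setX; [exact: compact01|exact: compact_ballnorm].
have [C hC] := cont_bound cK (fun p _ => Cinf_cont hG (I : setT p)).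
have C0 : 0 <= C.
  by apply: le_trans (hC (0, 0) _); rewrite ?normr_ge0 //; split=> /=; rewrite ?lexx ?ler01 ?normr0.
exists C => e z he; have [z2|z2] := leP `|z| 2; first by apply: hC; split.
by rewrite G0 // normr0.
Qed.

Section scaling.
Variables (e : R) (e_gt0 : 0 < e).

Definition zoom (q : E2) : V := (e, row2 (q 0 0 / e ^+ 2) (q 0 1 / e)).

Lemma squeeze_zoom q : squeeze (zoom q) = q.
Proof.
have e0' : e != 0 by rewrite gt_eqF.
rewrite /squeeze /zoom /= row20 row21 [RHS]row2_coord.
by congr row2; rewrite mulrC divfK // expf_neq0.
Qed.

Lemma Cinf_zoom : Cinf setT zoom.
Proof.
have hc (c : R) i : Cinf setT (fun q : E2 => q 0 i / c).
  by apply: (CinfM oT); [exact: Cinf_coord|exact: Cinf_cst].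
by apply: (Cinf_pair oT); [exact: Cinf_cst|exact: (Cinf_row2 oT)].
Qed.

Lemma pair_eq (x y : V) : x.1 = y.1 -> x.2 = y.2 -> x = y.
Proof. by case: x y => [a b] [c d] /= -> ->. Qed.

Lemma derive_zoom0 q : 'D_be0 zoom q = (e ^+ 2)^-1 *: e0.
Proof.
apply: derive_aff => t; apply: pair_eq => /=; first by rewrite !scaler0 addr0.
rewrite be0E; apply: row2P; rewrite ?row20 ?row21 !mxE /= ?row20 ?row21 -?row2E;
  by rewrite ?mulr1 ?mulr0 ?addr0 ?add0r // mulrDl addrC.
Qed.

Lemma derive_zoom1 q : 'D_be1 zoom q = e^-1 *: e1.
Proof.
apply: derive_aff => t; apply: pair_eq => /=; first by rewrite !scaler0 addr0.
rewrite be1E; apply: row2P; rewrite ?row20 ?row21 !mxE /= ?row20 ?row21 -?row2E;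
  by rewrite ?mulr1 ?mulr0 ?addr0 ?add0r // mulrDl addrC.
Qed.

(** A derivative costs e^-2 in the first direction and e^-1 in the second. This dictates the factor
    e^6 of the Hamiltonian in [cusp_modify]: its mixed derivative must carry e^3, the order of the
    remainder. *)
Lemma derive_zoomed (G : V -> R) a : Cinf setT G ->
  'D_be0 (fun q => a * G (zoom q)) = (fun q => a / e ^+ 2 * 'D_e0 G (zoom q)) /\
  'D_be1 (fun q => a * G (zoom q)) = (fun q => a / e * 'D_e1 G (zoom q)).
Proof.
move=> hG; have dz q := Cinf_diff Cinf_zoom (I : setT q).
have dG q := Cinf_diff hG (I : setT (zoom q)).
have dc q : differentiable (fun q => G (zoom q)) q.
  exact: (Cinf_diff (Cinf_comp fV oT (fun _ _ => I) Cinf_zoom hG) (I : setT q)).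
split; apply/funext => q; rewrite (deriveMcf a _ (dc q)) -mulrA; congr (a * _).
  apply: (etrans (derive_comp be0 (dz q) (dG q))); rewrite derive_zoom0.
  exact: deriveZv.
apply: (etrans (derive_comp be1 (dz q) (dG q))); rewrite derive_zoom1.
exact: deriveZv.
Qed.

Lemma Cinf_zoomed (G : V -> R) a : Cinf setT G -> Cinf setT (fun q => a * G (zoom q)).
Proof.
move=> hG; apply: (CinfM oT); first exact: Cinf_cst.
exact: (Cinf_comp fV oT (fun _ _ => I) Cinf_zoom hG).
Qed.

End scaling.

(* With [w] the remainder of [u], [w (e^2 z0, e z1) = e^3 W] and [D1 D0 P = W], take
   [h q = - e^6 (bump2 P) (q0 / e^2, q1 / e)]: then [h_112] and [h_1222] are O(e). *)
Lemma cusp_modify (u : E2 -> R) (eta rho : R) : Cinf setT u -> u 0 = 0 ->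
  'D_be1 u 0 = 0 -> 'D_be0 u 0 != 0 -> 'D_be1 ('D_be1 u) 0 != 0 -> 0 < eta -> 0 < rho ->
  exists (h : E2 -> R) (rho1 r : R), [/\ Cinf setT h, 0 < rho1 <= rho /\ 0 < r,
    forall z, rho1 <= `|z| -> h z = 0,
    forall z, `|'D_be0 h z| < eta /\ `|'D_be1 h z| < eta &
    let u' z := u z + 'D_be1 ('D_be0 h) z in
    (forall z, `|z| <= r -> u' z = 'D_be0 u 0 * z 0 0 + 'D_be1 ('D_be1 u) 0 / 2 * z 0 1 ^+ 2) /\
    forall z, `|z| <= rho1 -> 0 < 'D_be0 u 0 * 'D_be0 u' z /\
      0 < 'D_be1 ('D_be1 u) 0 * 'D_be1 ('D_be1 u') z].
Proof.
move=> hu u0 u2; set al := 'D_be0 u 0; set be := 'D_be1 ('D_be1 u) 0.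
move=> al0 be0' eta0 rho0.
(* The model polynomial al q0 + be q1^2 / 2; the third coefficient is the default 0 of [nth]. *)
pose ca := fun k => nth 0 [:: al; be / 2] k.
pose cb := fun k => nth (0, 0)%N [:: (1, 0); (0, 2)]%N k.
pose w z := u z - comb ca cb z.
have hcomb := Cinf_comb ca cb.
have hw : Cinf setT w by exact: (CinfB oT hu hcomb).
have Dw v z : 'D_v w z = 'D_v u z - 'D_v (comb ca cb) z.
  exact: (deriveBf v (Cinf_diff hu (I : setT z)) (Cinf_diff hcomb (I : setT z))).
have m0 i j : mono i j (0 : E2) = ((i == 0%N) && (j == 0%N))%:R.
  by rewrite /mono !mxE !expr0n; case: (i == 0%N); case: (j == 0%N); rewrite ?mulr1 ?mulr0.
have w0 : w 0 = 0 by rewrite /w u0 /comb !m0 /= !(mulr0, mul0r, mulr1, mul1r, addr0, add0r) ?subrr ?oppr0.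
have w1 : 'D_be0 w 0 = 0.
  rewrite Dw (congr1 (fun f : E2 -> R => f 0) (derive_comb0 ca cb)) /comb !m0 /= !(mulr0, mul0r, mulr1, mul1r, addr0, add0r); exact: subrr.
have w2 : 'D_be1 w 0 = 0.
  rewrite Dw (congr1 (fun f : E2 -> R => f 0) (derive_comb1 ca cb)) /comb !m0 /= !(mulr0, mul0r, mulr1, mul1r, addr0, add0r) u2; exact: subrr.
have w22 : 'D_be1 ('D_be1 w) 0 = 0.
  have hc1 := Cinf_derive be1 hcomb.
  rewrite (_ : 'D_be1 w = fun z => 'D_be1 u z - 'D_be1 (comb ca cb) z); last first.
    by apply/funext => z; exact: Dw.
  rewrite (deriveBf be1 (Cinf_diff (Cinf_derive be1 hu) (I : setT (0 : E2))) (Cinf_diff hc1 (I : setT (0 : E2)))).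
  have -> : 'D_be1 ('D_be1 (comb ca cb)) 0 = be.
    rewrite (derive_comb1 ca cb) (congr1 (fun f : E2 -> R => f 0) (derive_comb1 _ _)) /comb !m0 /=.
    by rewrite !(mulr0, mul0r, mulr1, mul1r, addr0, add0r) divfK // pnatr_eq0.
  exact: subrr.
have [W hW wW] := weight3 hw w0 w1 w2 w22.
have [P hP PW] := double_primitive hW.
pose G (p : V) := bump2 p.2 * P p.
have hG : Cinf setT G.
  apply: (CinfM oTV) => //.
  exact: (Cinf_comp (findim_rV R 2) oTV (fun _ _ => I) (@Cinf_snd R R E2 setT) (@Cinf_bump2 R)).
have G0 : osupp G by move=> p p2; rewrite /G bump2_0 ?mul0r // ltW.
have hG0 := Cinf_derive e0 hG; have hG1 := Cinf_derive e1 hG.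
have hG01 := Cinf_derive e1 hG0.
have hG010 := Cinf_derive e0 hG01; have hG011 := Cinf_derive e1 hG01.
have hG0111 := Cinf_derive e1 hG011.
have [C0 B0] := osupp_bound hG0 (osupp_derive e0 G0).
have [C1 B1] := osupp_bound hG1 (osupp_derive e1 G0).
have [C2 B2] := osupp_bound hG010 (osupp_derive e0 (osupp_derive e1 (osupp_derive e0 G0))).
have [C3 B3] := osupp_bound hG0111 (osupp_derive e1 (osupp_derive e1 (osupp_derive e1 (osupp_derive e0 G0)))).
(* Near 0 more than half of the value at 0 remains; a correction smaller than half of it cannot
   change the sign. *)
have near1 : \forall z \near (0 : E2), al ^+ 2 / 2 < al * 'D_be0 u z.
  have c : {for 0, continuous (fun z => al * 'D_be0 u z)}.
    apply: (Cinf_cont (U := setT)) => //; apply: (CinfM oT); first exact: Cinf_cst.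
    exact: Cinf_derive.
  apply: (cvgr_gt _ c); rewrite -/al -expr2 ltr_pdivrMr // ltr_pMr ?ltr1n //.
  by rewrite exprn_even_gt0.
have near2 : \forall z \near (0 : E2), be ^+ 2 / 2 < be * 'D_be1 ('D_be1 u) z.
  have c : {for 0, continuous (fun z => be * 'D_be1 ('D_be1 u) z)}.
    apply: (Cinf_cont (U := setT)) => //; apply: (CinfM oT); first exact: Cinf_cst.
    exact: (Cinf_derive be1 (Cinf_derive be1 hu)).
  apply: (cvgr_gt _ c); rewrite -/be -expr2 ltr_pdivrMr // ltr_pMr ?ltr1n //.
  by rewrite exprn_even_gt0.
have [rh rh0 near12] := nbhs_ballnorm (filterI near1 near2).
pose rho1 := Num.min rho rh.
have rho10 : 0 < rho1 by rewrite lt_min rho0.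
pose C := `|C0| + `|C1| + `|C2| + `|C3|.
have CC : [/\ 0 <= C, C0 <= C, C1 <= C & C2 <= C /\ C3 <= C].
  have := (ler_norm C0, ler_norm C1, ler_norm C2, ler_norm C3).
  have := (normr_ge0 C0, normr_ge0 C1, normr_ge0 C2, normr_ge0 C3).
  rewrite /C; move: `|C0| `|C1| `|C2| `|C3| => a b c d [[[a0 b0] c0] d0] [[[a1 b1] c1] d1].
  by split; [| | |split]; move: a0 b0 c0 d0 a1 b1 c1 d1; clear; lra.
have [Cge CC0 CC1 [CC2 CC3]] := CC.
pose mu := Num.min eta (Num.min (`|al| / 2) (`|be| / 2)).
have mu0 : 0 < mu by rewrite !lt_min eta0 !divr_gt0 ?normr_gt0.
(* e <= 1 bounds every positive power of e by e; 2 e <= rho1 confines the support, a box of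
   half-sides 2 e^2 and 2 e, to the ball of radius rho1; the last term gives e C < mu. *)
pose e := Num.min (Num.min 1 (rho1 / 2)) (mu / (C + 1)).
have C10 : 0 < C + 1 by rewrite ltr_wpDl.
have egt : 0 < e by rewrite !lt_min ltr01 !divr_gt0.
have e1' : e <= 1 by rewrite !ge_min lexx.
have erho : 2 * e <= rho1.
  have : e <= rho1 / 2 by rewrite !ge_min lexx orbT.
  by rewrite ler_pdivlMr // mulrC.
have emu : e * C < mu.
  have : e <= mu / (C + 1) by rewrite !ge_min lexx orbT.
  rewrite ler_pdivlMr // mulrDr mulr1; apply: lt_le_trans; by rewrite ltrDl.
have en0 : e != 0 by rewrite gt_eqF.
have e01 : 0 <= e <= 1 by rewrite ltW.
have small k (Ck X : R) : (0 < k)%N -> Ck <= C -> `|X| <= Ck -> `|- e ^+ k * X| < mu.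
  move=> k0 kC XC; rewrite normrM normrN normrX (gtr0_norm egt).
  apply: le_lt_trans emu; apply: ler_pM => //; first by rewrite exprn_ge0 // ltW.
    by rewrite -[leRHS]expr1; apply: ler_wiXn2l => //; exact: ltW.
  exact: le_trans XC kC.
pose h (q : E2) := - e ^+ 6 * G (zoom e q).
have [hD0 hD1] := derive_zoomed e (- e ^+ 6) hG.
have hD0' : 'D_be0 h = fun q => - e ^+ 4 * 'D_e0 G (zoom e q).
  by rewrite /h hD0; apply/funext => q; congr (_ * _); field.
have hD1' : 'D_be1 h = fun q => - e ^+ 5 * 'D_e1 G (zoom e q).
  by rewrite /h hD1; apply/funext => q; congr (_ * _); field.
have hD01 : 'D_be1 ('D_be0 h) = fun q => - e ^+ 3 * 'D_e1 ('D_e0 G) (zoom e q).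
  apply: (etrans (congr1 (fun f : E2 -> R => 'D_be1 f) hD0')).
  apply: (etrans (derive_zoomed e (- e ^+ 4) hG0).2).
  by apply/funext => q; congr (_ * _); field.
have hD010 : 'D_be0 ('D_be1 ('D_be0 h)) = fun q => - e ^+ 1 * 'D_e0 ('D_e1 ('D_e0 G)) (zoom e q).
  apply: (etrans (congr1 (fun f : E2 -> R => 'D_be0 f) hD01)).
  apply: (etrans (derive_zoomed e (- e ^+ 3) hG01).1).
  by apply/funext => q; congr (_ * _); field.
have hD011 : 'D_be1 ('D_be1 ('D_be0 h)) = fun q => - e ^+ 2 * 'D_e1 ('D_e1 ('D_e0 G)) (zoom e q).
  apply: (etrans (congr1 (fun f : E2 -> R => 'D_be1 f) hD01)).
  apply: (etrans (derive_zoomed e (- e ^+ 3) hG01).2).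
  by apply/funext => q; congr (_ * _); field.
have hD0111 : 'D_be1 ('D_be1 ('D_be1 ('D_be0 h))) =
    fun q => - e ^+ 1 * 'D_e1 ('D_e1 ('D_e1 ('D_e0 G))) (zoom e q).
  apply: (etrans (congr1 (fun f : E2 -> R => 'D_be1 f) hD011)).
  apply: (etrans (derive_zoomed e (- e ^+ 2) hG011).2).
  by apply/funext => q; congr (_ * _); field.
have hh : Cinf setT h by exact: (Cinf_zoomed e (- e ^+ 6) hG).
have hh01 := Cinf_derive be1 (Cinf_derive be0 hh).
have sgn (c x y : R) : c != 0 -> c ^+ 2 / 2 < c * x -> `|y| < `|c| / 2 -> 0 < c * (x + y).
  move=> c0 cx cy; have cp : 0 < `|c| by rewrite normr_gt0.
  have k : `|c * y| < c ^+ 2 / 2.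
    by rewrite normrM -[X in _ < X / 2]real_normK ?num_real // expr2 -mulrA ltr_pM2l.
  by move: k; rewrite mulrDr ltr_norml => /andP[k _]; move: k cx; clear; lra.
(* A point of norm at most e^2 / 2 is zoomed into the open unit ball, where the bump is 1 and the
   correction cancels the remainder exactly. *)
exists h, rho1, (e ^+ 2 / 2); split.
- exact: hh.
- by rewrite rho10 ge_min lexx /= divr_gt0 // exprn_gt0.
- move=> z zr; rewrite /h /G bump2_0 ?mul0r ?mulr0 // /zoom /=.
  rewrite leNgt norm2_lt row20 row21 negb_and -!leNgt !normrM !normfV normrX (gtr0_norm egt).
  have /orP[{}zr|{}zr] : (rho1 <= `|z 0 0|) || (rho1 <= `|z 0 1|).
    by move: zr; rewrite leNgt norm2_lt negb_and -!leNgt.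
    apply/orP; left; rewrite ler_pdivlMr ?exprn_gt0 //.
    apply: le_trans zr; apply: le_trans erho; rewrite ler_pM2l //.
    by rewrite -[leRHS]expr1; apply: ler_wiXn2l => //; exact: ltW.
  by apply/orP; right; rewrite ler_pdivlMr //; exact: le_trans erho zr.
- have me : mu <= eta by rewrite ge_min lexx.
  move=> z; rewrite (congr1 (fun f : E2 -> R => f z) hD0') (congr1 (fun f : E2 -> R => f z) hD1'); split; apply: lt_le_trans me.
    exact: (small 4%N C0 _ isT CC0 (B0 _ _ e01)).
  exact: (small 5%N C1 _ isT CC1 (B1 _ _ e01)).
- split=> z zr.
    have z1 : `|(zoom e z).2| < 1.
      rewrite /zoom /= norm2_lt row20 row21 !normrM !normfV normrX (gtr0_norm egt).
      have := zr; rewrite norm2_le => /andP[q0 q1].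
      have e20 : 0 < e ^+ 2 by rewrite exprn_gt0.
      have hlf : e ^+ 2 / 2 < e ^+ 2 by rewrite ltr_pdivrMr // ltr_pMr // ltr1n.
      apply/andP; split; rewrite ltr_pdivrMr // mul1r; first exact: le_lt_trans q0 hlf.
      apply: le_lt_trans q1 _; apply: lt_le_trans hlf _.
      by rewrite -[leRHS]expr1; apply: ler_wiXn2l => //; exact: ltW.
    pose B := [set p : V | `|p.2| < 1].
    have oB : open B.
      rewrite (_ : B = (fun p : V => `|p.2|) @^-1` [set t | t < 1]) //.
      apply: open_comp; last exact: open_lt.
      by move=> p _; apply: continuous_comp; [exact: snd_cont|exact: norm_continuous].
    have GP p : B p -> G p = P p by move=> Bp; rewrite /G bump2_1 ?mul1r // ltW.
    have GP0 p : B p -> 'D_e0 G p = 'D_e0 P p by exact: (derive_eqon oB e0 GP).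
    have E : 'D_e1 ('D_e0 G) (zoom e z) = W (zoom e z).
      by rewrite (derive_eqon oB e1 GP0 z1) PW.
    have wz : w z = e ^+ 3 * W (zoom e z) by rewrite -{1}(squeeze_zoom egt z) wW.
    rewrite (congr1 (fun f : E2 -> R => f z) hD01) E mulNr -wz /w opprB addrC subrK /comb /ca /cb /mono /=.
    by rewrite expr1 !expr0 !(mulr1, mul1r, mul0r, addr0).
  have zr' : `|z - 0| <= rh by rewrite subr0 (le_trans zr) // ge_min lexx orbT.
  have [n1 n2] := near12 _ zr'.
  have ma : mu <= `|al| / 2 by rewrite !ge_min lexx !orbT.
  have mb : mu <= `|be| / 2 by rewrite !ge_min lexx !orbT.
  have Du v y : 'D_v (fun z => u z + 'D_be1 ('D_be0 h) z) y =
     'D_v u y + 'D_v ('D_be1 ('D_be0 h)) y.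
    exact: (deriveDf v (Cinf_diff hu (I : setT y)) (Cinf_diff hh01 (I : setT y))).
  split.
    rewrite Du (congr1 (fun f : E2 -> R => f z) hD010); apply: (sgn _ _ _ al0 n1); apply: lt_le_trans ma.
    exact: (small 1%N C2 _ isT CC2 (B2 _ _ e01)).
  rewrite (_ : 'D_be1 (fun z => u z + 'D_be1 ('D_be0 h) z) =
    fun y => 'D_be1 u y + 'D_be1 ('D_be1 ('D_be0 h)) y); last first.
    by apply/funext => y; exact: Du.
  have hu1 := Cinf_derive be1 hu; have hh1 := Cinf_derive be1 hh01.
  rewrite (deriveDf be1 (Cinf_diff hu1 (I : setT z)) (Cinf_diff hh1 (I : setT z))).
  rewrite (congr1 (fun f : E2 -> R => f z) hD0111); apply: (sgn _ _ _ be0' n2); apply: lt_le_trans mb.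
  exact: (small 1%N C3 _ isT CC3 (B3 _ _ e01)).
Qed.

End Modify_cusp.

(** * Adapted coordinates and normal forms *)

Section Shift.
Variable R : realType.
Local Notation E2 := ('rV[R]_2).

Lemma derive_shift (W : normedModType R) (f : E2 -> W) (k : E2 -> E2) u v a :
  (forall y, k y = u + y) -> 'D_v (fun y => f (k y)) a = 'D_v f (k a).
Proof.
move=> kE; rewrite /derive; set g1 := fun h => h^-1 *: _; set g2 := fun h => h^-1 *: _.
suff -> : g1 = g2 by [].
by apply/funext => h; rewrite /g1 /g2 /= !kE [u + (_ + _)]addrCA.
Qed.

Lemma translate_chart (M : surface R) (c : chart E2 M) (u0 : E2) : local_coordinates c ->
  exists c' : chart E2 M, [/\ local_coordinates c', dom c' = dom c,
    forall v, cod c' v = cod c (u0 + v), forall v, bwd c' v = bwd c (u0 + v) &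
    forall x, fwd c' x = fwd c x - u0].
Proof.
move=> lc; have [c' [? ? h1 h2 h3]] := rescale_chart u0 (oner_neq0 R) lc.
exists c'; split=> // y; [rewrite h1|rewrite h2|rewrite h3 invr1]; by rewrite scale1r.
Qed.

Lemma translate_darboux (M : surface R) (w : form2 M) (c : chart E2 M) (u0 : E2) : darboux w c ->
  exists c' : chart E2 M, [/\ darboux w c', dom c' = dom c & forall x, fwd c' x = fwd c x - u0].
Proof.
move=> [lc dc]; have [c' [lc' dE cE bE fE]] := translate_chart u0 lc.
exists c'; split=> //; split=> // u cu v v'.
have bu : dom c' (bwd c' u) by exact: bwd_dom.
have bu' : dom c (bwd c' u) by rewrite -dE.
have T e y : tD c' e (bwd c' u) y = tD c e (bwd c' u) y.
  have fk : u0 + fwd c' (bwd c' u) = fwd c (bwd c' u) by rewrite fE addrC subrK.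
  have E : fwd e \o bwd c' = fun z => (fwd e \o bwd c) (u0 + z).
    by apply/funext => z; rewrite /= bE.
  rewrite /tD E -fk.
  exact: (@derive_shift _ (fwd e \o bwd c) (fun y => u0 + y) u0 y _ (fun=> erefl)).
rewrite -{1}(bwdK cu) (form2_in_chartE _ _ _ lc' bu) !T -(form2_in_chartE _ _ _ lc bu').
by apply: dc; exact: fwd_cod.
Qed.

End Shift.

Section Adapted.
Variable R : realType.
Local Notation E2 := ('rV[R]_2).
Variables (F F1 F2 : surface R) (w1 : form2 F1) (w2 : form2 F2).
Hypotheses (sw1 : symplectic w1) (sw2 : symplectic w2).
Local Notation LI := (lagrangian_immersion w1 w2).
Implicit Types (g : F -> prod_manifold F1 F2) (e : chart E2 F).

(* In these charts [g] reads [((q1, A), (q2, B))], and it is Lagrangian iff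
   [A_2 = - B_1]. *)
Definition adapted g e (d1 : chart E2 F1) (d2 : chart E2 F2) := [/\ local_coordinates e, darboux w1 d1, darboux w2 d2 &
  forall z, cod e z -> [/\ dom d1 (g1 g (bwd e z)), dom d2 (g2 g (bwd e z)),
    cQ1 e d1 g z = z 0 0 & cQ2 e d2 g z = z 0 1]].

Definition centered g e (d1 : chart E2 F1) (d2 : chart E2 F2) x := [/\ dom e x, fwd e x = 0, fwd d1 (g1 g x) = 0 & fwd d2 (g2 g x) = 0].

Section calculus.
Variables (g : F -> prod_manifold F1 F2) (e : chart E2 F) (d1 : chart E2 F1) (d2 : chart E2 F2).
Hypotheses (LIg : LI g) (ad : adapted g e d1 d2).

Let sg := LI_smooth LIg.

Lemma adapted_smooth : [/\ Cinf (cod e) (rep e d1 (g1 g)), Cinf (cod e) (rep e d2 (g2 g)),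
  Cinf (cod e) (cP1 e d1 g) & Cinf (cod e) (cP2 e d2 g)].
Proof.
have [le [l1 _] [l2 _] h] := ad; have oe := cod_open e.
have [_ h1] := srep sg.1 le l1; have [_ h2] := srep sg.2 le l2.
have k1 : Cinf (cod e) (rep e d1 (g1 g)) by apply: Cinf_sub h1 => z cz; have [] := h z cz.
have k2 : Cinf (cod e) (rep e d2 (g2 g)) by apply: Cinf_sub h2 => z cz; have [] := h z cz.
by split=> //; [apply: (Cinf_coordl 1 oe)|apply: (Cinf_coordl 1 oe)].
Qed.

Lemma adapted_Q z v : cod e z ->
  'D_v (cQ1 e d1 g) z = v 0 0 /\ 'D_v (cQ2 e d2 g) z = v 0 1.
Proof.
move=> cz; have [_ _ _ h] := ad; have oe := cod_open e.
have e1 y : cod e y -> cQ1 e d1 g y = y 0 0 by move=> /h[].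
have e2 y : cod e y -> cQ2 e d2 g y = y 0 1 by move=> /h[].
by rewrite (derive_eqon oe v e1 cz) (derive_eqon oe v e2 cz) !derive_coord_be.
Qed.

Lemma adapted_Dl z : cod e z -> cDl e d1 d2 g z = 1.
Proof.
move=> cz; rewrite /cDl /Dl /br.
have [a b] := adapted_Q be0 cz; have [a' b'] := adapted_Q be1 cz.
by rewrite a b a' b' be00 be01 be10 be11 !mulr1 mulr0 subr0.
Qed.

Lemma adapted_vdom z : cod e z -> vdom e d1 d2 g z.
Proof.
move=> cz; have [_ _ _ h] := ad; have [x1 x2 _ _] := h z cz.
by split=> //; rewrite adapted_Dl ?oner_neq0.
Qed.

Lemma adapted_dd f z : cod e z ->
  dd1 be0 be1 (cQ1 e d1 g) (cQ2 e d2 g) f z = 'D_be0 f z /\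
  dd2 be0 be1 (cQ1 e d1 g) (cQ2 e d2 g) f z = 'D_be1 f z.
Proof.
move=> cz; have [a b] := adapted_Q be0 cz; have [a' b'] := adapted_Q be1 cz.
have := adapted_Dl cz; rewrite /cDl /dd1 /dd2 => ->.
by rewrite /br a b a' b' be00 be01 be10 be11 !divr1 mulr1 !mulr0 mul1r mul0r !subr0.
Qed.

Lemma adapted_lagr z : cod e z -> 'D_be1 (cP1 e d1 g) z = - 'D_be0 (cP2 e d2 g) z.
Proof.
move=> cz; have [le D1 D2 h] := ad; have [x1 x2 _ _] := h z cz.
have := LI_in LIg le D1 D2 (bwd_dom cz) x1 x2; rewrite bwdK //.
move/(lagr_inP le D1.1 D2.1 sg (adapted_vdom cz)).
by rewrite (adapted_dd _ cz).2 (adapted_dd _ cz).1.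
Qed.

Lemma adapted_critical x : dom e x ->
  (critical_point (g1 g) x <-> 'D_be1 (cP1 e d1 g) (fwd e x) = 0) /\
  (critical_point (g2 g) x <-> 'D_be1 (cP1 e d1 g) (fwd e x) = 0).
Proof.
move=> ex; have [le [l1 _] [l2 _] h] := ad; have cz := fwd_cod ex.
have [x1 x2 _ _] := h _ cz; rewrite fwdK // in x1 x2.
have [r1 r2 _ _] := adapted_smooth.
have [a b] := adapted_Q be0 cz; have [a' b'] := adapted_Q be1 cz.
have C1 := critical_jac sg.1 le l1 ex x1; have C2 := critical_jac sg.2 le l2 ex x2.
rewrite (jac_br1 (Cinf_diff r1 cz)) /br a a' be00 be10 mul1r mul0r subr0 in C1.
rewrite (jac_br2 (Cinf_diff r2 cz)) /br b b' be01 be11 mul0r mul1r sub0r in C2.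
by split; [exact: C1|rewrite adapted_lagr].
Qed.

End calculus.

(** (Q1, Q2) has nonzero Jacobian and is itself taken as the chart of F; then [dd1] and [dd2] become
    the partial derivatives, and the jets become derivatives of u. *)
Lemma adapted_of_generic g x : LI g -> generic_at w1 w2 g x ->
  exists e d1 d2, [/\ adapted g e d1 d2, dom e x &
   forall m, (m < 3)%N -> exists i, pword (jet_words m i) ('D_be1 (cP1 e d1 g)) (fwd e x) != 0].
Proof.
move=> L [[c d1 d2] [[/= lc D1 D2] cx Vx C]].
have sg := LI_smooth L.
have wp : wfp w1 w2 (Patch c d1 d2) by split.
have [oU h1 h2 _ _] := jet_smooth wp sg.
set U := pdom _ g in oU h1 h2 Vx.
have hP : Cinf U (fun z => row2 (cQ1 c d1 g z) (cQ2 c d2 g z)) by exact: (Cinf_row2 oU h1 h2).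
have D0 y : U y -> Dl be0 be1 (cQ1 c d1 g) (cQ2 c d2 g) y != 0 by move=> [].
have j0 : jac (fun z => row2 (cQ1 c d1 g z) (cQ2 c d2 g z)) (fwd c x) != 0.
  have df1 := Cinf_diff h1 Vx; have df2 := Cinf_diff h2 Vx.
  rewrite /jac (derive_row2 be0 df1 df2).2 (derive_row2 be1 df1 df2).2 det2_row.
  have alg (a b a' b' : R) : a * b' - b * a' != 0 -> a * b' - a' * b != 0.
    by rewrite [b * _]mulrC.
  exact: alg _ _ _ _ (D0 _ Vx).
have Uc : U `<=` cod c by move=> z; exact: vdom_cod.
have [e [le ex he]] := chart_ift lc cx oU Uc Vx hP j0.
have ad : adapted g e d1 d2.
  split=> // z cz; have [cy Uy fy] := he _ (bwd_dom cz).
  have [[_ x1] [_ x2] _] := Uy; rewrite bwdK // in fy; rewrite !fwdK // in x1 x2.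
  split=> //.
    by rewrite [in RHS]fy row20 /cQ1 /rep (fwdK cy).
  by rewrite [in RHS]fy row21 /cQ2 /rep (fwdK cy).
exists e, d1, d2; split=> // m m3; have [i ne] := C m m3; exists i.
pose A := U `&` bwd c @^-1` dom e.
have oA : open A.
  by apply: open_preim; [exact: oU|exact: dom_open|move=> z Uz; apply: bwd_continuous; exact: Uc].
have Ax : A (fwd c x) by split=> //; rewrite /preimage /= fwdK.
have AU : A `<=` U by move=> z [].
have [_ _ hp1 _] := adapted_smooth L ad.
have key z : A z -> cP1 c d1 g z = cP1 e d1 g (row2 (cQ1 c d1 g z) (cQ2 c d2 g z)) /\
    cod e (row2 (cQ1 c d1 g z) (cQ2 c d2 g z)).
  move=> [Uz ez]; have [cy Uy fy] := he _ ez; rewrite bwdK in fy; last exact: Uc.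
  by rewrite -fy; split; [rewrite /cP1 /rep fwdK|exact: fwd_cod].
have r1 := Cinf_sub AU h1; have r2 := Cinf_sub AU h2.
have DA y (Ay : A y) := D0 y (AU _ Ay).
have oe := cod_open e.
have step (k : E2 -> R) (H : E2 -> R) : Cinf (cod e) H ->
   (forall z, A z -> k z = H (row2 (cQ1 c d1 g z) (cQ2 c d2 g z))) ->
   forall z, A z -> dd1 be0 be1 (cQ1 c d1 g) (cQ2 c d2 g) k z = 'D_be0 H (row2 (cQ1 c d1 g z) (cQ2 c d2 g z)) /\
     dd2 be0 be1 (cQ1 c d1 g) (cQ2 c d2 g) k z = 'D_be1 H (row2 (cQ1 c d1 g z) (cQ2 c d2 g z)).
  move=> hH kH z Az; have [<- <-] := dd_comp r1 r2 DA oe hH Az (key z Az).2.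
  by split; [exact: (dd1_eqon be0 be1 _ _ oA kH Az)|exact: (dd2_eqon be0 be1 _ _ oA kH Az)].
have hu := Cinf_derive be1 hp1.
have ju z : A z -> jet (Patch c d1 d2) [::] g z = 'D_be1 (cP1 e d1 g) (row2 (cQ1 c d1 g z) (cQ2 c d2 g z)).
  by move=> Az; have [] := step _ _ hp1 (fun z Az => (key z Az).1) z Az.
have jw w : Cinf (cod e) (pword w ('D_be1 (cP1 e d1 g))) /\ forall z, A z ->
    jet (Patch c d1 d2) w g z = pword w ('D_be1 (cP1 e d1 g)) (row2 (cQ1 c d1 g z) (cQ2 c d2 g z)).
  elim: w => [|b w [IH1 IH2]]; first by split.
  case: b; split=> [|z Az]; first exact: Cinf_derive.
  - by have [] := step _ _ IH1 IH2 z Az.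
  - exact: Cinf_derive.
  - by have [] := step _ _ IH1 IH2 z Az.
have [_ _ fx] := he x ex; rewrite fx -(jw _).2 //.
Qed.

Lemma recenter g e d1 d2 x : adapted g e d1 d2 -> dom e x ->
  exists e' d1' d2', [/\ adapted g e' d1' d2', centered g e' d1' d2' x, dom e' = dom e,
    forall y, fwd e' y = fwd e y - fwd e x &
    forall z, cod e' z = cod e (fwd e x + z) /\
      cP1 e' d1' g z = cP1 e d1 g (fwd e x + z) - cP1 e d1 g (fwd e x)].
Proof.
move=> [le D1 D2 h] ex; have [e' [le' dE cE bE fE]] := translate_chart (fwd e x) le.
have [d1' [D1' dE1 fE1]] := translate_darboux (fwd d1 (g1 g x)) D1.
have [d2' [D2' dE2 fE2]] := translate_darboux (fwd d2 (g2 g x)) D2.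
have [x1 x2 q1 q2] := h _ (fwd_cod ex); rewrite fwdK // in x1 x2.
exists e', d1', d2'; split=> //.
- split=> // z; rewrite cE => cz; have [y1 y2 r1 r2] := h _ cz.
  rewrite bE dE1 dE2; split=> //.
    move: r1 q1; rewrite /cQ1 /rep bE fE1 fwdK // !mxE => -> ->.
    by rewrite addrC addKr.
  move: r2 q2; rewrite /cQ2 /rep bE fE2 fwdK // !mxE => -> ->.
  by rewrite addrC addKr.
- by split; rewrite ?dE // ?fE ?fE1 ?fE2 subrr.
- by move=> z; rewrite cE /cP1 /rep bE fE1 fwdK // !mxE.
Qed.

End Adapted.

Section Plane.
Variable R : realType.
Local Notation E2 := ('rV[R]_2).

Let oT : open [set: E2]. Proof. exact: openT. Qed.

Lemma Cinf_sqrt : Cinf [set t : R | 0 < t] Num.sqrt.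
Proof.
have oP : open [set t : R | 0 < t] by exact: open_gt.
have ds (x : R) : 0 < x -> differentiable Num.sqrt x.
  by move=> x0; apply/derivable1_diffP; have [] := is_derive1_sqrt x0.
have Ds (x v : R) : 0 < x -> 'D_v Num.sqrt x = v *: (2 *: Num.sqrt x)^-1.
  move=> x0; rewrite (_ : v = v *: 1); last by rewrite /GRing.scale /= mulr1.
  by rewrite (deriveZv _ _ (ds x x0)) derive_sqrt // /GRing.scale /= mulr1.
elim=> [|k IH] /=; first by move=> x /ds /differentiable_continuous.
split=> [x /ds //|v].
apply: (eq_Ck oP (f := fun x => v *: (2 *: Num.sqrt x)^-1)).
  by move=> x x0; rewrite Ds.
apply: (CkZ oP); first exact: Ck_cst.
apply: (CkV oP) => [x x0|]; last by apply: (CkZ oP) => //; exact: Ck_cst.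
by rewrite /GRing.scale /= mulf_neq0 // gt_eqF // sqrtr_gt0.
Qed.

Lemma jac_shear0 (f g : E2 -> R) z : differentiable f z -> differentiable g z ->
  'D_be1 f z = 0 ->
  jac (fun z => row2 (f z) (g z)) z = 'D_be0 f z * 'D_be1 g z.
Proof.
move=> df dg f1.
by rewrite /jac (derive_row2 be0 df dg).2 (derive_row2 be1 df dg).2 det2_row f1 mulr0 subr0.
Qed.

Lemma vco1_be1 : vcoord 1 (be1 : E2) = 1 :> R. Proof. exact: be11. Qed.

(* Morse lemma in the variable [z 0 1], with parameter [z 0 0]. *)
Lemma fold_plane (A : E2 -> R) : Cinf setT A -> 'D_be1 A 0 = 0 ->
  'D_be1 ('D_be1 A) 0 != 0 ->
  exists (U : set E2) (X : E2 -> E2) (s : R) (m : E2 -> R),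
  [/\ open U /\ U 0, Cinf U X /\ (X 0 = 0 /\ jac X 0 != 0), Cinf setT m /\ m 0 = A 0,
      s != 0 & forall z : E2, U z -> X z 0 0 = z 0 0 /\
        s * (A z - m (row2 (z 0 0) 0)) = X z 0 1 ^+ 2].
Proof.
move=> hA A1 A11.
(* Inverting (z0, D1 A) solves D1 A = 0 for z1 as a function of z0. *)
pose f (z : E2) := row2 (z 0 0) ('D_be1 A z) : E2.
have hA1 := Cinf_derive be1 hA.
have hc i : Cinf setT (fun z : E2 => z 0 i) by exact: Cinf_coord.
have dc i (z : E2) : differentiable (fun z : E2 => z 0 i) z := Cinf_diff (hc i) (I : setT z).
have hf : Cinf setT f by exact: (Cinf_row2 oT (hc 0) hA1).
have jf : jac f 0 != 0.
  rewrite /f jac_shear0 ?derive_coord_be ?be00 ?be10 ?mul1r //; last exact: (Cinf_diff hA1 (I : setT (0 : E2))).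
have [U' [V' [gi [[oU' U'0] _ [oV' hgi] fg gf]]]] := ift2 oT I hf jf.
have row0 : row2 0 0 = 0 :> E2 by apply/rowP => i; rewrite !mxE; case: ifP.
have f0 : f 0 = 0 by rewrite /f A1 mxE row0.
have [V'0 gi0] : V' 0 /\ gi 0 = 0 by have := fg 0 U'0; rewrite f0.
(* A function of z0 alone is encoded as a function of [pr z], which keeps everything in the
   plane. *)
pose pr (z : E2) : E2 := row2 (z 0 0) 0.
have hpr : Cinf setT pr by apply: (Cinf_row2 oT (hc 0)); exact: Cinf_cst.
have pr0 : pr 0 = 0 by rewrite /pr mxE row0.
pose B := pr @^-1` V'.
have oB : open B by apply: open_comp oV' => z _; exact: (Cinf_cont hpr (I : setT z)).
have hcc : Cinf B (fun z => gi (pr z) 0 1).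
  have hprB : Cinf B pr by exact: Cinf_sub hpr.
  have prB x : B x -> V' (pr x) by [].
  exact: (Cinf_coordl 1 oB (Cinf_comp (findim_rV R 2) oB prB hprB hgi)).
have nB : nbhs (0 : E2) B by apply: open_nbhs_nbhs; split=> //; rewrite /B /preimage /= pr0.
have [r r0 rB] := nbhs_ballnorm nB.
have rB' (z : E2) : `|z| <= r -> B z by move=> zr; apply: rB; rewrite subr0.
have [c0 hc0 c0E] := Cinf_ext oB r0 hcc rB'.
pose c (z : E2) := c0 (pr z); have hcz : Cinf setT c.
  exact: (Cinf_comp (findim_rV R 2) oT (fun _ _ => I) hpr hc0).
have prpr (z : E2) : pr (pr z) = pr z by rewrite /pr row20.
have cE (z : E2) : `|pr z| <= r / 4 -> c z = gi (pr z) 0 1.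
  by move=> zr; rewrite /c c0E // prpr.
have cpr (z : E2) : c (pr z) = c z by rewrite /c prpr.
have c00 : c 0 = 0.
  rewrite cE pr0 ?normr0 ?gi0 ?mxE //; by rewrite ltW // divr_gt0.
(* the fibrewise critical point of [A] *)
have crit (z : E2) : `|pr z| <= r / 4 -> 'D_be1 A (row2 (z 0 0) (c z)) = 0.
  move=> zr; have Vp : V' (pr z).
    by have := rB' (pr z); rewrite /B /preimage /= prpr; apply; apply: le_trans zr _; rewrite ler_pdivrMr // ler_pMr // ler1n.
  have [_ e] := gf _ Vp; have e0 : gi (pr z) 0 0 = z 0 0.
    by have := congr1 (fun v : E2 => v 0 0) e; rewrite /f /pr !row20.
  have e1 : 'D_be1 A (gi (pr z)) = 0.
    by have := congr1 (fun v : E2 => v 0 1) e; rewrite /f /pr !row21.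
  rewrite cE // -[X in 'D_be1 A X](_ : gi (pr z) = _) //.
  by rewrite [LHS]row2_coord e0.
(* This moves the critical curve to the axis z1 = 0, where Hadamard's lemma, applied twice, gives K
   = K (pr z) + z1^2 S. *)
pose sh (z : E2) : E2 := row2 (z 0 0) (c z + z 0 1).
have hsh : Cinf setT sh by exact: (Cinf_row2 oT (hc 0) (CinfD oT hcz (hc 1))).
pose K (z : E2) := A (sh z).
have hK : Cinf setT K by exact: (Cinf_comp (findim_rV R 2) oT (fun _ _ => I) hsh hA).
have dcz (z : E2) : 'D_be1 c z = 0.
  apply: derive_aff => t; rewrite scaler0 addr0 /c; congr c0.
  by rewrite /pr !mxE be10 mulr0 add0r.
have Dsh (z : E2) : 'D_be1 sh z = be1.
  have d2 : differentiable (fun z : E2 => c z + z 0 1) z := Cinf_diff (CinfD oT hcz (hc 1)) (I : setT z).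
  rewrite /sh (derive_row2 be1 (dc 0 z) d2).2 derive_coord_be be10.
  rewrite (deriveDf be1 (Cinf_diff hcz (I : setT z)) (dc 1 z)) dcz derive_coord_be be11 add0r.
  by rewrite be1E.
have D1K (G : E2 -> R) (z : E2) : Cinf setT G -> 'D_be1 (fun z => G (sh z)) z = 'D_be1 G (sh z).
  move=> hG; apply: (etrans (derive_comp be1 (Cinf_diff hsh (I : setT z)) (Cinf_diff hG (I : setT (sh z))))).
  by rewrite Dsh.
have cl : continuous (vcoord 1 : E2 -> R) by exact: vcoord_continuous.
have fE2 := findim_rV R 2.
pose S := hadamard0 (vcoord 1) be1 (hadamard0 (vcoord 1) be1 K).
have hS : Cinf setT S by exact: (Cinf_hadamard0 fE2 _ cl (Cinf_hadamard0 fE2 _ cl hK)).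
have S0 : S 0 != 0.
  have l0 : vcoord 1 (0 : E2) = 0 :> R by rewrite /vcoord mxE.
  have := hadamard0_2_base fE2 cl vco1_be1 hK l0; rewrite -/S.
  rewrite (_ : 'D_be1 K = fun z => 'D_be1 A (sh z)); last by apply/funext => z; exact: D1K.
  rewrite (D1K _ _ hA1) /sh c00 !mxE addr0 row0 => e.
  by apply: contra A11 => /eqP s0; rewrite e s0 mulr0.
have KE (z : E2) : `|pr z| <= r / 4 -> K z = K (pr z) + z 0 1 ^+ 2 * S z.
  move=> zr; have pE : z - vcoord 1 z *: be1 = pr z.
    by rewrite be1E; apply: row2P; rewrite /pr /vcoord ?row20 ?row21 !mxE /= ?mulr0 ?mulr1 ?subr0 ?subrr.
  have h1 : 'D_be1 K (z - vcoord 1 z *: be1) = 0.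
    rewrite pE (D1K _ _ hA) /sh cpr /pr row20 row21 addr0; exact: crit.
  by have := hadamard0_2 fE2 cl vco1_be1 hK h1; rewrite pE.
pose T (z : E2) : E2 := row2 (z 0 0) (z 0 1 - c z).
have hT1 : Cinf setT (fun z : E2 => z 0 1 - c z) by exact: (CinfB oT (hc 1) hcz).
have hT : Cinf setT T by exact: (Cinf_row2 oT (hc 0) hT1).
have prT (z : E2) : pr (T z) = pr z by rewrite /pr /T row20.
have cT (z : E2) : c (T z) = c z by rewrite /c prT.
have shT (z : E2) : sh (T z) = z.
  by rewrite /sh cT /T row20 row21 addrC subrK [RHS]row2_coord.
have T0 : T 0 = 0 by rewrite /T c00 !mxE subr0 row0.
(* With this sign s S is positive near 0, and its square root turns s z1^2 S into a square. *)
pose s := Num.sg (S 0).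
have s0 : s != 0 by rewrite sgr_eq0.
have hST : Cinf setT (fun z => s * S (T z)).
  apply: (CinfM oT); first exact: Cinf_cst.
  exact: (Cinf_comp (findim_rV R 2) oT (fun _ _ => I) hT hS).
pose U := [set z : E2 | `|pr z| < r / 4] `&` [set z | 0 < s * S (T z)].
have oU : open U.
  apply: openI.
    rewrite (_ : [set z : E2 | _] = (fun z : E2 => `|pr z|) @^-1` [set t | t < r / 4]) //.
    apply: open_comp; last exact: open_lt.
    by move=> z _; apply: continuous_comp; [exact: (Cinf_cont hpr (I : setT z))|exact: norm_continuous].
  rewrite (_ : [set z : E2 | _] = (fun z : E2 => s * S (T z)) @^-1` [set t | 0 < t]) //.
  by apply: open_comp; [move=> z _; exact: (Cinf_cont hST (I : setT z))|exact: open_gt].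
have U0 : U 0.
  split; first by rewrite /= pr0 normr0 divr_gt0.
  by rewrite /= T0 /s -normrEsg normr_gt0.
have hq : Cinf U (fun z => Num.sqrt (s * S (T z))).
  by apply: (Cinf_comp (findim_R R) oU _ (Cinf_sub (fun _ _ => I) hST) Cinf_sqrt) => z [].
have hX1 : Cinf U (fun z : E2 => (z 0 1 - c z) * Num.sqrt (s * S (T z))).
  by apply: (CinfM oU) => //; exact: Cinf_sub hT1.
pose X (z : E2) : E2 := row2 (z 0 0) ((z 0 1 - c z) * Num.sqrt (s * S (T z))).
have hm : Cinf setT (fun z => K (pr z)).
  exact: (Cinf_comp (findim_rV R 2) oT (fun _ _ => I) hpr hK).
exists U, X, s, (fun z => K (pr z)); split.
- by split.
- split; first by apply: (Cinf_row2 oU) => //; exact: Cinf_sub (hc 0).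
  split; first by rewrite /X c00 !mxE subr0 mul0r row0.
  have dX1 := Cinf_diff hX1 U0; have dq := Cinf_diff hq U0.
  have dT1 := Cinf_diff hT1 (I : setT (0 : E2)).
  rewrite /X (jac_shear0 (dc 0 0) dX1) ?derive_coord_be ?be00 ?be10 // mul1r.
  rewrite (deriveMf be1 dT1 dq) c00 mxE subrr mul0r addr0.
  rewrite (deriveBf be1 (dc 1 0) (Cinf_diff hcz (I : setT (0 : E2)))) dcz derive_coord_be be11 subr0 mul1r.
  by rewrite gt_eqF // sqrtr_gt0; case: U0.
- by split=> //; rewrite /K pr0 /sh c00 !mxE addr0 row0.
- exact: s0.
- move=> z [zr zs]; rewrite /X row20 row21; split=> //.
  have zr' : `|pr (T z)| <= r / 4 by rewrite prT ltW.
  have := KE (T z) zr'; rewrite {1}/K shT prT => ->.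
  rewrite prpr /T row21 exprMn sqr_sqrtr; last exact: ltW zs.
  by rewrite /T; ring.
Qed.

End Plane.

Section Normal.
Variable R : realType.
Local Notation E2 := ('rV[R]_2).
Variables (F F1 F2 : surface R) (w1 : form2 F1) (w2 : form2 F2).
Hypotheses (sw1 : symplectic w1) (sw2 : symplectic w2).
Local Notation LI := (lagrangian_immersion w1 w2).
Variables (g : F -> prod_manifold F1 F2) (e : chart E2 F) (d1 : chart E2 F1) (d2 : chart E2 F2) (x : F).
Hypotheses (LIg : LI g) (ad : adapted w1 w2 g e d1 d2) (ce : centered g e d1 d2 x).
Local Notation A := (cP1 e d1 g).

Let oT : open [set: E2]. Proof. exact: openT. Qed.

Lemma centered_cod : cod e 0. Proof. by have [ex <- _ _] := ce; exact: fwd_cod. Qed.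

Lemma centered_A0 : A 0 = 0.
Proof. by have [ex e0 f0 _] := ce; rewrite /cP1 /rep -e0 fwdK // f0 mxE. Qed.

(** In adapted coordinates the first component is (z0, A), so a normal form amounts to coordinates X
    of the source and Psi of the target with Psi (z0, A) = hf (X); the inverse function theorem
    makes charts of both. *)
Lemma normal_form (U : set E2) (X Psi : E2 -> E2) hf : open U -> U 0 -> U `<=` cod e ->
  Cinf U X -> X 0 = 0 -> jac X 0 != 0 -> Cinf setT Psi -> Psi 0 = 0 -> jac Psi 0 != 0 ->
  (forall z : E2, U z -> Psi (row2 (z 0 0) (A z)) = hf (X z 0 0) (X z 0 1)) ->
  has_normal_form (g1 g) x hf.
Proof.
move=> oU U0 Ue hX X0 jX hP P0 jP key.
have [ex e0 f0 _] := ce; have [le [l1 _] _ had] := ad.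
have [x1 _ _ _] := had 0 centered_cod; rewrite -e0 fwdK // in x1.
have Ux : U (fwd e x) by rewrite e0.
have jX' := eq_ind_r (fun t => jac X t != 0) jX e0.
have [c [lc cx hc]] := chart_ift le ex oU Ue Ux hX jX'.
have jP' := eq_ind_r (fun t => jac Psi t != 0) jP f0.
have sub : cod d1 `<=` cod d1 by [].
have [d [ld dx hd']] := chart_ift l1 x1 (cod_open d1) sub (fwd_cod x1) (Cinf_sub (fun _ _ => I) hP) jP'.
have fcx : fwd c x = 0 by have [_ _ ->] := hc x cx; rewrite e0.
exists c, d; split.
- by split.
- by split=> //; have [_ _ ->] := hd' _ dx; rewrite f0.
have c0 : cod c 0 by rewrite -fcx; exact: fwd_cod.
have nc : \forall u \near (0 : E2), cod c u by apply: open_nbhs_nbhs; split=> //; exact: cod_open.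
have nd : \forall u \near (0 : E2), dom d (g1 g (bwd c u)).
  have cont : {for 0, continuous (g1 g \o bwd c)}.
    apply: continuous_comp; first exact: bwd_continuous.
    by have [] := (LI_smooth LIg).1 (bwd c 0).
  apply: cont; apply: open_nbhs_nbhs; split; first exact: dom_open.
  by rewrite /= -fcx fwdK.
apply: filterS2 nc nd => u cu du; split=> //.
have cy := bwd_dom cu; have [ey Uy fy] := hc _ cy; rewrite bwdK // in fy.
have [_ _ ->] := hd' _ du; have := key _ Uy; rewrite -fy => <-; congr Psi.
have [_ _ q _] := had _ (fwd_cod ey).
rewrite -q /cQ1 /cP1 /rep (fwdK ey); exact: row2_coord.
Qed.

Lemma local_global : exists2 A' : E2 -> R, Cinf setT A' & exists2 r : R, 0 < r &
  forall z : E2, `|z| <= r -> cod e z /\ A' z = A z.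
Proof.
have [_ _ hA _] := adapted_smooth LIg ad.
have nC : nbhs (0 : E2) (cod e) by apply: open_nbhs_nbhs; split; [exact: cod_open|exact: centered_cod].
have [r r0 rC] := nbhs_ballnorm nC.
have rC' (z : E2) : `|z| <= r -> cod e z by move=> zr; apply: rC; rewrite subr0.
have [A' hA' AE] := Cinf_ext (cod_open e) r0 hA rC'.
exists A' => //; exists (r / 4); first by rewrite divr_gt0.
move=> z zr; split; last exact: AE.
by apply: rC'; apply: le_trans zr _; rewrite ler_pdivrMr // ler_pMr // ler1n.
Qed.

(** The shear subtracts a function of the first coordinate from the second: the critical value in
    the case of a fold, the restriction of A to z1 = 0 in the case of a cusp. *)
Definition target_map (k b : R) (m : E2 -> R) (y : E2) : E2 :=
  row2 (k * y 0 0) (b * (y 0 1 - m (row2 (y 0 0) 0))).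

Lemma target_mapP k b m : Cinf setT m -> m 0 = 0 -> k != 0 -> b != 0 ->
  [/\ Cinf setT (target_map k b m), target_map k b m 0 = 0 & jac (target_map k b m) 0 != 0].
Proof.
move=> hm m0 k0 b0.
have hc i : Cinf setT (fun z : E2 => z 0 i) by exact: Cinf_coord.
have hk (c : R) : Cinf setT (fun _ : E2 => c) by exact: Cinf_cst.
have row0 : row2 0 0 = 0 :> E2 by apply/rowP => i; rewrite !mxE; case: ifP.
have hmp : Cinf setT (fun y : E2 => m (row2 (y 0 0) 0)).
  exact: (Cinf_comp (findim_rV R 2) oT (fun _ _ => I) (Cinf_row2 oT (hc 0) (hk 0)) hm).
have h1 : Cinf setT (fun y : E2 => k * y 0 0) by exact: (CinfM oT (hk k) (hc 0)).
have h2' : Cinf setT (fun y : E2 => y 0 1 - m (row2 (y 0 0) 0)) by exact: (CinfB oT (hc 1) hmp).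
have h2 : Cinf setT (fun y : E2 => b * (y 0 1 - m (row2 (y 0 0) 0))) by exact: (CinfM oT (hk b) h2').
have dc i : differentiable (fun z : E2 => z 0 i) (0 : E2) := Cinf_diff (hc i) (I : setT (0 : E2)).
split; first exact: (Cinf_row2 oT h1 h2).
  by rewrite /target_map !mxE row0 m0 mulr0 subr0 mulr0.
have dm : 'D_be1 (fun y : E2 => m (row2 (y 0 0) 0)) 0 = 0.
  by apply: derive_aff => t; rewrite !mxE be10 mulr0 add0r scaler0 addr0.
rewrite /target_map (jac_shear0 (Cinf_diff h1 (I : setT (0 : E2))) (Cinf_diff h2 (I : setT (0 : E2)))).
  rewrite (deriveMcf k be0 (dc 0)) derive_coord_be be00 (deriveMcf b be1 (Cinf_diff h2' (I : setT (0 : E2)))).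
  rewrite (deriveBf be1 (dc 1) (Cinf_diff hmp (I : setT (0 : E2)))) dm derive_coord_be be11 subr0 !mulr1.
  by rewrite mulf_neq0.
by rewrite (deriveMcf k be1 (dc 0)) derive_coord_be be10 mulr0.
Qed.

Lemma adapted_crit1 : 'D_be1 A 0 = 0 -> critical_point (g1 g) x.
Proof.
by have [ex e0 _ _] := ce; have [C _] := adapted_critical LIg ad ex; rewrite -e0 => /C.
Qed.

Lemma fold_of : 'D_be1 A 0 = 0 -> 'D_be1 ('D_be1 A) 0 != 0 -> fold_point (g1 g) x.
Proof.
move=> A1 A11; split; first exact: adapted_crit1.
have [A' hA' [r r0 AE]] := local_global.
pose B := [set z : E2 | `|z| < r].
have oB : open B by exact: open_normlt.
have B0 : B 0 by rewrite /B /= normr0.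
have BA z : B z -> A' z = A z by move=> /ltW /AE[].
have BA1 z : B z -> 'D_be1 A' z = 'D_be1 A z by exact: (derive_eqon oB be1 BA).
have A1' : 'D_be1 A' 0 = 0 by rewrite BA1.
have A11' : 'D_be1 ('D_be1 A') 0 != 0 by rewrite (derive_eqon oB be1 BA1 B0).
have [U [X [s [m [[oU U0] [hX [X0 jX]] [hm m0] s0 key]]]]] := fold_plane hA' A1' A11'.
have m0' : m 0 = 0 by rewrite m0 (BA _ B0) centered_A0.
have [hP P0 jP] := target_mapP hm m0' (oner_neq0 R) s0.
have oUB : open (U `&` B) by exact: openI.
apply: (normal_form oUB (conj U0 B0) _ (Cinf_sub (fun z (h : (U `&` B) z) => h.1) hX) X0 jX hP P0 jP).
  by move=> z [_ /ltW /AE[]].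
move=> z [Uz Bz]; have [k1 k2] := key z Uz.
by rewrite /target_map row20 row21 mul1r -BA // k2 k1.
Qed.

(** Integrating the exact model in z1 gives A = A (z0, 0) + al z0 z1 + be z1^3 / 6. After the shear
    by A (z0, 0) and multiplication by 6 / be, the substitution x1 = (6 al / be) z0 in source and
    target reaches x1 x2 + x2^3. *)
Lemma cusp_of (al be r : R) : al != 0 -> be != 0 -> 0 < r ->
  (forall z : E2, `|z| <= r -> 'D_be1 A z = al * z 0 0 + be / 2 * z 0 1 ^+ 2) ->
  cusp_point (g1 g) x.
Proof.
move=> al0 be0' r0 uE; split.
  by apply: adapted_crit1; rewrite uE ?normr0 ?(ltW r0) // !mxE expr0n /= !mulr0 addr0.
have [A' hA' [r1 r10 AE]] := local_global.
pose B := [set z : E2 | `|z| < Num.min r r1].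
have oB : open B by exact: open_normlt.
have B0 : B 0 by rewrite /B /= normr0 lt_min r0.
have Br z : B z -> `|z| <= r /\ `|z| <= r1.
  by rewrite /B /= lt_min => /andP[? ?]; split; exact: ltW.
have BA z : B z -> A' z = A z by move=> /Br[_ /AE[]].
have BA1 z : B z -> 'D_be1 A' z = 'D_be1 A z by exact: (derive_eqon oB be1 BA).
pose ca := fun k => nth 0 [:: al; be / 6] k.
pose cb := fun k => nth (0, 0)%N [:: (1, 1); (0, 3)]%N k.
have hcomb := Cinf_comb ca cb.
have combE z : comb ca cb z = al * (z 0 0 * z 0 1) + be / 6 * z 0 1 ^+ 3.
  by rewrite /comb /mono /= !expr0 !expr1 !mul1r mul0r addr0.
have comb1 z : 'D_be1 (comb ca cb) z = al * z 0 0 + be / 2 * z 0 1 ^+ 2.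
  rewrite (congr1 (fun f : E2 -> R => f z) (derive_comb1 ca cb)) /comb /mono /=.
  rewrite !expr0 expr1 !(mulr1, mul1r, mul0r, addr0).
  by rewrite /ca /=; field.
pose D z := A' z - comb ca cb z.
have dD z : differentiable D z.
  exact: (Cinf_diff (CinfB oT hA' hcomb) (I : setT z)).
have D1 z : B z -> 'D_be1 D z = 0.
  move=> Bz; rewrite /D (deriveBf be1 (Cinf_diff hA' (I : setT z)) (Cinf_diff hcomb (I : setT z))).
  by rewrite comb1 (BA1 z Bz) uE ?subrr //; have [] := Br z Bz.
have row0 : row2 0 0 = 0 :> E2 by apply/rowP => i; rewrite !mxE; case: ifP.
have DE (z : E2) : B z -> D z = D (row2 (z 0 0) 0).
  move=> Bz; have zE : z = row2 (z 0 0) 0 + z 0 1 *: be1.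
    by rewrite be1E; apply: row2P; rewrite !mxE /= ?row20 ?row21 ?mulr0 ?mulr1 ?addr0 ?add0r.
  have Bs (s : R) : 0 <= s <= 1 -> B (row2 (z 0 0) 0 + s *: (z 0 1 *: be1)).
    move=> /andP[s0 s1]; apply: le_lt_trans Bz; rewrite norm2_le.
    have := lexx `|z|; rewrite {1}norm2_le => /andP[z0 z1].
    rewrite !mxE /= be10 be11 ?row20 ?row21 !mulr0 addr0 add0r mulr1 z0 /=.
    by apply: le_trans z1; rewrite normrM ger0_norm // ler_piMl.
  (* The mean value inequality with bound 0: D does not depend on z1, the vertical segment from the
     axis to z staying in the square. *)
  have : `|D (row2 (z 0 0) 0 + z 0 1 *: be1) - D (row2 (z 0 0) 0)| <= 0.
    apply: MVT_le => s s01; first exact: dD.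
    by rewrite deriveZv // D1 ?scaler0 ?normr0 //; exact: Bs.
  by rewrite -zE normr_le0 subr_eq0 => /eqP.
pose k := 6 * al / be; pose b := 6 / be.
have k0 : k != 0 by rewrite !mulf_neq0 ?invr_neq0 // pnatr_eq0.
have b0 : b != 0 by rewrite mulf_neq0 ?invr_neq0 // pnatr_eq0.
have m0 : A' 0 = 0 by rewrite BA // centered_A0.
have [hP P0 jP] := target_mapP hA' m0 k0 b0.
pose X (z : E2) : E2 := row2 (k * z 0 0) (z 0 1).
have hc i : Cinf setT (fun z : E2 => z 0 i) by exact: Cinf_coord.
have h1 : Cinf setT (fun y : E2 => k * y 0 0) by apply: (CinfM oT) => //; exact: Cinf_cst.
have hX : Cinf setT X by exact: (Cinf_row2 oT h1 (hc 1)).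
have X0 : X 0 = 0 by rewrite /X !mxE mulr0 row0.
have dc i : differentiable (fun z : E2 => z 0 i) (0 : E2) := Cinf_diff (hc i) (I : setT (0 : E2)).
have jX : jac X 0 != 0.
  rewrite /X (jac_shear0 (Cinf_diff h1 (I : setT (0 : E2))) (dc 1)).
    by rewrite (deriveMcf k be0 (dc 0)) !derive_coord_be be00 be11 !mulr1.
  by rewrite (deriveMcf k be1 (dc 0)) derive_coord_be be10 mulr0.
apply: (normal_form oB B0 _ (Cinf_sub (fun _ _ => I) hX) X0 jX hP P0 jP).
  by move=> z /Br[_ /AE[]].
move=> z Bz; rewrite /target_map /X !row20 !row21 -BA //.
have := DE z Bz; rewrite /D !combE !row20 !row21 mulr0 expr0n /= !mulr0 addr0 subr0 => /eqP.
rewrite subr_eq => /eqP ->; congr row2; rewrite /b /k.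
by field.
Qed.

End Normal.

(** * Uniqueness of the degenerate zero *)

Section UniqueZero.
Variable R : realType.
Local Notation E2 := ('rV[R]_2).

Lemma ball_seg (r : R) (p q : E2) (s : R) : `|p| <= r -> `|q| <= r -> 0 <= s <= 1 ->
  `|p + s *: (q - p)| <= r.
Proof.
move=> pr qr /andP[s0 s1].
have -> : p + s *: (q - p) = s *: q + (1 - s) *: p.
  by rewrite scalerBr scalerBl scale1r addrCA addrC -addrA addrC.
apply: le_trans (ler_normD _ _) _; rewrite !normrZ (ger0_norm s0) ger0_norm ?subr_ge0 //.
have a := ler_wpM2l s0 qr; have s1' : 0 <= 1 - s by rewrite subr_ge0.
by have b := ler_wpM2l s1' pr; lra.
Qed.

Variables (u : E2 -> R) (r al be : R).
Hypothesis hu : forall z : E2, `|z| <= r -> differentiable u z /\ differentiable ('D_be1 u) z.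
Hypotheses (a1 : forall z : E2, `|z| <= r -> 0 < al * 'D_be0 u z)
  (b2 : forall z : E2, `|z| <= r -> 0 < be * 'D_be1 ('D_be1 u) z).

Let mvt (f : E2 -> R) (p : E2) (t : R) v : (forall z : E2, `|z| <= r -> differentiable f z) ->
  `|p| <= r -> `|p + t *: v| <= r -> 
  exists2 s : R, 0 < s < 1 & f (p + t *: v) - f p = t * 'D_v f (p + s *: (t *: v)) /\
    `|p + s *: (t *: v)| <= r.
Proof.
move=> df pr qr.
have seg (s : R) : 0 <= s <= 1 -> `|p + s *: (t *: v)| <= r.
  move=> s01; have := ball_seg pr qr s01; by rewrite [p + t *: v]addrC addrK.
have [s s01 e] := @MVT_line R _ f p (t *: v) 1 ltr01 (fun s s01 => df _ (seg s s01)).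
exists s => //; have s01' : 0 <= s <= 1 by case/andP: s01 => /ltW -> /ltW ->.
split; last exact: seg.
by rewrite scale1r mul1r in e; rewrite e deriveZv //; exact: df _ (seg s s01').
Qed.

(* convexity of [be * u] along the second coordinate *)
Let conv (p : E2) (t : R) : `|p| <= r -> `|p + t *: be1| <= r -> 'D_be1 u p = 0 -> t != 0 ->
  0 < be * (u (p + t *: be1) - u p).
Proof.
move=> pr qr up t0.
have [s s01 [e sr]] := mvt (fun z zr => (hu zr).1) pr qr.
have sr' : `|p + (s * t) *: be1| <= r by rewrite -scalerA.
have [s' s'01 [e' sr'']] := mvt (fun z zr => (hu zr).2) pr sr'.
rewrite up subr0 in e'; rewrite e scalerA e'.
have := b2 sr''; set X := 'D_be1 ('D_be1 u) _ => b.
have -> : be * (t * (s * t * X)) = t ^+ 2 * s * (be * X) by ring.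
have sp : 0 < s by case/andP: s01.
have t2 : 0 < t ^+ 2 by rewrite exprn_even_gt0.
exact: mulr_gt0 (mulr_gt0 t2 sp) b.
Qed.

(* The minimum of [be * u] along the fibre [z 0 0 = a] is a monotone function of
   [a]. *)
Lemma unique_zero z : u 0 = 0 -> 'D_be1 u 0 = 0 -> `|z| <= r -> u z = 0 -> 'D_be1 u z = 0 ->
  z = 0.
Proof.
move=> u0 u1 zr uz uz1.
have r0 : `|0 : E2| <= r by rewrite normr0; apply: le_trans zr.
have := zr; rewrite norm2_le => /andP[z0r z1r].
have pr : `|z 0 1 *: be1| <= r.
  by rewrite norm2_le !mxE be10 be11 mulr0 mulr1 normr0 z1r (le_trans _ z1r) ?normr_ge0.
have qr : `|z 0 0 *: be0| <= r.
  by rewrite norm2_le !mxE be00 be01 mulr0 mulr1 normr0 z0r (le_trans _ z1r) ?normr_ge0.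
have zE : z = z 0 1 *: be1 + z 0 0 *: be0 by rewrite {1}(be_sum z) addrC.
have zE' : z 0 0 *: be0 = z + (- z 0 1) *: be1 by rewrite {2}(be_sum z) scaleNr addrK.
have zr' : `|z 0 1 *: be1 + z 0 0 *: be0| <= r by rewrite -zE.
have qr' : `|0 + z 0 0 *: be0| <= r by rewrite add0r.
have [s s01 [e sr]] := mvt (fun z zr => (hu zr).1) pr zr'.
have [s' s'01 [e' sr']] := mvt (fun z zr => (hu zr).1) r0 qr'.
rewrite -zE uz sub0r in e; rewrite add0r u0 subr0 in e'.
have A := a1 sr; have A' := a1 sr'.
move: ('D_be0 u _) A e => X A e; move: ('D_be0 u _) A' e' => X' A' e'.
have [z10|z10] := eqVneq (z 0 1) 0.
  have z00 : z 0 0 = 0.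
    rewrite z10 scale0r u0 oppr0 in e; apply/eqP; apply: contraT => z0.
    have X0 : X = 0 by apply/eqP; move/eqP: e; rewrite eq_sym mulf_eq0 (negbTE z0).
    by move: A; rewrite X0 mulr0 ltxx.
  by rewrite zE z10 z00 !scale0r addr0.
have c1 : 0 < be * u (z 0 1 *: be1).
  have := conv (p := 0) r0 (t := z 0 1); rewrite add0r u0 subr0.
  by apply.
have c2 : 0 < be * u (z 0 0 *: be0).
  have := conv (p := z) zr (t := - z 0 1); rewrite -zE' uz subr0.
  by apply => //; rewrite oppr_eq0.
rewrite e' in c2; have {}e : u (z 0 1 *: be1) = - (z 0 0 * X) by rewrite -e opprK.
rewrite e in c1.
(* [al X], [al X'] > 0 while [be z00 X < 0 < be z00 X'] *)
have P1 : 0 < (be * - (z 0 0 * X)) * (be * (z 0 0 * X')) by rewrite mulr_gt0.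
have P2 : 0 < (al * X) * (al * X') by rewrite mulr_gt0.
have := mulr_gt0 P1 P2.
have -> : (be * - (z 0 0 * X)) * (be * (z 0 0 * X')) * (al * X * (al * X')) =
   - (be * z 0 0 * X * X' * al) ^+ 2 by ring.
by rewrite oppr_gt0 ltNge sqr_ge0.
Qed.

End UniqueZero.

(** * Exchange of the two factors *)

Section Swap.
Variable R : realType.
Local Notation E2 := ('rV[R]_2).

Definition flip (z : E2) : E2 := row2 (z 0 1) (z 0 0).

Lemma flipK : involutive flip.
Proof. by move=> z; rewrite /flip row20 row21 -row2_coord. Qed.

Lemma derive_lin (W : normedModType R) (f : E2 -> W) (k : E2 -> E2) v w a :
  (forall h : R, k (h *: v + a) = h *: w + k a) -> 'D_v (fun y => f (k y)) a = 'D_w f (k a).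
Proof.
move=> kE; rewrite /derive; set f1 := fun h => h^-1 *: _; set f2 := fun h => h^-1 *: _.
suff -> : f1 = f2 by [].
by apply/funext => h; rewrite /f1 /f2 /= kE.
Qed.

Lemma derive_flip (f : E2 -> R) a : 'D_be1 (fun y => f (flip y)) a = 'D_be0 f (flip a) /\
  'D_be0 (fun y => f (flip y)) a = 'D_be1 f (flip a).
Proof.
split; apply: derive_lin => h; apply: row2P;
  by rewrite /flip ?row20 ?row21 !mxE ?row20 ?row21 ?be00 ?be01 ?be10 ?be11.
Qed.

Lemma Cinf_flip : Cinf setT flip.
Proof. by apply: Cinf_row2; [exact: openT|exact: Cinf_coord|exact: Cinf_coord]. Qed.

(** The exchange only changes the sign of the difference form, so it preserves Lagrangian
    immersions, and results on the first projection carry over to the second. *)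
Definition swapg (F F1 F2 : surface R) (g : F -> prod_manifold F1 F2) : F -> prod_manifold F2 F1 :=
  fun x => ((g x).2, (g x).1).

Lemma swapgK (F F1 F2 : surface R) (g : F -> prod_manifold F1 F2) : swapg (swapg g) = g.
Proof. by apply/funext => x; rewrite /swapg /= -surjective_pairing. Qed.

Variables (F F1 F2 : surface R) (w1 : form2 F1) (w2 : form2 F2).
Hypotheses (sw1 : symplectic w1) (sw2 : symplectic w2).

Lemma swap_LI (g : F -> prod_manifold F1 F2) : lagrangian_immersion w1 w2 g ->
  lagrangian_immersion w2 w1 (swapg g).
Proof.
move=> L; have [s1 s2] := LI_smooth L.
have ss : smooth2 (swapg g) by split; [exact: s2|exact: s1].
apply: (LI_of ss) => x; have [c [d1 [d2 [lc D1 D2 [cx x1 x2] [je ker]]]]] := lagr_at_LI sw1 sw2 x L.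
exists c, d2, d1; split; [exact: lc|exact: D2|exact: D1|by split|].
by split=> [|v e1 e2]; [exact: esym je|exact: ker].
Qed.

Lemma swap_isotopic (g : F -> prod_manifold F1 F2) g' :
  (forall k : F -> prod_manifold F2 F1, lagrangian_immersion w2 w1 k ->
     lagrangian_immersion w1 w2 (swapg k)) ->
  isotopic w2 w1 (swapg g) g' -> isotopic w1 w2 g (swapg g').
Proof.
move=> sL [T [G [T0 [h1 h2] L e0 eT]]]; exists T, (fun t => swapg (G t)); split.
- exact: T0.
- by split.
- by move=> t; apply: sL.
- by move=> t t0; rewrite e0 // swapgK.
- by move=> t tT; rewrite eT.
Qed.

(** The new first component has B as its second coordinate, and A_2 = - B_1 turns u into minus u
    composed with [flip]. *)
Lemma swap_adapted (g : F -> prod_manifold F1 F2) e d1 d2 : lagrangian_immersion w1 w2 g ->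
  adapted w1 w2 g e d1 d2 -> exists e', [/\ adapted w2 w1 (swapg g) e' d2 d1, dom e' = dom e,
    forall x, fwd e' x = flip (fwd e x), forall z, cod e' z = cod e (flip z) &
    forall z, cod e' z -> 'D_be1 (cP1 e' d2 (swapg g)) z = - 'D_be1 (cP1 e d1 g) (flip z)].
Proof.
move=> L ad; have [le D1 D2 h] := ad.
have oV : open (flip @^-1` cod e).
  by apply: open_comp (cod_open e) => z _; exact: (Cinf_cont Cinf_flip I).
have cod_sub : cod e `<=` cod e by [].
have fU x : cod e x -> (flip @^-1` cod e) (flip x) /\ flip (flip x) = x.
  by rewrite /preimage /= flipK.
have fV y : (flip @^-1` cod e) y -> cod e (flip y) /\ flip (flip y) = y by rewrite flipK.
have cf A : Cinf A flip by exact: (Cinf_sub (fun _ _ => I) Cinf_flip).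
pose e' := dchart (cod_open e) oV cod_sub fU fV (cf _) (cf _) : chart E2 F.
exists e'; split=> //.
- split=> //; first exact: dchart_local.
  move=> z cz; have [x1 x2 q1 q2] := h _ cz; split=> //.
    by move: q2; rewrite /cQ2 /cQ1 /rep /= /flip row21 => ->.
  by move: q1; rewrite /cQ2 /cQ1 /rep /= /flip row20 => ->.
- by apply/seteqP; split=> x; [move=> []|move=> cx; split=> //; exact: fwd_cod].
- move=> z cz; have := adapted_lagr L ad cz => ->; rewrite opprK.
  exact: (derive_flip (cP2 e d2 g) z).1.
Qed.

End Swap.

Section At.
Variable R : realType.
Local Notation E2 := ('rV[R]_2).

Section one.
Variables (F F1 F2 : surface R) (w1 : form2 F1) (w2 : form2 F2).
Hypotheses (sw1 : symplectic w1) (sw2 : symplectic w2).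
Variables (g : F -> prod_manifold F1 F2) (e : chart E2 F) (d1 : chart E2 F1) (d2 : chart E2 F2) (y : F).
Hypotheses (LIg : lagrangian_immersion w1 w2 g) (ad : adapted w1 w2 g e d1 d2) (ey : dom e y).
Local Notation u := ('D_be1 (cP1 e d1 g)).

Lemma recenter_u : exists e' d1' d2', [/\ adapted w1 w2 g e' d1' d2', centered g e' d1' d2' y &
  (forall z, cod e' z -> 'D_be1 (cP1 e' d1' g) z = u (fwd e y + z)) /\
  'D_be1 ('D_be1 (cP1 e' d1' g)) 0 = 'D_be1 u (fwd e y)].
Proof.
have [e' [d1' [d2' [ad' ce' _ _ hz]]]] := recenter ad ey.
have [_ _ hA _] := adapted_smooth LIg ad.
have D1 z : cod e' z -> 'D_be1 (cP1 e' d1' g) z = u (fwd e y + z).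
  move=> cz; have cz' : cod e (fwd e y + z) by have [<-] := hz z.
  have dA := Cinf_diff hA cz'.
  have -> : cP1 e' d1' g = fun z => cP1 e d1 g (fwd e y + z) - cP1 e d1 g (fwd e y).
    by apply/funext => t; have [] := hz t.
  have dAs : differentiable (fun z => cP1 e d1 g (fwd e y + z)) z.
    have oT : open [set: E2] by exact: openT.
    have hs : Cinf setT (fun z : E2 => fwd e y + z) by apply: (CinfD oT); [exact: Cinf_cst|exact: Cinf_id].
    exact: (differentiable_comp (Cinf_diff hs (I : setT z)) dA).
  rewrite (deriveBf be1 dAs (differentiable_cst _ _)) derive_cst subr0.
  exact: (@derive_shift _ _ (cP1 e d1 g) (fun z => fwd e y + z) (fwd e y) be1 z (fun=> erefl)).
exists e', d1', d2'; split; [exact: ad'|exact: ce'|split; first exact: D1].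
rewrite (derive_eqon (cod_open e') be1 D1 (centered_cod ce')).
rewrite (@derive_shift _ _ u (fun z => fwd e y + z) (fwd e y) be1 0 (fun=> erefl)).
by rewrite addr0.
Qed.

Lemma fold1_at : u (fwd e y) = 0 -> 'D_be1 u (fwd e y) != 0 -> fold_point (g1 g) y.
Proof.
move=> u0 u1; have [e' [d1' [d2' [ad' ce' [D1 D11]]]]] := recenter_u.
apply: (fold_of LIg ad' ce'); last by rewrite D11.
by rewrite (D1 _ (centered_cod ce')) addr0; exact: u0.
Qed.

Lemma cusp1_at (al be r : R) : al != 0 -> be != 0 -> 0 < r ->
  (forall z : E2, `|z| <= r -> u (fwd e y + z) = al * z 0 0 + be / 2 * z 0 1 ^+ 2) ->
  cusp_point (g1 g) y.
Proof.
move=> al0 be0' r0 uE; have [e' [d1' [d2' [ad' ce' [D1 _]]]]] := recenter_u.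
have [A' _ [r1 r10 AE]] := local_global LIg ad' ce'.
apply: (cusp_of LIg ad' ce' al0 be0' (r := Num.min r r1)); first by rewrite lt_min r0.
move=> z; rewrite le_min => /andP[zr zr1]; rewrite D1; last by have [] := AE z zr1.
exact: uE.
Qed.

End one.

Lemma fold2_at (F F1 F2 : surface R) (w1 : form2 F1) (w2 : form2 F2)
  (sw1 : symplectic w1) (sw2 : symplectic w2)
  (g : F -> prod_manifold F1 F2) (e : chart E2 F) (d1 : chart E2 F1) (d2 : chart E2 F2) (y : F) :
  lagrangian_immersion w1 w2 g -> adapted w1 w2 g e d1 d2 -> dom e y ->
  'D_be1 (cP1 e d1 g) (fwd e y) = 0 -> 'D_be0 ('D_be1 (cP1 e d1 g)) (fwd e y) != 0 ->
  fold_point (g2 g) y.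
Proof.
move=> L ad ey u0 u1; have [e' [ad' dE fE cE uE]] := swap_adapted L ad.
have L' := swap_LI sw1 sw2 L.
have e'y : dom e' y by rewrite dE.
have cz := fwd_cod e'y.
apply: (fold1_at L' ad' e'y); first by rewrite uE // fE flipK u0 oppr0.
rewrite (derive_eqon (cod_open e') be1 uE cz).
have [_ _ hA _] := adapted_smooth L ad.
have hu := Cinf_derive be1 hA.
have cz' : cod e (flip (fwd e' y)) by rewrite -cE.
have df : differentiable (fun z => 'D_be1 (cP1 e d1 g) (flip z)) (fwd e' y).
  exact: (differentiable_comp (Cinf_diff (@Cinf_flip R) (I : setT _)) (Cinf_diff hu cz')).
by rewrite (deriveNf be1 df) (derive_flip ('D_be1 (cP1 e d1 g)) (fwd e' y)).1 fE flipK oppr_eq0.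
Qed.

End At.

(** * Isolation and modification of cusps *)

Section Classify.
Variable R : realType.
Local Notation E2 := ('rV[R]_2).

Definition both_folds (F F1 F2 : surface R) (g : F -> prod_manifold F1 F2) y :=
  bisingular_set g y -> fold_point (g1 g) y /\ fold_point (g2 g) y.

Definition folds_or_cusp (F F1 F2 : surface R) (g : F -> prod_manifold F1 F2) y :=
  bisingular_set g y -> (fold_point (g1 g) y /\ fold_point (g2 g) y) \/
    (cusp_point (g1 g) y \/ cusp_point (g2 g) y).

Lemma both_folds_or_cusp (F F1 F2 : surface R) (g : F -> prod_manifold F1 F2) y : both_folds g y -> folds_or_cusp g y.
Proof. by move=> h b; left; exact: h. Qed.

Lemma both_folds_swap (F F1 F2 : surface R) (g : F -> prod_manifold F1 F2) y : both_folds (swapg g) y -> both_folds g y.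
Proof. by move=> h [b1 b2]; have [] := h (conj b2 b1). Qed.

Lemma folds_or_cusp_swap (F F1 F2 : surface R) (g : F -> prod_manifold F1 F2) y : folds_or_cusp (swapg g) y -> folds_or_cusp g y.
Proof.
by move=> h [b1 b2]; have [[? ?]|[?|?]] := h (conj b2 b1);
  [left|right; right|right; left].
Qed.

Section one.
Variables (F F1 F2 : surface R) (w1 : form2 F1) (w2 : form2 F2).
Hypotheses (sw1 : symplectic w1) (sw2 : symplectic w2).
Local Notation LI := (lagrangian_immersion w1 w2).
Implicit Types g : F -> prod_manifold F1 F2.

Lemma both_folds_at g e d1 d2 y : LI g -> adapted w1 w2 g e d1 d2 -> dom e y ->
  ('D_be1 (cP1 e d1 g) (fwd e y) = 0 -> 'D_be0 ('D_be1 (cP1 e d1 g)) (fwd e y) != 0 /\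
     'D_be1 ('D_be1 (cP1 e d1 g)) (fwd e y) != 0) -> both_folds g y.
Proof.
move=> L ad ey h [c1 c2]; have [C _] := adapted_critical L ad ey.
have u0 := C.1 c1; have [u1 u2] := h u0.
by split; [exact: (fold1_at L ad ey)|exact: (fold2_at sw1 sw2 L ad ey)].
Qed.

(** D0 u does not vanish on the ball, and 0 is the only common zero of u and D1 u. At any other zero
    of u both derivatives are therefore nonzero. This serves before the modification of a cusp as
    well as after it. *)
Lemma both_folds_ball g e d1 d2 (al be r : R) : LI g -> adapted w1 w2 g e d1 d2 ->
  let u := 'D_be1 (cP1 e d1 g) in u 0 = 0 -> 'D_be1 u 0 = 0 ->
  (forall z : E2, `|z| <= r -> [/\ cod e z, 0 < al * 'D_be0 u z & 0 < be * 'D_be1 ('D_be1 u) z]) ->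
  forall y, dom e y -> `|fwd e y| <= r -> fwd e y != 0 -> both_folds g y.
Proof.
move=> L ad u u0 u1 h y ey yr yn.
have [_ _ hA _] := adapted_smooth L ad; have hu := Cinf_derive be1 hA.
have hadamard0 (z : E2) : `|z| <= r -> differentiable u z /\ differentiable ('D_be1 u) z.
  move=> /h[cz _ _]; split; first exact: (Cinf_diff hu cz).
  exact: (Cinf_diff (Cinf_derive be1 hu) cz).
have ha (z : E2) : `|z| <= r -> 0 < al * 'D_be0 u z by case/h.
have hb (z : E2) : `|z| <= r -> 0 < be * 'D_be1 ('D_be1 u) z by case/h.
apply: (both_folds_at L ad ey) => uy; split.
  have := ha _ yr; rewrite -/u; case: eqP => // ->; by rewrite mulr0 ltxx.
apply/eqP => uy1; have := unique_zero hadamard0 ha hb u0 u1 yr uy uy1.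
by move/eqP: yn.
Qed.

Lemma signs_near (f : E2 -> R) (A : set E2) : open A -> A 0 -> Cinf A f -> f 0 != 0 ->
  \forall z \near (0 : E2), 0 < f 0 * f z.
Proof.
move=> oA A0 hf f0; have c : {for 0, continuous (fun z => f 0 * f z)}.
  have h : Cinf A (fun z => f 0 * f z) by apply: (CinfM oA) => //; exact: Cinf_cst.
  exact: (Cinf_cont h A0).
by apply: (cvgr_gt _ c); rewrite -expr2 exprn_even_gt0.
Qed.

(* a cusp of the first projection, in adapted coordinates *)
Definition cuspidal g e (d1 : chart E2 F1) := let u := 'D_be1 (cP1 e d1 g) in
  [/\ u 0 = 0, 'D_be1 u 0 = 0, 'D_be0 u 0 != 0 & 'D_be1 ('D_be1 u) 0 != 0].

Lemma isolated_cusp g e d1 d2 x : LI g -> adapted w1 w2 g e d1 d2 -> centered g e d1 d2 x ->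
  cuspidal g e d1 -> \forall y \near x, y <> x -> both_folds g y.
Proof.
move=> L ad ce [u0 u1 ua ub]; have [ex e0 _ _] := ce.
have c0 := centered_cod ce; have oe := cod_open e.
have [_ _ hA _] := adapted_smooth L ad; have hu := Cinf_derive be1 hA.
have n1 := signs_near oe c0 (Cinf_derive be0 hu) ua.
have n2 := signs_near oe c0 (Cinf_derive be1 (Cinf_derive be1 hu)) ub.
have n3 : \forall z \near (0 : E2), cod e z by apply: open_nbhs_nbhs.
have [r r0 Hr] := nbhs_ballnorm (filterI n3 (filterI n1 n2)).
have n : \forall y \near x, dom e y /\ `|fwd e y| < r.
  apply: filterI; first by apply: open_nbhs_nbhs; split=> //; exact: dom_open.
  have nb : nbhs (fwd e x) [set z : E2 | `|z| < r].
    apply: open_nbhs_nbhs; split; first exact: open_normlt.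
    by rewrite /= e0 normr0.
  exact: (fwd_continuous ex nb).
apply: filterS n => y [ey yr] yx.
apply: (both_folds_ball L ad u0 u1 _ ey (ltW yr)).
  move=> z zr; have zr' : `|z - 0| <= r by rewrite subr0.
  by have [cz [a b]] := Hr z zr'; split; [exact: cz|exact: a|exact: b].
by apply/eqP => fy; apply: yx; rewrite -(fwdK ey) fy -e0 fwdK.
Qed.

Lemma recenter_all g e d1 d2 x : LI g -> adapted w1 w2 g e d1 d2 -> dom e x ->
  exists e' d1' d2', [/\ adapted w1 w2 g e' d1' d2', centered g e' d1' d2' x &
   forall w, pword w ('D_be1 (cP1 e' d1' g)) 0 = pword w ('D_be1 (cP1 e d1 g)) (fwd e x)].
Proof.
move=> L ad ex; have [e' [d1' [d2' [ad' ce' [D1 _]]]]] := recenter_u L ad ex.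
exists e', d1', d2'; split; [exact: ad'|exact: ce'|].
have oe := cod_open e'; have c0 := centered_cod ce'.
suff key w z : cod e' z -> pword w ('D_be1 (cP1 e' d1' g)) z = pword w ('D_be1 (cP1 e d1 g)) (fwd e x + z).
  by move=> w; rewrite key // addr0.
elim: w z => [|b w IH] z cz /=; first exact: D1.
set f := pword w _ in IH *; set f' := pword w ('D_be1 (cP1 e d1 g)) in IH *.
by case: b; [rewrite (derive_eqon oe be1 IH cz)|rewrite (derive_eqon oe be0 IH cz)];
  exact: (@derive_shift _ _ f' (fun z => fwd e x + z) (fwd e x) _ z (fun=> erefl)).
Qed.

End one.

(** Negating the letters of a word exchanges the two partial derivatives, as the flip of the
    coordinates does. *)
Lemma swap_all (F F1 F2 : surface R) (w1 : form2 F1) (w2 : form2 F2)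
    (g : F -> prod_manifold F1 F2) e d1 d2 : lagrangian_immersion w1 w2 g ->
  adapted w1 w2 g e d1 d2 -> exists e', [/\ adapted w2 w1 (swapg g) e' d2 d1, dom e' = dom e &
    forall w x, dom e x -> pword w ('D_be1 (cP1 e' d2 (swapg g))) (fwd e' x) =
      - pword (map negb w) ('D_be1 (cP1 e d1 g)) (fwd e x)].
Proof.
move=> L ad; have [e' [ad' dE fE cE uE]] := swap_adapted L ad.
exists e'; split; [exact: ad'|exact: dE|].
have oe := cod_open e'; have [_ _ hA _] := adapted_smooth L ad; have hu := Cinf_derive be1 hA.
have hw w : Cinf (cod e) (pword w ('D_be1 (cP1 e d1 g))).
  by elim: w => //= b w IH; case: b; exact: Cinf_derive.
suff key w z : cod e' z -> pword w ('D_be1 (cP1 e' d2 (swapg g))) z =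
    - pword (map negb w) ('D_be1 (cP1 e d1 g)) (flip z).
  move=> w x ex; rewrite key ?fE ?flipK //; first by rewrite cE flipK; exact: fwd_cod.
elim: w z => [|b w IH] z cz /=; first exact: uE.
set f := pword (map negb w) _ in IH *.
have hf : Cinf (cod e) f by exact: hw.
have cz' : cod e (flip z) by rewrite -cE.
have df : differentiable (fun z => f (flip z)) z.
  exact: (differentiable_comp (Cinf_diff (@Cinf_flip R) (I : setT z)) (Cinf_diff hf cz')).
case: b => /=.
  by rewrite (derive_eqon oe be1 IH cz) (deriveNf be1 df) (derive_flip f z).1.
by rewrite (derive_eqon oe be0 IH cz) (deriveNf be0 df) (derive_flip f z).2.
Qed.

Let eq_neq0 (a b : R) : a = b -> b != 0 -> a != 0. Proof. by move=> ->. Qed.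
Let opp_neq0 (b : R) : b != 0 -> - b != 0. Proof. by rewrite oppr_eq0. Qed.

Section cases.
Variables (F F1 F2 : surface R) (w1 : form2 F1) (w2 : form2 F2).
Hypotheses (sw1 : symplectic w1) (sw2 : symplectic w2).
Local Notation LI := (lagrangian_immersion w1 w2).
Implicit Types g : F -> prod_manifold F1 F2.

Definition cuspidal1 g x := exists e d1 d2,
  [/\ adapted w1 w2 g e d1 d2, centered g e d1 d2 x & cuspidal g e d1].

(** Let u = 0 at x. If u_1 = 0, the triple (u, u_1, u_2) gives u_2 nonzero and (u, u_1, u_11) gives
    u_11 nonzero, a cusp position for the exchanged map. If u_1 is nonzero and u_2 = 0, then (u,
    u_2, u_22) gives u_22 nonzero. Otherwise u_1 and u_2 are nonzero near x. *)
Lemma generic_cases g x : LI g -> generic_at w1 w2 g x ->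
  (\forall y \near x, both_folds g y) \/ cuspidal1 g x \/
  exists e d2 d1, [/\ adapted w2 w1 (swapg g) e d2 d1, centered (swapg g) e d2 d1 x &
    cuspidal (swapg g) e d2].
Proof.
move=> L G; have [e [d1 [d2 [ad ex C]]]] := adapted_of_generic L G.
pose u := 'D_be1 (cP1 e d1 g).
have [_ _ hA _] := adapted_smooth L ad; have hu := Cinf_derive be1 hA.
have oe := cod_open e; have cx := fwd_cod ex.
have n0 : \forall y \near x, dom e y by apply: open_nbhs_nbhs; split=> //; exact: dom_open.
have nz (f : E2 -> R) : Cinf (cod e) f -> f (fwd e x) != 0 -> \forall y \near x, f (fwd e y) != 0.
  move=> hf fx; have c : {for x, continuous (f \o fwd e)}.
    apply: continuous_comp; [exact: fwd_continuous|exact: (Cinf_cont hf cx)].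
  have nb : nbhs (f (fwd e x)) [set t | t != 0].
    by apply: open_nbhs_nbhs; split=> //; exact: open_neq.
  exact: (c _ nb).
have [u0|u0] := eqVneq (u (fwd e x)) 0; last first.
  left; apply: filterS2 n0 (nz _ hu u0) => y ey uy.
  by apply: (both_folds_at sw1 sw2 L ad ey) => /eqP; rewrite (negbTE uy).
have [ua|ua] := eqVneq ('D_be0 u (fwd e x)) 0.
  have ub : 'D_be1 u (fwd e x) != 0.
    have [[|[|[|i]]] H] := C 0%N isT.
    - by case/eqP: (H : u (fwd e x) != 0).
    - by case/eqP: (H : 'D_be0 u (fwd e x) != 0).
    - exact: H.
    - by move: H; rewrite /jet_words /= nth_nil => /eqP[].
  have uaa : 'D_be0 ('D_be0 u) (fwd e x) != 0.
    have [[|[|[|i]]] H] := C 2%N isT.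
    - by case/eqP: (H : u (fwd e x) != 0).
    - by case/eqP: (H : 'D_be0 u (fwd e x) != 0).
    - exact: H.
    - by move: H; rewrite /jet_words /= nth_nil => /eqP[].
  right; right; have L' := swap_LI sw1 sw2 L.
  have [e' [ad' dE uE]] := swap_all L ad.
  have e'x : dom e' x by rewrite dE.
  have [e'' [d2' [d1' [ad'' ce'' wE]]]] := recenter_all L' ad' e'x.
  exists e'', d2', d1'; split; [exact: ad''|exact: ce''|].
  split.
  - exact: (etrans (wE [::]) (etrans (uE [::] x ex) (etrans (congr1 -%R u0) (oppr0 _)))).
  - exact: (etrans (wE [:: true]) (etrans (uE [:: true] x ex) (etrans (congr1 -%R ua) (oppr0 _)))).
  - exact: (eq_neq0 (etrans (wE [:: false]) (uE [:: false] x ex)) (opp_neq0 ub)).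
  - exact: (eq_neq0 (etrans (wE [:: true; true]) (uE [:: true; true] x ex)) (opp_neq0 uaa)).
have [ub|ub] := eqVneq ('D_be1 u (fwd e x)) 0.
  have ubb : 'D_be1 ('D_be1 u) (fwd e x) != 0.
    have [[|[|[|i]]] H] := C 1%N isT.
    - by case/eqP: (H : u (fwd e x) != 0).
    - by case/eqP: (H : 'D_be1 u (fwd e x) != 0).
    - exact: H.
    - by move: H; rewrite /jet_words /= nth_nil => /eqP[].
  right; left; have [e'' [d1' [d2' [ad'' ce'' wE]]]] := recenter_all L ad ex.
  exists e'', d1', d2'; split; [exact: ad''|exact: ce''|].
  split.
  - exact: (etrans (wE [::]) u0).
  - exact: (etrans (wE [:: true]) ub).
  - exact: (eq_neq0 (wE [:: false]) ua).
  - exact: (eq_neq0 (wE [:: true; true]) ubb).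
left; apply: filterS3 n0 (nz _ (Cinf_derive be0 hu) ua) (nz _ (Cinf_derive be1 hu) ub) => y ey ya yb.
by apply: (both_folds_at sw1 sw2 L ad ey) => _; split; [exact: ya|exact: yb].
Qed.

End cases.

Lemma isolated (F F1 F2 : surface R) (w1 : form2 F1) (w2 : form2 F2) g x :
  symplectic w1 -> symplectic w2 -> lagrangian_immersion w1 w2 g -> generic_at w1 w2 g x ->
  \forall y \near x, y <> x -> @both_folds F F1 F2 g y.
Proof.
move=> sw1 sw2 L G.
have [n|[[e [d1 [d2 [ad ce cu]]]]|[e [d2 [d1 [ad ce cu]]]]]] := generic_cases sw1 sw2 L G.
- by apply: filterS n.
- exact: (isolated_cusp sw1 sw2 L ad ce cu).
- have := isolated_cusp sw2 sw1 (swap_LI sw1 sw2 L) ad ce cu.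
  by apply: filterS => y h yx; apply: both_folds_swap; exact: h.
Qed.

End Classify.

Section Step1.
Variable R : realType.
Local Notation E2 := ('rV[R]_2).
Local Notation PE := (R * E2)%type.

Let oT : open [set: E2]. Proof. exact: openT. Qed.

Let eq_neq0 (a b : R) : a = b -> b != 0 -> a != 0. Proof. by move=> ->. Qed.
Let half_le (m : R) : 0 < m -> 2 * (m / 4) <= m. Proof. by move=> m0; lra. Qed.

Let zero_form (a b : R) : a * (0 : E2) 0 0 + b / 2 * (0 : E2) 0 1 ^+ 2 = 0.
Proof. by rewrite !mxE expr0n /= !mulr0 addr0. Qed.

(* [g'] is a modification of [g] supported in [K]. *)
Definition modified (F F1 F2 : surface R) (g g' : F -> prod_manifold F1 F2) (K N : set F) x :=
  [/\ open (~` K), K `<=` N, forall y, ~ K y -> g' y = g y, folds_or_cusp g' x &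
      forall y, K y -> y <> x -> both_folds g' y].

(** The room for a deformation inside a target chart. Only the second coordinate moves, since a
    Hamiltonian in (q1, q2) leaves q1 and q2 fixed. *)
Lemma margin (M : surface R) (d : chart E2 M) (f : E2 -> E2) : {for 0, continuous f} ->
  cod d (f 0) -> exists2 eta : R, 0 < eta & \forall z \near (0 : E2),
    forall c : R, `|c| <= eta -> cod d (row2 (f z 0 0) (f z 0 1 + c)).
Proof.
move=> cf d0; have n : nbhs (f 0) (cod d) by apply: open_nbhs_nbhs; split=> //; exact: cod_open.
have [r r0 Hr] := nbhs_ballnorm n.
have r2 : 0 < r / 2 by rewrite divr_gt0.
exists (r / 2) => //.
have nz : \forall z \near (0 : E2), `|f 0 - f z| <= r / 2 by move/cvgrPdist_le: cf; apply.
apply: filterS nz => z; rewrite distrC norm2_le !mxE => /andP[z0 z1] c ce.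
apply: Hr; rewrite norm2_le !mxE /=; apply/andP; split.
  apply: le_trans z0 _; rewrite ler_pdivrMr // ler_pMr //; exact: ler1n.
rewrite addrAC; apply: le_trans (ler_normD _ _) _.
by apply: le_trans (lerD z1 ce) _; rewrite -splitr.
Qed.

Section one.
Variables (F F1 F2 : surface R) (w1 : form2 F1) (w2 : form2 F2).
Hypotheses (sw1 : symplectic w1) (sw2 : symplectic w2).
Local Notation LI := (lagrangian_immersion w1 w2).
Variables (g : F -> prod_manifold F1 F2) (e : chart E2 F) (d1 : chart E2 F1) (d2 : chart E2 F2) (x : F).
Hypotheses (LIg : LI g) (ad : adapted w1 w2 g e d1 d2) (ce : centered g e d1 d2 x).
Hypothesis cu : cuspidal g e d1.

(** The deformation has Hamiltonian t h, with h from [cusp_modify]. At t = 1 the function u is the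
    exact model near x, which makes x a cusp point, and the sign conditions on the whole support
    exclude a second degenerate point there. *)
Lemma cusp_step1 N : nbhs x N -> exists g' K, isotopic w1 w2 g g' /\ modified g g' K N x.
Proof.
move=> nN; have [ex e0 _ _] := ce; have [le D1 D2 had] := ad.
have c0 := centered_cod ce; have oe := cod_open e.
have [A' hA' [r0 r00 AE]] := local_global LIg ad ce.
have [hr1 hr2 hA _] := adapted_smooth LIg ad.
pose u := 'D_be1 A'; have hu : Cinf setT u by exact: Cinf_derive.
pose B := [set z : E2 | `|z| < r0].
have oB : open B by exact: open_normlt.
have B0 : B 0 by rewrite /B /= normr0.
have BA z : B z -> A' z = cP1 e d1 g z by move=> /ltW /AE[].
have BC z : B z -> cod e z by move=> /ltW /AE[].
have Bu z : B z -> u z = 'D_be1 (cP1 e d1 g) z by exact: (derive_eqon oB be1 BA).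
have [u0' u1' ua' ub'] := cu.
have u0 : u 0 = 0 by rewrite Bu.
have u1 : 'D_be1 u 0 = 0 by exact: (etrans (derive_eqon oB be1 Bu B0) u1').
have ua : 'D_be0 u 0 != 0 by exact: (eq_neq0 (derive_eqon oB be0 Bu B0) ua').
have Bu1 z : B z -> 'D_be1 u z = 'D_be1 ('D_be1 (cP1 e d1 g)) z by exact: (derive_eqon oB be1 Bu).
have ub : 'D_be1 ('D_be1 u) 0 != 0 by exact: (eq_neq0 (derive_eqon oB be1 Bu1 B0) ub').
have [x1 x2 _ _] := had 0 c0.
have [eta1 eta10 m1] := margin (Cinf_cont hr1 c0) (fwd_cod x1).
have [eta2 eta20 m2] := margin (Cinf_cont hr2 c0) (fwd_cod x2).
have nN' : \forall z \near (0 : E2), N (bwd e z).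
  have b0 : bwd e 0 = x by rewrite -e0 fwdK.
  by apply: (bwd_continuous c0); rewrite b0.
have [rh rh0 Hrh] := nbhs_ballnorm (filterI nN' (filterI m1 m2)).
pose rho := Num.min rh (r0 / 2).
have rho0 : 0 < rho by rewrite lt_min rh0 divr_gt0.
(* The parameter t runs over the open interval (-2, 2), which contains [0, 1], so the momenta move
   by at most 2 eta. *)
pose eta := Num.min eta1 eta2 / 4.
have eta0 : 0 < eta by rewrite divr_gt0 // lt_min eta10.
have [h [rho1 [r [hh [/andP[rho10 rho1r] r_gt0] hsupp hsmall [hnear hsign]]]]] :=
  cusp_modify hu u0 u1 ua ub eta0 rho0.
have rB (z : E2) : `|z| <= rho1 -> B z /\ `|z| <= rh.
  move=> zr; have zrho := le_trans zr rho1r; move: zrho; rewrite le_min => /andP[q1 q2].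
  by split=> //; apply: le_lt_trans q2 _; rewrite ltr_pdivrMr // ltr_pMr // ltr1n.
pose H (p : PE) := p.1 * h p.2.
have oTP : open [set: PE] by exact: openT.
have hH : Cinf setT H.
  apply: (CinfM oTP); first exact: Cinf_fst.
  exact: (Cinf_comp (findim_rV R 2) oTP (fun _ _ => I) (@Cinf_snd R R E2 setT) hh).
have hH' : Cinf (snd @^-1` vdom e d1 d2 g) H by exact: (Cinf_sub (fun _ _ => I) hH).
pose O := [set t : R | `|t| < 2].
have oO : open O by exact: open_normlt.
have KU (z : E2) : `|z| <= rho1 -> vdom e d1 d2 g z.
  by move=> /rB[/BC cz _]; exact: (adapted_vdom ad cz).
have H0 (a : R) z : vdom e d1 d2 g z -> rho1 < `|z| -> H (a, z) = 0.
  by move=> _ /ltW zr; rewrite /H /= hsupp // mulr0.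
have dh v z : differentiable ('D_v h) z by exact: (Cinf_diff (Cinf_derive v hh) (I : setT z)).
have DH (a : R) v z : 'D_v (fun z => H (a, z)) z = a * 'D_v h z.
  exact: (deriveMcf a v (Cinf_diff hh (I : setT z))).
have etale (a : R) v z : O a -> `|'D_v h z| < eta -> `|a * 'D_v h z| <= eta1 /\ `|a * 'D_v h z| <= eta2.
  move=> Oa ve; have : `|a * 'D_v h z| <= 2 * eta.
    by rewrite normrM; apply: ler_pM => //; apply: ltW.
  have et : 2 * eta <= Num.min eta1 eta2.
    have m0 : 0 < Num.min eta1 eta2 by rewrite lt_min eta10.
    exact: half_le m0.
  by move=> q; split; apply: le_trans q (le_trans et _); rewrite ge_min lexx ?orbT.
have hO (a : R) z : O a -> `|z| <= rho1 ->
    cod d1 (new1 e d1 d2 g H a z) /\ cod d2 (new2 e d1 d2 g H a z).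
  move=> Oa zr; have [Bz zrh] := rB z zr; have cz := BC z Bz.
  have [|_ [q1 q2]] := Hrh z; first by rewrite subr0.
  have [s1 s2] := hsmall z.
  rewrite /new1 /new2 (adapted_dd ad _ cz).1 (adapted_dd ad _ cz).2 !DH; split.
    by apply: q1; have [] := etale a be0 z Oa s1.
  by rewrite -mulNr; apply: q2; rewrite mulNr normrN; have [] := etale a be1 z Oa s2.
have O1 : O 1 by rewrite /O /= normr1 ltr1n.
pose g' := deform e d1 d2 g H (1 : R).
have iso : isotopic w1 w2 g g'.
  apply: (isotopic_deform sw1 sw2 le D1 D2 LIg (findim_R R) oO hH' KU H0 hO).
    move=> s /andP[s0 s1]; rewrite /O /= [_ *: _]mulr1 ger0_norm //.
    by apply: le_lt_trans s1 _; rewrite ltr1n.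
  by move=> z; rewrite /H mul0r.
have L' := isotopic_LI iso.
have ad' : adapted w1 w2 g' e d1 d2.
  split=> // z cz; have Uz := adapted_vdom ad cz.
  have [[_ y1] [_ y2] _ _] := deform_rep le D1 D2 LIg H0 hO O1 Uz.
  have [-> -> _ _] := deform_coords le D1 D2 LIg H0 hO O1 Uz.
  by have [_ _ q1 q2] := had z cz; split.
have A'E z : cod e z -> cP1 e d1 g' z = cP1 e d1 g z + 'D_be0 h z.
  move=> cz; have Uz := adapted_vdom ad cz.
  have [_ _ -> _] := deform_coords le D1 D2 LIg H0 hO O1 Uz.
  by rewrite (adapted_dd ad _ cz).1 DH mul1r.
pose U (z : E2) := u z + 'D_be1 ('D_be0 h) z.
have UE z : B z -> 'D_be1 (cP1 e d1 g') z = U z.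
  move=> Bz; have cz := BC z Bz.
  rewrite (derive_eqon oe be1 A'E cz) (deriveDf be1 (Cinf_diff hA cz) (dh be0 z)) -Bu //.
have U1 v z : B z -> 'D_v ('D_be1 (cP1 e d1 g')) z = 'D_v U z.
  exact: (derive_eqon oB v UE).
have U11 z : B z -> 'D_be1 ('D_be1 ('D_be1 (cP1 e d1 g'))) z = 'D_be1 ('D_be1 U) z.
  exact: (derive_eqon oB be1 (U1 be1)).
pose K := bwd e @` [set z : E2 | `|z| <= rho1].
have n0 : `|0 : E2| <= r by rewrite normr0 ltW.
have U00 : U 0 = 0 by exact: (etrans (hnear 0 n0) (zero_form _ _)).
set al := 'D_be0 u 0 in hnear hsign ua; set be := 'D_be1 ('D_be1 u) 0 in hnear hsign ub.
have U10 : 'D_be1 U 0 = 0.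
  pose ca := fun k => nth 0 [:: al; be / 2] k.
  pose cb := fun k => nth (0, 0)%N [:: (1, 0); (0, 2)]%N k.
  pose B' := [set z : E2 | `|z| < r].
  have oB' : open B' by exact: open_normlt.
  have B'0 : B' 0 by rewrite /B' /= normr0.
  have E z : B' z -> U z = comb ca cb z.
    move=> /ltW zr; rewrite /U hnear // /comb /mono /ca /cb /=.
    by rewrite expr1 !expr0 !(mulr1, mul1r, mul0r, addr0).
  rewrite (derive_eqon oB' be1 E B'0) (congr1 (fun f : E2 -> R => f 0) (derive_comb1 ca cb)).
  by rewrite /comb /mono /= !mxE !expr1 !(mulr0, mul0r, addr0).
exists g', K; split; first exact: iso.
split.
- exact: (deform_openNK KU).
- by move=> _ [z zr <-]; have [_ zrh] := rB z zr; have [|? _] := Hrh z; first by rewrite subr0.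
- by move=> y nK; exact: (deform_out le D1 D2 LIg H0 1 nK).
- move=> _; right; left.
  apply: (cusp1_at L' ad' ex ua ub (r := Num.min r (r0 / 2))); first by rewrite lt_min r_gt0 divr_gt0.
  move=> z; rewrite le_min e0 add0r => /andP[zr zr0].
  rewrite UE; first exact: hnear.
  by apply: le_lt_trans zr0 _; rewrite ltr_pdivrMr // ltr_pMr // ltr1n.
move=> y [z zr yE] yx; have [Bz _] := rB z zr; have cz := BC z Bz.
have ey : dom e y by rewrite -yE; exact: bwd_dom.
have fy : fwd e y = z by rewrite -yE bwdK.
apply: (both_folds_ball (al := al) (be := be) (r := rho1) sw1 sw2 L' ad' _ _ _ ey).
- by rewrite (UE 0 B0).
- by rewrite (U1 be1 0 B0).
- move=> q qr; have [Bq _] := rB q qr; have [s1 s2] := hsign q qr.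
  by split; [exact: BC|rewrite (U1 be0 q Bq)|rewrite (U11 q Bq)].
- by rewrite fy.
- by apply/eqP => fy0; apply: yx; rewrite -(fwdK ey) fy0 -e0 fwdK.
Qed.

End one.

Lemma cusp_step (F F1 F2 : surface R) (w1 : form2 F1) (w2 : form2 F2) g x N :
  symplectic w1 -> symplectic w2 -> lagrangian_immersion w1 w2 g -> generic_at w1 w2 g x ->
  nbhs x N -> exists g' K, isotopic w1 w2 g g' /\ @modified F F1 F2 g g' K N x.
Proof.
move=> sw1 sw2 L G nN.
have [n|[[e [d1 [d2 [ad ce cu]]]]|[e [d2 [d1 [ad ce cu]]]]]] := generic_cases sw1 sw2 L G.
- exists g, set0; split; first exact: isotopic_refl.
  split=> //; first by rewrite setC0; exact: openT.
  by apply: both_folds_or_cusp; exact: (nbhs_singleton n).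
- exact: (cusp_step1 sw1 sw2 L ad ce cu nN).
- have [g' [K [iso [oK KN gE ni ff]]]] := cusp_step1 sw2 sw1 (swap_LI sw1 sw2 L) ad ce cu nN.
  exists (swapg g'), K; split.
    apply: (swap_isotopic _ iso) => k Lk; exact: (swap_LI sw2 sw1 Lk).
  split; [exact: oK|exact: KN| | | ].
  + by move=> y nK; rewrite /swapg gE //= -surjective_pairing.
  + by apply: folds_or_cusp_swap; rewrite swapgK.
  + by move=> y Ky yx; apply: both_folds_swap; rewrite swapgK; exact: ff.
Qed.

End Step1.

(** * Conclusion *)

Section Germs.
Variable R : realType.
Local Notation E2 := ('rV[R]_2).

Lemma normal_form_near (M N : surface R) (f f' : M -> N) (x : M) hf :
  (\forall y \near x, f y = f' y) -> has_normal_form f x hf -> has_normal_form f' x hf.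
Proof.
move=> n [c [d [cx dx H]]]; exists c, d; have fx := nbhs_singleton n.
split; [exact: cx|by rewrite -fx|].
have [_ cx' c0] := cx; have cod0 : cod c 0 by rewrite -c0; exact: fwd_cod.
have nc : \forall u \near (0 : E2), f (bwd c u) = f' (bwd c u).
  have b0 : bwd c 0 = x by rewrite -c0 fwdK.
  have nb : nbhs (bwd c 0) [set y | f y = f' y] by rewrite b0.
  exact: (bwd_continuous cod0 nb).
by apply: filterS2 nc H => u <-.
Qed.

Lemma near_sym (T : topologicalType) (U : Type) (f f' : T -> U) (x : T) :
  (\forall y \near x, f y = f' y) -> \forall y \near x, f' y = f y.
Proof. by apply: filterS => y ->. Qed.

Lemma critical_near (M N : surface R) (f f' : M -> N) (x : M) : smooth f -> smooth f' ->
  (\forall y \near x, f y = f' y) -> critical_point f x -> critical_point f' x.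
Proof.
move=> sf sf' n; have fx := nbhs_singleton n.
have lc := chart_local x; have ld := chart_local (f x).
have cx := chart_at_dom x; have dx := chart_at_dom (f x).
have dx' : dom (chart_at (f x)) (f' x) by rewrite -fx.
move/(critical_jac sf lc ld cx dx) => j; apply/(critical_jac sf' lc ld cx dx'); rewrite -j.
have nr := near_sym (rep_near (chart_at (f x)) cx n).
by apply: (f_equal2 (@det2 R)); apply: near_eq_derive.
Qed.

Section maps.
Variables (F F1 F2 : surface R).
Implicit Types g : F -> prod_manifold F1 F2.

Lemma near_g1 g g' (x : F) : (\forall y \near x, g y = g' y) -> \forall y \near x, g1 g y = g1 g' y.
Proof. by apply: filterS => y; rewrite /g1 => ->. Qed.

Lemma near_g2 g g' (x : F) : (\forall y \near x, g y = g' y) -> \forall y \near x, g2 g y = g2 g' y.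
Proof. by apply: filterS => y; rewrite /g2 => ->. Qed.

Lemma fold_near (M N : surface R) (f f' : M -> N) (x : M) : smooth f -> smooth f' ->
  (\forall y \near x, f y = f' y) -> fold_point f x -> fold_point f' x.
Proof.
by move=> sf sf' n [c h]; split; [exact: critical_near c|exact: normal_form_near h].
Qed.

Lemma cusp_near (M N : surface R) (f f' : M -> N) (x : M) : smooth f -> smooth f' ->
  (\forall y \near x, f y = f' y) -> cusp_point f x -> cusp_point f' x.
Proof.
by move=> sf sf' n [c h]; split; [exact: critical_near c|exact: normal_form_near h].
Qed.

Lemma bisingular_near g g' (x : F) : smooth2 g -> smooth2 g' -> (\forall y \near x, g y = g' y) ->
  bisingular_set g' x -> bisingular_set g x.
Proof.
move=> [s1 s2] [s1' s2'] n [b1 b2]; split.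
  exact: (critical_near s1' s1 (near_sym (near_g1 n)) b1).
exact: (critical_near s2' s2 (near_sym (near_g2 n)) b2).
Qed.

Lemma both_folds_near g g' (x : F) : smooth2 g -> smooth2 g' -> (\forall y \near x, g y = g' y) ->
  both_folds g x -> both_folds g' x.
Proof.
move=> s s' n h b; have [f1 f2] := h (bisingular_near s s' n b).
split; first exact: (fold_near s.1 s'.1 (near_g1 n) f1).
exact: (fold_near s.2 s'.2 (near_g2 n) f2).
Qed.

Lemma folds_or_cusp_near g g' (x : F) : smooth2 g -> smooth2 g' -> (\forall y \near x, g y = g' y) ->
  folds_or_cusp g x -> folds_or_cusp g' x.
Proof.
move=> s s' n h b; have [[f1 f2]|[c|c]] := h (bisingular_near s s' n b).
- left; split; first exact: (fold_near s.1 s'.1 (near_g1 n) f1).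
  exact: (fold_near s.2 s'.2 (near_g2 n) f2).
- by right; left; exact: (cusp_near s.1 s'.1 (near_g1 n) c).
- by right; right; exact: (cusp_near s.2 s'.2 (near_g2 n) c).
Qed.

Variables (w1 : form2 F1) (w2 : form2 F2).

Lemma generic_near g g' (x : F) : (\forall y \near x, g y = g' y) ->
  generic_at w1 w2 g x -> generic_at w1 w2 g' x.
Proof.
move=> n [[c d1 d2] [wp cx Vx C]]; exists (Patch c d1 d2).
rewrite /= in cx Vx C *; have gx := nbhs_singleton n.
pose P : set E2 := [set z | rep c d1 (g1 g) z = rep c d1 (g1 g') z /\
  rep c d2 (g2 g) z = rep c d2 (g2 g') z].
have nP : nbhs (fwd c x) P.
  exact: filterI (rep_near d1 cx (near_g1 n)) (rep_near d2 cx (near_g2 n)).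
pose A := interior P; have oA : open A by exact: open_interior.
have Ax : A (fwd c x) by exact: nP.
have HA : A `<=` P by exact: interior_subset.
have e1 z : A z -> cQ1 c d1 g z = cQ1 c d1 g' z by move=> /HA[e _]; rewrite /cQ1 e.
have e2 z : A z -> cQ2 c d2 g z = cQ2 c d2 g' z by move=> /HA[_ e]; rewrite /cQ2 e.
have e3 z : A z -> cP1 c d1 g z = cP1 c d1 g' z by move=> /HA[e _]; rewrite /cP1 e.
have e4 z : A z -> dd2 be0 be1 (cQ1 c d1 g) (cQ2 c d2 g) (cP1 c d1 g) z =
    dd2 be0 be1 (cQ1 c d1 g') (cQ2 c d2 g') (cP1 c d1 g') z.
  by move=> Az; have [_ _] := dd_eqon3 oA Az e1 e2 e3.
split; [exact: wp|exact: cx| |].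
  have [[c0 x1] [_ x2] d0] := Vx; rewrite fwdK // in x1 x2.
  split.
  - by split=> //; rewrite fwdK // /g1 -gx.
  - by split=> //; rewrite fwdK // /g2 -gx.
  - by have [E _ _] := dd_eqon3 oA Ax e1 e2 e1; move: d0; rewrite /cDl E.
move=> m m3; have [i ne] := C m m3; exists i.
have E := dword_eqon3 (jet_words m i) oA e1 e2 e4 Ax.
by move: ne; rewrite /jet /= /pQ1 /pQ2 /pP1 /= E.
Qed.

Hypotheses (sw1 : symplectic w1) (sw2 : symplectic w2).

(** The support of each modification avoids the rest of the list, so the germs there, and with them
    genericity, are unchanged. The last two clauses protect the points off the list; the last one in
    particular keeps the point just treated intact while the others are handled. *)
Lemma fix_list (s : seq F) g : uniq s -> lagrangian_immersion w1 w2 g ->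
  (forall y, y \in s -> generic_at w1 w2 g y) ->
  exists g', [/\ isotopic w1 w2 g g', forall y, y \in s -> folds_or_cusp g' y,
    forall y, y \notin s -> both_folds g y -> both_folds g' y &
    forall y, y \notin s -> folds_or_cusp g y -> folds_or_cusp g' y].
Proof.
elim: s g => [|x s IH] g /=.
  by move=> _ L _; exists g; split=> //; exact: isotopic_refl.
move=> /andP[xs us] L G.
pose N := ~` [set` s].
have nN : nbhs x N.
  apply: open_nbhs_nbhs; split; last exact/negP.
  rewrite openC; apply: compact_closed; first exact: manifold_hausdorff.
  by apply: finite_compact; exact: finite_seq.
have [h [K [iso [oK KN hE ni ff]]]] := cusp_step sw1 sw2 L (G x (mem_head _ _)) nN.
have Lh := isotopic_LI iso; have sg := LI_smooth L; have sh := LI_smooth Lh.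
have germ y : ~ K y -> \forall z \near y, g z = h z.
  move=> nK; have nb : nbhs y (~` K) by apply: open_nbhs_nbhs.
  by apply: filterS nb => z nKz; rewrite hE.
have sK y : y \in s -> ~ K y by move=> ys /KN; apply.
have Gh y : y \in s -> generic_at w1 w2 h y.
  move=> ys; apply: (generic_near (germ y (sK y ys))).
  by apply: G; rewrite in_cons ys orbT.
have [g' [iso' NIs FFs NIs']] := IH h us Lh Gh.
exists g'; split; first exact: isotopic_trans iso iso'.
- move=> y; rewrite in_cons => /orP[/eqP ->|ys]; last exact: (NIs y ys).
  exact: (NIs' x xs ni).
- move=> y; rewrite in_cons negb_or => /andP[/eqP yx ys] fy; apply: (FFs y ys).
  have [Ky|nKy] := pselect (K y); first exact: (ff y Ky yx).
  exact: (both_folds_near sg sh (germ y nKy) fy).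
- move=> y; rewrite in_cons negb_or => /andP[/eqP yx ys] fy; apply: (NIs' y ys).
  have [Ky|nKy] := pselect (K y); first exact: (both_folds_or_cusp (ff y Ky yx)).
  exact: (folds_or_cusp_near sg sh (germ y nKy) fy).
Qed.

End maps.

(* The cusp map is locally onto, the fold map is not. *)
Lemma fold_not_cusp (M N : surface R) (f : M -> N) x :
  has_normal_form f x (fun x1 x2 => row2 x1 (x2 ^+ 2)) ->
  has_normal_form f x (fun x1 x2 => row2 x1 (x1 * x2 + x2 ^+ 3)) -> False.
Proof.
move=> [c [d [[_ cx c0] [_ dx d0] H]]] [c' [d' [[_ c'x c'0] [_ d'x d'0] H']]].
have W0 : \forall y \near x, dom c y /\ (dom d (f y) /\ fwd d (f y) = row2 (fwd c y 0 0) (fwd c y 0 1 ^+ 2)).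
  have n1 : \forall y \near x, dom c y by apply: open_nbhs_nbhs; split=> //; exact: dom_open.
  have n2 : \forall y \near x, dom d (f (bwd c (fwd c y))) /\
      fwd d (f (bwd c (fwd c y))) = row2 (fwd c y 0 0) (fwd c y 0 1 ^+ 2).
    have nb : nbhs (fwd c x) [set u | dom d (f (bwd c u)) /\
        fwd d (f (bwd c u)) = row2 (u 0 0) (u 0 1 ^+ 2)] by rewrite c0.
    exact: (fwd_continuous cx nb).
  by apply: filterS2 n1 n2 => y cy; rewrite fwdK.
have cod'0 : cod c' 0 by rewrite -c'0; exact: fwd_cod.
have n3 : \forall u \near (0 : E2), dom c (bwd c' u) /\ (dom d (f (bwd c' u)) /\
    fwd d (f (bwd c' u)) = row2 (fwd c (bwd c' u) 0 0) (fwd c (bwd c' u) 0 1 ^+ 2)).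
  have b0 : bwd c' 0 = x by rewrite -c'0 fwdK.
  have nb : nbhs (bwd c' 0) [set y | dom c y /\ (dom d (f y) /\
      fwd d (f y) = row2 (fwd c y 0 0) (fwd c y 0 1 ^+ 2))] by rewrite b0.
  exact: (bwd_continuous cod'0 nb).
have [r r0 Hr] := nbhs_ballnorm (filterI n3 H').
have cod0 : cod d 0 by rewrite -d0; exact: fwd_cod.
have b0 : bwd d 0 = f x by rewrite -d0 fwdK.
(* From |p0| <= r^2 / 2 the odd cubic p0 s + s^3 is at least r^3 / 2 >= |p1| at s = r, so it takes
   the value p1 on [-r, r]; and q <= r keeps the point (p0, s) in the ball. *)
pose q := Num.min r (Num.min (r ^+ 2 / 2) (r ^+ 3 / 2)).
have q0 : 0 < q by rewrite !lt_min r0 !divr_gt0 ?exprn_gt0.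
have n4 : \forall v \near (0 : E2), [/\ cod d v, dom d' (bwd d v) & `|fwd d' (bwd d v)| < q].
  have n5 : \forall v \near (0 : E2), cod d v by apply: open_nbhs_nbhs; split=> //; exact: cod_open.
  have n6 : \forall v \near (0 : E2), dom d' (bwd d v).
    have nb : nbhs (bwd d 0) (dom d').
      by rewrite b0; apply: open_nbhs_nbhs; split=> //; exact: dom_open.
    exact: (bwd_continuous cod0 nb).
  have n7 : \forall v \near (0 : E2), `|fwd d' (bwd d v)| < q.
    have nb : nbhs (fwd d' (f x)) [set z : E2 | `|z| < q].
      by apply: open_nbhs_nbhs; split; [exact: open_normlt|rewrite /= d'0 normr0].
    have nb' : nbhs (bwd d 0) [set y | `|fwd d' y| < q].
      by rewrite b0; exact: (fwd_continuous d'x nb).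
    exact: (bwd_continuous cod0 nb').
  by apply: filterS3 n5 n6 n7 => v.
have [t t0 Ht] := nbhs_ballnorm n4.
(* A point outside the image of the fold, whose second coordinate is a square. *)
pose v : E2 := row2 0 (- t).
have vt : `|v - 0| <= t.
  by rewrite subr0 norm2_le /v row20 row21 normr0 normrN gtr0_norm // lexx ltW.
have [cv dv sv] := Ht v vt.
set p := fwd d' (bwd d v) in sv.
have := sv; rewrite norm2_lt => /andP[pa pb].
have [s sr ps] : exists2 s : R, `|s| <= r & p 0 0 * s + s ^+ 3 = p 0 1.
  pose k (s : R) := p 0 0 * s + s ^+ 3.
  have ck : continuous k.
    move=> s; apply: cvgD; first by apply: cvgMr; exact: cvg_id.
    exact: exprn_continuous.
  have alg (a b : R) : `|a| < q -> `|b| < q -> k (- r) = - k r -> - (r ^+ 3 / 2) <= b <= r ^+ 3 / 2.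
    move=> _ bq _; rewrite -ler_norml; apply: le_trans (ltW bq) _.
    by rewrite !ge_min lexx !orbT.
  have kr : r ^+ 3 / 2 <= k r.
    have : `|p 0 0| <= r ^+ 2 / 2 by apply: le_trans (ltW pa) _; rewrite !ge_min lexx !orbT.
    rewrite ler_norml => /andP[+ _]; rewrite /k => a1.
    have := ler_wpM2r (ltW r0) a1; rewrite mulNr => a2.
    have e : r ^+ 2 / 2 * r = r ^+ 3 / 2 by rewrite mulrAC -exprSr.
    by rewrite e in a2; move: (p 0 0 * r) (r ^+ 3) a2 => X Y a2; lra.
  have kn : k (- r) = - k r by rewrite /k; ring.
  have /andP[b1 b2] := alg _ _ pa pb kn.
  have rr : - r <= r by rewrite ge0_cp // ltW.
  have [|s + sk] := @IVT _ k (- r) r (p 0 1) rr (continuous_subspaceT ck).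
    rewrite kn ge_min le_max; apply/andP; split; apply/orP.
      by left; apply: le_trans b1; rewrite lerN2.
    by right; exact: le_trans b2 kr.
  by rewrite in_itv /= -ler_norml => sr; exists s.
pose u : E2 := row2 (p 0 0) s.
have ur : `|u - 0| <= r.
  rewrite subr0 norm2_le /u row20 row21 sr andbT; apply: le_trans (ltW pa) _.
  by rewrite ge_min lexx.
have [[_ [du E]] [d'u E']] := Hr u ur.
have fu : f (bwd c' u) = bwd d v.
  rewrite -(fwdK d'u) E' /u row20 row21 ps -row2_coord /p fwdK //.
have := congr1 (fun z : E2 => z 0 1) E; rewrite fu bwdK // row21 /v row21 => e.
by have := sqr_ge0 (fwd c (bwd c' u) 0 1); rewrite -e oppr_ge0 leNgt t0.
Qed.

Lemma smooth_family_cont (M N : surface R) (G : R -> M -> N) : smooth_family (setT : set R) G ->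
  forall a x, {for (a, x), continuous (fun p : R * M => G p.1 p.2)}.
Proof.
move=> hG a x; pose c := chart_at x; pose d := chart_at (G a x).
have lc : local_coordinates c := chart_local x.
have ld : local_coordinates d := chart_local (G a x).
have cx : dom c x := chart_at_dom x; have dx : dom d (G a x) := chart_at_dom (G a x).
have [oD hD] := smooth_family_rep (findim_R R) hG lc ld.
have Dp : prep_dom (setT : set R) c d G (a, fwd c x).
  by split=> //=; [exact: fwd_cod|rewrite fwdK].
have cm : {for (a, x), continuous (fun p : R * M => (p.1, fwd c p.2) : R * E2)}.
  have ci : {for a, continuous (@id R)} by exact: cvg_id.
  exact: (continuous_map ci (fwd_continuous cx)).
have cb : {for prep c d G (a, fwd c x), continuous (bwd d)}.
  apply: bwd_continuous; rewrite /prep /= fwdK //; exact: fwd_cod.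
have c3 : {for (a, x), continuous (fun p : R * M => bwd d (prep c d G (p.1, fwd c p.2)))}.
  have c2 : {for (a, x), continuous (fun p : R * M => prep c d G (p.1, fwd c p.2))}.
    exact: (continuous_comp cm (Cinf_cont hD Dp)).
  exact: (continuous_comp c2 cb).
have E : G a x = bwd d (prep c d G (a, fwd c x)) by rewrite /prep /= fwdK // fwdK.
rewrite /prop_for /continuous_at /= E; apply: cvg_trans c3; apply: near_eq_cvg.
have nc : \forall p \near (a, x), dom c p.2.
  have nb : nbhs x (dom c) by apply: open_nbhs_nbhs; split=> //; exact: dom_open.
  exact: (cvg_snd nb).
have nD : \forall p \near (a, x), prep_dom (setT : set R) c d G (p.1, fwd c p.2).
  have nb : nbhs (a, fwd c x) (prep_dom (setT : set R) c d G) by apply: open_nbhs_nbhs.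
  exact: (cm _ nb).
by apply: filterS2 nc nD => p cp [_ _ /= dp]; rewrite fwdK // in dp; rewrite /prep /= fwdK // fwdK.
Qed.

End Germs.

Section Homotopy.
Variable R : realType.
Local Notation E2 := ('rV[R]_2).
Variables (F F1 F2 : surface R).

Lemma regular_homotopy_family (G : R -> F -> prod_manifold F1 F2) (T : R) :
  smooth_family (setT : set R) (fun t => g1 (G t)) -> smooth_family (setT : set R) (fun t => g2 (G t)) ->
  (forall t, immersion (G t)) -> regular_homotopy T G.
Proof.
move=> h1 h2 im; split; last by move=> t _.
(* The family is smooth for all times, so it is its own local extension at the ends of the
   interval. *)
move=> [t x] _; exists (fun p => G p.1 p.2); split; last exact: filterE.
pose c := chart_at x; pose d1 := chart_at (g1 (G t) x); pose d2 := chart_at (g2 (G t) x).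
have lc : local_coordinates c := chart_local x.
have l1 : local_coordinates d1 := chart_local _; have l2 : local_coordinates d2 := chart_local _.
have cx : dom c x := chart_at_dom x.
have [oD1 hD1] := smooth_family_rep (findim_R R) h1 lc l1; have [oD2 hD2] := smooth_family_rep (findim_R R) h2 lc l2.
split.
  have c1 := smooth_family_cont h1 (a := t) (x := x); have c2 := smooth_family_cont h2 (a := t) (x := x).
  rewrite /prop_for /continuous_at.
  rewrite (_ : (fun p => G p.1 p.2) = (fun p : R * F => (g1 (G p.1) p.2, g2 (G p.1) p.2) : F1 * F2)).
    exact: (cvg_pair c1 c2).
  by apply/funext => p; rewrite /g1 /g2 -surjective_pairing.
exists (prep_dom (setT : set R) c d1 (fun t => g1 (G t)) `&` prep_dom (setT : set R) c d2 (fun t => g2 (G t))).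
have oD := openI oD1 oD2.
split; first exact: oD.
  have fx : cod c (fwd c x) by exact: fwd_cod.
  by split; split=> //=; rewrite fwdK //; exact: chart_at_dom.
apply: (Cinf_pair oD); first by apply: Cinf_sub hD1 => p [].
by apply: Cinf_sub hD2 => p [].
Qed.

End Homotopy.

Theorem theorem1p3 (R : realType) (F F1 F2 : surface R)
    (w1 : form2 F1) (w2 : form2 F2) (g : F -> prod_manifold F1 F2)
    (closedF : closed_manifold F) (closedF1 : closed_manifold F1)
    (closedF2 : closed_manifold F2)
    (symp1 : symplectic w1) (symp2 : symplectic w2)
    (lagr_g : lagrangian_immersion w1 w2 g) :
  exists (d : R) (G : R -> F -> prod_manifold F1 F2),
    [/\ 0 < d,
        regular_homotopy d G /\
          (forall t, 0 <= t <= d -> lagrangian_immersion w1 w2 (G t)),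
        G 0 = g,
        (forall t, 0 < t <= d -> lagrangian_immersion w1 w2 (G t)) &
        (forall x, bisingular_set (G d) x ->
           bifold_point (G d) x \/ bisingular_cusp_point (G d) x) /\
        finite_set [set x | bisingular_cusp_point (G d) x]].
Proof.
have [h [iso gen]] := generic symp1 symp2 closedF lagr_g.
have Lh := isotopic_LI iso.
(* In [N x] only x itself can fail to be a fold of both projections; a finite subcover then leaves
   finitely many points to modify. *)
pose N x : set F := interior [set y | y <> x -> both_folds h y].
have hN x : open (N x) /\ N x x.
  by split; [exact: open_interior|exact: (isolated symp1 symp2 Lh (gen x))].
have [s Hs] := finite_subcover closedF hN.
have [k [iso' NIs FFs _]] := fix_list symp1 symp2 (undup_uniq s) Lh (fun y _ => gen y).
have FFk y : y \notin undup s -> both_folds k y.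
  move=> ys; apply: (FFs y ys); have [x xs Nx] := Hs y.
  apply: (interior_subset Nx) => yx; move/negP: ys; apply.
  by rewrite mem_undup yx.
have [T [G [T0 [G1 G2] L G0 GT]]] := isotopic_trans iso iso'.
have kT : G T = k by exact: GT.
exists T, G; split.
- exact: T0.
- split; last by move=> t _; exact: L.
  by apply: regular_homotopy_family => // t; have [] := L t.
- exact: G0.
- by move=> t _; exact: L.
rewrite kT; split.
  move=> x bx; have [xs|xs] := boolP (x \in undup s).
    have [[f1 f2]|cu] := NIs x xs bx; first by left; split.
    by right; split.
  by have [f1 f2] := FFk x xs bx; left; split.
(* Off the list a bisingular point is a fold of both projections, so by [fold_not_cusp] all cusp
   points belong to the list. *)
apply: (@sub_finite_set _ _ [set` undup s]); last exact: finite_seq.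
move=> x [bx cu] /=; apply: contraT => xs; have [[_ f1] [_ f2]] := FFk x xs bx.
by case: cu => -[_ c]; [case: (fold_not_cusp f1 c)|case: (fold_not_cusp f2 c)].
Qed.
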